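(* Let $\lambda,\mu,\alpha,\rho>0$, let $b(y)=(\lambda-\mu-\alpha y)\,y$ and $a(y)=\rho^2(\lambda+\mu+\alpha y)\,y$ for $y\ge 0$, and let $Q_t(\mathrm{d}y\,|\,x)$ be the transition kernel on $[0,\infty)$ of the non-negative diffusion $\mathrm{d}X_t=b(X_t)\,\mathrm{d}t+\sqrt{a(X_t)}\,\mathrm{d}B_t$. Then, for every fixed $x>0$ and every $t>0$, the kernel decomposes as $$Q_t(\mathrm{d}y\,|\,x)=E_t(x)\,\delta_0(\mathrm{d}y)+p_t(y\,|\,x)\,\mathrm{d}y,\qquad E_t(x)=1-\int_0^\infty p_t(y\,|\,x)\,\mathrm{d}y,$$ where the density $p_t(\cdot\,|\,x)$ of the absolutely continuous part satisfies, in the classical sense for $t>0$, $y>0$, the Fokker--Planck equation $$\frac{\partial p_t(y\,|\,x)}{\partial t}=-\frac{\partial[b(y)\,p_t(y\,|\,x)]}{\partial y}+\frac12\,\frac{\partial^2[a(y)\,p_t(y\,|\,x)]}{\partial y^2},\qquad \lim_{t\downarrow 0}p_t(y\,|\,x)\,\mathrm{d}y=\delta_x(\mathrm{d}y),$$ and the extinction probability $E_t(x)$ satisfies, for $t>0$, the equation $$\frac{\mathrm{d}}{\mathrm{d}t}E_t(x)=\frac12\,\frac{\partial\big(a(y)\,p_t(y\,|\,x)\big)}{\partial y}\bigg|_{y=0},\qquad E_0(x)=0 .$$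
   Context: $B_t$ is a standard one-dimensional Brownian motion, independent of $X_0$. The SDE has a unique non-negative solution with continuous paths for each deterministic initial value $x\ge 0$, and once this solution hits $0$ it stays at $0$. The transition kernel is $Q_t(\mathrm{d}y\,|\,x)=\mathbb{P}(X_{s+t}\in\mathrm{d}y\,|\,X_s=x)$. $\delta_z$ denotes the Dirac mass at $z$, and $\mathrm{d}y$ denotes Lebesgue measure on $[0,\infty)$. The limit of measures as $t\downarrow0$ is in the sense of weak convergence. The density $p_t(\cdot\,|\,x)$ is understood as its regular version, and the derivative at $y=0$ is taken from the right. *)

(* Defs.v *)
From HB Require Import structures.
From mathcomp Require Import all_boot all_order all_algebra.
From mathcomp Require Import all_classical all_reals all_analysis.

Set Implicit Arguments.
Unset Strict Implicit.
Unset Printing Implicit Defensive.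

Import Order.TTheory GRing.Theory Num.Theory.
Import numFieldNormedType.Exports.

Local Open Scope classical_set_scope.
Local Open Scope ring_scope.

(** Processes are functions [X : R -> T -> R], [X t w] being the value at time
    [t] and outcome [w]; only times [0 <= t] are ever constrained or used. *)

Section Processes.
Context {R : realType} {d : measure_display} {T : measurableType d}.
Variable P : probability T R.

Definition is_filtration (F : R -> set (set T)) : Prop :=
  [/\ forall t, 0 <= t -> sigma_algebra setT (F t),
      forall t, 0 <= t -> F t `<=` measurable
    & forall s t, 0 <= s -> s <= t -> F s `<=` F t].

Definition measurable_wrt (G : set (set T)) (Y : T -> R) : Prop :=
  forall A : set R, measurable A -> G (Y @^-1` A).

Definition adapted (F : R -> set (set T)) (X : R -> T -> R) : Prop :=
  forall t, 0 <= t -> measurable_wrt (F t) (X t).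

Definition continuous_paths (X : R -> T -> R) : Prop :=
  forall w, {within `[0, +oo[, continuous (X ^~ w)}.

Definition cvg_in_probability (Y : nat -> T -> \bar R) : Prop :=
  forall eps : R, 0 < eps ->
    (fun n => P [set w | eps%:E <= Y n w]%E) @ \oo --> 0%E.

(* The increment clause says both that B t - B s is N(0, t - s)-distributed
   and that it is independent of F s; with s = 0 and B 0 = 0, B is independent
   of every F 0-measurable initial value.  The second argument of
   [normal_prob] is the standard deviation. *)
Definition is_brownian_motion (F : R -> set (set T)) (B : R -> T -> R) : Prop :=
  [/\ forall w, B 0 w = 0,
      continuous_paths B,
      adapted F B
    & forall (s t : R) (G : set T) (A : set R),
        0 <= s -> s < t -> F s G -> measurable A ->
        P (G `&` [set w | A (B t w - B s w)])
        = (P G * normal_prob 0 (Num.sqrt (t - s)) A)%E].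

(* The process  s |-> \sum_(i < size) coef i * 1_(time i, time i.+1](s). *)
Record simple_process (F : R -> set (set T)) := SimpleProcess {
  sp_size : nat;
  sp_time : nat -> R;
  sp_coef : nat -> T -> R;
  sp_time_ge0 : 0 <= sp_time 0;
  sp_time_nd : forall i, sp_time i <= sp_time i.+1;
  sp_coef_meas : forall i, measurable_wrt (F (sp_time i)) (sp_coef i);
  sp_coef_bnd : exists K : R, forall i w, `|sp_coef i w| <= K
}.

Definition sp_val F (phi : simple_process F) (s : R) (w : T) : R :=
  \sum_(i < sp_size phi)
    sp_coef phi i w * \1_(`]sp_time phi i, sp_time phi i.+1]) s.

Definition sp_integral F (phi : simple_process F) (B : R -> T -> R)
    (t : R) (w : T) : R :=
  \sum_(i < sp_size phi)
    sp_coef phi i w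
      * (B (Num.min (sp_time phi i.+1) t) w - B (Num.min (sp_time phi i) t) w).

(* [I] is (a version of) the Ito integral of [H] against [B] over [0, t]: it is
   the limit in probability of the integrals of simple processes approximating
   [H] in L^2([0, t]) in probability.  It is used for measurable adapted [H]
   only; measurability of [I] matters since [P] is meaningless on
   non-measurable sets. *)
Definition is_ito_integral (F : R -> set (set T)) (B H : R -> T -> R) (t : R)
    (I : T -> R) : Prop :=
  measurable_fun setT I /\
  exists phi : nat -> simple_process F,
    cvg_in_probability (fun n w =>
      \int[lebesgue_measure]_(s in `[0%R, t])
        ((sp_val (phi n) s w - H s w) ^+ 2)%:E)%E
    /\ cvg_in_probability (fun n w => `|sp_integral (phi n) B t w - I w|%:E).

(* Non-negative solutions of  dX = b(X) dt + sigma(X) dB. *)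
Definition nonneg_sde_solution (F : R -> set (set T)) (B : R -> T -> R)
    (b sigma : R -> R) (X : R -> T -> R) : Prop :=
  [/\ adapted F X,
      continuous_paths X,
      forall t w, 0 <= t -> 0 <= X t w
    & forall t, 0 <= t -> exists I : T -> R,
        is_ito_integral F B (fun s w => sigma (X s w)) t I
        /\ {ae P, forall w, X t w =
             X 0 w + (\int[lebesgue_measure]_(s in `[0, t]) b (X s w)) + I w}].

(* For each deterministic initial value there is a pathwise unique non-negative
   solution, and it is absorbed at 0. *)
Definition well_posed_absorbed (F : R -> set (set T)) (B : R -> T -> R)
    (b sigma : R -> R) : Prop :=
  forall x, 0 <= x -> exists X : R -> T -> R,
    [/\ nonneg_sde_solution F B b sigma X,
        forall w, X 0 w = x,
        {ae P, forall w, forall s t, 0 <= s -> s <= t ->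
           X s w = 0 -> X t w = 0}
      & forall Y : R -> T -> R, nonneg_sde_solution F B b sigma Y ->
          (forall w, Y 0 w = x) ->
          {ae P, forall w, forall t, 0 <= t -> Y t w = X t w}].

(* Q t y A = P(X (s + t) \in A | X s = y), as a regular conditional
   probability, for every non-negative solution X whatever its F 0-measurable
   initial value.  For X 0 = x deterministic and s = 0 this reads
   Q t x A = P(X t \in A).  Only [0 <= t] and starting points [0 <= y] matter;
   Q t x then automatically lives on [0, +oo[. *)
Definition is_transition_kernel (F : R -> set (set T)) (B : R -> T -> R)
    (b sigma : R -> R) (Q : R -> R.-pker R ~> R) : Prop :=
  forall X : R -> T -> R, nonneg_sde_solution F B b sigma X ->
  forall s t : R, 0 <= s -> 0 <= t ->
  forall C A : set R, measurable C -> measurable A ->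
    P ([set w | C (X s w)] `&` [set w | A (X (s + t) w)])
    = (\int[P]_(w in [set w | C (X s w)]) Q t (X s w) A)%E.

End Processes.

Section Analysis.
Context {R : realType}.

(* p is C^{1,2} on {t > 0, y > 0}, first argument t, second argument y. *)
Definition C12 (p : R -> R -> R) : Prop :=
  forall t y : R, 0 < t -> 0 < y ->
  [/\ derivable (p ^~ y) t 1, derivable (p t) y 1 & derivable (derive1 (p t)) y 1] /\
  [/\ {for (t, y), continuous (fun z : R * R => p z.1 z.2)},
      {for (t, y), continuous (fun z : R * R => derive1 (p ^~ z.2) z.1)},
      {for (t, y), continuous (fun z : R * R => derive1 (p z.1) z.2)}
    & {for (t, y), continuous (fun z : R * R => derive1n 2 (p z.1) z.2)}].

Definition is_right_derive (f : R -> R) (x l : R) : Prop :=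
  h^-1 * (f (x + h) - f x) @[h --> 0^'+] --> l.

(* m t --> the Dirac mass at x, weakly on [0, +oo[, as t decreases to 0, where
   m t is the measure of density p t. *)
Definition weak_cvg_dirac (p : R -> R -> R) (x : R) : Prop :=
  forall f : R -> R, {within `[0, +oo[, continuous f} ->
    (exists K : R, forall y, 0 <= y -> `|f y| <= K) ->
    (\int[lebesgue_measure]_(y in `[0, +oo[) (f y * p t y))
      @[t --> 0^'+] --> f x.

End Analysis.

(* Submission.v *)
Require Import Defs.
From HB Require Import structures.
From mathcomp Require Import all_boot all_order all_algebra.
From mathcomp Require Import all_classical all_reals all_analysis.
From mathcomp Require Import measurable_realfun lebesgue_integral_under.
From mathcomp Require Import finmap ring lra.

Set Implicit Arguments.
Unset Strict Implicit.
Unset Printing Implicit Defensive.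

Import Order.TTheory GRing.Theory Num.Theory.
Import numFieldNormedType.Exports.

Local Open Scope classical_set_scope.
Local Open Scope ring_scope.


(** With [S] the scale function of the diffusion, vanishing at [0], [mb] the
    density [2 / (a S')] of its speed measure and [G v y = S (min v y)] its Green
    function, Dynkin's formula (proved for weak solutions through the Euler
    scheme) yields an occupation formula relating [W t z y], the expectation of
    [G (X_t) y] started from [z], to the occupation measure of [X] on [0, t].
    Combined with the Chapman-Kolmogorov equation it turns [W] into a symmetric
    convolution semigroup for the speed measure.  The diagonal terms of this
    semigroup are positive definite in time, hence completely monotone, hence
    smooth in [t] with bounds on all derivatives; polarisation transfers this to
    the off-diagonal terms.  Each [- d/dt] of these functions has the function
    itself as its potential against [G], whence smoothness in [y]; the density is
    [mb] times the function whose potential is [W].  The forward equation and the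
    flux at [0] are then read off from the formula for [Q t x (]y, +oo[)]. *)

(** * Completely monotone functions *)

Section CompletelyMonotone.
Context {R : realType}.
Implicit Types (g : R -> R) (h t u : R) (hs : seq R).

(** The obstacle is the degenerate boundary: [a] vanishes at 0, and the speed density [mb] behaves
    there like a multiple of 1 / y, so the speed measure has infinite mass. Its product with sqrt S
    is however integrable, and sqrt S is the weight in which the estimates are stated: [G v y] is at
    most the product of the weights at [v] and [y], so that products of two such functions can be
    integrated. [W] is preferred to a density as starting point because it is a function of its
    arguments before anything is known of the laws of X_t. Formally, with P_t the semigroup killed
    at 0 and G the Green operator, [W] is the kernel of P_t G. The semigroup argument is run on P_t
    G^4, written as an inner product of two kernels P_t G^2; each - d/dt removes one factor G, so
    the third returns [W] and the fourth is the density with respect to the speed measure. Flux and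
    extinction agree because both come from one integral: half the slope of a p at 0 and the
    derivative of E are each the total mass of - dp/dt. *)

Definition dec h g t := g t - g (t + h).

Definition decs hs g := foldr dec g hs.

(** Complete monotonicity by finite differences with possibly different steps: no smoothness is
    presumed, and as a family of inequalities between finitely many values it passes to pointwise
    limits. *)
Definition cmono g := forall hs t, all (fun h => 0 < h) hs -> 0 < t -> 0 <= decs hs g t.

Definition nderive g t := - derive1 g t.

Lemma decC h k g : dec h (dec k g) = dec k (dec h g).
Proof.
apply/funext => t; rewrite /dec.
by rewrite (addrAC t h k) !opprB addrACA [X in _ + X]addrC -addrACA [RHS]addrA addrA; ring.
Qed.

Lemma decs_decs hs ks g : decs hs (decs ks g) = decs (hs ++ ks) g.
Proof. by rewrite /decs foldr_cat. Qed.

Lemma cmono_dec h g : 0 < h -> cmono g -> cmono (dec h g).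
Proof.
move=> h0 cg hs t hs0 t0.
have := cg (rcons hs h) t; rewrite -cats1 -decs_decs /=; apply => //.
by rewrite all_cat hs0 /= h0.
Qed.

Lemma cmono_ge0 g t : cmono g -> 0 < t -> 0 <= g t.
Proof. by move=> cg t0; exact: (cg [::]). Qed.

Lemma cmono_le g t u : cmono g -> 0 < t -> t <= u -> g u <= g t.
Proof.
move=> cg t0; rewrite le_eqVlt => /predU1P[->//|tu].
have := cg [:: u - t] t; rewrite /= subr_gt0 tu => /(_ isT t0).
by rewrite /dec (addrC t) subrK subr_ge0.
Qed.

Lemma cmono_cvg (f : nat -> R -> R) g :
  (forall n, cmono (f n)) -> (forall t, 0 < t -> f n t @[n --> \oo] --> g t) -> cmono g.
Proof.
move=> cf fg hs t hs0 t0.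
have H : decs hs (f n) t @[n --> \oo] --> decs hs g t.
  elim: hs t t0 hs0 => [|h hs ih] t t0 /=; first by move=> _; exact: fg.
  move=> /andP[h0 hs0]; rewrite /dec.
  by apply: cvgB; apply: ih => //; rewrite addr_gt0.
rewrite -(cvg_lim (@Rhausdorff R) H); apply: limr_ge; first by apply/cvg_ex; exists (decs hs g t).
by apply: nearW => n; exact: cf.
Qed.

Lemma cmonoZ c g : 0 <= c -> cmono g -> cmono (fun t => c * g t).
Proof.
move=> c0 cg hs t hs0 t0.
have -> : decs hs (fun t => c * g t) = fun t => c * decs hs g t.
  by elim: hs {hs0} => //= h hs ->; apply/funext => u; rewrite /dec mulrBr.
by rewrite mulr_ge0// cg.
Qed.

(* Convexity; commensurability of [h] and [k] is avoided by monotonicity. *)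
Lemma cmono_slope g t h u k : cmono g -> 0 < t -> 0 < h -> 0 < k -> t + h <= u ->
  (g u - g (u + k)) / k <= (g t - g (t + h)) / h.
Proof.
move=> cg t0 h0 k0 thu.
have u0 : 0 < u by apply: lt_le_trans thu; rewrite addr_gt0.
rewrite ler_pdivrMr//.
have dg0 v e : 0 < v -> 0 < e -> 0 <= g v - g (v + e).
  by move=> v0 e0; rewrite subr_ge0 cmono_le// lerDl ltW.
suff H n : g u - g (u + k) <= (k / h + n.+1%:R^-1) * (g t - g (t + h)).
  rewrite -subr_ge0 leNgt; apply/negP => lt0.
  set d := g t - g (t + h) in H lt0.
  have d0 : 0 <= d by exact: dg0.
  have [n hn] : exists n : nat, d < n.+1%:R * (g u - g (u + k) - d / h * k).
    exists (Num.truncn (d / (g u - g (u + k) - d / h * k))).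
    by rewrite -ltr_pdivrMr ?truncnS_gt//; move: lt0; rewrite -oppr_gt0 opprB.
  have := H n; rewrite mulrDl -lerBlDl => H1.
  move: hn; rewrite ltNge => /negP; apply.
  rewrite -ler_pdivlMl//; apply: le_trans H1.
  by rewrite le_eqVlt; apply/orP; left; apply/eqP; field; rewrite gt_eqF.
(* The mesh [e] divides [h] exactly. [M] steps of it overshoot [k], which monotonicity permits, and
   M / n.+1 exceeds k / h by at most 1 / n.+1. *)
pose e := h / n.+1%:R.
have e0 : 0 < e by rewrite divr_gt0.
pose M := (Num.truncn (k / e)).+1.
have sumE v j : g v - g (v + j%:R * e) = \sum_(i < j) dec e g (v + i%:R * e).
  elim: j => [|j ih]; first by rewrite big_ord0 mul0r addr0 subrr.
  rewrite big_ord_recr/= -ih /dec -[X in g (v + X%:R * e)]addn1 natrD mulrDl mul1r addrA.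
  by rewrite addrA subrK.
have decle v v' : 0 < v -> v <= v' -> dec e g v' <= dec e g v.
  move=> v0 vv'; exact: (cmono_le (cmono_dec e0 cg)).
have ub : g u - g (u + k) <= M%:R * dec e g u.
  apply: (@le_trans _ _ (g u - g (u + M%:R * e))).
    rewrite lerD2l lerN2 cmono_le ?addr_gt0//.
    by rewrite lerD2l -ler_pdivrMr// ltW// truncnS_gt.
  rewrite sumE (le_trans (y := \sum_(i < M) dec e g u))//.
    by apply: ler_sum => i _; rewrite decle// lerDl mulr_ge0// ltW.
  by rewrite sumr_const card_ord mulr_natl.
have lb : n.+1%:R * dec e g u <= g t - g (t + h).
  have -> : t + h = t + n.+1%:R * e by rewrite /e mulrC divfK.
  rewrite sumE (le_trans (y := \sum_(i < n.+1) dec e g u))//.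
    by rewrite sumr_const card_ord mulr_natl.
  apply: ler_sum => i _; rewrite decle//.
    by rewrite ltr_wpDr// mulr_ge0// ltW.
  apply: le_trans thu; rewrite lerD2l /e mulrC -mulrA ler_piMr ?(ltW h0)//.
  by rewrite mulrC ler_pdivrMr// mul1r ler_nat ltnW.
apply: (le_trans ub).
apply: (@le_trans _ _ (M%:R / n.+1%:R * (g t - g (t + h)))).
  by rewrite -mulrA ler_wpM2l// ler_pdivlMl.
rewrite ler_wpM2r ?dg0// ler_pdivrMr// mulrDl mulVf// /M -natr1 lerD2r.
have -> : k / h * n.+1%:R = k / e by rewrite /e invf_div mulrA mulrAC.
by rewrite truncn_le ltW ?divr_gt0.
Qed.

(** The slope over [t, t + k] averages those over [t, t + h] and [t + h, t + k], and by convexity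
    the second is the smaller. *)
Lemma cmono_slope_start g t h k : cmono g -> 0 < t -> 0 < h -> h <= k ->
  (g t - g (t + k)) / k <= (g t - g (t + h)) / h.
Proof.
move=> cg t0 h0; rewrite le_eqVlt => /predU1P[->//|hk].
have k0 := lt_trans h0 hk.
have kh0 : 0 < k - h by rewrite subr_gt0.
have := cmono_slope cg t0 h0 kh0 (lexx _).
rewrite -addrA (addrC h) subrK ler_pdivrMr// => H.
rewrite ler_pdivrMr//.
have -> : g t - g (t + k) = (g t - g (t + h)) / h * h + (g (t + h) - g (t + k)).
  by rewrite divfK ?gt_eqF// addrA subrK.
by rewrite -lerBrDl (le_trans H)// -mulrBr.
Qed.

(** Forward slopes at [t] increase as the step shrinks and stay below every slope taken to the left
    of [t]; the slope over [t / 2, t] gives the explicit bound, [g t] being nonnegative. *)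
Lemma cmono_rder g t : cmono g -> 0 < t ->
  exists l, [/\ (g t - g (t + n.+1%:R^-1)) / n.+1%:R^-1 @[n --> \oo] --> l,
    l <= 2 / t * g (t / 2),
    forall h, 0 < h -> (g t - g (t + h)) / h <= l &
    forall u h, 0 < u -> 0 < h -> u + h <= t -> l <= (g u - g (u + h)) / h].
Proof.
move=> cg t0.
have t20 : 0 < t / 2 by rewrite divr_gt0.
pose q n := (g t - g (t + n.+1%:R^-1)) / n.+1%:R^-1.
have ndq : nondecreasing_seq q.
  by move=> n m nm; rewrite /q cmono_slope_start// lef_pV2 ?posrE// ler_nat.
have ubq u h n : 0 < u -> 0 < h -> u + h <= t -> q n <= (g u - g (u + h)) / h.
  by move=> u0 h0 uht; rewrite /q cmono_slope.
have cq : cvgn q.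
  apply: nondecreasing_is_cvgn => //.
  exists ((g (t / 2) - g (t / 2 + t / 2)) / (t / 2)) => _ [n _ <-].
  by apply: ubq => //; rewrite -splitr.
have ubl u h : 0 < u -> 0 < h -> u + h <= t -> limn q <= (g u - g (u + h)) / h.
  by move=> u0 h0 uht; apply: limr_le => //; apply: nearW => n; exact: ubq.
exists (limn q); split => //.
- apply: (le_trans (ubl _ _ t20 t20 _)); first by rewrite -splitr.
  rewrite invf_div mulrC ler_wpM2l ?divr_ge0 ?(ltW t0)//.
  by rewrite lerBlDr lerDl -splitr cmono_ge0.
- move=> h h0.
  have [n hn] : exists n : nat, n.+1%:R^-1 <= h.
    exists (Num.truncn h^-1).
    by rewrite -[leRHS]invrK lef_pV2 ?posrE ?invr_gt0// ltW// truncnS_gt.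
  apply: le_trans (nondecreasing_cvgn_le ndq cq n).
  by rewrite /q cmono_slope_start.
Qed.

(** The one-sided derivative is a pointwise limit of multiples of differences of [g], hence
    completely monotone itself. As such it is locally Lipschitz, which makes it the two-sided
    derivative. *)
Lemma cmono_nderive g : cmono g ->
  [/\ cmono (nderive g), forall t, 0 < t -> is_derive t 1 g (- nderive g t)
    & forall t, 0 < t -> nderive g t <= 2 / t * g (t / 2)].
Proof.
move=> cg.
have /choice[g1 Hg1] : forall t, exists l, 0 < t ->
    [/\ (g t - g (t + n.+1%:R^-1)) / n.+1%:R^-1 @[n --> \oo] --> l,
    l <= 2 / t * g (t / 2),
    forall h, 0 < h -> (g t - g (t + h)) / h <= l &
    forall u h, 0 < u -> 0 < h -> u + h <= t -> l <= (g u - g (u + h)) / h].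
  move=> t; have [t0|t0] := ltP 0 t; last by exists 0.
  by have [l Hl] := cmono_rder cg t0; exists l.
have cg1 : cmono g1.
  apply: (@cmono_cvg (fun n t => n.+1%:R * dec n.+1%:R^-1 g t)).
    by move=> n; apply: cmonoZ => //; apply: cmono_dec.
  move=> t t0; have [H _ _ _] := Hg1 t t0.
  by under eq_fun do rewrite mulrC -[X in _ * X]invrK.
have lip t h : 0 < t -> 0 < h -> g1 t - g1 (t + h) <= (2 / t * g1 (t / 2)) * h.
  move=> t0 h0; have t20 : 0 < t / 2 by rewrite divr_gt0.
  rewrite -ler_pdivrMr//.
  apply: (le_trans (cmono_slope cg1 t20 t20 h0 _)); first by rewrite -splitr.
  rewrite invf_div mulrC ler_wpM2l ?divr_ge0 ?(ltW t0)//.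
  by rewrite lerBlDr lerDl -splitr cmono_ge0.
have dg t : 0 < t -> is_derive t 1 g (- g1 t).
  move=> t0.
  have t20 : 0 < t / 2 by rewrite divr_gt0.
  have t40 : 0 < t / 2 / 2 by rewrite divr_gt0.
  have H : h^-1 *: ((g \o shift t) (h *: 1) - g t) @[h --> 0^'] --> - g1 t.
    apply/cvgrPdist_le => e e0.
    (* For h < 0 the Lipschitz estimate is based at t + h > t / 2, so the constant is taken at t /
       2, where it dominates the one at [t]. *)
    pose C := 2 / (t / 2) * g1 (t / 2 / 2).
    have G0 u : 0 < u -> 0 <= g1 u by exact: cmono_ge0.
    have C0 : 0 <= C by apply: mulr_ge0; [apply: divr_ge0 => //; exact: ltW|exact: G0].
    have C0' : 2 / t * g1 (t / 2) <= C.
      rewrite /C ler_pM ?G0 ?divr_ge0 ?(ltW t0)//.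
        by rewrite ler_pM2l// lef_pV2 ?posrE// ler_pdivrMr// ler_peMr ?(ltW t0)// ler1n.
      by apply: cmono_le => //; rewrite ler_pdivrMr// ler_peMr ?(ltW t20)// ler1n.
    near=> h.
    have hn0 : h != 0 by near: h; exact: nbhs_dnbhs_neq.
    have hlt : `|h| < t / 2.
      by near: h; apply: dnbhs0_lt.
    have hC : `|h| * C <= e.
      apply: (@le_trans _ _ (`|h| * (C + 1))); first by rewrite ler_wpM2l// lerDl.
      by rewrite -ler_pdivlMr ?ltr_wpDl//; near: h; apply: dnbhs0_le; rewrite divr_gt0 ?ltr_wpDl.
    rewrite /= /GRing.scale/= mulr1.
    have [h0|h0|h0] := ltgtP 0 h; last by rewrite -h0 eqxx in hn0.
    - have [_ _ H1 _] := Hg1 t t0; have [_ _ _ H2] := Hg1 (t + h) (addr_gt0 t0 h0).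
      have {}H1 := H1 h h0; have {}H2 := H2 t h t0 h0 (lexx _).
      have := lip t h t0 h0.
      have -> : - g1 t - h^-1 * (g (h + t) - g t) = - (g1 t - (g t - g (t + h)) / h).
        by rewrite (addrC h); ring.
      rewrite normrN ger0_norm ?subr_ge0// => L.
      apply: (le_trans _ hC); rewrite (gtr0_norm h0) [leRHS]mulrC.
      apply: (@le_trans _ _ (2 / t * g1 (t / 2) * h)); last by rewrite ler_wpM2r// ltW.
      by apply: le_trans L; rewrite lerD2l lerN2.
    - have k0 : 0 < - h by rewrite oppr_gt0.
      have hk : - h < t / 2 by rewrite -(ltr0_norm h0).
      have th0 : t / 2 < h + t by rewrite -ltrBlDr; lra.
      have th00 := lt_trans t20 th0.
      have [_ _ H1 _] := Hg1 (h + t) th00; have [_ _ _ H2] := Hg1 t t0.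
      have E : h + t + - h = t by ring.
      have {}H1 := H1 (- h) k0; rewrite E in H1.
      have H3 := H2 (h + t) (- h) th00 k0; rewrite E in H3; have {}H3 := H3 (lexx _).
      have := lip (h + t) (- h) th00 k0; rewrite E => L.
      have -> : - g1 t - h^-1 * (g (h + t) - g t) = (g (h + t) - g t) / (- h) - g1 t.
        by rewrite invrN; ring.
      rewrite ger0_norm ?subr_ge0//.
      apply: (le_trans _ hC); rewrite (ltr0_norm h0) [leRHS]mulrC.
      apply: (@le_trans _ _ (g1 (h + t) - g1 t)); first by rewrite lerD2r.
      apply: (le_trans L); rewrite ler_wpM2r ?(ltW k0)// /C.
      rewrite ler_pM ?G0 ?divr_ge0 ?divr_gt0 ?(ltW th00)//.
        by rewrite ler_pM2l// lef_pV2 ?posrE// ltW.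
      by apply: cmono_le => //; rewrite ler_pM2r// ltW.
  apply: DeriveDef; first by apply/cvg_ex; exists (- g1 t).
  exact: cvg_lim H.
have E t : 0 < t -> nderive g t = g1 t.
  by move=> t0; rewrite /nderive derive1E; have [_ ->] := dg t t0; rewrite opprK.
split.
- apply: (@cmono_cvg (fun=> g1)) => // t t0; rewrite E//; exact: cvg_cst.
- by move=> t t0; rewrite E//; exact: dg.
- by move=> t t0; rewrite E//; have [] := Hg1 t t0.
Unshelve. all: by end_near. Qed.

Lemma cmono_iter g k : cmono g -> cmono (iter k nderive g).
Proof. by move=> cg; elim: k => //= k /cmono_nderive[]. Qed.

Lemma is_derive_iter_nderive g k t : cmono g -> 0 < t ->
  is_derive t 1 (iter k nderive g) (- iter k.+1 nderive g t).
Proof. by move=> /(@cmono_iter _ k) /cmono_nderive[_ + _]; apply. Qed.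

(** The bound of [cmono_nderive] is iterated, halving the time at each order, at the price of a
    factor 2 * 2^k. The constant depends on the order only: it serves later for a whole family of
    functions at once. *)
Lemma iter_nderive_le k : exists2 c : R, 0 <= c &
  forall g B, cmono g -> (forall t, 0 < t -> g t <= B) ->
  forall t, 0 < t -> iter k nderive g t <= c / t ^+ k * B.
Proof.
elim: k => [|k [c c0 ih]].
  by exists 1 => // g B _ gB t t0; rewrite /= expr0 divr1 mul1r gB.
exists (2 * 2 ^+ k * c); first by rewrite !mulr_ge0// exprn_ge0.
move=> g B cg gB t t0.
have [_ _ /(_ t t0) H] := cmono_nderive (cmono_iter k cg).
apply: (le_trans H); have t20 : 0 < t / 2 by rewrite divr_gt0.
apply: (@le_trans _ _ (2 / t * (c / (t / 2) ^+ k * B))).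
  by rewrite ler_wpM2l ?divr_ge0 ?(ltW t0)//; exact: ih.
have tk : t ^+ k != 0 by rewrite expf_neq0// gt_eqF.
have tn : t != 0 by rewrite gt_eqF.
rewrite expr_div_n exprS le_eqVlt; apply/orP; left; apply/eqP.
by field; rewrite tn tk expf_neq0.
Qed.

Definition sqdecs hs g := foldr (fun h f => dec h (dec h f)) g hs.

(* Differences with repeated steps are squared norms for a positive definite
   function on the additive semigroup of positive reals; boundedness turns
   the resulting midpoint convexity into monotonicity. *)
Definition posdef g := forall hs, all (fun h => 0 < h) hs ->
  exists C, forall t, 0 < t -> 0 <= sqdecs hs g t <= C.

(** Second differences along t + k h are nonnegative, so an initial increase persists and [g] grows
    at least linearly, against its bound. *)
Lemma posdef_noninc g h t : posdef g -> 0 < h -> 0 < t -> 0 <= dec h g t.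
Proof.
move=> pg h0 t0; rewrite leNgt; apply/negP => d0.
have [C gC] := pg [::] isT.
have H k : g t - k%:R * dec h g t <= g (t + k%:R * h) /\ dec h g (t + k%:R * h) <= dec h g t.
  elim: k => [|k [ih1 ih2]]; first by rewrite !mul0r subr0 addr0.
  have E : t + k.+1%:R * h = t + k%:R * h + h by rewrite -natr1 mulrDl mul1r addrA.
  split.
    rewrite E -natr1 mulrDl mul1r opprD addrA.
    apply: (@le_trans _ _ (g (t + k%:R * h) - dec h g (t + k%:R * h))).
      by rewrite lerB.
    by rewrite /dec subKr.
  apply: le_trans ih2; rewrite E -subr_ge0.
  have [|C' /(_ (t + k%:R * h))] := pg [:: h]; first by rewrite /= h0.
  by rewrite ltr_wpDr// ?mulr_ge0// ?(ltW h0)// => /(_ isT)/andP[].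
have [n hn] : exists n : nat, C < n%:R * (- dec h g t).
  exists (Num.truncn (C / (- dec h g t))).+1.
  by rewrite -ltr_pdivrMr ?oppr_gt0// truncnS_gt.
have [H1 _] := H n.
have tn : 0 < t + n%:R * h by rewrite ltr_wpDr// mulr_ge0// ltW.
have /andP[_ H2] := gC _ tn.
have /andP[H3 _] := gC _ t0.
rewrite /= in H2 H3.
have := lt_le_trans hn (le_trans _ (le_trans H1 H2)).
by rewrite mulrN lerDr => /(_ H3); rewrite ltxx.
Qed.

Lemma sqdecs_dec hs h g : sqdecs hs (dec h g) = dec h (sqdecs hs g).
Proof. by elim: hs => //= k hs ->; rewrite !(decC _ h). Qed.

Lemma posdef_sqdec g h : posdef g -> 0 < h -> posdef (dec h (dec h g)).
Proof.
move=> pg h0 hs hs0; have [|C HC] := pg (rcons hs h).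
  by rewrite all_rcons h0 hs0.
by exists C => t t0; have := HC t t0; rewrite -cats1 /sqdecs foldr_cat.
Qed.

Lemma posdef_sqdecs g hs : posdef g -> all (fun h => 0 < h) hs -> posdef (sqdecs hs g).
Proof.
by move=> pg; elim: hs => //= h hs ih /andP[h0 hs0]; apply: posdef_sqdec => //; exact: ih.
Qed.

(** Single and double differences commute, and the single difference of a positive definite function
    lies between 0 and that function. This passes from repeated steps to arbitrary ones. *)
Lemma posdef_dec g h : posdef g -> 0 < h -> posdef (dec h g).
Proof.
move=> pg h0 hs hs0; have [C HC] := pg hs hs0; exists C => t t0.
rewrite sqdecs_dec posdef_noninc//=; last exact: posdef_sqdecs.
have /andP[_ H1] := HC t t0; have /andP[H2 _] := HC (t + h) (addr_gt0 t0 h0).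
by rewrite /dec lerBlDr (le_trans H1)// lerDl.
Qed.

Lemma posdef_cmono g : posdef g -> cmono g.
Proof.
move=> pg hs t hs0 t0.
have H : posdef (decs hs g).
  elim: hs hs0 => //= h hs ih /andP[h0 hs0]; apply: posdef_dec => //; exact: ih.
by have [C /(_ t t0)/andP[]] := H [::] isT.
Qed.

End CompletelyMonotone.

(** * Functionals behaving like integrals *)

Section IntegralLike.
Context {R : realType}.

Section Def.
Context d (T : measurableType d).
Local Open Scope ereal_scope.

Definition nnmeas (f : T -> \bar R) :=
  (forall x, 0 <= f x) /\ measurable_fun [set: T] f.

(** Iterated integrals against kernels, laws and time are handled as functionals. An identity
    between two of them then needs checking on indicators only, or on a generating class such as
    rays or rectangles. *)
Record integral_like (Phi : (T -> \bar R) -> \bar R) : Prop := IntegralLike {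
  il_ge0 : forall f, nnmeas f -> 0 <= Phi f;
  il_add : forall f g, nnmeas f -> nnmeas g -> Phi (f \+ g) = Phi f + Phi g;
  il_scale : forall (c : R) f, (0 <= c)%R -> nnmeas f ->
    Phi (fun x => c%:E * f x) = c%:E * Phi f;
  il_le : forall f g, nnmeas f -> nnmeas g -> (forall x, f x <= g x) -> Phi f <= Phi g;
  il_lim : forall (f : nat -> T -> \bar R), (forall n, nnmeas (f n)) ->
    (forall x, nondecreasing_seq (f ^~ x)) ->
    Phi (fun x => limn (f ^~ x)) = limn (fun n => Phi (f n)) }.

Lemma nnmeas_indic (A : set T) : measurable A -> nnmeas (fun x => (\1_A x)%:E).
Proof.
by move=> mA; split => [x|]; [rewrite lee_fin|exact/measurable_EFinP/measurable_indic].
Qed.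

Lemma nnmeas_scale (c : R) f : (0 <= c)%R -> nnmeas f -> nnmeas (fun x => c%:E * f x).
Proof.
move=> c0 [f0 mf]; split => [x|]; first by rewrite mule_ge0 ?lee_fin.
exact: measurable_funeM.
Qed.

Lemma nnmeas_add f g : nnmeas f -> nnmeas g -> nnmeas (f \+ g).
Proof.
by move=> [f0 mf] [g0 mg]; split => [x|]; [exact: adde_ge0|exact: emeasurable_funD].
Qed.

Lemma nnmeas0 : nnmeas (fun=> 0).
Proof. by split => // x. Qed.

Lemma nnmeas_sum (I : Type) (s : seq I) (f : I -> T -> \bar R) :
  (forall i, nnmeas (f i)) -> nnmeas (fun x => \sum_(i <- s) f i x).
Proof.
move=> nf; elim: s => [|i s ih].
  by under eq_fun do rewrite big_nil; exact: nnmeas0.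
by under eq_fun do rewrite big_cons; exact: nnmeas_add.
Qed.

Lemma il0 Phi : integral_like Phi -> Phi (fun=> 0) = 0.
Proof.
move=> ilP; have := il_scale ilP (lexx 0%R) nnmeas0.
by under [X in Phi X]eq_fun do rewrite mul0e; rewrite mul0e.
Qed.

Lemma il_sum Phi (I : Type) (s : seq I) (f : I -> T -> \bar R) : integral_like Phi ->
  (forall i, nnmeas (f i)) ->
  Phi (fun x => \sum_(i <- s) f i x) = \sum_(i <- s) Phi (f i).
Proof.
move=> ilP nf; elim: s => [|i s ih].
  by under [X in Phi X]eq_fun do rewrite big_nil; rewrite big_nil il0.
under [X in Phi X]eq_fun do rewrite big_cons.
by rewrite big_cons -ih -il_add//; exact: nnmeas_sum.
Qed.

Import HBNNSimple.

(** The test on the sign of [r] is there because the sum is split term by term, where it is no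
    longer visible that [r] is a value of [h]; [il_scale] covers nonnegative factors only. *)
Lemma il_nnsfun Phi (h : {nnsfun T >-> R}) : integral_like Phi ->
  Phi (fun x => (h x)%:E) =
  \sum_(r <- fset_set (range h)) (if (0 <= r)%R then r%:E * Phi (fun x => (\1_(h @^-1` [set r]) x)%:E) else 0).
Proof.
move=> ilP.
transitivity (Phi (fun x => \sum_(r <- fset_set (range h))
    (if (0 <= r)%R then r%:E * (\1_(h @^-1` [set r]) x)%:E else 0))).
  congr Phi; apply/funext => x; rewrite fimfunE/= fsbig_finite//= -sumEFin.
  apply: eq_big_seq => r.
  by rewrite in_fset_set// => /set_mem[y _ <-]; rewrite fun_ge0.
rewrite il_sum//; last first.
  move=> r; have [r0|_] := leP 0%R r; last exact: nnmeas0.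
  apply: nnmeas_scale => //; exact: nnmeas_indic.
apply: eq_bigr => r _; have [r0|_] := leP 0%R r; last exact: il0.
by rewrite il_scale//; exact: nnmeas_indic.
Qed.

Lemma il_eq Phi Psi : integral_like Phi -> integral_like Psi ->
  (forall A, measurable A -> Phi (fun x => (\1_A x)%:E) = Psi (fun x => (\1_A x)%:E)) ->
  forall f, nnmeas f -> Phi f = Psi f.
Proof.
move=> il1 il2 e f [f0 mf].
pose h := nnsfun_approx measurableT mf.
have fE : f = fun x => limn (fun n => (h n x)%:E).
  apply/funext => x; apply/esym/cvg_lim => //.
  exact: (@cvg_nnsfun_approx _ _ _ _ measurableT _ mf).
have nh n : nnmeas (fun x => (h n x)%:E).
  by split => [x|]; [rewrite lee_fin|exact/measurable_EFinP].
have ndh x : nondecreasing_seq (fun n => (h n x)%:E).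
  by move=> n m nm; rewrite lee_fin; exact/lefP/nd_nnsfun_approx.
rewrite fE (il_lim il1)// (il_lim il2)//; congr (limn _); apply/funext => n.
rewrite !il_nnsfun//; apply: eq_bigr => r _; case: ifPn => // r0.
by rewrite e.
Qed.

Lemma il_addf Phi Psi : integral_like Phi -> integral_like Psi ->
  integral_like (fun f => Phi f + Psi f).
Proof.
move=> i1 i2; split.
- by move=> f nf; rewrite adde_ge0// il_ge0.
- by move=> f g nf ng; rewrite !il_add// addeACA.
- by move=> c f c0 nf; rewrite !il_scale// ge0_muleDr// il_ge0.
- by move=> f g nf ng fg; rewrite leeD// il_le.
- move=> f nf ndf; rewrite !il_lim// limeD//.
  + by apply: ereal_nondecreasing_is_cvgn => n m nm; apply: (il_le i1) => // x; exact: ndf.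
  + by apply: ereal_nondecreasing_is_cvgn => n m nm; apply: (il_le i2) => // x; exact: ndf.
  + apply: ge0_adde_def; rewrite inE; apply: lime_ge.
    * by apply: ereal_nondecreasing_is_cvgn => n m nm; apply: (il_le i1) => // x; exact: ndf.
    * by apply: nearW => n; exact: il_ge0.
    * by apply: ereal_nondecreasing_is_cvgn => n m nm; apply: (il_le i2) => // x; exact: ndf.
    * by apply: nearW => n; exact: il_ge0.
Qed.

End Def.

Section Comp.
Context d (T : measurableType d).
Local Open Scope ereal_scope.

Lemma il_eval (k : \bar R) (y : T) : 0 <= k -> integral_like (fun f => k * f y).
Proof.
move=> k0; split.
- by move=> f [f0 _]; rewrite mule_ge0.
- by move=> f g [f0 _] [g0 _]; rewrite ge0_muleDr.
- by move=> c f c0 _; rewrite muleCA.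
- by move=> f g _ _ fg; rewrite lee_wpmul2l.
- move=> f nf ndf; have [->|kN] := eqVneq k 0.
    rewrite mul0e; apply/esym; under eq_fun do rewrite mul0e; exact: lim_cst.
  have cf : cvgn (f ^~ y) by exact: ereal_nondecreasing_is_cvgn.
  (* For infinite [k] the limit is 0 or +oo according to whether every [f n y] vanishes. *)
  case: k k0 kN => [k k0 kN|_ _|//]; last first.
    have [f0|] := pselect (forall n, f n y = 0).
      under [X in limn X]eq_fun do rewrite f0; rewrite lim_cst// mule0.
      by apply/esym; under eq_fun do rewrite f0 mule0; exact: lim_cst.
    move=> /existsNP[n fn].
    have fn0 : 0 < f n y by rewrite lt0e; have [-> _] := nf n; rewrite andbT; apply/eqP.
    rewrite gt0_mulye; last first.
      apply: (lt_le_trans fn0); apply: lime_ge => //; near=> m.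
      by apply: ndf; near: m; exact: nbhs_infty_ge.
    apply/esym/cvg_lim => //; apply: cvg_near_cst; near=> m.
    rewrite gt0_mulye// (lt_le_trans fn0)//; apply: ndf; near: m; exact: nbhs_infty_ge.
  by rewrite limeMl.
Unshelve. all: by end_near. Qed.

Context d' (U : measurableType d') (mu : {measure set U -> \bar R}) (D : set U)
  (mD : measurable D).

(** Closure under mixtures: together with [il_eval] it covers the iterated integrals met later. *)
Lemma il_comp (Psi : U -> (T -> \bar R) -> \bar R) :
  (forall x, D x -> integral_like (Psi x)) ->
  (forall f, nnmeas f -> measurable_fun D (Psi ^~ f)) ->
  integral_like (fun f => \int[mu]_(x in D) Psi x f).
Proof.
move=> ilP mP; split.
- by move=> f nf; apply: integral_ge0 => x Dx; exact: (il_ge0 (ilP x Dx)).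
- move=> f g nf ng; rewrite -ge0_integralD//; first last.
  + exact: mP.
  + by move=> x Dx; exact: (il_ge0 (ilP x Dx)).
  + exact: mP.
  + by move=> x Dx; exact: (il_ge0 (ilP x Dx)).
  by apply: eq_integral => x /set_mem Dx; rewrite (il_add (ilP x Dx)).
- move=> c f c0 nf; rewrite -ge0_integralZl//; first last.
  + by move=> x Dx; exact: (il_ge0 (ilP x Dx)).
  + exact: mP.
  by apply: eq_integral => x /set_mem Dx; rewrite (il_scale (ilP x Dx)).
- move=> f g nf ng fg; apply: ge0_le_integral => //.
  + by move=> x Dx; exact: (il_ge0 (ilP x Dx)).
  + exact: mP.
  + exact: mP.
  + by move=> x Dx; exact: (il_le (ilP x Dx)).
- move=> f nf ndf; rewrite -monotone_convergence//; first last.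
  + by move=> x Dx n m nm; apply: (il_le (ilP x Dx)) => // y; exact: ndf.
  + by move=> n x Dx; exact: (il_ge0 (ilP x Dx)).
  + by move=> n; exact: mP.
  by apply: eq_integral => x /set_mem Dx; rewrite (il_lim (ilP x Dx)).
Qed.

End Comp.

Section Pushforward.
Context d (T : measurableType d) d' (U : measurableType d') (mu : {measure set U -> \bar R})
  (D : set U) (mD : measurable D).
Local Open Scope ereal_scope.

Lemma il_pushforward (phi : U -> T) : measurable_fun D phi ->
  integral_like (fun f : T -> \bar R => \int[mu]_(x in D) f (phi x)).
Proof.
move=> mphi.
have := @il_comp _ T _ U mu D mD (fun x (f : T -> \bar R) => 1 * f (phi x)).
under [X in _ -> _ -> integral_like X]eq_fun do under eq_integral do rewrite mul1e.
apply; first by move=> x _; exact: il_eval.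
move=> g [_ mg]; under eq_fun do rewrite mul1e.
exact: (measurableT_comp mg).
Qed.

End Pushforward.

Section Measure.
Context d (T : measurableType d) (Phi : (T -> \bar R) -> \bar R) (ilP : integral_like Phi).
Local Open Scope ereal_scope.

(** The default 0 off the measurable sets keeps the set function nonnegative everywhere, as the
    measure structure demands. *)
Definition il_measure (A : set T) : \bar R :=
  if A \in measurable then Phi (fun x => (\1_A x)%:E) else 0.

Let m0 : il_measure set0 = 0.
Proof.
rewrite /il_measure mem_set//; under [X in Phi X]eq_fun do rewrite indic0; exact: il0.
Qed.

Let mge0 A : 0 <= il_measure A.
Proof.
rewrite /il_measure; case: ifPn => // /set_mem mA.
by apply: il_ge0 => //; exact: nnmeas_indic.
Qed.

Let msig : semi_sigma_additive il_measure.
Proof.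
move=> F mF tF mUF; rewrite {2}/il_measure mem_set//.
have nF n : nnmeas (fun x => (\1_(F n) x)%:E : \bar R) by exact: nnmeas_indic.
pose f n (x : T) : \bar R := \sum_(i <- iota 0 n) (\1_(F i) x)%:E.
have nf n : nnmeas (f n) by exact: nnmeas_sum.
have ndf x : nondecreasing_seq (f ^~ x).
  apply/nondecreasing_seqP => n; rewrite /f -addn1 iotaD big_cat/= leeDl//.
  by rewrite big_seq1 lee_fin.
have -> : (fun n => \sum_(0 <= i < n) il_measure (F i)) = fun n => Phi (f n).
  apply/funext => n; rewrite il_sum// /index_iota subn0; apply: eq_bigr => i _.
  by rewrite /il_measure mem_set.
have -> : (fun x => (\1_(\bigcup_n F n) x)%:E) = fun x => limn (f ^~ x).
  apply/funext => x; rewrite indic_bigcup//.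
  by congr (limn _); apply/funext => n; rewrite /f /index_iota subn0.
rewrite (il_lim ilP)//; apply: ereal_nondecreasing_is_cvgn => n m nm.
by apply: il_le => // x; exact: ndf.
Qed.

HB.instance Definition _ := isMeasure.Build _ _ _ il_measure m0 mge0 msig.

Definition ilm : {measure set T -> \bar R} := il_measure.

Lemma ilmE A : measurable A -> ilm A = Phi (fun x => (\1_A x)%:E).
Proof. by move=> mA; rewrite /ilm /= /il_measure mem_set. Qed.

End Measure.

Section Rays.
Local Open Scope ereal_scope.

(** Open rays form a generating pi-system, and those starting at - n exhaust the line with finite
    measure. *)
Lemma measure_unique_rays (m1 m2 : {measure set R -> \bar R}) :
  (forall y : R, m1 `]y, +oo[%classic = m2 `]y, +oo[%classic) ->
  (forall y : R, m1 `]y, +oo[%classic < +oo) ->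
  forall A, measurable A -> m1 A = m2 A.
Proof.
move=> e fin A mA.
apply: (@measure_unique _ _ _ (@RGenOInfty.G R)
  (fun n => `](- n%:R)%R, +oo[%classic)) => //.
- exact: RGenOInfty.measurableE.
- move=> _ _ [x ->] [y ->]; exists (Num.max x y).
  apply/seteqP; split => z /=; rewrite !in_itv/= !andbT gt_max; first by move=> [-> ->].
  by move/andP.
- by move=> i; exists (- i%:R)%R.
- rewrite -subTset => x _; exists (Num.truncn `|x|).+1 => //=.
  rewrite in_itv/= andbT ltrNl; apply: le_lt_trans (truncnS_gt _).
  by rewrite -normrN ler_norm.
- by move=> _ [x ->].
Qed.

Lemma il_eq_rays (Phi Psi : (R -> \bar R) -> \bar R) :
  integral_like Phi -> integral_like Psi ->
  (forall y : R, Phi (fun x => (\1_`]y, +oo[%classic x)%:E) =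
    Psi (fun x => (\1_`]y, +oo[%classic x)%:E)) ->
  (forall y : R, Phi (fun x => (\1_`]y, +oo[%classic x)%:E) < +oo) ->
  forall f, nnmeas f -> Phi f = Psi f.
Proof.
move=> i1 i2 e fin; apply: il_eq => // A mA.
rewrite -(ilmE i1 mA) -(ilmE i2 mA).
apply: measure_unique_rays => //.
- by move=> y; rewrite !ilmE.
- by move=> y; rewrite ilmE.
Qed.

End Rays.
End IntegralLike.

(** * Sequential limits and dominated convergence for real-valued integrals *)

Section Generalities.
Context {R : realType}.

Lemma is_derive_cvg_seq (f : R -> R) (a l : R) (u : nat -> R) :
  is_derive a 1 f l -> u n @[n --> \oo] --> 0 -> (forall n, u n != 0) ->
  (f (a + u n) - f a) / u n @[n --> \oo] --> l.
Proof.
move=> [df fl] u0 un0; rewrite -fl.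
have H : h^-1 *: ((f \o shift a) (h *: 1) - f a) @[h --> 0^'] --> 'D_1 f a by exact: df.
have /(_ u) := (cvgr_dnbhsP _ _ _).1 H; move=> /(_ (conj un0 u0)).
rewrite (_ : (fun n => _) = (fun n => (f (a + u n) - f a) / u n))//.
by apply/funext => n /=; rewrite /GRing.scale/= mulr1 mulrC (addrC a).
Qed.

Lemma eq_cvgn (u v : nat -> R) (l : R) :
  u =1 v -> u n @[n --> \oo] --> l -> v n @[n --> \oo] --> l.
Proof. by move=> /funext ->. Qed.

Lemma invS_cvg0 : (n.+1%:R^-1 : R) @[n --> \oo] --> 0.
Proof. exact: cvg_harmonic. Qed.

Lemma near_invS_lt (e : R) : 0 < e -> \forall n \near \oo, (n.+1%:R^-1 : R) < e.
Proof. by move=> e0; exact: (near_infty_natSinv_lt (PosNum e0)). Qed.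

Section Integral.
Context d (T : measurableType d) (mu : {measure set T -> \bar R}) (D : set T)
  (mD : measurable D).

Lemma EFin_Rintegral (f : T -> R) : mu.-integrable D (EFin \o f) ->
  (\int[mu]_(x in D) f x)%:E = (\int[mu]_(x in D) (f x)%:E)%E.
Proof. by move=> intf; rewrite /Rintegral fineK//; exact: integrable_fin_num. Qed.

Lemma Rintegral_dct (f_ : nat -> T -> R) (f g : T -> R) :
  (forall n, measurable_fun D (f_ n)) ->
  (forall x, D x -> f_ n x @[n --> \oo] --> f x) ->
  mu.-integrable D (EFin \o g) -> (forall n x, D x -> `|f_ n x| <= g x) ->
  mu.-integrable D (EFin \o f) /\
  \int[mu]_(x in D) f_ n x @[n --> \oo] --> \int[mu]_(x in D) f x.
Proof.
move=> mf ff ig fg.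
have mlim : measurable_fun D f by apply: (measurable_fun_cvg mf).
have ifn n : mu.-integrable D (EFin \o f_ n).
  apply: le_integrable ig => //; first exact/measurable_EFinP.
  by move=> x Dx /=; rewrite lee_fin (le_trans (fg n x Dx))// ler_norm.
have [|||||i1 _ i2] := @dominated_convergence _ _ _ mu D mD (fun n => EFin \o f_ n) (EFin \o f) (EFin \o g).
- by move=> n; exact/measurable_EFinP.
- exact/measurable_EFinP.
- by apply: aeW => x Dx /=; apply: cvg_EFin; [exact: nearW|exact: ff].
- exact: ig.
- by apply: aeW => x n Dx /=; rewrite lee_fin; exact: fg.
split => //; apply: fine_cvg; rewrite EFin_Rintegral//.
Qed.

Lemma bounded_integrable (f : T -> R) (C : R) : (mu D < +oo)%E ->
  measurable_fun D f -> (forall x, D x -> `|f x| <= C) -> mu.-integrable D (EFin \o f).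
Proof.
move=> muD mf fC; apply: (@le_integrable _ _ _ mu D mD (EFin \o f) (EFin \o cst C)).
- exact/measurable_EFinP.
- by move=> x Dx /=; rewrite lee_fin (le_trans (fC x Dx))// ler_norm.
- apply/integrableP; split; first exact/measurable_EFinP.
  by rewrite /= integral_cst// lte_mul_pinfty.
Qed.

End Integral.

Lemma bounded_integrableP d (T : measurableType d) (P : probability T R) (f : T -> R) (C : R) :
  measurable_fun setT f -> (forall x, `|f x| <= C) -> P.-integrable setT (EFin \o f).
Proof.
move=> mf fC; apply: (@bounded_integrable _ T P setT measurableT f C) => //.
by apply: (le_lt_trans (probability_le1 P measurableT)); rewrite ltry.
Qed.

Lemma RintegralP_cst d (T : measurableType d) (P : probability T R) (c : R) :
  \int[P]_w c = c.
Proof. by rewrite Rintegral_cst//= (probability_setT P) mulr1. Qed.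

Lemma normr_RintegralP d (T : measurableType d) (P : probability T R) (f : T -> R) (C : R) :
  measurable_fun setT f -> (forall x, `|f x| <= C) -> `|\int[P]_x f x| <= C.
Proof.
move=> mf fC; have ig := bounded_integrableP P mf fC.
apply: (le_trans (le_normr_Rintegral measurableT ig)).
rewrite -(RintegralP_cst P C); apply: le_Rintegral => //.
- by have := integrable_abse ig; apply: eq_integrable.
- by apply: (@bounded_integrableP _ T P _ `|C|).
Qed.

Lemma lebesgue_itv_lty (b0 b1 : bool) (a c : R) :
  (lebesgue_measure [set` Interval (BSide b0 a) (BSide b1 c)] < +oo :> \bar R)%E.
Proof. by rewrite lebesgue_measure_itv/=; case: ifP => _; rewrite -?EFinB ltry. Qed.

Lemma bounded_integrable_itv (b0 b1 : bool) (a c : R) (f : R -> R) (C : R) :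
  let D := [set` Interval (BSide b0 a) (BSide b1 c)] in
  measurable_fun D f -> (forall x, D x -> `|f x| <= C) ->
  lebesgue_measure.-integrable D (EFin \o f).
Proof.
move=> D mf fC; apply: (@bounded_integrable _ (measurableTypeR R) lebesgue_measure _ _ _ C) => //.
  exact: measurable_itv.
exact: lebesgue_itv_lty.
Qed.

End Generalities.

(** * Gaussian increments *)

Definition gauss {R : realType} (s : R) : probability (measurableTypeR R) R :=
  normal_prob 0 s.

Section Gaussian.
Context {R : realType} (s : R) (s0 : 0 < s).
Notation mu := (@lebesgue_measure R).
Notation N := (gauss s).

Lemma gauss_lty A : measurable A -> (N A < +oo)%E.
Proof. by move=> mA; apply: (le_lt_trans (probability_le1 (gauss s) mA)); rewrite ltry. Qed.

Lemma Rintegral_gauss_cst (c : R) : \int[N]_x c = c.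
Proof. by rewrite Rintegral_cst//= (probability_setT (gauss s)) mulr1. Qed.

Lemma integral_normal_prob (f : R -> \bar R) : nnmeas f ->
  (\int[N]_x f x = \int[mu]_x ((normal_pdf 0 s x)%:E * f x))%E.
Proof.
have mp : measurable_fun [set: R] (EFin \o normal_pdf 0 s).
  apply/measurable_EFinP; apply: measurable_normal_pdf.
have i1 : integral_like (fun f : R -> \bar R => \int[N]_x f x)%E.
  have := @il_comp R _ _ _ _ N setT measurableT (fun x (f : R -> \bar R) => 1 * f x)%E.
  under [X in _ -> _ -> integral_like X]eq_fun do under eq_integral do rewrite mul1e.
  apply; first by move=> x _; exact: il_eval.
  by move=> g [_ mg]; under eq_fun do rewrite mul1e.
have i2 : integral_like (fun f : R -> \bar R => \int[mu]_x ((normal_pdf 0 s x)%:E * f x))%E.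
  apply: il_comp => //.
    by move=> x _; apply: il_eval; rewrite lee_fin normal_pdf_ge0.
  by move=> g [_ mg]; exact: emeasurable_funM.
move=> nf; apply: (il_eq i1 i2) => // A mA.
rewrite integral_indic// setIT /gauss/= /normal_prob [LHS]integral_mkcond; apply: eq_integral => x _.
rewrite patchE indicE; case: ifPn => xA; last by rewrite mule0.
by rewrite mule1.
Qed.

(** Completing the square tilts the centred density into the one of mean h s^2. *)
Lemma normal_mgf (h : R) :
  (\int[N]_x (expR (h * x))%:E = (expR (h ^+ 2 * s ^+ 2 / 2))%:E)%E.
Proof.
have mE : measurable_fun [set: R] (fun x => expR (h * x)).
  by apply: measurableT_comp => //; exact: measurable_funM.
have sN : s != 0 by rewrite gt_eqF.
rewrite integral_normal_prob; last first.
  by split => [x|]; [rewrite lee_fin expR_ge0|exact/measurable_EFinP].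
transitivity (\int[mu]_x ((expR (h ^+ 2 * s ^+ 2 / 2))%:E * (normal_pdf (h * s ^+ 2) s x)%:E))%E.
  apply: eq_integral => x _; rewrite -!EFinM; congr EFin.
  rewrite !normal_pdfE// /normal_fun subr0 mulrCA -[LHS]mulrA; congr (_ * _).
  by rewrite -!expRD; congr expR; field.
rewrite ge0_integralZl//.
- by rewrite integral_normal_pdf mule1.
- apply/measurable_EFinP; apply: measurable_normal_pdf.
- by move=> x _; rewrite lee_fin normal_pdf_ge0.
Qed.

Let mexp (h : R) : measurable_fun [set: R] (fun x => expR (h * x)).
Proof. by apply: measurableT_comp => //; exact: measurable_funM. Qed.

Lemma integrable_normal_expR (h : R) : N.-integrable setT (EFin \o (fun x => expR (h * x))).
Proof.
apply/integrableP; split; first by apply/measurable_EFinP; exact: mexp.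
under eq_integral => x _ do rewrite /= ger0_norm ?expR_ge0//.
by rewrite normal_mgf ltry.
Qed.

Lemma Rintegral_normal_expR (h : R) :
  \int[N]_x expR (h * x) = expR (h ^+ 2 * s ^+ 2 / 2).
Proof. by rewrite /Rintegral normal_mgf. Qed.

Lemma integrable_normal_cosh (h C : R) :
  N.-integrable setT (EFin \o (fun x => C * (expR (h * x) + expR (- h * x)))).
Proof.
have := integrableZl measurableT C (integrableD measurableT (integrable_normal_expR h) (integrable_normal_expR (- h))).
by apply: eq_integrable => // x _.
Qed.

(** Both moments are read off from the exponential ones through D = sinh (u x) / u, which tends to x
    with u: its mean is 0 by parity, and 2 sinh^2 (u x) = cosh (2 u x) - 1 gives the mean of its
    square. *)
Lemma normal_moments :
  [/\ N.-integrable setT (EFin \o (fun x => x)),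
      N.-integrable setT (EFin \o (fun x => x ^+ 2)),
      \int[N]_x x = 0 & \int[N]_x (x ^+ 2) = s ^+ 2].
Proof.
pose u (n : nat) : R := n.+1%:R^-1.
have u0 n : u n != 0 by rewrite invr_neq0.
have u1 n : 0 < u n <= 1 by rewrite invr_gt0 ltr0n /= invf_le1// ler1n.
pose D n (x : R) := (expR (u n * x) - expR (- u n * x)) / 2 / u n.
have mD n : measurable_fun [set: R] (D n).
  apply: measurable_funM => //; apply: measurable_funM => //.
  by apply: measurable_funB; exact: mexp.
have cD x : D n x @[n --> \oo] --> x.
  have der : is_derive (0 : R) 1 (fun h : R => (expR (h * x) - expR (- h * x)) / 2) x.
    apply: is_derive_eq.
    rewrite /GRing.scale/= !(mul0r, oppr0, mulr0, addr0, expR0, add0r, mulr1, mul1r, scale0r).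
    by field.
  have := is_derive_cvg_seq der invS_cvg0 u0.
  apply: cvg_trans; apply: near_eq_cvg; apply: nearW => n.
  by rewrite /D/= add0r !mul0r oppr0 !mul0r subrr mul0r subr0.
(* sinh v <= v exp v, from exp (- 2 v) >= 1 - 2 v; it dominates [D n] by exp (2 |x|) uniformly in
   [n]. *)
have shle (v : R) : 0 <= v -> (expR v - expR (- v)) / 2 <= v * expR v.
  move=> v0; have := expR_ge1Dx (- 2 * v).
  have -> : expR (- 2 * v) = expR (- v) * expR (- v) by rewrite -expRD; congr expR; ring.
  have := expR_gt0 v; have := expRxMexpNx_1 v.
  set a := expR v; set b := expR (- v) => ab a0 H.
  have : a * (1 + -2 * v) <= b.
    by have := ler_wpM2l (ltW a0) H; rewrite [leRHS]mulrA ab mul1r.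
  lra.
have bD n x : `|D n x| <= expR (2 * `|x|).
  have /andP[p1 p2] := u1 n.
  have E : `|D n x| = (expR (u n * `|x|) - expR (- (u n * `|x|))) / 2 / u n.
    rewrite /D mulNr; have [x0|x0] := leP 0 x.
      have v0 : 0 <= u n * x by rewrite mulr_ge0// ltW.
      rewrite [in RHS](ger0_norm x0) ger0_norm// divr_ge0 ?(ltW p1)// divr_ge0// subr_ge0 ler_expR.
      lra.
    rewrite [in RHS](ltr0_norm x0) mulrN opprK ler0_norm; first by rewrite -!mulNr opprB.
    rewrite mulr_le0_ge0 ?invr_ge0 ?(ltW p1)// mulr_le0_ge0// subr_le0 ler_expR.
    rewrite -mulrN ler_pM2l//; lra.
  rewrite E ler_pdivrMr//; apply: (le_trans (shle _ _)); first by rewrite mulr_ge0// ltW.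
  rewrite -mulrA [leRHS]mulrC ler_pM2l//.
  have -> : 2 * `|x| = `|x| + `|x| by rewrite mulr_natl.
  rewrite expRD ler_pM ?expR_ge0//; first by rewrite (le_trans _ (expR_ge1Dx _))// lerDr.
  by rewrite ler_expR ler_piMl.
have abse (k x : R) : 0 <= k -> expR (k * `|x|) <= 1 * (expR (k * x) + expR (- k * x)).
  move=> k0; rewrite mul1r; have [x0|x0] := leP 0 x; first by rewrite (ger0_norm x0) lerDl expR_ge0.
  by rewrite (ltr0_norm x0) mulNr mulrN lerDr expR_ge0.
have bD1 n x : `|D n x| <= 1 * (expR (2 * x) + expR (- 2 * x)).
  by rewrite (le_trans (bD n x))// abse.
have bD2 n x : `|D n x ^+ 2| <= 1 * (expR (4 * x) + expR (- 4 * x)).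
  apply: le_trans (abse 4 x _) => //; rewrite normrX.
  have -> : 4 * `|x| = 2 * `|x| + 2 * `|x| by lra.
  by rewrite expRD -expr2 lerXn2r// ?nnegrE ?expR_ge0.
have [i1 l1] := @Rintegral_dct R _ (measurableTypeR R) N _ measurableT D id _ mD (fun x _ => cD x)
  (integrable_normal_cosh 2 1) (fun n x _ => bD1 n x).
have cD2 x : D n x ^+ 2 @[n --> \oo] --> x ^+ 2.
  by under eq_cvg do rewrite expr2; rewrite expr2; apply: cvgM; exact: cD.
have mD2 n : measurable_fun [set: R] (fun x => D n x ^+ 2) by exact: measurable_funX.
have [i2 l2] := @Rintegral_dct R _ (measurableTypeR R) N _ measurableT (fun n x => D n x ^+ 2)
  (fun x => x ^+ 2) _ mD2 (fun x _ => cD2 x) (integrable_normal_cosh 4 1) (fun n x _ => bD2 n x).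
have i0 n : N.-integrable setT (EFin \o D n).
  apply: (le_integrable measurableT _ _ (integrable_normal_cosh 2 1)).
    by apply/measurable_EFinP; exact: mD.
  by move=> x _ /=; rewrite lee_fin (le_trans (bD1 n x))// ler_norm.
split => //.
- rewrite -(cvg_lim (@Rhausdorff R) l1); apply: cvg_lim => //.
  apply: cvg_near_cst; apply: nearW => n.
  rewrite [LHS](_ : _ = \int[N]_x ((u n)^-1 / 2 * (expR (u n * x) - expR (- u n * x)))); last first.
    by apply: eq_Rintegral => x _; rewrite /D mulrC mulrA mulrAC mulrC.
  rewrite RintegralZl//; last first.
    have := integrableB measurableT (integrable_normal_expR (u n)) (integrable_normal_expR (- u n)).
    by apply: eq_integrable => // x _.
  rewrite RintegralB// ?Rintegral_normal_expR ?sqrrN ?subrr ?mulr0//; exact: integrable_normal_expR.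
- rewrite -(cvg_lim (@Rhausdorff R) l2); apply: cvg_lim => //.
  have der : is_derive (0 : R) 1 (fun h : R => expR (2 * s ^+ 2 * h) / 2) (s ^+ 2).
    apply: is_derive_eq.
    rewrite /GRing.scale/= !(mul0r, oppr0, mulr0, addr0, expR0, add0r, mulr1, mul1r, scale0r).
    by field.
  have u20 : u n ^+ 2 @[n --> \oo] --> 0.
    apply: (@eq_cvgn _ (fun n => u n * u n)) => [n|]; first by rewrite expr2.
    have := cvgM (@invS_cvg0 R) (@invS_cvg0 R); rewrite mulr0; exact.
  have := is_derive_cvg_seq der u20 (fun n => expf_neq0 2 (u0 n)).
  apply: cvg_trans; apply: near_eq_cvg; apply: nearW => n.
  rewrite add0r mulr0 expR0.
  rewrite [RHS](_ : _ = \int[N]_x ((u n ^+ 2)^-1 / 4 * ((expR (2 * u n * x) + expR (- (2 * u n) * x)) - 2))); last first.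
    apply: eq_Rintegral => x _; rewrite /D.
    have -> : expR (2 * u n * x) = expR (u n * x) * expR (u n * x) by rewrite -expRD; congr expR; ring.
    have -> : expR (- (2 * u n) * x) = expR (- u n * x) * expR (- u n * x) by rewrite -expRD; congr expR; ring.
    have ab : expR (u n * x) * expR (- u n * x) = 1 by rewrite mulNr expRxMexpNx_1.
    set a := expR (u n * x) in ab *; set b := expR (- u n * x) in ab *.
    have -> : a * a + b * b - 2 = a * a + b * b - 2 * (a * b) by rewrite ab mulr1.
    by field; rewrite u0.
  have iC : N.-integrable setT (EFin \o (fun=> (2 : R))).
    apply: (@bounded_integrable R _ (measurableTypeR R) N setT measurableT _ `|2|) => //.
    exact: gauss_lty.
  have iS : N.-integrable setT (EFin \o (fun x => expR (2 * u n * x) + expR (- (2 * u n) * x))).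
    have := integrableD measurableT (integrable_normal_expR (2 * u n)) (integrable_normal_expR (- (2 * u n))).
    by apply: eq_integrable => // x _.
  rewrite RintegralZl//; last first.
    by have := integrableB measurableT iS iC; apply: eq_integrable => // x _.
  rewrite RintegralB//.
  rewrite RintegralD//; last 2 first.
    exact: integrable_normal_expR.
    exact: integrable_normal_expR.
  rewrite !Rintegral_normal_expR Rintegral_gauss_cst sqrrN.
  have -> : (2 * u n) ^+ 2 * s ^+ 2 / 2 = 2 * s ^+ 2 * u n ^+ 2 by field.
  by field; rewrite u0.
Qed.

(** Crude on purpose, only the order s^4 matters: v^4 <= 4! exp v at v = |x| / s, and the two
    exponential moments equal exp (1 / 2) <= 2, whence 96 = 24 * 4. *)
Lemma normal_moment4 : N.-integrable setT (EFin \o (fun x => x ^+ 4)) /\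
  \int[N]_x (x ^+ 4) <= 96 * s ^+ 4.
Proof.
pose g x := 24 * s ^+ 4 * (expR (s^-1 * x) + expR (- s^-1 * x)).
have ig : N.-integrable setT (EFin \o g) by exact: integrable_normal_cosh.
have x4 (x : R) : 0 <= x ^+ 4 by rewrite (exprM x 2 2) sqr_ge0.
have le x : x ^+ 4 <= g x.
  have H (v : R) : 0 <= v -> v ^+ 4 <= 24 * expR v.
    move=> v0; have := expR_ge1Dxn 3 v0; rewrite (_ : 4`!%N = 24%N)// => H.
    rewrite -ler_pdivrMl// mulrC; lra.
  have -> : x ^+ 4 = s ^+ 4 * `|s^-1 * x| ^+ 4.
    by rewrite -normrX (ger0_norm (x4 _)); field; rewrite gt_eqF.
  rewrite /g [24 * _]mulrC -[leRHS]mulrA ler_pM2l ?exprn_gt0//.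
  apply: (le_trans (H _ _)) => //; rewrite ler_pM2l//.
  have [x0|x0] := leP 0 (s^-1 * x).
    by rewrite (ger0_norm x0) lerDl expR_ge0.
  by rewrite (ltr0_norm x0) mulNr lerDr expR_ge0.
have i4 : N.-integrable setT (EFin \o (fun x => x ^+ 4)).
  apply: (le_integrable measurableT _ _ ig).
    by apply/measurable_EFinP; exact: measurable_funX.
  by move=> x _ /=; rewrite lee_fin (ger0_norm (x4 x)) (le_trans (le x))// ler_norm.
split => //.
apply: (le_trans (le_Rintegral measurableT i4 ig (fun x _ => le x))).
rewrite /g RintegralZl//; last first.
  by have := integrable_normal_cosh s^-1 1; apply: eq_integrable => // x _ /=; rewrite mul1r.
rewrite RintegralD//; last 2 first.
  exact: integrable_normal_expR.
  exact: integrable_normal_expR.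
rewrite !Rintegral_normal_expR sqrrN exprVn mulVf ?expf_neq0 ?gt_eqF//.
have : expR (1 / 2 : R) <= 2.
  have := expRxMexpNx_1 (1 / 2 : R); have := expR_ge1Dx (- (1 / 2) : R).
  have := expR_gt0 (1 / 2 : R); nra.
have := exprn_gt0 4 s0; nra.
Qed.

End Gaussian.

(** * Riemann sums on a uniform grid *)

Section Grid.
Context {R : realType}.
Notation mu := (@lebesgue_measure R).

Lemma truncn_mul_cvg (u : R) : 0 <= u ->
  (Num.truncn (u * n.+1%:R))%:R / n.+1%:R @[n --> \oo] --> u.
Proof.
move=> u0; apply: (@squeeze_cvgr _ _ _ _ (fun n => u - n.+1%:R^-1) (fun=> u)).
- apply: nearW => n.
  have un0 : 0 <= u * n.+1%:R by rewrite mulr_ge0.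
  rewrite ler_pdivlMr// ler_pdivrMr// mulrBl mulVf//.
  have /andP[-> H] := truncn_itv un0.
  by rewrite andbT lerBlDr natr1 ltW.
- rewrite -[X in _ --> X]subr0; apply: cvgB; [exact: cvg_cst|exact: invS_cvg0].
- exact: cvg_cst.
Qed.

(** The sum is the integral of a step function with cells of length 1 / (n + 1), so dominated
    convergence gives the limit and the integrability of [g] together. *)
Lemma grid_Riemann_sum (h : nat -> nat -> R) (g : R -> R) (t C : R) : 0 <= t ->
  (forall n k, `|h n k| <= C) ->
  (forall u : R, 0 < u < t -> h n (Num.truncn (u * n.+1%:R)) @[n --> \oo] --> g u) ->
  mu.-integrable `]0, t[ (EFin \o g) /\
  \sum_(k < Num.truncn (t * n.+1%:R)) h n k / n.+1%:R @[n --> \oo]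
    --> \int[mu]_(u in `]0, t[) g u.
Proof.
move=> t0 hC hg.
have C0 : 0 <= C by apply: le_trans (hC 0%N 0%N).
pose I n k : set R := `[k%:R / n.+1%:R, k.+1%:R / n.+1%:R[%classic.
pose f n (u : R) := \sum_(k < Num.truncn (t * n.+1%:R)) h n k * \1_(I n k) u.
have fE n u : 0 <= u -> f n u = if (Num.truncn (u * n.+1%:R) < Num.truncn (t * n.+1%:R))%N
    then h n (Num.truncn (u * n.+1%:R)) else 0.
  move=> u0.
  have un0 : 0 <= u * n.+1%:R by rewrite mulr_ge0.
  have IE k : \1_(I n k) u = (Num.truncn (u * n.+1%:R) == k)%:R :> R.
    rewrite indicE; congr (nat_of_bool _)%:R.
    rewrite truncn_eq// /I; apply/idP/idP.
      by move/set_mem; rewrite /= in_itv/= ler_pdivrMr// ltr_pdivlMr.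
    by move=> H; apply/mem_set; rewrite /= in_itv/= ler_pdivrMr// ltr_pdivlMr.
  rewrite /f; under eq_bigr do rewrite IE.
  case: ifPn => H.
    rewrite (bigD1 (Ordinal H))//= eqxx mulr1 big1 ?addr0// => k kH.
    rewrite (_ : _ == _ = false) ?mulr0//; apply/eqP => E.
    by move/eqP: kH; apply; apply/val_inj => /=.
  rewrite big1// => k _; rewrite (_ : _ == _ = false) ?mulr0//; apply/eqP => E.
  by move: H; rewrite E ltn_ord.
have mI n k : measurable (I n k) by exact: measurable_itv.
have mf n : measurable_fun (`]0, t[%classic : set R) (f n).
  by apply: measurable_sum => k; apply: measurable_funM.
have ff (u : R) : (`]0, t[%classic : set R) u -> f n u @[n --> \oo] --> g u.
  rewrite /= in_itv/= => /andP[u0 ut]; have tu : 0 < t - u by rewrite subr_gt0.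
  apply: cvg_trans (hg u _); last by rewrite u0.
  apply: near_eq_cvg; near=> n; rewrite (fE _ _ (ltW u0)).
  (* The step function is 0 beyond the last full cell; a fixed u < t lies before it as soon as the
     mesh is below t - u. *)
  case: ifPn => //; rewrite -leqNgt => H; exfalso.
  have t00 : 0 <= t * n.+1%:R by rewrite mulr_ge0.
  have u00 : 0 <= u * n.+1%:R by rewrite mulr_ge0 ?ltW.
  have /andP[_ H1] := truncn_itv t00; have /andP[H2 _] := truncn_itv u00.
  have H3 : t * n.+1%:R < u * n.+1%:R + 1.
    apply: (lt_le_trans H1); rewrite -natr1 lerD2r; apply: le_trans H2.
    by rewrite ler_nat.
  have H4 : n.+1%:R^-1 < t - u by near: n; exact: near_invS_lt.
  have : 1 < (t - u) * n.+1%:R by rewrite -ltr_pdivrMr// div1r.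
  by rewrite mulrBl ltNge; apply/negP; rewrite negbK; lra.
have fC n (u : R) : (`]0, t[%classic : set R) u -> `|f n u| <= C.
  rewrite /= in_itv/= => /andP[u0 ut]; rewrite (fE _ _ (ltW u0)); case: ifPn => _ //.
  by rewrite normr0.
have iC : mu.-integrable `]0, t[ (EFin \o (fun=> C)).
  by apply: (@bounded_integrable_itv R _ _ _ _ _ `|C|).
have [ig lg] := @Rintegral_dct R _ (measurableTypeR R) mu _ (measurable_itv _) f g _ mf ff iC fC.
split => //; apply: (eq_cvgn _ lg) => n.
have sub k : (k < Num.truncn (t * n.+1%:R))%N -> I n k `<=` `[0, t[.
  move=> kt x; rewrite /I/= !in_itv/= => /andP[H1 H2]; apply/andP; split.
    by apply: le_trans H1; rewrite divr_ge0.
  apply: (lt_le_trans H2); rewrite ler_pdivrMr//.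
  have t00 : 0 <= t * n.+1%:R by rewrite mulr_ge0.
  have /andP[H3 _] := truncn_itv t00; apply: le_trans H3.
  by rewrite ler_nat.
have i1 k : (k < Num.truncn (t * n.+1%:R))%N ->
    (\int[mu]_(x in `[0%R, t[) (h n k * \1_(I n k) x)%:E = (h n k / n.+1%:R)%:E)%E.
  move=> kt; under eq_integral do rewrite EFinM.
  rewrite integralZl//; last first.
    apply: (@bounded_integrable_itv R _ _ _ _ _ 1).
    - by apply: measurable_indic; exact: mI.
    - by move=> x _; rewrite ger0_norm// indicE; case: (_ \in _).
  have -> : (\int[mu]_(x in `[0%R, t[) (\1_(I n k) x)%:E = mu (I n k))%E.
    transitivity (mu (I n k `&` `[0, t[)).
      by apply: (@integral_indic _ (measurableTypeR R)); [exact: measurable_itv|exact: mI].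
    by congr (mu _); apply: setIidl; exact: sub.
  rewrite /I lebesgue_measure_itv/= lte_fin ltr_pM2r ?invr_gt0// ltr_nat ltnSn -EFinB -EFinM.
  by rewrite -mulrBl -natr1 addrC addKr mul1r.
rewrite /Rintegral.
rewrite (_ : \int[mu]_(x in `]0%R, t[) (f n x)%:E = \int[mu]_(x in `[0%R, t[) (f n x)%:E)%E; last first.
  apply: integral_itv_obnd_cbnd; apply/measurable_EFinP; exact: mf.
rewrite /f; under eq_integral do rewrite -sumEFin.
rewrite integral_sum//; last first.
  move=> k; apply: (@bounded_integrable_itv R _ _ _ _ _ C).
  - apply: measurable_funM => //; apply: measurable_indic; exact: mI.
  - by move=> x _; rewrite normrM (le_trans _ (hC n k))// ler_piMr// ger0_norm// indicE; case: (_ \in _).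
rewrite (eq_bigr (fun k : 'I_(Num.truncn (t * n.+1%:R)) => (h n k / n.+1%:R)%:E)); last by move=> k _; exact: i1.
by rewrite sumEFin.
Unshelve. all: by end_near. Qed.

End Grid.

(** * Joint measurability and passage from pathwise to in-probability statements *)

Section JointMeasurability.
Context {R : realType}.

Lemma within_cvg_seq (D : set R) (f : R -> R) (u : R) (v : nat -> R) :
  {within D, continuous f} -> D u -> (forall n, D (v n)) ->
  v n @[n --> \oo] --> u -> f (v n) @[n --> \oo] --> f u.
Proof.
move=> /subspace_continuousP /(_ u) H Du Dv vu.
apply: cvg_comp (H Du) => S; rewrite /= /within/= => HS.
have {}HS : \forall n \near \oo, D (v n) -> S (v n) := vu _ HS.
by apply: filterS HS => n /(_ (Dv n)).
Qed.

Section Process.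
Context d (T : measurableType d).

(** By path continuity the process is the limit of its values at the grid time to the left, which
    are jointly measurable. [Num.max 0] keeps times in the range where processes are constrained. *)
Lemma measurable_process (X : R -> T -> R) :
  (forall u, 0 <= u -> measurable_fun [set: T] (X u)) ->
  continuous_paths X ->
  measurable_fun [set: measurableTypeR R * T]
    (fun p : measurableTypeR R * T => X (Num.max 0 p.1) p.2).
Proof.
move=> mX cX.
pose k n (u : R) := Num.truncn (Num.max 0 u * n.+1%:R).
have mk n : measurable_fun [set: measurableTypeR R * T] (fun p : measurableTypeR R * T => X ((k n p.1)%:R / n.+1%:R) p.2).
  move=> _ A mA; rewrite setTI.
  rewrite [X in measurable X](_ : _ = \bigcup_j
     ([set u : measurableTypeR R | k n u = j] `*` (X (j%:R / n.+1%:R) @^-1` A))).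
    apply: bigcupT_measurable => j; apply: measurableX; last first.
      by rewrite -[X in measurable X]setTI; apply: mX => //; rewrite divr_ge0.
    (* The cell of index 0 is unbounded on the left, since all negative times are sent to 0. *)
    have [->|j0] := eqVneq j 0%N.
      rewrite (_ : [set u | _] = `]-oo, n.+1%:R^-1[%classic); first exact: measurable_itv.
      apply/seteqP; split => u /=; rewrite !in_itv/= /k.
        move=> /eqP; rewrite truncn_eq ?mulr_ge0 ?le_max ?lexx// => /andP[_].
        by rewrite -ltr_pdivlMr// div1r gt_max => /andP[].
      move=> H; apply/eqP; rewrite truncn_eq ?mulr_ge0 ?le_max ?lexx//.
      by rewrite -ltr_pdivlMr// div1r gt_max H invr_gt0 ltr0n.
    rewrite (_ : [set u | _] = `[j%:R / n.+1%:R, j.+1%:R / n.+1%:R[%classic); first exact: measurable_itv.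
    have jn : 0 < j%:R / n.+1%:R :> R by rewrite divr_gt0// ltr0n lt0n.
    apply/seteqP; split => u /=; rewrite !in_itv/= /k.
      move=> /eqP; rewrite truncn_eq ?mulr_ge0 ?le_max ?lexx//.
      rewrite -ltr_pdivlMr// -ler_pdivrMr// gt_max le_max => /andP[+ /andP[_ ->]].
      by rewrite leNgt jn/= => ->.
    move=> /andP[H1 H2]; apply/eqP; rewrite truncn_eq ?mulr_ge0 ?le_max ?lexx//.
    rewrite -ltr_pdivlMr// -ler_pdivrMr// gt_max le_max H1 H2 orbT/= andbT.
    by rewrite divr_gt0// ltr0n.
  apply/seteqP; split => [[u w] /= H|[u w] [j _ [/= <-]]] //.
  by exists (k n u) => //; split => //=.
apply: (measurable_fun_cvg mk) => -[u w] _ /=; apply: (within_cvg_seq (cX w)) => /=.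
- by rewrite in_itv/= andbT le_max lexx.
- by move=> n; rewrite in_itv/= andbT divr_ge0.
- by apply: truncn_mul_cvg; rewrite le_max lexx.
Qed.

(** Dominated convergence of indicators. Pathwise convergence enters estimates in probability in
    this form. *)
Lemma prob_cvg0 (P : probability T R) (E : nat -> set T) :
  (forall n, measurable (E n)) -> (forall w, \forall n \near \oo, ~ E n w) ->
  forall e : R, 0 < e -> \forall n \near \oo, (P (E n) <= e%:E)%E.
Proof.
move=> mE hE e e0.
have mi n : measurable_fun [set: T] (\1_(E n) : T -> R) by exact: measurable_indic.
have ci w : [set: T] w -> \1_(E n) w @[n --> \oo] --> (0 : R).
  move=> _; apply: cvg_near_cst; have := hE w; apply: filterS => n nE.
  by rewrite indicE memNset.
have ig : P.-integrable setT (EFin \o (fun=> (1 : R))).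
  by apply: (@bounded_integrableP R _ _ P _ 1) => // ?; rewrite normr1.
have [|_ l] := Rintegral_dct measurableT mi ci ig.
  by move=> n w _; rewrite ger0_norm// indicE; case: (_ \in _).
move: l; rewrite Rintegral_cst// mul0r => /cvgrPdist_le /(_ e e0).
apply: filterS => n; rewrite sub0r normrN ger0_norm; last by apply: Rintegral_ge0 => w _; rewrite indicE.
rewrite -lee_fin EFin_Rintegral//; last first.
  apply: (@bounded_integrableP R _ _ P _ 1) => // w.
  by rewrite ger0_norm// indicE; case: (_ \in _).
by rewrite integral_indic// setIT.
Qed.

End Process.

Section Rectangles.
Context d1 d2 (T1 : measurableType d1) (T2 : measurableType d2).
Local Open Scope ereal_scope.

Lemma il_eq_rectangles (Phi Psi : (T1 * T2 -> \bar R) -> \bar R) :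
  integral_like Phi -> integral_like Psi ->
  (forall A B, measurable A -> measurable B ->
    Phi (fun x => (\1_(A `*` B) x)%:E) = Psi (fun x => (\1_(A `*` B) x)%:E)) ->
  Phi (fun x => (\1_setT x)%:E) < +oo ->
  forall f, nnmeas f -> Phi f = Psi f.
Proof.
move=> i1 i2 e fin; apply: il_eq => // A mA.
rewrite -(ilmE i1 mA) -(ilmE i2 mA).
apply: (measure_unique [set A1 `*` A2 | A1 in measurable & A2 in measurable] (fun=> setT)) => //.
- exact: measurable_prod_measurableType.
- move=> X Y [X1 mX1 [X2 mX2 <-{X}]] [Y1 mY1 [Y2 mY2 <-{Y}]].
  by rewrite -setXI; exists (X1 `&` Y1) => //; [exact: measurableI|exists (X2 `&` Y2) => //; exact: measurableI].
- by move=> _; exists setT => //; exists setT => //; rewrite setXTT.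
- by rewrite -subTset => x _; exists 0%N.
- by move=> _ [A1 mA1 [A2 mA2 <-]]; rewrite !ilmE//; [exact: e|exact: measurableX|exact: measurableX].
- by move=> _; rewrite ilmE.
Qed.

End Rectangles.
End JointMeasurability.

(** * Euler scheme *)

Section Brownian.
Context {R : realType} {d : measure_display} {T : measurableType d}.
Variables (P : probability T R) (F : R -> set (set T)) (B : R -> T -> R).
Hypotheses (hF : is_filtration F) (hB : is_brownian_motion P F B).

Section Adapted.
Context d' (U : measurableType d').
Implicit Type V : T -> U.

(** Adaptedness for values in any measurable space. [F t] is a bare set of sets, so closure
    properties are borrowed from [g_sigma_algebraType] through [fmeasP]. *)
Definition fmeas t V := forall A, measurable A -> F t (V @^-1` A).

Lemma fmeasP t V : 0 <= t ->
  fmeas t V <-> measurable_fun (setT : set (g_sigma_algebraType (F t))) V.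
Proof.
move=> t0; have [sF _ _] := hF.
have E : measurable = F t :> set (set (g_sigma_algebraType (F t))).
  by rewrite /measurable/=; apply: sigma_algebra_id; exact: sF.
split => [H _ A mA|H A mA].
  by rewrite setTI E; exact: H.
by rewrite -E -[X in measurable X]setTI; exact: H.
Qed.

Lemma fmeas_measurable t V : 0 <= t -> fmeas t V -> measurable_fun [set: T] V.
Proof.
by move=> t0 H _ A mA; rewrite setTI; have [_ + _] := hF; apply; [exact: t0|exact: H].
Qed.

Lemma fmeas_le s t V : 0 <= s -> s <= t -> fmeas s V -> fmeas t V.
Proof. by move=> s0 st H A mA; have [_ _ +] := hF; apply; [exact: s0|exact: st|exact: H]. Qed.

End Adapted.

Lemma fmeas_comp t d1 (U1 : measurableType d1) d2 (U2 : measurableType d2)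
  (V : T -> U1) (f : U1 -> U2) : measurable_fun setT f -> fmeas t V -> fmeas t (f \o V).
Proof.
move=> mf mV A mA; rewrite comp_preimage; apply: mV.
by rewrite -[X in measurable X]setTI; exact: mf.
Qed.

Lemma fmeas_pair t d1 (U1 : measurableType d1) d2 (U2 : measurableType d2)
  (V1 : T -> U1) (V2 : T -> U2) : 0 <= t -> fmeas t V1 -> fmeas t V2 ->
  fmeas t (fun w => (V1 w, V2 w)).
Proof.
move=> t0 /(fmeasP _ t0) m1 /(fmeasP _ t0) m2; apply/(fmeasP _ t0).
exact: measurable_fun_pair.
Qed.

Lemma brownian_fmeas t : 0 <= t -> fmeas t (B t : T -> measurableTypeR R).
Proof. by move=> t0 A mA; have [_ _ + _] := hB; exact. Qed.

Lemma brownian_measurable t : 0 <= t -> measurable_fun [set: T] (B t).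
Proof. by move=> t0; exact: (fmeas_measurable t0 (brownian_fmeas t0)). Qed.

Lemma increment_measurable s t : 0 <= s -> 0 <= t ->
  measurable_fun [set: T] (fun w => B t w - B s w : measurableTypeR R).
Proof. by move=> s0 t0; apply: measurable_funB; exact: brownian_measurable. Qed.

Section Increment.
Variables (s t : R) (s0 : 0 <= s) (st : s < t).
Let t0 : 0 <= t. Proof. exact: le_trans (ltW st). Qed.
Let sg0 : 0 < Num.sqrt (t - s). Proof. by rewrite sqrtr_gt0 subr_gt0. Qed.
Notation N := (gauss (Num.sqrt (t - s))).

Section Independence.
Context d' (U : measurableType d') (V : T -> U).
Hypothesis hV : fmeas s V.
Let mV : measurable_fun setT V. Proof. exact: fmeas_measurable hV. Qed.

Lemma measurable_gauss_integral (f : U * measurableTypeR R -> \bar R) : nnmeas f ->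
  measurable_fun setT (fun w => \int[N]_x f (V w, x))%E.
Proof.
move=> [f0 mf].
apply: (@measurableT_comp _ _ _ _ _ _ (fun u => \int[N]_x f (u, x))%E _ V) => //.
by apply: (@measurable_fun_fubini_tonelli_F _ _ _ _ R N f).
Qed.

(** The independence clause of Brownian motion is the case of rectangles, and integral-like
    functionals agreeing there agree everywhere. It acts as conditioning on [F s] with the increment
    integrated out. *)
Lemma increment_indep (f : U * measurableTypeR R -> \bar R) : nnmeas f ->
  (\int[P]_w f (V w, (B t w - B s w)%R) = \int[P]_w \int[N]_x f (V w, x))%E.
Proof.
apply: (@il_eq_rectangles R _ _ U (measurableTypeR R)
  (fun f => \int[P]_w f (V w, ((B t w - B s w)%R : measurableTypeR R)))%E
  (fun f => \int[P]_w \int[N]_x f (V w, x))%E).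
- apply: il_pushforward => //; apply: measurable_fun_pair => //.
  exact: increment_measurable.
- apply: il_comp => //; last by move=> g ng; exact: measurable_gauss_integral.
  by move=> w _; apply: il_pushforward => //; exact: measurable_fun_pair.
- move=> A C mA mC.
  rewrite [LHS](_ : _ = P (V @^-1` A `&` [set w | C (B t w - B s w)%R])).
    have [_ _ _ indep] := hB.
    rewrite indep//; last exact: hV.
    transitivity (\int[P]_w ((N C) * (\1_(V @^-1` A) w)%:E))%E.
      have mVA : measurable (V @^-1` A) by rewrite -[X in measurable X]setTI; exact: mV.
      rewrite ge0_integralZl//; last exact/measurable_EFinP/measurable_indic.
      by rewrite integral_indic// setIT; exact: muleC.
    apply: eq_integral => w _.
    transitivity (\int[N]_x ((\1_A (V w))%:E * (\1_C x)%:E))%E.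
      rewrite ge0_integralZl//.
      + by rewrite integral_indic// setIT muleC !indicE.
      + exact/measurable_EFinP/measurable_indic.
    by apply: eq_integral => x _; rewrite -EFinM !indicE in_setX /=; case: (V w \in A); case: (x \in C); rewrite /= ?mulr1 ?mulr0.
  rewrite -[in RHS](setIT (V @^-1` A `&` _)) -integral_indic//.
  apply: measurableI; first by rewrite -[X in measurable X]setTI; exact: mV.
  by rewrite -[X in measurable X]setTI; exact: (increment_measurable s0 t0).
- under eq_integral do rewrite indicT/=.
  by rewrite integral_cst// mul1e (le_lt_trans (probability_le1 P measurableT))// ltry.
Qed.

End Independence.
End Increment.
End Brownian.

(** * One Gaussian step against a test function *)

Section GaussPoly.
Context {R : realType} (s : R) (s0 : 0 < s).
Notation N := (gauss s).

Lemma gauss_poly (a0 a1 a2 a4 : R) :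
  N.-integrable setT (EFin \o (fun x => a0 + a1 * x + a2 * x ^+ 2 + a4 * x ^+ 4)) /\
  \int[N]_x (a0 + a1 * x + a2 * x ^+ 2 + a4 * x ^+ 4) =
  a0 + a2 * s ^+ 2 + a4 * \int[N]_x (x ^+ 4).
Proof.
have [i1 i2 e1 e2] := normal_moments s0.
have [i4 _] := normal_moment4 s0.
have i0 : N.-integrable setT (EFin \o (fun=> a0)).
  by apply: (@bounded_integrableP R _ _ N _ `|a0|).
have j1 : N.-integrable setT (EFin \o (fun x => a1 * x)).
  by have := integrableZl measurableT a1 i1; apply: eq_integrable => // x _; rewrite /= EFinM.
have j2 : N.-integrable setT (EFin \o (fun x => a2 * x ^+ 2)).
  by have := integrableZl measurableT a2 i2; apply: eq_integrable => // x _; rewrite /= EFinM.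
have j4 : N.-integrable setT (EFin \o (fun x => a4 * x ^+ 4)).
  by have := integrableZl measurableT a4 i4; apply: eq_integrable => // x _; rewrite /= EFinM.
have k1 : N.-integrable setT (EFin \o (fun x => a0 + a1 * x)).
  by have := integrableD measurableT i0 j1; apply: eq_integrable.
have k2 : N.-integrable setT (EFin \o (fun x => a0 + a1 * x + a2 * x ^+ 2)).
  by have := integrableD measurableT k1 j2; apply: eq_integrable.
split; first by have := integrableD measurableT k2 j4; apply: eq_integrable.
rewrite RintegralD// RintegralD// RintegralD// Rintegral_gauss_cst.
by rewrite !RintegralZl// e1 e2 mulr0 addr0.
Qed.

End GaussPoly.

Section Step.
Context {R : realType}.

(** Uniform continuity of the second derivative makes the second-order Taylor remainder small
    uniformly in the base point. *)
Record test_fun (f f1 f2 : R -> R) (C : R) : Prop := TestFun {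
  tf_d1 : forall y : R, is_derive y 1 f (f1 y);
  tf_d2 : forall y : R, is_derive y 1 f1 (f2 y);
  tf_b0 : forall y, `|f y| <= C;
  tf_b1 : forall y, `|f1 y| <= C;
  tf_b2 : forall y, `|f2 y| <= C;
  tf_uc : forall e : R, 0 < e -> exists2 h : R, 0 < h &
    forall x y, `|x - y| <= h -> `|f2 x - f2 y| <= e }.

Lemma mvt_bound (g dg : R -> R) (M D : R) : (forall x : R, is_derive x 1 g (dg x)) ->
  (forall x, `|x| <= `|D| -> `|dg x| <= M) -> `|g D - g 0| <= M * `|D|.
Proof.
move=> dgx bM.
have cg a b : {within `[a, b], continuous g}.
  apply: continuous_subspaceT => x; apply: differentiable_continuous.
  by apply/derivable1_diffP; have [] := dgx x.
have [D0|D0] := leP 0 D.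
  have [c cD ->] := MVT_segment D0 (fun x _ => dgx x) (cg _ _).
  move: cD; rewrite in_itv/= subr0 => /andP[c0 cD].
  by rewrite normrM ler_wpM2r// bM// !ger0_norm.
have [c cD H] := MVT_segment (ltW D0) (fun x _ => dgx x) (cg _ _).
move: cD; rewrite in_itv/= => /andP[c0 cD].
rewrite distrC H sub0r normrM normrN ler_wpM2r//.
by apply: bM; rewrite (ler0_norm cD) (ltr0_norm D0) lerN2.
Qed.

(** Increments shorter than the modulus [h] cost [e]. A longer one has D^2 >= h^2, so the trivial
    bound 2 C on the oscillation of [f2] is absorbed in 2 C D^2 / h^2, leaving a fourth moment to be
    controlled. *)
Lemma test_fun_taylor f f1 f2 C (e : R) : test_fun f f1 f2 C -> 0 < e ->
  exists2 K, 0 <= K & forall y D,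
   `|f (y + D) - f y - f1 y * D - 2^-1 * f2 y * D ^+ 2| <= D ^+ 2 * (e + K * D ^+ 2).
Proof.
move=> tf e0; have [h h0 uc] := tf_uc tf e0.
have C0 : 0 <= C by rewrite (le_trans _ (tf_b0 tf 0)).
exists (2 * C / h ^+ 2); first by rewrite divr_ge0 ?mulr_ge0 ?exprn_ge0// ltW.
move=> y D.
pose w := if `|D| <= h then e else 2 * C.
have w0 : 0 <= w by rewrite /w; case: ifP => _; [exact: ltW|rewrite mulr_ge0].
have wle : w <= e + 2 * C / h ^+ 2 * D ^+ 2.
  have X0 : 0 <= 2 * C / h ^+ 2 * D ^+ 2.
    by apply: mulr_ge0; [apply: divr_ge0; [exact: mulr_ge0|exact: sqr_ge0]|exact: sqr_ge0].
  rewrite /w; case: ifPn => [_|]; first by rewrite lerDl.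
  rewrite -ltNge => hD; apply: ler_wpDl; first exact: ltW.
  rewrite -mulrA ler_peMr ?mulr_ge0//.
  rewrite mulrC ler_pdivlMr ?exprn_gt0// mul1r -[leRHS]real_normK ?num_real//.
  by rewrite lerXn2r ?nnegrE// ltW.
have w2 x : `|x| <= `|D| -> `|f2 (y + x) - f2 y| <= w.
  move=> xD; rewrite /w; case: ifP => Dh.
    by apply: uc; rewrite addrC addKr (le_trans xD).
  by rewrite (le_trans (ler_normB _ _))// mulr_natl mulr2n lerD// (tf_b2 tf).
have dshift (g g' : R -> R) x : is_derive (y + x) 1 g (g' (y + x)) ->
    is_derive x 1 (fun u => g (y + u)) (g' (y + x)).
  move=> dg; have := @is_derive1_comp R g (fun u => y + u) x (g' (y + x)) 1 dg.
  rewrite mulr1; apply; have := is_deriveD (is_derive_cst y x (1 : R)) (is_derive_id x (1 : R)).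
  by rewrite add0r.
have E1 x : `|x| <= `|D| -> `|f1 (y + x) - f1 y - f2 y * x| <= w * `|D|.
  move=> xD.
  have := @mvt_bound (fun u => f1 (y + u) - f2 y * u) (fun u => f2 (y + u) - f2 y) w x.
  rewrite addr0 mulr0 subr0.
  have -> : f1 (y + x) - f2 y * x - f1 y = f1 (y + x) - f1 y - f2 y * x by ring.
  move=> H; apply: le_trans (H _ _) _; last by rewrite ler_wpM2l.
  - move=> u; have := dshift _ _ u (tf_d2 tf (y + u)) => du.
    by apply: is_derive_eq; rewrite /GRing.scale/=; ring.
  - by move=> u ux; apply: w2; exact: le_trans xD.
have := @mvt_bound (fun u => f (y + u) - f1 y * u - 2^-1 * f2 y * u ^+ 2)
  (fun u => f1 (y + u) - f1 y - f2 y * u) (w * `|D|) D.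
rewrite addr0 expr0n/= !mulr0 !subr0.
have -> : f (y + D) - f1 y * D - 2^-1 * f2 y * D ^+ 2 - f y =
  f (y + D) - f y - f1 y * D - 2^-1 * f2 y * D ^+ 2 by ring.
move=> H; apply: le_trans (H _ E1) _.
  move=> u; have := dshift _ _ u (tf_d1 tf (y + u)) => du.
  by apply: is_derive_eq; rewrite /GRing.scale/= /GRing.scale/=; field.
by rewrite -mulrA -expr2 real_normK ?num_real// mulrC ler_wpM2l ?sqr_ge0.
Qed.

Lemma test_fun_measurable f f1 f2 C : test_fun f f1 f2 C ->
  [/\ continuous f, continuous f1 & continuous f2].
Proof.
move=> tf; split.
- by move=> x; apply: differentiable_continuous; apply/derivable1_diffP; have [] := tf_d1 tf x.
- by move=> x; apply: differentiable_continuous; apply/derivable1_diffP; have [] := tf_d2 tf x.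
- move=> x; apply/cvgrPdist_le => e e0; have [h h0 uc] := tf_uc tf e0.
  near=> y; apply: uc; near: y; exact: cvgr_dist_le.
Unshelve. all: by end_near. Qed.

(** The quadratic Taylor polynomial integrates to the generator term plus one of order s^4, and the
    remainder is dominated by a polynomial of degree four. The coefficients enter the bounds through
    [C] only, so they may later be random. *)
Lemma gauss_step f f1 f2 Cf C (e : R) : test_fun f f1 f2 Cf -> 0 <= C -> 0 < e ->
  exists2 d0, 0 < d0 & forall s y b c, 0 < s -> s ^+ 2 <= d0 -> `|b| <= C -> `|c| <= C ->
  `|\int[gauss s]_x f (y + (b * s ^+ 2 + c * x)) - f y
    - s ^+ 2 * (b * f1 y + 2^-1 * c ^+ 2 * f2 y)| <= e * s ^+ 2.
Proof.
move=> tf C0 e0.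
have Cf0 : 0 <= Cf by rewrite (le_trans _ (tf_b0 tf 0)).
(* With this e' the Taylor remainder contributes 4 e' C^2 s^2, at most half of e s^2. [L] collects
   the terms of order s^4, and the bound on s^2 makes them at most the other half. *)
have e1 : 0 < e / (8 * (C ^+ 2 + 1)) by rewrite divr_gt0// mulr_gt0// ltr_wpDl ?sqr_ge0.
have [K K0 tay] := test_fun_taylor tf e1.
set e' := e / _ in e1 tay.
have [M M0 m4le] : exists2 M : R, 0 <= M & forall s : R, 0 < s -> \int[gauss s]_x (x ^+ 4) <= M * s ^+ 4.
  by exists 96; [exact: ler0n|move=> s s0; have [] := normal_moment4 s0].
pose L := 8 * (1 + M) * K * C ^+ 4 + Cf * C ^+ 2.
have C20 := sqr_ge0 C.
have C40 : 0 <= C ^+ 4 by rewrite (exprM C 2 2) sqr_ge0.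
have L0 : 0 <= L by rewrite addr_ge0// !mulr_ge0// addr_ge0.
exists (Num.min 1 (e / (2 * (L + 1)))).
  by rewrite lt_min ltr01 divr_gt0// mulr_gt0// ltr_wpDl.
move=> s y b c s0; rewrite le_min => /andP[s1 sL] bC cC.
have b2 : b ^+ 2 <= C ^+ 2 by rewrite -[leLHS]real_normK ?num_real// lerXn2r ?nnegrE.
have c2 : c ^+ 2 <= C ^+ 2 by rewrite -[leLHS]real_normK ?num_real// lerXn2r ?nnegrE.
have b4 : b ^+ 4 <= C ^+ 4 by rewrite (exprM b 2 2) (exprM C 2 2) lerXn2r ?nnegrE ?sqr_ge0.
have c4 : c ^+ 4 <= C ^+ 4 by rewrite (exprM c 2 2) (exprM C 2 2) lerXn2r ?nnegrE ?sqr_ge0.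
have [cf _ _] := test_fun_measurable tf.
pose D x := b * s ^+ 2 + c * x.
have mD : measurable_fun [set: R] D by apply: measurable_funD => //; exact: measurable_funM.
have ifD : (gauss s).-integrable setT (EFin \o (fun x => f (y + D x))).
  apply: (@bounded_integrableP R _ _ (gauss s) _ Cf) => [|x]; last exact: (tf_b0 tf).
  apply: (measurableT_comp (continuous_measurable_fun cf)).
  exact: measurable_funD.
pose dl := s ^+ 2.
pose q x := f y + f1 y * D x + 2^-1 * f2 y * D x ^+ 2.
have qE x : q x = (f y + f1 y * b * dl + 2^-1 * f2 y * b ^+ 2 * dl ^+ 2)
    + (f1 y * c + f2 y * b * dl * c) * x + (2^-1 * f2 y * c ^+ 2) * x ^+ 2 + 0 * x ^+ 4.
  by rewrite /q /D /dl; field.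
have [iq eq] : (gauss s).-integrable setT (EFin \o q) /\ \int[gauss s]_x q x =
    f y + f1 y * b * dl + 2^-1 * f2 y * b ^+ 2 * dl ^+ 2 + (2^-1 * f2 y * c ^+ 2) * dl.
  rewrite (funext qE).
  have [i1 ->] := gauss_poly s0 (f y + f1 y * b * dl + 2^-1 * f2 y * b ^+ 2 * dl ^+ 2)
    (f1 y * c + f2 y * b * dl * c) (2^-1 * f2 y * c ^+ 2) 0.
  by split => //; rewrite mul0r addr0.
pose g x := e' * 2 * b ^+ 2 * dl ^+ 2 + 8 * K * b ^+ 4 * dl ^+ 4 + 0 * x
   + (e' * 2 * c ^+ 2) * x ^+ 2 + (8 * K * c ^+ 4) * x ^+ 4.
have [ig eg] : (gauss s).-integrable setT (EFin \o g) /\ \int[gauss s]_x g x =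
    e' * 2 * b ^+ 2 * dl ^+ 2 + 8 * K * b ^+ 4 * dl ^+ 4 + (e' * 2 * c ^+ 2) * dl
    + (8 * K * c ^+ 4) * \int[gauss s]_x (x ^+ 4).
  exact: gauss_poly.
have le1 x : `|f (y + D x) - q x| <= g x.
  have -> : f (y + D x) - q x = f (y + D x) - f y - f1 y * D x - 2^-1 * f2 y * D x ^+ 2.
    by rewrite /q; ring.
  apply: (le_trans (tay y (D x))).
  have D2 : D x ^+ 2 <= 2 * (b ^+ 2 * dl ^+ 2) + 2 * (c ^+ 2 * x ^+ 2).
    rewrite -subr_ge0 (_ : _ - _ = (b * dl - c * x) ^+ 2) ?sqr_ge0// /D /dl; ring.
  have D4 : (D x ^+ 2) ^+ 2 <= 8 * (b ^+ 4 * dl ^+ 4) + 8 * (c ^+ 4 * x ^+ 4).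
    apply: (@le_trans _ _ ((2 * (b ^+ 2 * dl ^+ 2) + 2 * (c ^+ 2 * x ^+ 2)) ^+ 2)).
      by rewrite lerXn2r ?nnegrE ?sqr_ge0// (le_trans _ D2)// sqr_ge0.
    rewrite -subr_ge0 (_ : _ - _ = 4 * (b ^+ 2 * dl ^+ 2 - c ^+ 2 * x ^+ 2) ^+ 2); last ring.
    by rewrite mulr_ge0// sqr_ge0.
  have -> : D x ^+ 2 * (e' + K * D x ^+ 2) = D x ^+ 2 * e' + K * (D x ^+ 2) ^+ 2 by ring.
  apply: (@le_trans _ _ ((2 * (b ^+ 2 * dl ^+ 2) + 2 * (c ^+ 2 * x ^+ 2)) * e' +
     K * (8 * (b ^+ 4 * dl ^+ 4) + 8 * (c ^+ 4 * x ^+ 4)))).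
    by rewrite lerD// ?ler_wpM2r ?ler_wpM2l// ltW.
  by rewrite le_eqVlt; apply/orP; left; apply/eqP; rewrite /g; ring.
have H : `|\int[gauss s]_x f (y + D x) - \int[gauss s]_x q x| <= \int[gauss s]_x g x.
  rewrite -RintegralB//.
  have iB : (gauss s).-integrable setT (EFin \o (fun x => f (y + D x) - q x)).
    by have := integrableB measurableT ifD iq; apply: eq_integrable.
  apply: (le_trans (le_normr_Rintegral measurableT iB)); apply: le_Rintegral => //.
  by have := integrable_abse iB; apply: eq_integrable.
have m4 : \int[gauss s]_x (x ^+ 4) <= M * dl ^+ 2.
  by have := m4le s s0; rewrite /dl -exprM.
have dl0 : 0 < dl by rewrite exprn_gt0.
have {}H : `|\int[gauss s]_x f (y + D x) - \int[gauss s]_x q x| <=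
    e' * 4 * C ^+ 2 * dl + 8 * (1 + M) * K * C ^+ 4 * dl ^+ 2.
  apply: (le_trans H); rewrite eg.
  have d2 : dl ^+ 2 <= dl by rewrite expr2 ler_piMl// ltW.
  have d4 : dl ^+ 4 <= dl ^+ 2.
    by rewrite (exprM dl 2 2) expr2 ler_piMl ?sqr_ge0// (le_trans d2).
  have dd0 := sqr_ge0 dl.
  have mle (A p p1 r v : R) : 0 <= A -> 0 <= p -> 0 <= r -> p <= p1 -> r <= v -> A * p * r <= A * p1 * v.
    by move=> A0 p0 r0 pq rv; rewrite -[leLHS]mulrA -[leRHS]mulrA ler_wpM2l// ler_pM.
  have e20 : 0 <= e' * 2 by rewrite mulr_ge0// ltW.
  have K80 : 0 <= 8 * K by rewrite mulr_ge0.
  have h1 : e' * 2 * b ^+ 2 * dl ^+ 2 <= e' * 2 * C ^+ 2 * dl by apply: mle => //; exact: sqr_ge0.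
  have h2 : 8 * K * b ^+ 4 * dl ^+ 4 <= 8 * K * C ^+ 4 * dl ^+ 2.
    by apply: mle => //; [rewrite (exprM b 2 2) sqr_ge0|rewrite (exprM dl 2 2) sqr_ge0].
  have h3 : e' * 2 * c ^+ 2 * dl <= e' * 2 * C ^+ 2 * dl.
    by apply: mle => //; [exact: sqr_ge0|exact: ltW].
  have h4 : 8 * K * c ^+ 4 * \int[gauss s]_x (x ^+ 4) <= 8 * K * C ^+ 4 * (M * dl ^+ 2).
    apply: mle => //; first by rewrite (exprM c 2 2) sqr_ge0.
    by apply: Rintegral_ge0 => x _; rewrite (exprM x 2 2) sqr_ge0.
  have := lerD (lerD (lerD h1 h2) h3) h4.
  move/le_trans; apply; rewrite le_eqVlt; apply/orP; left; apply/eqP; ring.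
have E : \int[gauss s]_x f (y + D x) - f y - dl * (b * f1 y + 2^-1 * c ^+ 2 * f2 y) =
   (\int[gauss s]_x f (y + D x) - \int[gauss s]_x q x) + 2^-1 * f2 y * b ^+ 2 * dl ^+ 2.
  by rewrite eq; ring.
rewrite -/dl -/(D _) (_ : \int[gauss s]_x f (y + (b * dl + c * x)) = \int[gauss s]_x f (y + D x))// E.
apply: (le_trans (ler_normD _ _)).
have H5 : `|2^-1 * f2 y * b ^+ 2 * dl ^+ 2| <= Cf * C ^+ 2 * dl ^+ 2.
  rewrite (normrM _ (dl ^+ 2)) (normrM _ (b ^+ 2)) (ger0_norm (sqr_ge0 dl)) (ger0_norm (sqr_ge0 b)).
  rewrite ler_wpM2r ?sqr_ge0// ler_pM ?sqr_ge0// normrM -[leRHS]mul1r ler_pM//; last exact: (tf_b2 tf).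
  by rewrite ger0_norm// invf_le1// ler1n.
apply: (le_trans (lerD H H5)).
have -> : e' * 4 * C ^+ 2 * dl + 8 * (1 + M) * K * C ^+ 4 * dl ^+ 2 + Cf * C ^+ 2 * dl ^+ 2 =
  (e' * 4 * C ^+ 2 + L * dl) * dl by rewrite /L; ring.
rewrite ler_pM2r//.
have C1 : 0 < C ^+ 2 + 1 by rewrite ltr_wpDl.
have h1 : e' * (8 * (C ^+ 2 + 1)) = e by rewrite /e' divfK// gt_eqF// mulr_gt0.
have h2 : dl * (2 * (L + 1)) <= e.
  by rewrite -ler_pdivlMr// mulr_gt0// ltr_wpDl.
have := ltW e1; nra.
Qed.

End Step.

(** * Weak error of adapted Euler sums, discrete stochastic integrals *)

Section Euler.
Context {R : realType} {d : measure_display} {T : measurableType d}.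
Variables (P : probability T R) (F : R -> set (set T)) (B : R -> T -> R).
Hypotheses (hF : is_filtration F) (hB : is_brownian_motion P F B).

Lemma increment_indepR s t d' (U : measurableType d') (V : T -> U)
    (f : U * measurableTypeR R -> R) (C : R) :
  0 <= s -> s < t -> fmeas F s V -> measurable_fun setT f -> (forall u, `|f u| <= C) ->
  measurable_fun setT (fun w => \int[gauss (Num.sqrt (t - s))]_x f (V w, x)) /\
  \int[P]_w f (V w, B t w - B s w) =
  \int[P]_w \int[gauss (Num.sqrt (t - s))]_x f (V w, x).
Proof.
move=> s0 st hV mf fC.
set N := gauss _.
have t0 : 0 <= t by rewrite (le_trans s0)// ltW.
(* Shifted to be nonnegative, the case settled by [increment_indep]. *)
pose g u := f u + C.
have mg : measurable_fun setT g by exact: measurable_funD.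
have ng : nnmeas (fun u => (g u)%:E).
  split => [u|]; last exact/measurable_EFinP.
  by rewrite lee_fin /g; have := fC u; rewrite ler_norml; lra.
have mfV w : measurable_fun [set: measurableTypeR R] (fun x => f (V w, x)).
  by apply: (measurableT_comp mf); exact: measurable_fun_pair.
have ifV w : N.-integrable setT (EFin \o (fun x => f (V w, x))).
  by apply: (@bounded_integrableP R _ _ N _ C).
have iC d'' (T' : measurableType d'') (P' : probability T' R) : P'.-integrable setT (EFin \o (fun=> C)).
  by apply: (@bounded_integrableP R _ _ P' _ `|C|).
have E w : (\int[N]_x (g (V w, x))%:E = (\int[N]_x f (V w, x) + C)%:E)%E.
  rewrite -EFin_Rintegral//; last first.
    by have := integrableD measurableT (ifV w) (iC _ _ N); apply: eq_integrable.
  by rewrite /g (RintegralD measurableT (ifV w) (iC _ _ N)) Rintegral_gauss_cst.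
have mI : measurable_fun setT (fun w => \int[N]_x f (V w, x)).
  have m1 := measurable_gauss_integral hF t s0 hV ng.
  have {}m1 : measurable_fun setT (EFin \o (fun w => \int[N]_x f (V w, x) + C)).
    by apply: eq_measurable_fun m1 => w _; rewrite /= -E.
  have {}m1 : measurable_fun setT (fun w => \int[N]_x f (V w, x) + C) by exact/measurable_EFinP.
  rewrite (_ : (fun w => _) = (fun w => \int[N]_x f (V w, x) + C - C)); last first.
    by apply/funext => w; rewrite addrK.
  exact: measurable_funB.
split => //.
have mV : measurable_fun [set: T] V by exact: (fmeas_measurable hF s0 hV).
have mVB : measurable_fun [set: T] (fun w => f (V w, (B t w - B s w : measurableTypeR R))).
  apply: (measurableT_comp mf); apply: measurable_fun_pair => //.
  exact: (increment_measurable hF hB s0 t0).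
have := increment_indep hF hB s0 st hV ng.
under [X in _ = X]eq_integral do rewrite -/N E.
have iL : P.-integrable setT (EFin \o (fun w => f (V w, (B t w - B s w : measurableTypeR R)))).
  by apply: (@bounded_integrableP R _ _ P _ C).
have iR : P.-integrable setT (EFin \o (fun w => \int[N]_x f (V w, x))).
  apply: (@bounded_integrableP R _ _ P _ C) => // w.
  exact: (normr_RintegralP N).
rewrite -EFin_Rintegral//; last first.
  by have := integrableD measurableT iL (iC _ _ P); apply: eq_integrable.
rewrite -EFin_Rintegral//; last first.
  by have := integrableD measurableT iR (iC _ _ P); apply: eq_integrable.
by rewrite /g (RintegralD measurableT iL (iC _ _ P)) (RintegralD measurableT iR (iC _ _ P)) => -[]; exact: addIr.
Qed.

Variable n : nat.
Notation dl := (n.+1%:R^-1 : R).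
Definition gridt k : R := k%:R / n.+1%:R.
Definition gridB k w := B (gridt k.+1) w - B (gridt k) w.

Lemma gridt_ge0 k : 0 <= gridt k. Proof. by rewrite divr_ge0. Qed.

Lemma gridt_lt k : gridt k < gridt k.+1.
Proof. by rewrite ltr_pM2r ?invr_gt0// ltr_nat. Qed.

Lemma gridtB k : Num.sqrt (gridt k.+1 - gridt k) = Num.sqrt dl.
Proof. by congr Num.sqrt; rewrite /gridt -mulrBl -natr1 addrC addKr mul1r. Qed.

Lemma sqrt_dl_gt0 : 0 < Num.sqrt dl. Proof. by rewrite sqrtr_gt0 invr_gt0. Qed.

Lemma sqr_sqrt_dl : Num.sqrt dl ^+ 2 = dl. Proof. by rewrite sqr_sqrtr// invr_ge0. Qed.

Lemma fmeas_gridB k : fmeas F (gridt k.+1) (gridB k : T -> R).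
Proof.
apply/(fmeasP hF _ (gridt_ge0 _)).
apply: (@measurable_funB _ (g_sigma_algebraType (F (gridt k.+1)))).
  apply/(fmeasP hF _ (gridt_ge0 _)); exact: (brownian_fmeas hB (gridt_ge0 _)).
apply/(fmeasP hF _ (gridt_ge0 _)).
by apply: fmeas_le; [exact: hF|exact: gridt_ge0|exact: ltW (gridt_lt k)|exact: (brownian_fmeas hB (gridt_ge0 _))].
Qed.

Lemma fmeas_grid_sum (V : nat -> T -> R) K :
  (forall k, (k < K)%N -> fmeas F (gridt k.+1) (V k)) ->
  fmeas F (gridt K) (fun w => \sum_(k < K) V k w : R).
Proof.
move=> mV; apply/(fmeasP hF _ (gridt_ge0 _)).
apply: (@measurable_sum _ (g_sigma_algebraType (F (gridt K)))) => k.
apply/(fmeasP hF _ (gridt_ge0 _)); apply: fmeas_le (mV k (ltn_ord k)); [exact: hF|exact: gridt_ge0|].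
by rewrite ler_pM2r ?invr_gt0// ler_nat.
Qed.

Lemma fmeas_op2 t (V W : T -> R) (op : R * R -> R) : 0 <= t -> measurable_fun setT op ->
  fmeas F t V -> fmeas F t W -> fmeas F t (fun w => op (V w, W w)).
Proof.
move=> t0 mop mV mW; apply: (fmeas_comp (f := op) mop (V := fun w => (V w, W w))).
exact: fmeas_pair.
Qed.

Section Scheme.
Variables (b c : nat -> T -> R) (C : R).
Hypotheses (mb : forall k, fmeas F (gridt k) (b k)) (mc : forall k, fmeas F (gridt k) (c k)).
Hypotheses (bC : forall k w, `|b k w| <= C) (cC : forall k w, `|c k w| <= C).

(** The coefficients are arbitrary adapted data, later those of the solution at the grid times
    rather than functions of the scheme. The scheme thus follows the solution by convergence of sums
    and not by a stability estimate. *)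
Definition euler (z : R) k w := z + \sum_(j < k) (b j w * dl + c j w * gridB j w).

Lemma eulerS z k w : euler z k.+1 w = euler z k w + (b k w * dl + c k w * gridB k w).
Proof. by rewrite /euler big_ord_recr addrA. Qed.

Lemma fmeas_up k (V : T -> R) : fmeas F (gridt k) V -> fmeas F (gridt k.+1) V.
Proof. by apply: fmeas_le => //; [exact: gridt_ge0|exact: ltW (gridt_lt k)]. Qed.

Lemma fmeas_stoch k : fmeas F (gridt k.+1) (fun w => c k w * gridB k w : R).
Proof.
apply: (@fmeas_op2 _ (c k) (gridB k) (fun u => u.1 * u.2)); [exact: gridt_ge0|exact: measurable_funM| |exact: fmeas_gridB].
exact: fmeas_up.
Qed.

Lemma fmeas_euler z k : fmeas F (gridt k) (euler z k).
Proof.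
have := @fmeas_grid_sum (fun j w => b j w * dl + c j w * gridB j w) k.
move=> H; apply: (fmeas_comp (f := fun u : R => z + u) _ (H _)); first exact: measurable_funD.
move=> j _; apply: (@fmeas_op2 _ (b j) (fun w => c j w * gridB j w) (fun u => u.1 * dl + u.2)).
- exact: gridt_ge0.
- by apply: measurable_funD => //; exact: measurable_funM.
- exact: fmeas_up.
- exact: fmeas_stoch.
Qed.

(** One-step errors add up. Given the past up to the K-th grid time, the scheme and its two
    coefficients are frozen, and the one-step hypothesis, provided by [gauss_step], applies under
    the expectation. *)
Lemma euler_weak_error f f1 f2 Cf (e z : R) K : test_fun f f1 f2 Cf ->
  (forall s y b c, 0 < s -> s ^+ 2 = dl -> `|b| <= C -> `|c| <= C ->
    `|\int[gauss s]_x f (y + (b * s ^+ 2 + c * x)) - f y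
      - s ^+ 2 * (b * f1 y + 2^-1 * c ^+ 2 * f2 y)| <= e * s ^+ 2) ->
  `|\int[P]_w f (euler z K w) - f z
    - \sum_(k < K) (\int[P]_w (b k w * f1 (euler z k w) + 2^-1 * c k w ^+ 2 * f2 (euler z k w))) / n.+1%:R|
  <= e * dl * K%:R.
Proof.
move=> tf step.
have [cf cf1 cf2] := test_fun_measurable tf.
have C0 : 0 <= C by rewrite (le_trans _ (bC 0 point)).
have Cf0 : 0 <= Cf by rewrite (le_trans _ (tf_b0 tf 0)).
have mT k V : fmeas F (gridt k) V -> measurable_fun [set: T] (V : T -> R).
  exact: (fmeas_measurable hF (gridt_ge0 k)).
elim: K => [|K ih].
  rewrite big_ord0 mulr0 subr0 /euler.
  under eq_Rintegral do rewrite big_ord0 addr0.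
  by rewrite RintegralP_cst subrr normr0.
pose V w := ((euler z K w, b K w), c K w).
have mV : fmeas F (gridt K) V.
  apply: fmeas_pair => //; first exact: gridt_ge0.
  by apply: fmeas_pair => //; [exact: gridt_ge0|exact: fmeas_euler].
pose g (u : (R * R * R) * measurableTypeR R) := f (u.1.1.1 + (u.1.1.2 * dl + u.1.2 * u.2)).
have mg : measurable_fun setT g.
  apply: (measurableT_comp (continuous_measurable_fun cf)).
  apply: measurable_funD; first by do 2 apply: (measurableT_comp measurable_fst) => //.
  apply: measurable_funD.
    apply: measurable_funM => //; apply: (measurableT_comp measurable_snd).
    by apply: (measurableT_comp measurable_fst).
  apply: measurable_funM; last exact: measurable_snd.
  by apply: (measurableT_comp measurable_snd).
have [mI EI] := increment_indepR (gridt_ge0 K) (gridt_lt K) mV mg (fun u => tf_b0 tf _).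
rewrite gridtB in mI EI.
set N := gauss _ in mI EI.
have iG k : P.-integrable setT (EFin \o (fun w => b k w * f1 (euler z k w) + 2^-1 * c k w ^+ 2 * f2 (euler z k w))).
  apply: (@bounded_integrableP R _ _ P _ (C * Cf + 2^-1 * C ^+ 2 * Cf)).
    have me := mT _ _ (fmeas_euler z k).
    apply: measurable_funD; apply: measurable_funM.
    - exact: (mT _ _ (mb k)).
    - exact: (measurableT_comp (continuous_measurable_fun cf1)).
    - apply: measurable_funM => //; apply: measurable_funX; exact: (mT _ _ (mc k)).
    - exact: (measurableT_comp (continuous_measurable_fun cf2)).
  move=> w; apply: (le_trans (ler_normD _ _)); rewrite !normrM; apply: lerD.
    by rewrite ler_pM// (tf_b1 tf).
  rewrite ler_pM ?mulr_ge0 ?(tf_b2 tf)//.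
  have h2 : `|2^-1 : R| = 2^-1 by rewrite ger0_norm.
  by rewrite h2 ler_wpM2l// expr2 ler_pM.
have iE k : P.-integrable setT (EFin \o (fun w => f (euler z k w))).
  apply: (@bounded_integrableP R _ _ P _ Cf) => [|w]; last exact: (tf_b0 tf).
  apply: (measurableT_comp (continuous_measurable_fun cf)); exact: (mT _ _ (fmeas_euler z k)).
have ES : \int[P]_w f (euler z K.+1 w) = \int[P]_w \int[N]_x g (V w, x).
  by rewrite -EI; apply: eq_Rintegral => w _; rewrite eulerS.
have iN : P.-integrable setT (EFin \o (fun w => \int[N]_x g (V w, x))).
  apply: (@bounded_integrableP R _ _ P _ Cf) => // w.
  apply: (normr_RintegralP N) => [|x]; last exact: (tf_b0 tf).
  by apply: (measurableT_comp mg); exact: measurable_fun_pair.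
pose G k w := b k w * f1 (euler z k w) + 2^-1 * c k w ^+ 2 * f2 (euler z k w).
have {}iG k : P.-integrable setT (EFin \o G k) by exact: iG.
have H : `|\int[P]_w (\int[N]_x g (V w, x) - f (euler z K w) - dl * G K w)| <= e * dl.
  have i2 : P.-integrable setT (EFin \o (fun w => dl * G K w)).
    by have := integrableZl measurableT dl (iG K); apply: eq_integrable => // w _; rewrite /= EFinM.
  apply: (normr_RintegralP P) => [|w].
    apply: measurable_funB; first apply: measurable_funB => //.
      by have /integrableP[/measurable_EFinP] := iE K.
    by have /integrableP[/measurable_EFinP] := i2.
  have := step (Num.sqrt dl) (euler z K w) (b K w) (c K w) sqrt_dl_gt0 sqr_sqrt_dl (bC K w) (cC K w).
  by rewrite sqr_sqrt_dl.
rewrite big_ord_recr/= -[K.+1%:R]natr1 mulrDr mulr1.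
have i2 : P.-integrable setT (EFin \o (fun w => dl * G K w)).
  by have := integrableZl measurableT dl (iG K); apply: eq_integrable => // w _; rewrite /= EFinM.
have HB : \int[P]_w (\int[N]_x g (V w, x) - f (euler z K w) - dl * G K w) =
    \int[P]_w f (euler z K.+1 w) - \int[P]_w f (euler z K w) - \int[P]_w G K w / n.+1%:R.
  rewrite RintegralB//; last by have := integrableB measurableT iN (iE K); apply: eq_integrable.
  by rewrite RintegralB// ES RintegralZl// [dl * _]mulrC.
rewrite HB in H.
apply: le_trans (lerD ih H); apply: le_trans (ler_normD _ _).
by rewrite le_eqVlt; apply/orP; left; apply/eqP; congr `|_|; rewrite /G; ring.
Qed.

End Scheme.

Section Lenglart.
Variables (c : nat -> T -> R) (mc : forall k, fmeas F (gridt k) (c k)).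

Definition stoch (c : nat -> T -> R) K w : R := \sum_(k < K) c k w * gridB k w.

Lemma fmeas_stoch_sum (e : nat -> T -> R) K : (forall k, fmeas F (gridt k) (e k)) ->
  fmeas F (gridt K) (stoch e K).
Proof.
move=> me; apply: (@fmeas_grid_sum (fun k w => e k w * gridB k w) K) => k _.
by apply: fmeas_stoch.
Qed.

(** Stated between extended nonnegative integrals, which make sense for every adapted [e]. The cross
    term is the linear coefficient of a polynomial in a centred Gaussian, so it integrates to 0. *)
Lemma ito_isometry (e : nat -> T -> R) K : (forall k, fmeas F (gridt k) (e k)) ->
  (\int[P]_w (stoch e K w ^+ 2)%:E = \int[P]_w (\sum_(k < K) e k w ^+ 2 * dl)%:E)%E.
Proof.
move=> me.
have mT k V : fmeas F (gridt k) V -> measurable_fun [set: T] (V : T -> R).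
  exact: (fmeas_measurable hF (gridt_ge0 k)).
elim: K => [|K ih].
  by apply: eq_integral => w _; rewrite /stoch !big_ord0 expr0n.
pose V w := (stoch e K w, e K w).
have mV : fmeas F (gridt K) V.
  by apply: fmeas_pair => //; [exact: gridt_ge0|exact: fmeas_stoch_sum].
pose g (u : (R * R) * measurableTypeR R) := (u.1.1 + u.1.2 * u.2) ^+ 2.
have ng : nnmeas (fun u => (g u)%:E).
  split => [u|]; first by rewrite lee_fin sqr_ge0.
  apply/measurable_EFinP; apply: measurable_funX; apply: measurable_funD.
    by apply: (measurableT_comp measurable_fst).
  by apply: measurable_funM => //; apply: (measurableT_comp measurable_snd).
have := increment_indep hF hB (gridt_ge0 K) (gridt_lt K) mV ng.
rewrite gridtB => E.
transitivity (\int[P]_w (stoch e K w ^+ 2 + e K w ^+ 2 * dl)%:E)%E.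
  transitivity (\int[P]_w (g (V w, (B (gridt K.+1) w - B (gridt K) w)%R))%:E)%E.
    by apply: eq_integral => w _; rewrite /g /V/= /stoch big_ord_recr.
  rewrite E; apply: eq_integral => w _.
  have [] := gauss_poly sqrt_dl_gt0 (stoch e K w ^+ 2) (2 * stoch e K w * e K w) (e K w ^+ 2) 0.
  rewrite mul0r addr0 sqr_sqrt_dl => ig <-.
  rewrite EFin_Rintegral//; apply: eq_integral => x _; congr EFin.
  by rewrite /g /V/=; ring.
under eq_integral do rewrite EFinD.
under [X in _ = X]eq_integral do rewrite big_ord_recr/= EFinD.
have me2 k : measurable_fun [set: T] (fun w => (e k w ^+ 2 * dl)%:E).
  apply/measurable_EFinP; apply: measurable_funM => //; apply: measurable_funX; exact: (mT _ _ (me k)).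
rewrite ge0_integralD//; first last.
- by move=> w _; rewrite lee_fin mulr_ge0 ?sqr_ge0.
- apply/measurable_EFinP; apply: measurable_funX; exact: (mT _ _ (fmeas_stoch_sum K me)).
- by move=> w _; rewrite lee_fin sqr_ge0.
rewrite ge0_integralD//; first last.
- by move=> w _; rewrite lee_fin mulr_ge0 ?sqr_ge0.
- apply/measurable_EFinP; apply: measurable_sum => k.
  by have /measurable_EFinP := me2 k; exact.
- by move=> w _; rewrite lee_fin sumr_ge0// => k _; rewrite mulr_ge0 ?sqr_ge0.
by rewrite ih.
Qed.

(** Coefficients switched off before the accumulated squares exceed [eta] give a sum of second
    moment at most [eta], to which Chebyshev applies; the two sums agree where the total stays below
    [eta]. The event [A] may depend on the whole path: it only limits where that total is
    examined. *)
Lemma lenglart (A : set T) (eta e : R) K : measurable A -> 0 < eta -> 0 < e ->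
  (P (A `&` [set w | (e <= `|stoch c K w|)%R]) <=
   ((eta / e ^+ 2)%R)%:E + P (A `&` [set w | (eta < \sum_(k < K) c k w ^+ 2 * dl)%R]))%E.
Proof.
move=> mA eta0 e0.
have mT k V : fmeas F (gridt k) V -> measurable_fun [set: T] (V : T -> R).
  exact: (fmeas_measurable hF (gridt_ge0 k)).
pose S k w := \sum_(j < k) c j w ^+ 2 * dl.
have S_ge0 k w : 0 <= S k w by rewrite sumr_ge0// => j _; rewrite mulr_ge0 ?sqr_ge0.
have SS k w : S k.+1 w = S k w + c k w ^+ 2 * dl by rewrite /S big_ord_recr.
have S_le k w : S k w <= S k.+1 w by rewrite SS lerDl mulr_ge0 ?sqr_ge0.
(* [S k.+1] involves c 0, ..., c k only, all known at the k-th grid time, so the truncated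
   coefficient is still adapted. *)
pose c' k w := if S k.+1 w <= eta then c k w else 0.
have mSf k : fmeas F (gridt k) (S k.+1 : T -> R).
  apply/(fmeasP hF _ (gridt_ge0 _)).
  apply: (@measurable_sum _ (g_sigma_algebraType (F (gridt k)))) => j.
  apply: (@measurable_funM _ (g_sigma_algebraType (F (gridt k)))) => //.
  apply: (@measurable_funX _ (g_sigma_algebraType (F (gridt k)))).
  apply/(fmeasP hF _ (gridt_ge0 _)); apply: fmeas_le (mc (j : nat)); [exact: hF|exact: gridt_ge0|].
  by rewrite ler_pM2r ?invr_gt0// ler_nat -ltnS.
have mc' k : fmeas F (gridt k) (c' k : T -> R).
  apply: (@fmeas_op2 _ (S k.+1) (c k) (fun u => if u.1 <= eta then u.2 else 0)) => //.
  - exact: gridt_ge0.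
  - by apply: measurable_fun_ifT => //; exact: measurable_fun_ler.
have S'le w : forall k, \sum_(j < k) c' j w ^+ 2 * dl <= Num.min (S k w) eta.
  elim=> [|k ih]; first by rewrite !big_ord0 le_min S_ge0 ltW.
  move: ih; rewrite big_ord_recr/= !le_min /c' => /andP[i1 i2].
  case: ifPn => [le|_]; last by rewrite expr0n/= mul0r addr0 i2 (le_trans i1).
  have H : \sum_(i < k) (if S i.+1 w <= eta then c i w else 0) ^+ 2 * dl + c k w ^+ 2 * dl <= S k.+1 w.
    by rewrite SS lerD2r.
  by rewrite H (le_trans H).
have cE w : S K w <= eta -> stoch c K w = stoch c' K w.
  move=> SK; apply: eq_bigr => k _; rewrite /c'.
  rewrite ifT//; apply: le_trans SK.
  have : forall j, S k.+1 w <= S (k.+1 + j)%N w.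
    by elim=> [|j ih]; [rewrite addn0|rewrite addnS (le_trans ih)].
  by move=> /(_ (K - k.+1)%N); rewrite subnKC.
have mst (f : nat -> T -> R) : (forall k, fmeas F (gridt k) (f k)) ->
    measurable_fun [set: T] (fun w => `|stoch f K w|).
  by move=> mf; apply: measurableT_comp => //; exact: (mT _ _ (fmeas_stoch_sum K mf)).
have mE (f : T -> R) x : measurable_fun setT f -> measurable [set w | x <= f w].
  move=> mf; have := measurable_fun_ler (measurable_cst x) mf.
  by move=> /(_ measurableT [set true] I); rewrite setTI.
have mE' (f : T -> R) x : measurable_fun setT f -> measurable [set w | x < f w].
  move=> mf; have := measurable_fun_ltr (measurable_cst x) mf.
  by move=> /(_ measurableT [set true] I); rewrite setTI.
have mS : measurable_fun [set: T] (S K).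
  apply: measurable_sum => j; apply: measurable_funM => //; apply: measurable_funX; exact: (mT _ _ (mc j)).
apply: (@le_trans _ _ (P ([set w | e <= `|stoch c' K w|] `|` (A `&` [set w | eta < S K w])))).
  apply: le_measure.
  - by apply/mem_set; apply: measurableI => //; apply: mE; exact: mst.
  - by apply/mem_set; apply: measurableU; [apply: mE; exact: mst|apply: measurableI => //; exact: mE'].
  - move=> w [Aw /= ew]; have [SK|SK] := leP (S K w) eta; [left|right] => //=.
    by rewrite -cE.
apply: (le_trans (measureU2 _ _ _)).
- by apply: mE; exact: mst.
- by apply: measurableI => //; exact: mE'.
apply: leeD => //.
have e20 : 0 < e ^+ 2 by rewrite exprn_gt0.
rewrite EFinM lee_pdivlMr//.
have mE1 : measurable [set w | e <= `|stoch c' K w|] by apply: mE; exact: mst.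
apply: (@le_trans _ _ (\int[P]_w (stoch c' K w ^+ 2)%:E)%E).
  set E := [set w | _] in mE1 *.
  rewrite [X in (X * _ <= _)%E](_ : _ = (\int[P]_w (\1_E w)%:E)%E); last first.
    by rewrite integral_indic// setIT.
  rewrite muleC -ge0_integralZl//; first last.
  - by rewrite lee_fin ltW.
  - exact/measurable_EFinP/measurable_indic.
  apply: ge0_le_integral => //.
  - by move=> w _; rewrite mule_ge0 ?lee_fin// ltW.
  - by apply: measurable_funeM; exact/measurable_EFinP/measurable_indic.
  - apply/measurable_EFinP; apply: measurable_funX; exact: (mT _ _ (fmeas_stoch_sum K mc')).
  - move=> w _; rewrite -EFinM lee_fin indicE; case: (boolP (w \in _)) => [/set_mem/= H|_].
      rewrite mulr1 -[leRHS]real_normK ?num_real// lerXn2r ?nnegrE//; exact: ltW.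
    by rewrite mulr0 sqr_ge0.
rewrite ito_isometry//.
apply: (@le_trans _ _ (\int[P]_w eta%:E)%E).
  apply: ge0_le_integral => //.
  - by move=> w _; rewrite lee_fin sumr_ge0// => k _; rewrite mulr_ge0 ?sqr_ge0.
  - apply/measurable_EFinP; apply: measurable_sum => j; apply: measurable_funM => //.
    by apply: measurable_funX; exact: (mT _ _ (mc' j)).
  - by move=> w _; rewrite lee_fin; have := S'le w K; rewrite le_min => /andP[].
by rewrite integral_cst//= (probability_setT P) mule1.
Qed.

End Lenglart.
End Euler.

(** * Pathwise discretisation of simple processes and localisation of solutions *)

Section Approximation.
Context {R : realType} {d : measure_display} {T : measurableType d}.
Notation mu := (@lebesgue_measure R).
Variables (P : probability T R) (F : R -> set (set T)) (B : R -> T -> R).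
Hypotheses (hF : is_filtration F) (hB : is_brownian_motion P F B).

Lemma cvgn_sum K (f : nat -> nat -> R) (l : nat -> R) :
  (forall i, f n i @[n --> \oo] --> l i) ->
  \sum_(i < K) f n i @[n --> \oo] --> \sum_(i < K) l i.
Proof.
move=> fl; elim: K => [|K ih].
  rewrite big_ord0; apply: (@eq_cvgn _ (fun=> 0)); last exact: cvg_cst.
  by move=> n; rewrite big_ord0.
rewrite big_ord_recr/=.
apply: (@eq_cvgn _ (fun n => \sum_(i < K) f n i + f n K)).
  by move=> n; rewrite big_ord_recr.
by apply: cvgD.
Qed.

Lemma cvge0_near_le (u : nat -> \bar R) (e : R) : u n @[n --> \oo] --> 0%E -> 0 < e ->
  \forall n \near \oo, (u n <= e%:E)%E.
Proof.
move=> /fine_cvgP[fu /cvgrPdist_le cu] e0.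
near=> n.
have un : u n \is a fin_num by near: n; exact: fu.
rewrite -(fineK un) lee_fin.
have : `|0 - fine (u n)| <= e by near: n; exact: cu.
by rewrite sub0r normrN; apply: le_trans; exact: ler_norm.
Unshelve. all: by end_near. Qed.

Lemma measurable_ge (f : T -> R) (x : R) : measurable_fun setT f -> measurable [set w | x <= f w].
Proof.
move=> mf; have := measurable_fun_ler (measurable_cst x) mf.
by move=> /(_ measurableT [set true] I); rewrite setTI.
Qed.

Lemma measurable_gt (f : T -> R) (x : R) : measurable_fun setT f -> measurable [set w | x < f w].
Proof.
move=> mf; have := measurable_fun_ltr (measurable_cst x) mf.
by move=> /(_ measurableT [set true] I); rewrite setTI.
Qed.

Definition gridn n (s : R) := Num.truncn (s * n.+1%:R).

Lemma gridt_gridn_cvg (s : R) : 0 <= s -> gridt n (gridn n s) @[n --> \oo] --> s.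
Proof. exact: truncn_mul_cvg. Qed.

Lemma gridt_gridn_le n (s : R) : 0 <= s -> gridt n (gridn n s) <= s :> R.
Proof.
move=> s0; rewrite /gridt /gridn ler_pdivrMr// truncn_le.
by rewrite mulr_ge0.
Qed.

Lemma gridt_le n k l : (k <= l)%N -> gridt n k <= gridt n l :> R.
Proof. by move=> kl; rewrite ler_pM2r ?invr_gt0// ler_nat. Qed.

Lemma le_gridn n (u s : R) : u <= s -> (gridn n u <= gridn n s)%N.
Proof. by move=> us; apply: le_truncn; rewrite ler_pM2r. Qed.

Section SimpleProcess.
Variable phi : simple_process F.

Lemma sp_time_ge0' i : 0 <= sp_time phi i.
Proof.
elim: i => [|i ih]; first exact: sp_time_ge0.
exact: le_trans ih (sp_time_nd phi i).
Qed.

Lemma sp_coef_fmeas i t : sp_time phi i <= t -> fmeas F t (sp_coef phi i : T -> R).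
Proof.
move=> it A mA; have [_ _ +] := hF.
by apply; [exact: (sp_time_ge0' i)|exact: it|exact: sp_coef_meas].
Qed.

Lemma sp_val_fmeas t : 0 <= t -> fmeas F t (sp_val phi t : T -> R).
Proof.
move=> t0; apply/(fmeasP hF _ t0).
apply: (@measurable_sum _ (g_sigma_algebraType (F t))) => i.
have [it|it] := leP (sp_time phi i) t.
  apply: (@measurable_funM _ (g_sigma_algebraType (F t))) => //.
  by apply/(fmeasP hF _ t0); exact: sp_coef_fmeas.
rewrite (_ : (fun x => _) = (fun=> 0))//.
apply/funext => w; rewrite indicE memNset ?mulr0// /= in_itv/= => /andP[].
by rewrite ltNge (ltW it).
Qed.

Lemma sp_val_bounded : exists2 C, 0 <= C & forall t w, `|sp_val phi t w| <= C.
Proof.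
have [K KP] := sp_coef_bnd phi.
exists (\sum_(i < sp_size phi) `|K|) => [|t w]; first by rewrite sumr_ge0.
apply: (le_trans (ler_norm_sum _ _ _)); apply: ler_sum => i _.
rewrite normrM -[leRHS]mulr1 ler_pM//.
  by rewrite (le_trans (KP i w))// ler_norm.
by rewrite ger0_norm// indicE; case: (_ \in _).
Qed.

(** Simple processes are left-continuous, and the grid points approach [u] from the left. *)
Lemma sp_val_cvg (u : R) w : 0 < u ->
  sp_val phi (gridt n (gridn n u)) w @[n --> \oo] --> sp_val phi u w.
Proof.
move=> u0; rewrite /sp_val.
have cg (x : R) : \forall n \near \oo, (x < gridt n (gridn n u)) = (x < u).
  have [xu|ux] := ltP x u.
    have /cvgr_gt := gridt_gridn_cvg (ltW u0); move=> /(_ x xu).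
    by apply: filterS => n ->.
  apply: nearW => n; apply/negbTE; rewrite -leNgt (le_trans _ ux)//.
  by apply: gridt_gridn_le; exact: ltW.
apply: (@cvgn_sum _ (fun n i => sp_coef phi i w * \1_(`]sp_time phi i, sp_time phi i.+1]) (gridt n (gridn n u)))
  (fun i => sp_coef phi i w * \1_(`]sp_time phi i, sp_time phi i.+1]) u)) => i.
apply: cvgM; first exact: cvg_cst.
apply: cvg_near_cst; near=> n.
have E v : (v \in `]sp_time phi i, sp_time phi i.+1]%classic) =
    (sp_time phi i < v) && ~~ (sp_time phi i.+1 < v).
  rewrite -leNgt; apply/idP/idP; first by move/set_mem; rewrite /= in_itv.
  by move=> H; apply/mem_set; rewrite /= in_itv.
rewrite !indicE !E; congr (nat_of_bool (_ && ~~ _))%:R; near: n; exact: cg.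
Unshelve. all: by end_near. Qed.

Lemma gridt0 n : gridt n 0 = 0 :> R.
Proof. by rewrite /gridt mul0r. Qed.

(** The grid times not exceeding [a] are those of index at most [gridn n a], whence the successor;
    [minn] caps it at the end of the sum. *)
Lemma telescope_grid n (a : R) w K : 0 <= a ->
  \sum_(k < K) (gridt n k <= a)%R%:R * gridB B n k w =
  B (gridt n (minn (gridn n a).+1 K)) w - B (gridt n 0) w.
Proof.
move=> a0; elim: K => [|K ih]; first by rewrite big_ord0 minn0 subrr.
rewrite big_ord_recr/= ih.
have -> : (gridt n K <= a) = (K < (gridn n a).+1)%N.
  by rewrite ltnS /gridn truncn_ge_nat ?mulr_ge0// /gridt ler_pdivrMr.
case: ltnP => H.
  by rewrite mul1r (minn_idPr H) /gridB; ring.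
by rewrite mul0r addr0 (minn_idPl (leqW H)).
Qed.

Lemma telescope_grid_cvg (a s : R) w : 0 <= a -> 0 <= s ->
  \sum_(k < gridn n s) (gridt n k <= a)%R%:R * gridB B n k w @[n --> \oo]
  --> B (Num.min a s) w - B 0 w.
Proof.
move=> a0 s0; have [_ cB _ _] := hB.
apply: (@eq_cvgn _ (fun n => B (gridt n (minn (gridn n a).+1 (gridn n s))) w - B 0 w)).
  by move=> n; rewrite telescope_grid// gridt0.
apply: cvgB; last exact: cvg_cst.
apply: (within_cvg_seq (cB w)).
- by rewrite /= in_itv/= andbT le_min a0.
- by move=> n; rewrite /= in_itv/= andbT gridt_ge0.
- have ca : gridt n (gridn n a).+1 @[n --> \oo] --> a.
    apply: (@eq_cvgn _ (fun n => gridt n (gridn n a) + n.+1%:R^-1)).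
      by move=> n; rewrite /gridt -[(gridn n a).+1%:R]natr1 mulrDl mul1r.
    by rewrite -[X in _ --> X]addr0; apply: cvgD; [exact: gridt_gridn_cvg|exact: invS_cvg0].
  have cs := gridt_gridn_cvg s0.
  have cm : Num.min (gridt n (gridn n a).+1) (gridt n (gridn n s)) @[n --> \oo] --> Num.min a s.
    exact: (@continuous2_cvg nat R R R \oo _ _ _ (fun x y : R => Num.min x y) a s (@min_continuous _ R (a, s)) ca cs).
  apply: (eq_cvgn _ cm) => n.
  rewrite /minn; case: ltnP => H; first by apply/min_idPl; apply: gridt_le; exact: ltnW.
  by apply/min_idPr; exact: gridt_le.
Qed.

(** The indicator of ]u, v] is a difference of two half-line indicators. Each half-line sum
    telescopes to one increment of the path, and path continuity concludes. *)
Lemma stoch_sp_val_cvg (s : R) w : 0 <= s ->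
  stoch B n (fun k => sp_val phi (gridt n k)) (gridn n s) w @[n --> \oo]
  --> sp_integral phi B s w.
Proof.
move=> s0; rewrite /sp_integral.
apply: (@eq_cvgn _ (fun n => \sum_(i < sp_size phi) sp_coef phi i w *
    (\sum_(k < gridn n s) (gridt n k <= sp_time phi i.+1)%R%:R * gridB B n k w -
     \sum_(k < gridn n s) (gridt n k <= sp_time phi i)%R%:R * gridB B n k w))).
  move=> n; rewrite /stoch /sp_val.
  under [RHS]eq_bigr do rewrite mulr_suml.
  rewrite exchange_big/=; apply: eq_bigr => i _.
  rewrite -sumrB mulr_sumr; apply: eq_bigr => k _.
  rewrite -mulrA -mulrBl; congr (_ * (_ * _)).
  have -> : \1_(`]sp_time phi i, sp_time phi i.+1]) (gridt n k) =
    ((sp_time phi i < gridt n k) && (gridt n k <= sp_time phi i.+1))%:R :> R.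
    rewrite indicE; congr (nat_of_bool _)%:R; apply/idP/idP; first by move/set_mem; rewrite /= in_itv.
    by move=> H; apply/mem_set; rewrite /= in_itv.
  have := sp_time_nd phi i; case: (leP (gridt n k) (sp_time phi i)) => H1 H2.
    by rewrite (le_trans H1 H2) subrr.
  by case: (_ <= _); rewrite /= ?subr0.
have := @cvgn_sum (sp_size phi) (fun n i => sp_coef phi i w *
    (\sum_(k < gridn n s) (gridt n k <= sp_time phi i.+1)%R%:R * gridB B n k w -
     \sum_(k < gridn n s) (gridt n k <= sp_time phi i)%R%:R * gridB B n k w))
  (fun i => sp_coef phi i w
      * (B (Num.min (sp_time phi i.+1) s) w - B (Num.min (sp_time phi i) s) w)).
apply => i; apply: cvgM; first exact: cvg_cst.
have -> : B (Num.min (sp_time phi i.+1) s) w - B (Num.min (sp_time phi i) s) w =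
  (B (Num.min (sp_time phi i.+1) s) w - B 0 w) - (B (Num.min (sp_time phi i) s) w - B 0 w) by ring.
by apply: cvgB; apply: telescope_grid_cvg => //; exact: sp_time_ge0'.
Qed.

Lemma sp_integral_measurable (s : R) : 0 <= s -> measurable_fun setT (sp_integral phi B s).
Proof.
move=> s0; apply: measurable_sum => i; apply: measurable_funM.
  have [_ + _] := hF => /(_ _ (sp_time_ge0' i)) sub.
  by move=> _ A mA; rewrite setTI; apply: sub; exact: sp_coef_meas.
by apply: measurable_funB; apply: (brownian_measurable hF hB); rewrite le_min s0 sp_time_ge0'.
Qed.

End SimpleProcess.

Section Solution.
Variables (sigma : R -> R) (X : R -> T -> R).
Hypotheses (csigma : continuous sigma).
Hypotheses (aX : adapted F X) (cX : continuous_paths X) (X0 : forall t w, 0 <= t -> 0 <= X t w).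
Variable (N : R).

(** A condition on finitely many values, hence adapted at the grid times. [below_set] asks the same
    of the whole path and inherits measurability as its limit. *)
Definition below n k w : bool := [forall j : 'I_k.+1, X (gridt n j) w <= N].

Definition below_set (s : R) : set T := [set w | forall u, 0 <= u <= s -> X u w <= N].

Lemma X_grid_cvg (u : R) w : 0 <= u -> X (gridt n (gridn n u)) w @[n --> \oo] --> X u w.
Proof.
move=> u0; apply: (within_cvg_seq (@cX w)).
- by rewrite /= in_itv/= andbT.
- by move=> n; rewrite /= in_itv/= andbT gridt_ge0.
- exact: gridt_gridn_cvg.
Qed.

(** A path exceeding [N] at some time does so at a nearby grid time by continuity; in the other
    direction, grid times are times. *)
Lemma below_cvg (s : R) w : 0 <= s ->
  \forall n \near \oo, below n (gridn n s) w = (w \in below_set s).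
Proof.
move=> s0; case: (boolP (w \in below_set s)) => [/set_mem H|/negP H].
  apply: nearW => n; apply/forallP => j; apply: H.
  rewrite gridt_ge0/= (le_trans _ (gridt_gridn_le n s0))//; apply: gridt_le.
  by rewrite -ltnS.
have [u [/andP[u0 us] Xu]] : exists u, 0 <= u <= s /\ N < X u w.
  apply: contrapT => /forallNP nH; apply: H; apply/mem_set => u us.
  by rewrite leNgt; apply/negP => Xu; apply: (nH u).
have /cvgr_gt := @X_grid_cvg u w u0; move=> /(_ _ Xu); apply: filterS => n Xn.
apply/negbTE/negP => /forallP bl.
have jlt : (gridn n u < (gridn n s).+1)%N by rewrite ltnS; exact: le_gridn.
by have := bl (Ordinal jlt); rewrite /= leNgt Xn.
Qed.

Lemma below_fmeas n k : fmeas F (gridt n k) (fun w => (below n k w)%:R : R).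
Proof.
apply/(fmeasP hF _ (gridt_ge0 n k)).
rewrite (_ : (fun w => _) = fun w => \prod_(j < k.+1) (X (gridt n j) w <= N)%R%:R); last first.
  apply/funext => w; rewrite -natr_prod; congr (_%:R).
  case: (boolP (below n k w)) => [/forallP H|].
    by rewrite big1// => j _; rewrite H.
  rewrite negb_forall => /existsP[j /negbTE Hj].
  by rewrite (bigD1 j)//= Hj mul0n.
apply: (@measurable_prod _ (g_sigma_algebraType (F (gridt n k)))) => j _.
have mXj : measurable_fun (setT : set (g_sigma_algebraType (F (gridt n k)))) (X (gridt n j)).
  apply/(fmeasP hF _ (gridt_ge0 n k)); apply: (@fmeas_le _ _ _ _ hF _ _ (gridt n j)).
  - exact: gridt_ge0.
  - by apply: gridt_le; rewrite -ltnS.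
  - by move=> A mA; apply: aX => //; exact: gridt_ge0.
apply: (@measurableT_comp _ _ _ _ _ _ (fun b : bool => b%:R : R)) => //.
exact: measurable_fun_ler.
Qed.

Lemma below_set_measurable (s : R) : 0 <= s -> measurable (below_set s).
Proof.
move=> s0.
have -> : below_set s = [set w | 1 <= limn (fun n => (below n (gridn n s) w)%:R : R)].
  have lE w : limn (fun n => (below n (gridn n s) w)%:R : R) = (w \in below_set s)%:R.
    apply/cvg_lim => //; apply: cvg_near_cst; have := @below_cvg s w s0.
    by apply: filterS => n ->.
  apply/seteqP; split => w /=; rewrite lE; first by move=> H; rewrite mem_set.
  by case: (boolP (w \in _)) => [/set_mem//|_]; rewrite ler10.
apply: measurable_ge.
apply: (@measurable_fun_cvg _ _ _ _ (fun n w => (below n (gridn n s) w)%:R : R)) => [n|w _].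
  exact: (fmeas_measurable hF (gridt_ge0 n _) (@below_fmeas n _)).
apply/cvg_ex; exists ((w \in below_set s)%:R); apply: cvg_near_cst; have := @below_cvg s w s0.
by apply: filterS => n ->.
Qed.

End Solution.
End Approximation.

(** * The Dynkin formula *)

Section Dynkin.
Context {R : realType} {d : measure_display} {T : measurableType d}.
Notation mu := (@lebesgue_measure R).
Variables (P : probability T R) (F : R -> set (set T)) (B : R -> T -> R).
Hypotheses (hF : is_filtration F) (hB : is_brownian_motion P F B).

Lemma mulr_frac_le (x e : R) : 0 <= x -> 0 <= e -> x * (e / (x + 1)) <= e.
Proof.
move=> x0 e0; have x1 : 0 < x + 1 by rewrite ltr_wpDl.
by rewrite mulrA ler_pdivrMr// mulrC ler_wpM2l// lerDl.
Qed.

Lemma prob_subU (A C D : set T) (x y : R) : measurable A -> measurable C -> measurable D ->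
  A `<=` C `|` D -> (P C <= x%:E)%E -> (P D <= y%:E)%E -> (P A <= (x + y)%:E)%E.
Proof.
move=> mA mC mD s Cx Dy; rewrite EFinD; apply: le_trans (leeD Cx Dy).
apply: (@le_trans _ _ (P (C `|` D))).
  by apply: le_measure => //; apply/mem_set => //; exact: measurableU.
exact: measureU2.
Qed.

Variables (b sigma : R -> R) (X : R -> T -> R).
Hypotheses (cb : continuous b) (csigma : continuous sigma).
Hypotheses (aX : adapted F X) (cX : continuous_paths X) (X0 : forall t w, 0 <= t -> 0 <= X t w).

Let mX u : 0 <= u -> measurable_fun setT (X u).
Proof. by move=> u0; apply: (fmeas_measurable hF u0) => A mA; exact: aX. Qed.

Lemma integral_oo_cc (s t : R) (f : R -> \bar R) : measurable_fun (`]s, t[ : set R) f ->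
  (\int[mu]_(x in `]s, t[) f x = \int[mu]_(x in `[s, t]) f x)%E.
Proof.
move=> mf; rewrite integral_itv_bndo_bndc//.
by rewrite integral_itv_obnd_cbnd//; apply/emeasurable_fun_itv_bndo_bndcP.
Qed.

(** The coefficient is set to 0 once a grid value of the path exceeds [N]. As the path is
    nonnegative, what remains are values of [h] on the compact [0, N]. *)
Definition stopped (h : R -> R) (N : R) n k w : R := (below X N n k w)%:R * h (X (gridt n k) w).

Lemma stopped_fmeas h N n k : continuous h -> fmeas F (gridt n k) (stopped h N n k).
Proof.
move=> ch; have k0 : 0 <= gridt n k :> R by exact: gridt_ge0.
apply: (@fmeas_op2 _ _ _ _ hF _ (fun w => (below X N n k w)%:R : R) (fun w => h (X (gridt n k) w))
  (fun u => u.1 * u.2)) => //.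
- exact: measurable_funM.
- exact: below_fmeas.
- apply: (fmeas_comp (f := h) _ (V := X (gridt n k))); first exact: continuous_measurable_fun.
  by move=> A mA; exact: aX.
Qed.

Lemma stopped_bounded h N : continuous h ->
  exists2 C, 0 <= C & forall n k w, `|stopped h N n k w| <= C.
Proof.
move=> ch; have [N0|N0] := leP 0 N.
  have /(EVT_max N0)[c cN H] : {within `[0, N], continuous (fun y => `|h y|)}.
    by apply: continuous_subspaceT => x; apply: continuous_comp; [exact: ch|exact: norm_continuous].
  exists `|h c| => // n k w; rewrite /stopped; case: (boolP (below _ _ _ _ _)) => [bl|_].
    rewrite mul1r; apply: H; rewrite in_itv/= X0 ?gridt_ge0//=.
    by have /forallP /(_ ord_max) := bl.
  by rewrite mul0r normr0.
exists 0 => // n k w; rewrite /stopped; case: (boolP (below _ _ _ _ _)) => [/forallP/(_ ord0)|_].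
  by rewrite /= leNgt (lt_le_trans N0)// X0// gridt_ge0.
by rewrite mul0r normr0.
Qed.

Lemma stopped_cvg h N u w : continuous h -> 0 <= u ->
  stopped h N n (gridn n u) w @[n --> \oo] --> (w \in below_set X N u)%:R * h (X u w).
Proof.
move=> ch u0; apply: cvgM.
  by apply: cvg_near_cst; apply: filterS (below_cvg cX N w u0) => n ->.
by apply: continuous_cvg; [exact: ch|exact: X_grid_cvg].
Qed.

Lemma below_set_le N u s : 0 <= u <= s -> below_set X N s `<=` below_set X N u.
Proof. by move=> /andP[u0 us] w H v /andP[v0 vu]; apply: H; rewrite v0 (le_trans vu). Qed.

(** The event on which a simple process approximates badly must be measurable before its probability
    can be compared with others; joint measurability of the path provides this. *)
Lemma sqr_error_measurable (phi : simple_process F) (s : R) :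
  measurable_fun setT (fun w => (\int[mu]_(u in `[0%R, s])
    ((sp_val phi u w - sigma (X u w)) ^+ 2)%:E)%E).
Proof.
pose f (p : measurableTypeR R * T) : \bar R := (((sp_val phi p.1 p.2 - sigma (X (Num.max 0 p.1) p.2)) ^+ 2) *
  \1_(`[0%R, s]) p.1)%:E.
have mf : measurable_fun [set: measurableTypeR R * T] f.
  apply/measurable_EFinP; apply: measurable_funM; last first.
    apply: (@measurableT_comp _ _ _ _ _ _ (\1_(`[0%R, s]) : measurableTypeR R -> R)) => //.
  apply: measurable_funX; apply: measurable_funB.
    apply: measurable_sum => i; apply: measurable_funM.
      apply: (@measurableT_comp _ _ _ _ _ _ (sp_coef phi i)) => //.
      have [_ + _] := hF => /(_ _ (sp_time_ge0' phi i)) sub.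
      by move=> _ A mA; rewrite setTI; apply: sub; exact: sp_coef_meas.
    apply: (@measurableT_comp _ _ _ _ _ _ (\1_(`]sp_time phi i, sp_time phi i.+1]) : measurableTypeR R -> R)) => //.
  apply: (@measurableT_comp _ _ _ _ _ _ sigma); first exact: continuous_measurable_fun.
  exact: measurable_process.
have f0 p : (0 <= f p)%E by rewrite lee_fin mulr_ge0 ?sqr_ge0// indicE.
have := @measurable_fun_fubini_tonelli_G _ _ _ _ _ mu f mf f0.
congr measurable_fun; apply/funext => w; rewrite /fubini_G.
rewrite [RHS]integral_mkcond; apply: eq_integral => u _.
rewrite patchE /f/= indicE; case: ifPn => us; last by rewrite mulr0.
rewrite mulr1; congr ((_ - sigma (X _ w)) ^+ 2)%:E; apply/max_idPr.
by move: us => /set_mem; rewrite /= in_itv => /andP[].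
Qed.

(** The Ito integral is known only as a limit of simple integrals, so one simple process close to
    the integrand is fixed. On [below_set] its grid values have a small sum of squared differences
    with the stopped coefficients, and [lenglart] turns this into closeness of the stochastic
    sums. *)
Lemma stoch_cvg N (s : R) (I : T -> R) (e eta : R) : 0 <= s ->
  is_ito_integral P F B (fun u w => sigma (X u w)) s I -> 0 < e -> 0 < eta ->
  \forall n \near \oo, (P (below_set X N s `&`
    [set w | (e <= `|stoch B n (stopped sigma N n) (gridn n s) w - I w|)%R]) <= eta%:E)%E.
Proof.
move=> s0 [mI [phi [phiH phiI]]] e0 eta0.
set A := below_set X N s.
have mA : measurable A by exact: (below_set_measurable hF aX cX).
have e30 : 0 < e / 3 by rewrite divr_gt0.
have eta5 : 0 < eta / 5 by rewrite divr_gt0.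
(* Makes the Chebyshev term x / (e / 3)^2 of [lenglart] equal to eta / 5; five contributions of that
   size add up to [eta]. *)
pose x := (e / 3) ^+ 2 * (eta / 5).
have x0 : 0 < x by rewrite mulr_gt0// exprn_gt0.
have x20 : 0 < x / 2 by rewrite divr_gt0.
have [m [m1 m2]] : exists m,
   (P [set w | (x / 2)%:E <= (\int[mu]_(u in `[0%R, s]) ((sp_val (phi m) u w - sigma (X u w)) ^+ 2)%:E)]%E
     <= (eta / 5)%:E)%E /\
   (P [set w | (e / 3)%:E <= `|sp_integral (phi m) B s w - I w|%:E]%E <= (eta / 5)%:E)%E.
  have H1 := cvge0_near_le (phiH _ x20) eta5.
  have H2 := cvge0_near_le (phiI _ e30) eta5.
  by have [m [? ?]] := filter_ex (filterI H1 H2); exists m.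
pose dd n k := sp_val (phi m) (gridt n k) : T -> R.
pose cc n := stopped sigma N n.
have md n k : fmeas F (gridt n k) (dd n k) by apply: sp_val_fmeas; [exact: hF|exact: gridt_ge0].
have mc n k : fmeas F (gridt n k) (cc n k) by exact: stopped_fmeas.
have mcd n k : fmeas F (gridt n k) (fun w => cc n k w - dd n k w).
  apply: (@fmeas_op2 _ _ _ _ hF _ (cc n k) (dd n k) (fun u => u.1 - u.2)) => //.
    exact: gridt_ge0.
  exact: measurable_funB.
have mT n k V : fmeas F (gridt n k) V -> measurable_fun [set: T] (V : T -> R).
  exact: (fmeas_measurable hF (gridt_ge0 n k)).
have mst n c K : (forall k, fmeas F (gridt n k) (c k)) -> measurable_fun [set: T] (stoch B n c K).
  by move=> mc'; apply: (mT n K); exact: (fmeas_stoch_sum hF hB _ mc').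
pose S n w := \sum_(k < gridn n s) (cc n k w - dd n k w) ^+ 2 * (n.+1%:R^-1 : R).
have mS n : measurable_fun setT (S n).
  apply: measurable_sum => k; apply: measurable_funM => //; apply: measurable_funX.
  exact: (mT n k).
pose Z w := (\int[mu]_(u in `[0%R, s]) ((sp_val (phi m) u w - sigma (X u w)) ^+ 2)%:E)%E.
have mZ : measurable [set w | ((x / 2)%:E <= Z w)%E].
  have mZ' := sqr_error_measurable (phi m) s.
  by have := emeasurable_fun_c_infty measurableT mZ' (x / 2)%:E; rewrite setTI.
(* Here the Riemann sum exceeds [x] while the integral it converges to is below x / 2; along a fixed
   path this fails for large [n]. *)
pose E n := A `&` [set w | x < S n w] `&` ~` [set w | ((x / 2)%:E <= Z w)%E].
have mE n : measurable (E n).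
  by apply: measurableI; [apply: measurableI => //; exact: measurable_gt|exact: measurableC].
have hE w : \forall n \near \oo, ~ E n w.
  have [Aw|nAw] := pselect (A w); last by apply: nearW => n [[]].
  have [Zw|nZw] := pselect ((x / 2)%:E <= Z w)%E; first by apply: nearW => n [_ /(_ Zw)].
  have [C C0 CP] := stopped_bounded N csigma.
  have [K K0 KP] := sp_val_bounded (phi m).
  have := @grid_Riemann_sum R (fun n k => (cc n k w - dd n k w) ^+ 2)
    (fun u => (sp_val (phi m) u w - sigma (X u w)) ^+ 2) s ((C + K) ^+ 2) s0.
  case.
  - move=> n k; rewrite normrX lerXn2r ?nnegrE ?addr_ge0//.
    by rewrite (le_trans (ler_normB _ _))// lerD// ?CP ?KP.
  - move=> u /andP[u0 us].
    rewrite -sqrrN opprB; apply: (@eq_cvgn _ (fun n => (cc n (gridn n u) w - dd n (gridn n u) w)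
      * (cc n (gridn n u) w - dd n (gridn n u) w))); first by move=> n; rewrite expr2.
    have H : (cc n (gridn n u) w - dd n (gridn n u) w) @[n --> \oo] --> sigma (X u w) - sp_val (phi m) u w.
      apply: cvgB; last exact: sp_val_cvg.
      have := @stopped_cvg sigma N u w csigma (ltW u0).
      rewrite mem_set ?mul1r//; apply: below_set_le Aw.
      by rewrite !ltW.
    by rewrite expr2; apply: cvgM.
  move=> ig lim.
  have ZE : Z w = (\int[mu]_(u in `]0%R, s[) ((sp_val (phi m) u w - sigma (X u w)) ^+ 2))%:E.
    rewrite EFin_Rintegral ?measurable_itv//.
    rewrite integral_oo_cc//; exact: measurable_int ig.
  have {}lim : S n w @[n --> \oo] --> fine (Z w) by rewrite ZE.
  have Zx : fine (Z w) < x.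
    move: nZw => /negP; rewrite -ltNge ZE lte_fin => /lt_trans; apply.
    by rewrite ltr_pdivrMr// ltr_pMr// ltr1n.
  have /cvgr_lt := lim; move=> /(_ _ Zx); apply: filterS => n Sn [[_ /=]].
  by rewrite ltNge (ltW Sn).
have hD w : \forall n \near \oo,
    ~ [set w | e / 3 <= `|stoch B n (dd n) (gridn n s) w - sp_integral (phi m) B s w|] w.
  have /cvgrPdist_lt := @stoch_sp_val_cvg _ _ _ _ _ _ hB (phi m) s w s0.
  by move=> /(_ _ e30); apply: filterS => n H /=; rewrite leNgt distrC H.
have mD n : measurable [set w | e / 3 <= `|stoch B n (dd n) (gridn n s) w - sp_integral (phi m) B s w|].
  apply: measurable_ge; apply: measurableT_comp => //; apply: measurable_funB; first exact: mst.
  exact: (sp_integral_measurable hF hB).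
have PD := prob_cvg0 P mD hD eta5.
near=> n.
have PA2 : (P [set w | (e / 3 <= `|stoch B n (dd n) (gridn n s) w - sp_integral (phi m) B s w|)%R] <= (eta / 5)%:E)%E by near: n.

pose A1 := A `&` [set w | (e / 3 <= `|stoch B n (fun k w => (cc n k w - dd n k w)%R) (gridn n s) w|)%R].
have mA1 : measurable A1.
  by apply: measurableI => //; apply: measurable_ge; apply: measurableT_comp => //; exact: mst.
pose A2 := [set w | e / 3 <= `|stoch B n (dd n) (gridn n s) w - sp_integral (phi m) B s w|].
have mA2 : measurable A2 by exact: mD.
pose A3 := [set w | ((e / 3)%:E <= `|sp_integral (phi m) B s w - I w|%:E)%E].
have mA3 : measurable A3.
  rewrite (_ : A3 = [set w | e / 3 <= `|sp_integral (phi m) B s w - I w|]).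
    apply: measurable_ge; apply: measurableT_comp => //; apply: measurable_funB => //.
    exact: (sp_integral_measurable hF hB).
  by apply/seteqP; split => w; rewrite /A3/= lee_fin.
have P1 : (P A1 <= (eta / 5 + (eta / 5 + eta / 5))%:E)%E.
  apply: le_trans (lenglart hF hB (mcd n) (gridn n s) mA x0 e30) _.
  rewrite EFinD; apply: leeD.
    by rewrite lee_fin /x mulrAC divff ?mul1r// expf_neq0// gt_eqF.
  apply: (@prob_subU _ (E n) [set w | ((x / 2)%:E <= Z w)%E]) => //.
  - by apply: measurableI => //; exact: (measurable_gt x (mS n)).
  - move=> w [Aw /= Sw]; have [Zw|nZw] := pselect ((x / 2)%:E <= Z w)%E; first by right.
    by left.
  - near: n; exact: prob_cvg0.
have -> : eta = (eta / 5 + (eta / 5 + eta / 5)) + (eta / 5 + eta / 5) by field.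
apply: (@prob_subU _ A1 (A2 `|` A3)) => //.
- apply: measurableI => //; apply: measurable_ge; apply: measurableT_comp => //.
  by apply: measurable_funB => //; exact: mst.
- exact: measurableU.
- move=> w [Aw /= H]; apply: contrapT => nH.
  have [n1 [n2 n3]] : ~ A1 w /\ ~ A2 w /\ ~ A3 w.
    by split; [|split] => ?; apply: nH; [left|right; left|right; right].
  have {}n1 : `|stoch B n (fun k w => (cc n k w - dd n k w)%R) (gridn n s) w| < e / 3.
    by rewrite ltNge; apply/negP => ?; apply: n1.
  have {}n2 : `|stoch B n (dd n) (gridn n s) w - sp_integral (phi m) B s w| < e / 3.
    by rewrite ltNge; apply/negP => ?; apply: n2.
  have {}n3 : `|sp_integral (phi m) B s w - I w| < e / 3.
    by rewrite ltNge; apply/negP => ?; apply: n3; rewrite /A3/= lee_fin.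
  move: H; apply/negP; rewrite -ltNge.
  have -> : stoch B n (cc n) (gridn n s) w - I w =
    stoch B n (fun k w => (cc n k w - dd n k w)%R) (gridn n s) w +
    ((stoch B n (dd n) (gridn n s) w - sp_integral (phi m) B s w) + (sp_integral (phi m) B s w - I w)).
    have -> : stoch B n (fun k w => (cc n k w - dd n k w)%R) (gridn n s) w =
       stoch B n (cc n) (gridn n s) w - stoch B n (dd n) (gridn n s) w.
      by rewrite /stoch -sumrB; apply: eq_bigr => k _; rewrite mulrBl.
    by ring.
  apply: (le_lt_trans (ler_normD _ _)); have -> : e = e / 3 + (e / 3 + e / 3) by field.
  by apply: ltrD => //; apply: (le_lt_trans (ler_normD _ _)); apply: ltrD.
- apply: (@prob_subU _ A2 A3) => //; first exact: measurableU.
Unshelve. all: by end_near. Qed.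

Definition stopped_euler N z n k w : R := euler B n (stopped b N n) (stopped sigma N n) z k w.

Lemma stopped_euler_fmeas N z n k : fmeas F (gridt n k) (stopped_euler N z n k).
Proof. by apply: (fmeas_euler hF hB) => j; exact: stopped_fmeas. Qed.

(** While the path stays in [0, N] the scheme uses the coefficients of the solution: its drift part
    is a Riemann sum of the drift integral, and [stoch_cvg] treats the noise part. Subtracting the
    equation, valid off the null set [N0], leaves these two errors. *)
Lemma euler_cvg N (s z : R) (I : T -> R) (e eta : R) : 0 <= s ->
  is_ito_integral P F B (fun u w => sigma (X u w)) s I ->
  {ae P, forall w, X s w = z + (\int[mu]_(u in `[0, s]) b (X u w)) + I w} ->
  0 < e -> 0 < eta ->
  \forall n \near \oo, (P (below_set X N s `&`
    [set w | (e <= `|stopped_euler N z n (gridn n s) w - X s w|)%R]) <= eta%:E)%E.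
Proof.
move=> s0 hI [N0 [mN0 PN0 N0P]] e0 eta0.
set A := below_set X N s.
have mA : measurable A by exact: (below_set_measurable hF aX cX).
have mI : measurable_fun setT I by case: hI.
have e20 : 0 < e / 2 by rewrite divr_gt0.
have eta20 : 0 < eta / 2 by rewrite divr_gt0.
have mT n k V : fmeas F (gridt n k) V -> measurable_fun [set: T] (V : T -> R).
  exact: (fmeas_measurable hF (gridt_ge0 n k)).
have mst n : measurable_fun [set: T] (stoch B n (stopped sigma N n) (gridn n s)).
  by apply: (mT n (gridn n s)); apply: (fmeas_stoch_sum hF hB) => k; exact: stopped_fmeas.
have meu n : measurable_fun [set: T] (stopped_euler N z n (gridn n s)).
  by apply: (mT n (gridn n s)); exact: stopped_euler_fmeas.
pose G n w := stopped_euler N z n (gridn n s) w - stoch B n (stopped sigma N n) (gridn n s) w + I w - X s w.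
have mG n : measurable_fun setT (G n).
  apply: measurable_funB; last exact: mX.
  by apply: measurable_funD => //; exact: measurable_funB.
pose E n := A `&` [set w | e / 2 <= `|G n w|] `\` N0.
have mAG n : measurable (A `&` [set w | e / 2 <= `|G n w|]).
  by apply: measurableI => //; apply: measurable_ge; exact: measurableT_comp.
have mE n : measurable (E n) by exact: measurableD.
have hE w : \forall n \near \oo, ~ E n w.
  have [Aw|nAw] := pselect (A w); last by apply: nearW => n [[]].
  have [Nw|nNw] := pselect (N0 w); first by apply: nearW => n [_].
  have Xw : X s w = z + (\int[mu]_(u in `[0, s]) b (X u w)) + I w.
    by apply: contrapT => H; apply: nNw; apply: N0P.
  have [C C0 CP] := stopped_bounded N cb.
  have := @grid_Riemann_sum R (fun n k => stopped b N n k w) (fun u => b (X u w)) s C s0 (fun n k => CP n k w).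
  case=> [u /andP[u0 us]|ig lim].
    have := @stopped_cvg b N u w cb (ltW u0).
    by rewrite mem_set ?mul1r//; apply: below_set_le Aw; rewrite !ltW.
  have IE : \int[mu]_(u in `]0, s[) b (X u w) = \int[mu]_(u in `[0, s]) b (X u w).
    by rewrite /Rintegral integral_oo_cc//; exact: measurable_int ig.
  rewrite IE in lim; move/cvgrPdist_lt: lim => /(_ _ e20).
  apply: filterS => n Hn [[_ /=] + _]; apply/negP; rewrite -ltNge.
  rewrite distrC in Hn.
  suff -> : G n w = \sum_(k < gridn n s) stopped b N n k w / n.+1%:R - \int[mu]_(u in `[0, s]) b (X u w) by [].
  rewrite /G Xw /stopped_euler /euler /stoch big_split/=; ring.
have PD := stoch_cvg N s0 hI e20 eta20.
near=> n.
have PA1 : (P (A `&` [set w | (e / 2 <= `|stoch B n (stopped sigma N n) (gridn n s) w - I w|)%R]) <= (eta / 2)%:E)%E by near: n.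

have -> : eta = eta / 2 + (eta / 2 + 0) by field.
pose A1 := A `&` [set w | (e / 2 <= `|stoch B n (stopped sigma N n) (gridn n s) w - I w|)%R].
have mA1 : measurable A1.
  by apply: measurableI => //; apply: measurable_ge; apply: measurableT_comp => //; exact: measurable_funB.
apply: (@prob_subU _ A1 (E n `|` N0)) => //.
- apply: measurableI => //; apply: measurable_ge; apply: measurableT_comp => //.
  by apply: measurable_funB => //; exact: mX.
- exact: measurableU.
- move=> w [Aw /= H]; apply: contrapT => nH.
  have n1 : `|stoch B n (stopped sigma N n) (gridn n s) w - I w| < e / 2.
    by rewrite ltNge; apply/negP => ?; apply: nH; left.
  have n2 : `|G n w| < e / 2.
    rewrite ltNge; apply/negP => ?; apply: nH; right.
    by have [|nN] := pselect (N0 w); [right|left].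
  move: H; apply/negP; rewrite -ltNge.
  have -> : stopped_euler N z n (gridn n s) w - X s w =
    (stoch B n (stopped sigma N n) (gridn n s) w - I w) + G n w by rewrite /G; ring.
  by apply: (le_lt_trans (ler_normD _ _)); rewrite [X in _ < X]splitr ltrD.
- apply: (@prob_subU _ (E n) N0) => //; first exact: measurableU.
    by near: n; exact: prob_cvg0.
  by rewrite PN0.
Unshelve. all: by end_near. Qed.

Lemma Rintegral_diff_le (G G0 : T -> R) (C e : R) (D : set T) :
  measurable_fun setT G -> measurable_fun setT G0 -> measurable D ->
  (forall w, `|G w| <= C) -> (forall w, `|G0 w| <= C) -> 0 <= e ->
  (forall w, ~ D w -> `|G w - G0 w| <= e) ->
  `|\int[P]_w G w - \int[P]_w G0 w| <= e + 2 * C * fine (P D).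
Proof.
move=> mG mG0 mD GC G0C e0 De.
have C0 : 0 <= C by apply: le_trans (G0C point).
have ig1 := bounded_integrableP P mG GC.
have ig0 := bounded_integrableP P mG0 G0C.
have GGC w : `|G w - G0 w| <= 2 * C.
  by rewrite (le_trans (ler_normB _ _))// mulrC mulr_natr mulr2n lerD.
have mGG : measurable_fun setT (fun w => `|G w - G0 w|).
  by apply: measurableT_comp => //; exact: measurable_funB.
have iGG : P.-integrable setT (EFin \o (fun w => `|G w - G0 w|)).
  by apply: (@bounded_integrableP _ _ _ P _ (2 * C)) => // w; rewrite normr_id.
have mi : measurable_fun [set: T] (\1_D : T -> R) by exact: measurable_indic.
have iI : P.-integrable setT (EFin \o (fun w => 2 * C * \1_D w)).
  apply: (@bounded_integrableP _ _ _ P _ (2 * C)) => [|w]; first exact: measurable_funM.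
  rewrite ger0_norm ?mulr_ge0 ?indicE// -[leRHS]mulr1 ler_wpM2l ?mulr_ge0//.
  by case: (_ \in _).
have iC : P.-integrable setT (EFin \o (fun _ : T => e)).
  by apply: (@bounded_integrableP _ _ _ P _ e) => // w; rewrite ger0_norm.
rewrite -RintegralB//.
apply: le_trans (le_normr_Rintegral _ _) _ => //.
  by have := integrableB measurableT ig1 ig0; apply: eq_integrable.
apply: (@le_trans _ _ (\int[P]_w (e + 2 * C * \1_D w))).
  apply: le_Rintegral => //.
    by have := integrableD measurableT iC iI; apply: eq_integrable.
  move=> w _; rewrite indicE; have [Dw|nD] := pselect (D w).
    by rewrite mem_set// mulr1 (le_trans (GGC w))// lerDr.
  by rewrite memNset// mulr0 addr0 De.
rewrite RintegralD// RintegralP_cst lerD2l.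
rewrite RintegralZl//; last first.
  by apply: (@bounded_integrableP _ _ _ P _ 1) => // w; rewrite indicE; case: (_ \in _); rewrite ?normr1 ?normr0.
by rewrite /Rintegral integral_indic// setIT.
Qed.

Lemma Rintegral_cvg_prob (G : nat -> T -> R) (G0 : T -> R) (C : R) :
  (forall n, measurable_fun setT (G n)) -> measurable_fun setT G0 ->
  (forall n w, `|G n w| <= C) -> (forall w, `|G0 w| <= C) ->
  (forall e eta : R, 0 < e -> 0 < eta -> \forall n \near \oo,
     (P [set w | (e <= `|G n w - G0 w|)%R] <= eta%:E)%E) ->
  \int[P]_w G n w @[n --> \oo] --> \int[P]_w G0 w.
Proof.
move=> mG mG0 GC G0C cv; apply/cvgrPdist_le => e e0.
have C0 : 0 <= C by apply: le_trans (G0C point).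
have e20 : 0 < e / 2 by rewrite divr_gt0.
have eta0 : 0 < e / 2 / (2 * C + 1) by rewrite divr_gt0// ltr_wpDl// mulr_ge0.
have PD := cv _ _ e20 eta0.
near=> n.
have PA : (P [set w | (e / 2 <= `|G n w - G0 w|)%R] <= (e / 2 / (2 * C + 1))%:E)%E by near: n.
set A := [set w | e / 2 <= `|G n w - G0 w|] in PA.
have mA : measurable A by apply: measurable_ge; apply: measurableT_comp => //; exact: measurable_funB.
rewrite distrC; apply: le_trans (Rintegral_diff_le (mG n) mG0 mA (GC n) G0C (ltW e20) _) _.
  by move=> w /negP; rewrite -ltNge => /ltW.
rewrite [X in _ <= X]splitr lerD2l.
have fA : P A \is a fin_num by rewrite fin_num_measure.
have {}PA : fine (P A) <= e / 2 / (2 * C + 1) by rewrite -lee_fin fineK.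
apply: le_trans (ler_wpM2l _ PA) _; first exact: mulr_ge0.
apply: mulr_frac_le; [exact: mulr_ge0|exact: ltW].
Unshelve. all: by end_near. Qed.

Section Formula.
Variables (f f1 f2 : R -> R) (Cf : R).
Hypothesis tf : test_fun f f1 f2 Cf.

Definition gen y := b y * f1 y + 2^-1 * sigma y ^+ 2 * f2 y.

Lemma gen_continuous : continuous gen.
Proof.
have [cf cf1 cf2] := test_fun_measurable tf; move=> y.
apply: cvgD; first by apply: cvgM; [exact: cb|exact: cf1].
apply: cvgM; last exact: cf2.
by apply: cvgM; [exact: cvg_cst|rewrite expr2; apply: cvgM; exact: csigma].
Qed.

(** The integrand produced by the weak error: coefficients at the solution, derivatives of [f] at
    the scheme. *)
Definition stopped_gen N z n k w : R := stopped b N n k w * f1 (stopped_euler N z n k w)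
  + 2^-1 * stopped sigma N n k w ^+ 2 * f2 (stopped_euler N z n k w).

Definition gen_on (N u : R) w : R := (w \in below_set X N u)%:R * gen (X u w).

Lemma stopped_gen_measurable N z n k : measurable_fun setT (stopped_gen N z n k).
Proof.
have [cf cf1 cf2] := test_fun_measurable tf.
have mT V : fmeas F (gridt n k) V -> measurable_fun [set: T] (V : T -> R).
  exact: (fmeas_measurable hF (gridt_ge0 n k)).
have mE : measurable_fun setT (stopped_euler N z n k) by apply: mT; exact: stopped_euler_fmeas.
have mf1 : measurable_fun setT f1 by exact: continuous_measurable_fun.
have mf2 : measurable_fun setT f2 by exact: continuous_measurable_fun.
apply: measurable_funD; apply: measurable_funM.
- by apply: mT; exact: stopped_fmeas.
- exact: measurableT_comp.
- apply: measurable_funM => //; apply: measurable_funX.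
  by apply: mT; exact: stopped_fmeas.
- exact: measurableT_comp.
Qed.

Lemma gen_on_measurable N u : 0 <= u -> measurable_fun setT (gen_on N u).
Proof.
move=> u0; apply: measurable_funM.
  have mA : measurable (below_set X N u) by exact: (below_set_measurable hF aX cX).
  have : measurable_fun [set: T] (\1_(below_set X N u) : T -> R) by exact: measurable_indic.
  by congr measurable_fun; apply/funext => w; rewrite indicE.
apply: measurableT_comp; last exact: mX.
by apply: continuous_measurable_fun; exact: gen_continuous.
Qed.

Lemma stopped_gen_bounded N z : exists2 C, 0 <= C & forall n k w, `|stopped_gen N z n k w| <= C.
Proof.
have [C C0 CP] := stopped_bounded N cb.
have [K K0 KP] := stopped_bounded N csigma.
have Cf0 : 0 <= Cf by rewrite (le_trans _ (tf_b0 tf 0)).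
exists (C * Cf + 2^-1 * K ^+ 2 * Cf) => [|n k w].
  by rewrite addr_ge0// !mulr_ge0// exprn_ge0.
apply: (le_trans (ler_normD _ _)); apply: lerD; rewrite normrM ler_pM ?(tf_b1 tf) ?(tf_b2 tf)//.
rewrite normrM normrX ger0_norm// ler_wpM2l//.
by rewrite lerXn2r ?nnegrE// KP.
Qed.

Lemma test_fun_unif (e : R) : 0 < e -> exists2 h, 0 < h & forall x y, `|x - y| <= h ->
  [/\ `|f x - f y| <= e, `|f1 x - f1 y| <= e & `|f2 x - f2 y| <= e].
Proof.
move=> e0; have [h h0 hP] := tf_uc tf e0.
have Cf0 : 0 <= Cf by rewrite (le_trans _ (tf_b0 tf 0)).
have lip (g dg : R -> R) : (forall y : R, is_derive y 1 g (dg y)) -> (forall y, `|dg y| <= Cf) ->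
    forall x y, `|x - y| <= e / (Cf + 1) -> `|g x - g y| <= e.
  move=> dgP dgb x y xy.
  have H := @mvt_bound R (fun t => g (y + t)) (fun t => dg (y + t)) Cf (x - y).
  have : forall u : R, is_derive u 1 (fun t => g (y + t)) (dg (y + u)).
    move=> u; have := @is_derive1_comp R g (fun t => y + t) u (dg (y + u)) 1 (dgP _).
    rewrite mulr1; apply; have := is_deriveD (is_derive_cst y u (1 : R)) (is_derive_id u (1 : R)).
    by rewrite add0r.
  move=> /H /(_ (fun u _ => dgb (y + u))); rewrite addr0 (addrC y (x - y)) subrK => /le_trans; apply.
  apply: (le_trans (ler_wpM2l Cf0 xy)); exact: mulr_frac_le (ltW e0).
exists (Num.min h (e / (Cf + 1))) => [|x y].
  by rewrite lt_min h0 divr_gt0// ltr_wpDl.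
rewrite le_min => /andP[xy1 xy2]; split; last exact: hP.
  by apply: (lip _ _ (tf_d1 tf)) => //; exact: tf_b1 tf.
by apply: (lip _ _ (tf_d2 tf)) => //; exact: tf_b2 tf.
Qed.

(** Once the path has exceeded [N] both sides are eventually 0. This gives convergence on the whole
    space although the scheme follows the solution on [below_set] only. *)
Lemma stopped_gen_cvg N (u z : R) (I : T -> R) (e eta : R) : 0 <= u ->
  is_ito_integral P F B (fun u w => sigma (X u w)) u I ->
  {ae P, forall w, X u w = z + (\int[mu]_(v in `[0, u]) b (X v w)) + I w} ->
  0 < e -> 0 < eta ->
  \forall n \near \oo, (P [set w | (e <= `|stopped_gen N z n (gridn n u) w - gen_on N u w|)%R]
     <= eta%:E)%E.
Proof.
move=> u0 hI hX e0 eta0.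
set A := below_set X N u.
have mA : measurable A by exact: (below_set_measurable hF aX cX).
have [C C0 CP] := stopped_bounded N cb.
have [K K0 KP] := stopped_bounded N csigma.
have CK1 : 0 < C + 2^-1 * K ^+ 2 + 1 by rewrite ltr_wpDl// addr_ge0// mulr_ge0// exprn_ge0.
have e20 : 0 < e / 2 by rewrite divr_gt0.
have [|h h0 hP] := @test_fun_unif (e / 2 / (C + 2^-1 * K ^+ 2 + 1)); first by rewrite divr_gt0.
have eta20 : 0 < eta / 2 by rewrite divr_gt0.
have eta40 : 0 < eta / 4 by rewrite divr_gt0.
have PD := euler_cvg N u0 hI hX h0 eta20.
have [cf cf1 cf2] := test_fun_measurable tf.
pose G n w := stopped b N n (gridn n u) w * f1 (X u w) + 2^-1 * stopped sigma N n (gridn n u) w ^+ 2 * f2 (X u w).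
have mst g n : continuous g -> measurable_fun setT (stopped g N n (gridn n u)).
  move=> cg; apply: (fmeas_measurable hF (gridt_ge0 n (gridn n u))); exact: stopped_fmeas.
have mG n : measurable_fun setT (G n).
  apply: measurable_funD; apply: measurable_funM.
  - exact: mst.
  - by apply: measurableT_comp; [exact: continuous_measurable_fun|exact: mX].
  - by apply: measurable_funM => //; apply: measurable_funX; exact: mst.
  - by apply: measurableT_comp; [exact: continuous_measurable_fun|exact: mX].
pose E1 n := [set w | e / 2 <= `|G n w - gen_on N u w|].
have mE1 n : measurable (E1 n).
  apply: measurable_ge; apply: measurableT_comp => //; apply: measurable_funB => //.
  exact: gen_on_measurable.
pose E2 n := ~` A `&` [set w | 1 <= (below X N n (gridn n u) w)%:R :> R].
have mE2 n : measurable (E2 n).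
  apply: measurableI; first exact: measurableC.
  apply: measurable_ge; apply: (fmeas_measurable hF (gridt_ge0 n (gridn n u))).
  exact: below_fmeas.
have hE1 w : \forall n \near \oo, ~ E1 n w.
  have H : G n w @[n --> \oo] --> gen_on N u w.
    have -> : gen_on N u w = (w \in A)%:R * b (X u w) * f1 (X u w) +
        2^-1 * (((w \in A)%:R * sigma (X u w)) * ((w \in A)%:R * sigma (X u w))) * f2 (X u w).
      by rewrite /gen_on /gen -/A; case: (w \in A); rewrite ?mul1r ?mul0r ?mulr0 ?mul0r ?addr0// expr2.
    apply: cvgD; first by apply: cvgM; [exact: stopped_cvg|exact: cvg_cst].
    apply: cvgM; last exact: cvg_cst.
    apply: cvgM; first exact: cvg_cst.
    by apply: cvgM; exact: stopped_cvg.
  move/cvgrPdist_lt: H => /(_ _ e20); apply: filterS => n H.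
  by rewrite /E1/= leNgt distrC H.
have hE2 w : \forall n \near \oo, ~ E2 n w.
  have := @below_cvg _ _ _ _ cX N u w u0.
  by apply: filterS => n bE [nA /=]; rewrite bE memNset// ler10.
have PE1 := prob_cvg0 P mE1 hE1 eta40.
have PE2 := prob_cvg0 P mE2 hE2 eta40.
near=> n.
pose A1 := A `&` [set w | (h <= `|stopped_euler N z n (gridn n u) w - X u w|)%R].
have mA1 : measurable A1.
  apply: measurableI => //; apply: measurable_ge; apply: measurableT_comp => //.
  apply: measurable_funB; last exact: mX.
  by apply: (fmeas_measurable hF (gridt_ge0 n (gridn n u))); exact: stopped_euler_fmeas.
have PA1 : (P (A `&` [set w | (h <= `|stopped_euler N z n (gridn n u) w - X u w|)%R]) <= (eta / 2)%:E)%E.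
  by near: n.
have PE1n : (P (E1 n) <= (eta / 4)%:E)%E by near: n.
have PE2n : (P (E2 n) <= (eta / 4)%:E)%E by near: n.
have -> : eta = eta / 2 + (eta / 4 + eta / 4) by field.
apply: (@prob_subU _ A1 (E1 n `|` E2 n)) => //.
- apply: measurable_ge; apply: measurableT_comp => //; apply: measurable_funB.
    exact: stopped_gen_measurable.
  exact: gen_on_measurable.
- exact: measurableU.
- move=> w /= H; apply: contrapT => nH.
  have n1 : `|G n w - gen_on N u w| < e / 2.
    by rewrite ltNge; apply/negP => ?; apply: nH; right; left.
  move: H; apply/negP; rewrite -ltNge.
  have -> : stopped_gen N z n (gridn n u) w - gen_on N u w =
    (G n w - gen_on N u w) + (stopped_gen N z n (gridn n u) w - G n w) by ring.
  apply: (le_lt_trans (ler_normD _ _)); rewrite [X in _ < X]splitr ltr_leD//.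
  have [bl|nbl] := boolP (below X N n (gridn n u) w); last first.
    rewrite /stopped_gen /G /stopped (negbTE nbl) !mul0r expr0n/= !mulr0 !mul0r subrr normr0.
    exact: ltW.
  have Aw : A w by apply: contrapT => nA; apply: nH; right; right; split => //=; rewrite bl.
  have n2 : `|stopped_euler N z n (gridn n u) w - X u w| <= h.
    by rewrite leNgt; apply/negP => /ltW ?; apply: nH; left.
  have [_ q1 q2] := hP _ _ n2.
  set q := e / 2 / _ in q1 q2.
  have q0 : 0 <= q by apply: le_trans q1.
  apply: (@le_trans _ _ (C * q + 2^-1 * K ^+ 2 * q)).
    have -> : stopped_gen N z n (gridn n u) w - G n w =
      stopped b N n (gridn n u) w * (f1 (stopped_euler N z n (gridn n u) w) - f1 (X u w)) +
      2^-1 * stopped sigma N n (gridn n u) w ^+ 2 * (f2 (stopped_euler N z n (gridn n u) w) - f2 (X u w)).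
      by rewrite /stopped_gen /G; ring.
    apply: (le_trans (ler_normD _ _)); apply: lerD; rewrite normrM ler_pM//.
    by rewrite normrM normrX ger0_norm// ler_wpM2l// lerXn2r ?nnegrE.
  rewrite -mulrDl /q; apply: mulr_frac_le; last exact: ltW.
  by rewrite addr_ge0// mulr_ge0// exprn_ge0.
- by apply: (@prob_subU _ (E1 n) (E2 n)) => //; exact: measurableU.
Unshelve. all: by end_near. Qed.

Variable CL : R.
Hypothesis genC : forall y, 0 <= y -> `|gen y| <= CL.

Let CL0 : 0 <= CL. Proof. exact: le_trans (genC (lexx 0)). Qed.

Let genX_bounded u w : 0 <= u -> `|gen (X u w)| <= CL.
Proof. by move=> u0; exact/genC/X0. Qed.

Lemma gen_on_bounded N u w : 0 <= u -> `|gen_on N u w| <= CL.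
Proof.
move=> u0; rewrite /gen_on; case: (_ \in _); rewrite ?mul1r ?mul0r ?normr0//.
exact: genX_bounded.
Qed.

Variable z : R.
Hypothesis solX : forall u, 0 <= u -> exists I : T -> R,
  is_ito_integral P F B (fun u w => sigma (X u w)) u I /\
  {ae P, forall w, X u w = z + (\int[mu]_(v in `[0, u]) b (X v w)) + I w}.

Let mf (g : R -> R) : continuous g -> forall u, 0 <= u -> measurable_fun setT (fun w => g (X u w)).
Proof.
by move=> cg u u0; apply: measurableT_comp; [exact: continuous_measurable_fun|exact: mX].
Qed.

(** The weak-error sum is a Riemann sum in time. In the limit the scheme departs from the solution
    only on paths that have exceeded [N]; there [f] is merely bounded, whence the error term. *)
Lemma dynkin_stopped N t : 0 <= t ->
  mu.-integrable `]0, t[ (EFin \o (fun u => \int[P]_w gen_on N u w)) /\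
  `|\int[P]_w f (X t w) - f z - \int[mu]_(u in `]0, t[) \int[P]_w gen_on N u w|
    <= 2 * Cf * fine (P (~` below_set X N t)).
Proof.
move=> t0; have Cf0 : 0 <= Cf by rewrite (le_trans _ (tf_b0 tf 0)).
have [cf cf1 cf2] := test_fun_measurable tf.
have [C C0 CP] := stopped_gen_bounded N z.
have := @grid_Riemann_sum R (fun n k => \int[P]_w stopped_gen N z n k w)
  (fun u => \int[P]_w gen_on N u w) t C t0.
case=> [n k|u /andP[u0 ut]|ig lim].
- by apply: normr_RintegralP; [exact: stopped_gen_measurable|exact: CP].
- have [I [hI hX]] := solX (ltW u0).
  apply: (@Rintegral_cvg_prob (fun n => stopped_gen N z n (gridn n u)) _ (C + CL)).
  + by move=> n; exact: stopped_gen_measurable.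
  + by apply: gen_on_measurable; exact: ltW.
  + by move=> n w; rewrite (le_trans (CP _ _ _))// lerDl.
  + by move=> w; rewrite (le_trans (gen_on_bounded _ _ _)) ?lerDr// ltW.
  + by move=> e eta e0 eta0; apply: (stopped_gen_cvg N _ hI hX e0 eta0); exact: ltW.
split => //.
set J := Rintegral _ _ _ in lim *; set p := fine _.
have p0 : 0 <= p by exact: fine_ge0.
apply/ler_addgt0Pr => e' e'0.
(* Counts the errors of size [e]: 1 + 2 Cf from replacing the scheme by the solution, [t] from the
   weak error, 1 from the Riemann sum. *)
pose q := 1 + 2 * Cf + t + 1.
have q0 : 0 <= q by rewrite /q !addr_ge0// mulr_ge0.
have q1 : 0 < q + 1 by rewrite ltr_wpDl.
pose e := e' / (q + 1).
have e0 : 0 < e by rewrite divr_gt0.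
apply: (@le_trans _ _ (2 * Cf * p + q * e)); last by rewrite lerD2l; apply: mulr_frac_le => //; exact: ltW.
have [h h0 hP] := test_fun_unif e0.
have [I [hI hX]] := solX t0.
have PD := euler_cvg N t0 hI hX h0 e0.
have [Cb Cb0 CbP] := stopped_bounded N cb.
have [Cs Cs0 CsP] := stopped_bounded N csigma.
have [|d0 d00 dP] := gauss_step tf _ e0 (C := Cb + Cs); first by rewrite addr_ge0.
have Nd := near_invS_lt d00.
move/cvgrPdist_le: lim => /(_ _ e0) NS.
set A := below_set X N t in PD p p0 *.
have mA : measurable A by exact: (below_set_measurable hF aX cX).
have [n [[Pn dn] Sn]] := filter_ex (filterI (filterI PD Nd) NS).
pose Y := stopped_euler N z n (gridn n t).
have mY : measurable_fun setT Y.
  by apply: (fmeas_measurable hF (gridt_ge0 n (gridn n t))); exact: stopped_euler_fmeas.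
set A1 := _ `&` _ in Pn.
have mA1 : measurable A1.
  apply: measurableI => //; apply: measurable_ge; apply: measurableT_comp => //.
  by apply: measurable_funB => //; exact: mX.
have D1 : `|\int[P]_w f (Y w) - \int[P]_w f (X t w)| <= e + 2 * Cf * fine (P (A1 `|` ~` A)).
  apply: Rintegral_diff_le => //.
  - by apply: measurableT_comp => //; exact: continuous_measurable_fun.
  - exact: mf.
  - by apply: measurableU => //; exact: measurableC.
  - by move=> w; exact: (tf_b0 tf).
  - by move=> w; exact: (tf_b0 tf).
  - exact: ltW.
  - move=> w nD; have [] // := hP (Y w) (X t w); rewrite leNgt; apply/negP => H.
    have [Aw|nA] := pselect (A w); last by apply: nD; right.
    by apply: nD; left; split => //=; exact: ltW.
have pU : fine (P (A1 `|` ~` A)) <= e + p.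
  rewrite -lee_fin fineK ?fin_num_measure//; last by apply: measurableU => //; exact: measurableC.
  apply: (@prob_subU _ A1 (~` A)) => //.
  - by apply: measurableU => //; exact: measurableC.
  - exact: measurableC.
  - by rewrite /p fineK// fin_num_measure//; exact: measurableC.
have bC k w : `|stopped b N n k w| <= Cb + Cs by rewrite (le_trans (CbP _ _ _))// lerDl.
have sC k w : `|stopped sigma N n k w| <= Cb + Cs by rewrite (le_trans (CsP _ _ _))// lerDr.
have stepP s y b0 c0 : 0 < s -> s ^+ 2 = n.+1%:R^-1 -> `|b0| <= Cb + Cs -> `|c0| <= Cb + Cs ->
    `|\int[gauss s]_x f (y + (b0 * s ^+ 2 + c0 * x)) - f y
      - s ^+ 2 * (b0 * f1 y + 2^-1 * c0 ^+ 2 * f2 y)| <= e * s ^+ 2.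
  by move=> s0 sd; apply: dP => //; rewrite sd ltW.
have D2 := euler_weak_error hF hB
  (fun k => @stopped_fmeas b N n k cb) (fun k => @stopped_fmeas sigma N n k csigma) bC sC
  z (gridn n t) tf stepP.
have D3 : e * (n.+1%:R^-1) * (gridn n t)%:R <= e * t.
  rewrite -mulrA; apply: ler_wpM2l; first exact: ltW.
  by rewrite mulrC; exact: (gridt_gridn_le n t0).
set U := Rintegral P _ _ in D1 D2; set V := \int[P]_w f (X t w) in D1 *.
set W := \sum_(k < _) _ in D2 Sn.
have -> : V - f z - J = (V - U) + ((U - f z - W) + (W - J)) by ring.
apply: (le_trans (ler_normD _ _)).
have := le_trans D2 D3; rewrite distrC in D1; rewrite distrC in Sn => D4.
have D5 : `|U - f z - W + (W - J)| <= e * t + e.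
  by apply: (le_trans (ler_normD _ _)); exact: lerD.
apply: (le_trans (lerD D1 D5)).
have : 2 * Cf * fine (P (A1 `|` ~` A)) <= 2 * Cf * (e + p).
  by apply: ler_wpM2l => //; exact: mulr_ge0.
by rewrite /q; lra.
Qed.

Lemma below_set_near t w : 0 <= t -> \forall n \near \oo, below_set X n%:R t w.
Proof.
move=> t0; have : {within `[0, t], continuous (X ^~ w)}.
  apply: continuous_subspaceW (@cX w) => u /=; rewrite !in_itv/= andbT.
  by case/andP.
move=> /(EVT_max t0)[c cI cM].
have := nbhs_infty_ger (X c w); apply: filterS => n cn u ut.
by apply: le_trans cn; apply: cM; rewrite in_itv.
Qed.

(** As [N] grows the error term vanishes, paths being bounded on [0, t]; the bound [CL] of the
    generator on [0, +oo[ provides the domination. *)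
Theorem dynkin t : 0 <= t ->
  mu.-integrable `]0, t[ (EFin \o (fun u => \int[P]_w gen (X u w))) /\
  \int[P]_w f (X t w) = f z + \int[mu]_(u in `]0, t[) \int[P]_w gen (X u w).
Proof.
move=> t0; have Cf0 : 0 <= Cf by rewrite (le_trans _ (tf_b0 tf 0)).
have := @Rintegral_dct R _ (measurableTypeR R) mu `]0, t[%classic (measurable_itv _)
  (fun n u => \int[P]_w gen_on n%:R u w) (fun u => \int[P]_w gen (X u w)) (fun=> CL).
case.
- by move=> n; have [/integrableP[/measurable_EFinP]] := dynkin_stopped n%:R t0.
- move=> u /=; rewrite in_itv/= => /andP[/ltW u0 ut].
  have := @Rintegral_dct R _ T P setT measurableT (fun n w => gen_on n%:R u w)
     (fun w => gen (X u w)) (fun=> CL).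
  case=> //.
  + by move=> n; exact: gen_on_measurable.
  + move=> w _; apply: cvg_near_cst; have := below_set_near w u0; apply: filterS => n H.
    by rewrite /gen_on mem_set// mul1r.
  + by apply: (@bounded_integrableP _ _ _ P _ CL) => // ?; rewrite ger0_norm.
  + by move=> n w _; exact: gen_on_bounded.
- by apply: (@bounded_integrable_itv _ _ _ _ _ _ CL) => // ? _; rewrite ger0_norm.
- move=> n u /=; rewrite in_itv/= => /andP[/ltW u0 ut].
  apply: normr_RintegralP; first exact: gen_on_measurable.
  by move=> w; exact: gen_on_bounded.
move=> ig lim; split => //; apply/eqP; rewrite -subr_eq0 opprD addrA -normr_eq0.
set V := \int[P]_w f (X t w); set J := Rintegral _ _ _ in lim *.
rewrite eq_le normr_ge0 andbT; apply/ler_addgt0Pr => e e0; rewrite add0r.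
have e20 : 0 < e / 2 by rewrite divr_gt0.
have eta0 : 0 < e / 2 / (2 * Cf + 1) by rewrite divr_gt0// ltr_wpDl// mulr_ge0.
have mA n : measurable (~` below_set X n%:R t).
  by apply: measurableC; exact: (below_set_measurable hF aX cX).
have PD := prob_cvg0 P mA _ eta0.
have {}PD : \forall n \near \oo, (P (~` below_set X n%:R t) <= (e / 2 / (2 * Cf + 1))%:E)%E.
  by apply: PD => w; have := below_set_near w t0; apply: filterS => n H; exact.
move/cvgrPdist_le: lim => /(_ _ e20) NS.
have [n [Pn Jn]] := filter_ex (filterI PD NS).
have [_ Dn] := dynkin_stopped n%:R t0.
set Jn' := Rintegral mu _ _ in Dn Jn.
have -> : V - f z - J = (V - f z - Jn') + (Jn' - J) by ring.
apply: (le_trans (ler_normD _ _)); rewrite [X in _ <= X]splitr lerD//; last by rewrite distrC.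
apply: (le_trans Dn).
have {}Pn : fine (P (~` below_set X n%:R t)) <= e / 2 / (2 * Cf + 1).
  by rewrite -lee_fin fineK ?fin_num_measure.
apply: le_trans (ler_wpM2l _ Pn) _; first exact: mulr_ge0.
apply: mulr_frac_le; [exact: mulr_ge0|exact: ltW].
Qed.

End Formula.
End Dynkin.

(** * Scale function and speed measure *)

Section Calculus.
Context {R : realType}.
Notation mu := (@lebesgue_measure R).

Lemma is_derive_quad (f : R -> R) (u l C : R) :
  (forall h, `|f (u + h) - f u - l * h| <= C * h ^+ 2) -> is_derive u 1 f l.
Proof.
move=> H.
have C0 : 0 <= C by have := H 1; rewrite expr1n !mulr1; apply: le_trans.
have L : h^-1 *: ((f \o shift u) (h *: 1) - f u) @[h --> 0^'] --> l.
  apply/cvgrPdist_le => e e0; near=> h.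
  have h0 : h != 0 by near: h; exact: nbhs_dnbhs_neq.
  have hs : `|h| <= e / (C + 1).
    near: h; apply: dnbhs0_le; by rewrite divr_gt0// ltr_wpDl.
  rewrite /= /GRing.scale/= mulr1 (addrC h u) distrC.
  have -> : h^-1 * (f (u + h) - f u) - l = h^-1 * (f (u + h) - f u - l * h) by field.
  rewrite normrM normfV ler_pdivrMl ?normr_gt0//; apply: (le_trans (H h)).
  rewrite -real_normK ?num_real// expr2 mulrCA ler_wpM2l//.
  apply: (le_trans (ler_wpM2l C0 hs)).
  have C1 : 0 < C + 1 by rewrite ltr_wpDl.
  by rewrite mulrA ler_pdivrMr// mulrC ler_wpM2l ?(ltW e0)// lerDl.
by split; [apply/cvg_ex; exists l; exact: L|apply/cvg_lim => //; exact: L].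
Unshelve. all: by end_near. Qed.

(** Square of the positive part, the C^1 building block for extensions to negative arguments. *)
Definition sqpos (u : R) := Num.max 0 u ^+ 2.

Lemma is_derive_sqpos (u : R) : is_derive u 1 sqpos (2 * Num.max 0 u).
Proof.
apply: (@is_derive_quad _ _ _ 1) => h; rewrite mul1r /sqpos ler_norml.
have [u0|u0] := leP 0 u; have [uh|uh] := leP 0 (u + h); rewrite ?expr0n/= ?mulr0 ?mul0r ?subr0;
  apply/andP; split; nra.
Qed.

Lemma continuous_deriv (f g : R -> R) : (forall x : R, is_derive x 1 f (g x)) -> continuous f.
Proof. by move=> fg x; apply: differentiable_continuous; apply/derivable1_diffP; have [] := fg x. Qed.

Lemma nondecreasing_deriv (f g : R -> R) (x y : R) : (forall z : R, is_derive z 1 f (g z)) -> x <= y ->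
  (forall z, x <= z <= y -> 0 <= g z) -> f x <= f y.
Proof.
move=> fg xy g0.
have cf : {within `[x, y], continuous f}.
  by apply: continuous_subspaceT; exact: continuous_deriv fg.
have [c cI H] := MVT_segment xy (fun z _ => fg z) cf.
by rewrite -subr_ge0 H mulr_ge0 ?subr_ge0// g0//.
Qed.

Lemma deriv_le (f g : R -> R) (x y C : R) : (forall z : R, is_derive z 1 f (g z)) -> x <= y ->
  (forall z, x <= z <= y -> g z <= C) -> f y - f x <= C * (y - x).
Proof.
move=> fg xy gC.
have cf : {within `[x, y], continuous f}.
  by apply: continuous_subspaceT; exact: continuous_deriv fg.
have [c cI ->] := MVT_segment xy (fun z _ => fg z) cf.
by rewrite ler_wpM2r ?subr_ge0// gC//.
Qed.

Lemma max0E (t : R) : Num.max 0 t = 2^-1 * (t + `|t|).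
Proof.
case: (leP 0 t) => H; first by rewrite ger0_norm//; field.
by rewrite ltr0_norm// subrr mulr0.
Qed.

Lemma cvg_max0 (U : Type) (F : set_system U) (FF : Filter F) (f : U -> R) (l : R) :
  f x @[x --> F] --> l -> Num.max 0 (f x) @[x --> F] --> Num.max 0 l.
Proof.
move=> fl; rewrite max0E; under eq_fun do rewrite max0E.
by apply: cvgM; [exact: cvg_cst|apply: cvgD => //; exact: cvg_norm].
Qed.

(** The base point p - 1 lies strictly inside the region where the integrands vanish, so the
    derivative formula [is_derive_primitive] holds at every real. *)
Definition primitive (p : R) (h : R -> R) (v : R) : R := \int[mu]_(u in `[p - 1, v]) h u.

Lemma continuous_integrable_itv (h : R -> R) (x y : R) : continuous h ->
  mu.-integrable `[x, y] (EFin \o h).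
Proof.
by move=> ch; apply: continuous_compact_integrable; [exact: segment_compact|exact: continuous_subspaceT].
Qed.

Lemma is_derive_primitive p (h : R -> R) (v : R) : continuous h -> (forall u, u <= p -> h u = 0) ->
  is_derive v 1 (primitive p h) (h v).
Proof.
move=> ch h0; have [pv|vp] := ltP (p - 1) v.
  have vv1 : v < v + 1 by rewrite ltrDl.
  have [] := @continuous_FTC1_closed R h (p - 1) v (v + 1) vv1 (continuous_integrable_itv _ _ ch) pv (ch v).
  by move=> d1 d2; split; [exact: d1|rewrite -derive1E].
have vp' : v < p by apply: le_lt_trans vp _; rewrite ltrBlDr ltrDl.
rewrite h0 ?ltW//; apply: (near_eq_is_derive (f := fun=> 0)).
  near=> u; have up : u < p by near: u; exact: lt_nbhsl.
  rewrite /primitive /Rintegral (eq_integral (fun=> 0%E)) ?integral0// => t /set_mem.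
  by rewrite /= in_itv/= => /andP[_ tu]; rewrite h0// (le_trans tu)// ltW.
Unshelve. all: by end_near. Qed.

(** Only [x] is confined to the compact interval. Compactness is used as a near-covering property,
    the admissible steps being filtered to the right of 0. *)
Lemma Heine (f : R -> R) (A e : R) : continuous f -> 0 < e -> exists2 h : R, 0 < h &
  forall x y, `|x| <= A -> `|x - y| <= h -> `|f x - f y| <= e.
Proof.
move=> cf e0.
have e20 : 0 < e / 2 by rewrite divr_gt0.
pose Q (h x : R) := forall y, `|x - y| <= h -> `|f x - f y| <= e.
have cov x : `[- A, A]%classic x -> \forall x' \near x & h \near (0 : R)^'+, Q h x'.
  move=> xA; have /cvgrPdist_lt/(_ _ e20) := cf x; move=> /nbhs_ballP[del /= del0 H].
  have d20 : 0 < del / 2 by rewrite divr_gt0.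
  exists (ball x (del / 2), [set h : R | h < del / 2]) => /=.
    by split; [exact: nbhsx_ballx|exact: nbhs_right_lt].
  move=> [x' h] /= [bx' hd] y xy.
  have E1 : `|f x - f x'| < e / 2.
    by apply: H; apply: le_ball bx'; rewrite ler_pdivrMr// ler_pMr// ler1n.
  have E2 : `|f x - f y| < e / 2.
    apply: H; rewrite /ball/= (splitr del).
    have -> : x - y = (x - x') + (x' - y) by ring.
    apply: (le_lt_trans (ler_normD _ _)); apply: ltr_leD; first exact: bx'.
    by rewrite (le_trans xy)// ltW.
  have -> : f x' - f y = (f x - f y) - (f x - f x') by ring.
  by rewrite (le_trans (ler_normB _ _))// (splitr e) lerD// ltW.
have H := (compact_near_coveringP _).1 (@segment_compact R (- A) A) R (0 : R)^'+ Q _ cov.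
have [h [h0 hP]] := filter_ex (filterI (nbhs_right_gt (0 : R)) (H _)).
exists h => // x y xA; apply: (hP x).
by rewrite /= in_itv/= -ler_norml.
Qed.

(** Only the derivatives vanish far out; [f] is constant on either side, with the value at the
    corresponding end of the interval. *)
Lemma test_fun_compact (f f1 f2 : R -> R) (A : R) :
  (forall y : R, is_derive y 1 f (f1 y)) -> (forall y : R, is_derive y 1 f1 (f2 y)) ->
  continuous f2 -> (forall y, A <= `|y| -> f1 y = 0) -> (forall y, A <= `|y| -> f2 y = 0) ->
  exists C, test_fun f f1 f2 C.
Proof.
move=> d1 d2 cf2 z1 z2.
have cf1 := continuous_deriv d2; have cf := continuous_deriv d1.
pose A' := Num.max A 0.
have A0 : 0 <= A' by rewrite le_max lexx orbT.
have AA : A <= A' by rewrite le_max lexx.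
have bnd (g : R -> R) : continuous g -> exists C, forall y, `|y| <= A' -> `|g y| <= C.
  move=> cg; have AA' : - A' <= A' by rewrite (le_trans _ A0)// oppr_le0.
  have /(EVT_max AA')[c cI H] : {within `[- A', A'], continuous (fun y => `|g y|)}.
    by apply: continuous_subspaceT => x; apply: continuous_comp; [exact: cg|exact: norm_continuous].
  by exists `|g c| => y yA; apply: H; rewrite in_itv/= -ler_norml.
have [C0 H0] := bnd _ cf; have [C1 H1] := bnd _ cf1; have [C2 H2] := bnd _ cf2.
have K0 : 0 <= `|C0| + `|C1| + `|C2| by rewrite !addr_ge0.
have L0 : C0 <= `|C0| + `|C1| + `|C2| by rewrite (le_trans (ler_norm _))// -addrA lerDl addr_ge0.
have L1 : C1 <= `|C0| + `|C1| + `|C2| by rewrite (le_trans (ler_norm _))// addrAC lerDr addr_ge0.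
have L2 : C2 <= `|C0| + `|C1| + `|C2| by rewrite (le_trans (ler_norm _))// lerDr addr_ge0.
have cst x y : x <= y -> (forall z, x <= z <= y -> f1 z = 0) -> f x = f y.
  move=> xy fz; apply/eqP; rewrite eq_le; apply/andP; split.
    by apply: (nondecreasing_deriv d1 xy) => z zI; rewrite fz.
  have := deriv_le d1 xy (C := 0); rewrite mul0r subr_le0; apply => z zI.
  by rewrite fz.
exists (`|C0| + `|C1| + `|C2|); split => // [y|y|y|e e0].
- have [yA|yA] := leP `|y| A'; first exact: le_trans (H0 _ yA) L0.
  have [y0|y0] := leP 0 y.
    rewrite ger0_norm// in yA; rewrite -(cst A' y).
    - by rewrite (le_trans (H0 _ _) L0)// ger0_norm.
    - exact: ltW.
    - move=> z /andP[z1' z2']; apply: z1; rewrite (le_trans AA)// (le_trans z1')//; exact: ler_norm.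
  rewrite ltr0_norm// in yA; rewrite (cst y (- A')).
  - by rewrite (le_trans (H0 _ _) L0)// normrN ger0_norm.
  - by rewrite lerNr ltW.
  - move=> z /andP[z1' z2']; apply: z1; rewrite (le_trans AA)// -normrN (le_trans _ (ler_norm _))//.
    by rewrite lerNr.
- have [yA|yA] := leP `|y| A'; first exact: le_trans (H1 _ yA) L1.
  by rewrite z1 ?normr0// (le_trans AA)// ltW.
- have [yA|yA] := leP `|y| A'; first exact: le_trans (H2 _ yA) L2.
  by rewrite z2 ?normr0// (le_trans AA)// ltW.
- have [h h0 hP] := Heine A' cf2 e0; exists h => // x y xy.
  have [xA|xA] := leP `|x| A'; first exact: hP.
  have [yA|yA] := leP `|y| A'; first by rewrite distrC; apply: hP => //; rewrite distrC.
  have H z : A' < `|z| -> f2 z = 0 by move=> zA; rewrite z2// (le_trans AA)// ltW.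
  by rewrite !H// subrr normr0 ltW.
Qed.

End Calculus.

(** [S] is the scale function and [s] its derivative; [sc_ode] says that the generator kills [S]. On
    negative arguments, never visited by the diffusion, [s] is C^1 and cut off below - 1, so that
    potentials become test functions on the whole line. [sc_bound] carries the growth behind
    integrability against the speed measure. *)
Record scale_fun (R : realType) (a b s sd S : R -> R) : Prop := ScaleFun {
  sc_s : forall y : R, is_derive y 1 s (sd y);
  sc_sd : continuous sd;
  sc_S : forall y : R, is_derive y 1 S (s y);
  sc_S0 : S 0 = 0;
  sc_cut : forall y, y <= - 1 -> s y = 0 /\ sd y = 0;
  sc_gt0 : forall y, 0 <= y -> 0 < s y;
  sc_ode : forall y, 0 <= y -> b y * s y + 2^-1 * a y * sd y = 0;
  sc_bound : exists2 C, 0 < C & forall y, 0 <= y ->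
    [/\ S y <= C * s y, S y <= C * y * s y & 1 <= C * s y] }.

Section Scale.
Context {R : realType}.
Variables (lambda m_ alpha rho : R).
Hypotheses (lambda_gt0 : 0 < lambda) (m_gt0 : 0 < m_) (alpha_gt0 : 0 < alpha) (rho_gt0 : 0 < rho).

Let b (y : R) : R := (lambda - m_ - alpha * y) * y.
Let a (y : R) : R := rho ^+ 2 * (lambda + m_ + alpha * y) * y.
Let c := lambda + m_.
Let q := alpha / c.
(** From s' / s = - 2 b / a = (2 / rho^2) (1 - 2 lambda / (c + alpha y)): the scale density is exp
    (2 y / rho^2) times 1 + q y to the power - kp. *)
Let kp := 4 * lambda / (rho ^+ 2 * alpha).
Let c_gt0 : 0 < c. Proof. exact: addr_gt0. Qed.
Let q_gt0 : 0 < q. Proof. exact: divr_gt0. Qed.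

(** Extension of 1 + q y, equal to 1 + q y + q^2 y^2 on the left of 0, so that the logarithm stays
    defined. *)
Let th (y : R) : R := 1 + q * y + q ^+ 2 * sqpos (- y).
Let thd (y : R) : R := q - q ^+ 2 * (2 * Num.max 0 (- y)).
Let ex (y : R) : R := 2 / rho ^+ 2 * y - kp * ln (th y).
Let exd (y : R) : R := 2 / rho ^+ 2 - kp * (thd y / th y).
(** A C^1 cut-off, 1 on the right of 0 and 0 on the left of - 1. *)
Let ch (y : R) : R := sqpos (1 - sqpos (- y)).
Let chd (y : R) : R := 2 * Num.max 0 (1 - sqpos (- y)) * (2 * Num.max 0 (- y)).
Let s (y : R) : R := expR (ex y) * ch y.
Let sd (y : R) : R := expR (ex y) * (exd y * ch y + chd y).

Let th_gt0 y : 0 < th y.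
Proof.
rewrite /th /sqpos; have [y0|y0] := leP 0 (- y).
  have -> : 1 + q * y + q ^+ 2 * (- y) ^+ 2 = (q * y + 2^-1) ^+ 2 + 3 / 4 by field.
  by rewrite ltr_wpDl ?sqr_ge0// divr_gt0.
rewrite expr0n mulr0 addr0 ltr_pwDl// mulr_ge0 ?(ltW q_gt0)//.
by rewrite oppr_lt0 in y0; exact: ltW.
Qed.

Let d_opp (y : R) : is_derive y 1 (fun u : R => - u) (- 1).
Proof. by have := is_deriveN (is_derive_id y (1 : R)). Qed.

Let d_sqopp (y : R) : is_derive y 1 (fun u => sqpos (- u)) (- (2 * Num.max 0 (- y))).
Proof.
have := @is_derive1_comp R sqpos -%R y _ (- 1) (is_derive_sqpos (- y)) (d_opp y).
by rewrite mulrN1.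
Qed.

Let d_lin (k y : R) : is_derive y 1 (fun u : R => k * u) k.
Proof.
have := is_deriveZ k (is_derive_id y (1 : R)).
by rewrite /GRing.scale/= mulr1.
Qed.

Let d_th (y : R) : is_derive y 1 th (thd y).
Proof.
have H1 := is_deriveD (is_derive_cst (1 : R) y 1) (d_lin q y).
have H2 := is_deriveZ (q ^+ 2) (d_sqopp y).
have := is_deriveD H1 H2.
by rewrite add0r /GRing.scale/= mulrN.
Qed.

Let d_ex (y : R) : is_derive y 1 ex (exd y).
Proof.
have H1 := @is_derive1_comp R (@ln R) th y _ _ (is_derive1_ln (th_gt0 y)) (d_th y).
have H2 := is_deriveZ kp H1.
have := is_deriveB (d_lin (2 / rho ^+ 2) y) H2.
by rewrite /exd /GRing.scale/= [_^-1 * _]mulrC.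
Qed.

Let d_ch (y : R) : is_derive y 1 ch (chd y).
Proof.
have H1 := is_deriveB (is_derive_cst (1 : R) y 1) (d_sqopp y).
have := @is_derive1_comp R sqpos _ y _ _ (is_derive_sqpos (1 - sqpos (- y))) H1.
by rewrite sub0r opprK.
Qed.

Let d_s (y : R) : is_derive y 1 s (sd y).
Proof.
have H1 := @is_derive1_comp R (@expR R) ex y _ _ (is_derive_expR (ex y)) (d_ex y).
have := is_deriveM H1 (d_ch y).
rewrite (_ : _ *: _ + _ = sd y)//.
by rewrite /sd /GRing.scale/=; ring.
Qed.

Let sd_cont : continuous sd.
Proof.
move=> y.
have cth : th u @[u --> y] --> th y by exact: (continuous_deriv d_th).
have cex : ex u @[u --> y] --> ex y by exact: (continuous_deriv d_ex).
have cch : ch u @[u --> y] --> ch y by exact: (continuous_deriv d_ch).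
have csq : sqpos (- u) @[u --> y] --> sqpos (- y) by exact: (continuous_deriv d_sqopp).
have cm : Num.max 0 (- u) @[u --> y] --> Num.max 0 (- y) by apply: cvg_max0; apply: cvgN; exact: cvg_id.
apply: cvgM.
  by apply: continuous_cvg; [exact: continuous_expR|exact: cex].
apply: cvgD.
  apply: cvgM => //; apply: cvgB; first exact: cvg_cst.
  apply: cvgM; first exact: cvg_cst.
  apply: cvgM; last by apply: cvgV => //; rewrite gt_eqF.
  apply: cvgB; first exact: cvg_cst.
  apply: cvgM; first exact: cvg_cst.
  by apply: cvgM => //; exact: cvg_cst.
apply: cvgM; last by apply: cvgM => //; exact: cvg_cst.
apply: cvgM; first exact: cvg_cst.
by apply: cvg_max0; apply: cvgB => //; exact: cvg_cst.
Qed.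

Let nonneg_vals y : 0 <= y -> [/\ th y = 1 + q * y, thd y = q, ch y = 1 & chd y = 0].
Proof.
move=> y0; have my : Num.max 0 (- y) = 0 by apply/max_idPl; rewrite oppr_le0.
rewrite /th /thd /ch /chd /sqpos my expr0n/= !mulr0 addr0 !subr0.
by split => //; rewrite (max_idPr _) ?ler01// expr1n.
Qed.

Let s_gt0 y : 0 <= y -> 0 < s y.
Proof. by move=> y0; have [_ _ e _] := nonneg_vals y0; rewrite /s e mulr1 expR_gt0. Qed.

Let sdE y : 0 <= y -> (c + alpha * y) * sd y = 2 / rho ^+ 2 * (m_ - lambda + alpha * y) * s y.
Proof.
move=> y0; have [e1 e2 e3 e4] := nonneg_vals y0.
have n1 : lambda + m_ != 0 by rewrite gt_eqF.
have n2 : alpha != 0 by rewrite gt_eqF.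
have n3 : rho != 0 by rewrite gt_eqF.
have n4 : lambda + m_ + alpha * y != 0 by rewrite gt_eqF// ltr_wpDr// mulr_ge0// ltW.
rewrite /s /sd e3 e4 addr0 !mulr1 /exd e1 e2 /kp /q /c.
have -> : alpha / (lambda + m_) / (1 + alpha / (lambda + m_) * y) = alpha / (lambda + m_ + alpha * y).
  by field; rewrite n1 n4.
by field; rewrite n2 n3 n4.
Qed.

Lemma scale_exists : exists s sd S, scale_fun a b s sd S.
Proof.
have cut y : y <= - 1 -> s y = 0 /\ sd y = 0.
  move=> y1; have y0 : 1 <= - y by rewrite lerNr.
  have my : Num.max 0 (- y) = - y by apply/max_idPr; rewrite (le_trans _ y0).
  have q1 : 1 - sqpos (- y) <= 0 by rewrite /sqpos my subr_le0 exprn_ege1.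
  have e1 : Num.max 0 (1 - sqpos (- y)) = 0 by apply/max_idPl.
  have c0 : ch y = 0 by rewrite /ch [LHS]/sqpos e1 expr0n.
  have d0 : chd y = 0 by rewrite /chd e1 mulr0 mul0r.
  by rewrite /s /sd c0 d0 !mulr0 addr0 mulr0.
have cs : continuous s := continuous_deriv d_s.
pose S y := primitive (- 1) s y - primitive (- 1) s 0.
have dS (y : R) : is_derive y 1 S (s y).
  have := is_deriveB (is_derive_primitive y cs (fun u h => (cut u h).1)) (is_derive_cst (primitive (- 1) s 0) y 1).
  by rewrite subr0.
have S0 : S 0 = 0 by rewrite /S subrr.
exists s, sd, S; split => //.
- move=> y y0; have := sdE y0; rewrite /b /a.
  have r2 : rho ^+ 2 != 0 by rewrite expf_neq0// gt_eqF.
  rewrite /c => H; have -> : 2^-1 * (rho ^+ 2 * (lambda + m_ + alpha * y) * y) * sd y =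
    2^-1 * rho ^+ 2 * y * ((lambda + m_ + alpha * y) * sd y) by ring.
  by rewrite H; field; rewrite gt_eqF.
(* Beyond [y1] one has s' >= s / rho^2. This asks for alpha y >= 3 lambda - m_; the larger value
   chosen also makes y1 > 1. *)
pose y1 := (3 * lambda + m_) / alpha + 1.
have y11 : 1 < y1 by rewrite ltrDr divr_gt0// addr_gt0// mulr_gt0.
have y10 : 0 <= y1 by rewrite (le_trans ler01)// ltW.
have cI : {within `[0, y1], continuous s} by exact: continuous_subspaceT.
have [u uI Hu] := EVT_min y10 cI.
have [v vI Hv] := EVT_max y10 cI.
have u0 : 0 <= u by move: uI; rewrite in_itv/= => /andP[].
have c0 : 0 < s u by exact: s_gt0.
have c1 : 0 < s v by apply: s_gt0; move: vI; rewrite in_itv/= => /andP[].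
have incr y : y1 <= y -> rho ^- 2 * s y <= sd y.
  move=> yy; have y0 : 0 <= y by exact: le_trans yy.
  have n4 : 0 < c + alpha * y by rewrite ltr_wpDr// mulr_ge0// ltW.
  rewrite -(ler_pM2l n4) sdE// mulrA ler_wpM2r ?(ltW (s_gt0 y0))//.
  rewrite [2 / _]mulrC mulrAC [_ * rho ^- 2]mulrC -!mulrA ler_wpM2l ?invr_ge0 ?sqr_ge0//.
  have : 3 * lambda + m_ <= alpha * y.
    have : (3 * lambda + m_) / alpha <= y by rewrite (le_trans _ yy)// lerDl.
    by rewrite ler_pdivrMr// (mulrC y).
  move: m_gt0; rewrite /c; move: (alpha * y) (lambda) (m_) => w l k; lra.
have r2 : 0 < rho ^+ 2 by rewrite exprn_gt0.
have s_incr y : y1 <= y -> s y1 <= s y.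
  move=> yy; apply: (nondecreasing_deriv d_s yy) => z /andP[z1 _].
  apply: le_trans (incr z z1); rewrite mulr_ge0 ?invr_ge0 ?ltW//.
  by apply: s_gt0; exact: le_trans z1.
have s_min y : 0 <= y -> s u <= s y.
  move=> y0; have [yy|/ltW yy] := leP y y1; first by apply: Hu; rewrite in_itv/= y0.
  by apply: le_trans (s_incr _ yy); apply: Hu; rewrite in_itv/= y10 lexx.
have S_lin y : 0 <= y <= y1 -> S y <= s v * y.
  move=> /andP[y0 yy]; have := deriv_le dS y0 (C := s v); rewrite S0 !subr0; apply.
  by move=> z /andP[z0 zy]; apply: Hv; rewrite in_itv/= z0 (le_trans zy).
(* The summands serve in turn the growth beyond [y1], where C s' >= s; the bounds of [S] on [0, y1];
   and the lower bound of [s]. The points [u] and [v] are where [s] is minimal and maximal on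
   [0, y1]. *)
pose C := rho ^+ 2 + s v / s u * y1 + (s u)^-1.
have sv0 : 0 <= s v / s u by rewrite divr_ge0// ltW.
have su0 : 0 <= (s u)^-1 by rewrite invr_ge0 ltW.
have r20 : 0 <= rho ^+ 2 by exact: ltW.
have svy0 : 0 <= s v / s u * y1 by exact: mulr_ge0.
have C0 : 0 < C by rewrite /C -addrA ltr_wpDr// addr_ge0.
have small y : 0 <= y <= y1 -> S y <= s v / s u * y * s y.
  move=> /[dup] yI /andP[y0 yy]; apply: (le_trans (S_lin _ yI)).
  have -> : s v / s u * y * s y = (s v * y) * (s y / s u) by ring.
  apply: ler_peMr; first by rewrite mulr_ge0// ltW.
  by rewrite ler_pdivlMr// mul1r s_min.
have Cv : s v / s u * y1 <= C.
  by rewrite /C addrAC lerDr addr_ge0.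
have H1 y : 0 <= y -> S y <= C * s y.
  move=> y0; have [yy|/ltW yy] := leP y y1.
    have yI : 0 <= y <= y1 by rewrite y0.
    apply: (le_trans (small _ yI)); rewrite ler_wpM2r ?(ltW (s_gt0 y0))//.
    by apply: le_trans Cv; rewrite ler_wpM2l.
  rewrite -subr_ge0; apply: (@le_trans _ _ (C * s y1 - S y1)).
    rewrite subr_ge0; have yI : 0 <= y1 <= y1 by rewrite y10 lexx.
    by apply: (le_trans (small _ yI)); rewrite ler_wpM2r// ltW// s_gt0.
  have dd (z : R) : is_derive z 1 (fun t => C * s t - S t) (C * sd z - s z).
    by have := is_deriveB (is_deriveZ C (d_s z)) (dS z).
  apply: (nondecreasing_deriv dd yy) => z /andP[z1 _]; rewrite subr_ge0.
  have sz : 0 < s z by apply: s_gt0; exact: le_trans z1.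
  apply: le_trans (ler_wpM2l (ltW C0) (incr _ z1)); rewrite mulrA -[leLHS]mul1r ler_wpM2r ?(ltW sz)//.
  by rewrite ler_pdivlMr// mul1r /C -addrA lerDl addr_ge0.
exists C => // y y0; split; first exact: H1.
- have [yy|/ltW yy] := leP y 1.
    have yI : 0 <= y <= y1 by rewrite y0 (le_trans yy)// ltW.
    apply: (le_trans (small _ yI)); rewrite ler_wpM2r ?(ltW (s_gt0 y0))// ler_wpM2r//.
    by apply: le_trans Cv; rewrite ler_peMr// ltW.
  apply: (le_trans (H1 _ y0)); rewrite ler_wpM2r ?(ltW (s_gt0 y0))//.
  by rewrite ler_peMr// ltW.
- apply: (@le_trans _ _ ((s u)^-1 * s y)).
    by rewrite mulrC ler_pdivlMr// mul1r s_min.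
  by rewrite ler_wpM2r ?(ltW (s_gt0 y0))// /C lerDr addr_ge0//.
Qed.

End Scale.

(** * Measures with a density on the positive half-line *)

Section Density.
Context {R : realType}.
Notation mu := (@lebesgue_measure R).
Notation D := (`]0, +oo[%classic : set R).

Lemma measurable_pos : measurable D. Proof. exact: measurable_itv. Qed.

Lemma measurable_posL : measurable (D : set (measurableTypeR R)). Proof. exact: measurable_itv. Qed.

Lemma posP (y : R) : D y <-> 0 < y.
Proof. by rewrite /= in_itv/= andbT. Qed.

Lemma continuous_pos_measurable (g : R -> R) : (forall y : R, 0 < y -> {for y, continuous g}) ->
  measurable_fun D g.
Proof.
move=> cg; apply: open_continuous_measurable_fun; first exact: interval_open.
by move=> y /set_mem/posP; exact: cg.
Qed.

(** On [1 / (n + 1), n + 1] the integral of [g] is a difference of two values of [F], at most 2 M;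
    monotone convergence passes to the half-line. *)
Lemma ge0_deriv_integrable (g F : R -> R) (M : R) :
  (forall y : R, 0 < y -> is_derive y 1 F (g y)) -> (forall y, 0 < y -> 0 <= g y) ->
  (forall y : R, 0 < y -> {for y, continuous g}) -> (forall y, 0 < y -> `|F y| <= M) ->
  mu.-integrable D (EFin \o g).
Proof.
move=> dF g0 cg FM; have mg := continuous_pos_measurable cg.
apply/integrableP; split; first exact/measurable_EFinP.
pose I n : set R := `[n.+1%:R^-1, n.+1%:R]%classic.
have I0 n y : I n y -> 0 < y.
  by rewrite /I/= in_itv/= => /andP[+ _]; apply: lt_le_trans; rewrite invr_gt0.
have DE : \bigcup_n I n = D.
  apply/seteqP; split => [y [n _ /I0/posP]//|y /posP y0].
  have [n [n1 n2]] := filter_ex (filterI (near_invS_lt y0) (nbhs_infty_ger y)).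
  exists n => //; rewrite /I/= in_itv/= (ltW n1)/= (le_trans n2)//.
  by rewrite ler_nat.
have ndI : nondecreasing_seq I.
  move=> m n mn; apply/subsetPset => y; rewrite /I/= !in_itv/= => /andP[y1 y2].
  rewrite (le_trans _ y1) ?lef_pV2 ?posrE ?ler_nat//= (le_trans y2)// ler_nat.
  by rewrite ltnS.
have lim : (\int[mu]_(x in I n) `|(g x)%:E| @[n --> \oo] --> \int[mu]_(x in D) `|(g x)%:E|)%E.
  rewrite -DE; apply: ge0_nondecreasing_set_cvg_integral => //.
  - by move=> n; apply: measurable_itv.
  - move=> n; apply: measurableT_comp => //; apply/measurable_EFinP.
    by apply: measurable_funS mg => // y /I0/posP.
apply: (@le_lt_trans _ _ (M + M)%:E); last by rewrite ltry.
rewrite -(cvg_lim _ lim)//; apply: lime_le; first by apply/cvg_ex; eexists; exact: lim.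
apply: nearW => n.
have -> : (\int[mu]_(x in I n) `|(g x)%:E| = \int[mu]_(x in I n) (g x)%:E)%E.
  apply: eq_integral.
  by move=> x /set_mem/I0 x0; rewrite gee0_abs// lee_fin g0.
(* For n = 0 the interval is the single point 1, to which the fundamental theorem does not apply. *)
case: n => [|n].
  rewrite /I invr1 set_itv1 integral_set1 lee_fin; have := FM 1 ltr01.
  by move=> ?; rewrite addr_ge0// (le_trans _ (FM 1 ltr01)).
have nn : (n.+2%:R^-1 : R) < n.+2%:R by rewrite (@lt_le_trans _ _ 1) ?invf_lt1 ?ltr1n ?ler1n.
have n0 : (0 : R) < n.+2%:R^-1 by rewrite invr_gt0.
have cF (y : R) : 0 < y -> F z @[z --> y] --> F y.
  by move=> y0; apply: differentiable_continuous; apply/derivable1_diffP; have [] := dF y y0.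
rewrite /I (@continuous_FTC2 _ g F)//.
- rewrite -EFinB lee_fin; apply: (le_trans (ler_norm _)); apply: (le_trans (ler_normB _ _)).
  by rewrite lerD// FM// (lt_trans n0).
- apply/continuous_in_subspaceT => y /set_mem yI; apply: cg; exact: (I0 n.+1).
- split.
  + move=> y; rewrite in_itv/= => /andP[y1 _]; have [] // := dF y.
    exact: lt_trans y1.
  + by apply: cvg_at_right_filter; exact: cF.
  + by apply: cvg_at_left_filter; apply: cF; exact: lt_trans nn.
- move=> y; rewrite in_itv/= => /andP[y1 _]; rewrite derive1E.
  by have [] := dF y (lt_trans n0 y1).
Qed.

Variable f : R -> R.
Hypotheses (f0 : forall y, 0 <= f y) (mf : measurable_fun setT f).

Let Phi (g : R -> \bar R) : \bar R := (\int[mu]_(x in D) ((f x)%:E * g x))%E.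

Lemma density_il : integral_like Phi.
Proof.
apply: (@il_comp R _ R _ (measurableTypeR R) mu D measurable_pos (fun x g => (f x)%:E * g x)%E).
  by move=> x _; apply: il_eval; rewrite lee_fin.
move=> g [g0 mg]; apply: emeasurable_funM.
  by apply/measurable_EFinP; exact: measurable_funTS.
exact: measurable_funTS.
Qed.

Definition density : {measure set R -> \bar R} := ilm density_il.

Lemma integral_density (g : R -> \bar R) : nnmeas g ->
  (\int[density]_(x in D) g x = \int[mu]_(x in D) ((f x)%:E * g x))%E.
Proof.
apply: (@il_eq _ _ R (fun g => \int[density]_(x in D) g x)%E Phi).
- exact: (@il_pushforward R _ R _ R density D measurable_pos id).
- exact: density_il.
move=> A mA; have mD : measurable (D : set R) := measurable_pos.
rewrite integral_indic//.
rewrite /density ilmE; last by apply: measurableI => //; exact: measurable_pos.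
rewrite /Phi; apply: eq_integral => x xD; congr (_ * _%:E)%E.
by rewrite !indicE in_setI xD andbT.
Qed.

Lemma integrable_density (g : R -> R) : measurable_fun setT g ->
  mu.-integrable D (EFin \o (fun x => f x * g x)) -> density.-integrable D (EFin \o g).
Proof.
move=> mg /integrableP[_ fin]; apply/integrableP; split.
  by apply/measurable_EFinP; exact: measurable_funTS.
rewrite (@integral_density (fun x => `|(g x)%:E|%E)).
  apply: le_lt_trans fin; rewrite le_eqVlt; apply/orP; left; apply/eqP; apply: eq_integral => x _ /=.
  by rewrite normrM EFinM ger0_norm.
by split => // ; apply/measurable_EFinP; exact: measurableT_comp.
Qed.

End Density.

(** * Speed measure, weights and Green function *)

Section Speed.
Context {R : realType}.
Notation mu := (@lebesgue_measure R).
Notation D := (`]0, +oo[%classic : set R).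
Variables (a b s sd S : R -> R).
Hypothesis hs : scale_fun a b s sd S.
Hypothesis ca : continuous a.
Variable k : R.
Hypotheses (k0 : 0 < k) (ak : forall y, 0 <= y -> k * (y * (1 + y)) <= a y).

Lemma speed_a_gt0 y : 0 < y -> 0 < a y.
Proof.
move=> y0; apply: lt_le_trans (ak (ltW y0)); rewrite !mulr_gt0// ltr_pwDl// ltW//.
Qed.

Lemma S_le x y : 0 <= x -> x <= y -> S x <= S y.
Proof.
move=> x0 xy; apply: (nondecreasing_deriv (sc_S hs) xy) => z /andP[xz _].
by apply/ltW/(sc_gt0 hs); exact: le_trans xz.
Qed.

Lemma S_ge0 y : 0 <= y -> 0 <= S y.
Proof. by move=> y0; rewrite -(sc_S0 hs); exact: S_le. Qed.

Lemma S_continuous : continuous S. Proof. exact: continuous_deriv (sc_S hs). Qed.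

Lemma s_continuous : continuous s. Proof. exact: continuous_deriv (sc_s hs). Qed.

Lemma S_lt x y : 0 <= x -> x < y -> S x < S y.
Proof.
move=> x0 xy.
have cS : {within `[x, y], continuous S} by apply: continuous_subspaceT; exact: S_continuous.
have [c cI H] := MVT xy (fun z _ => sc_S hs z) cS.
rewrite -subr_gt0 H mulr_gt0 ?subr_gt0//; apply: (sc_gt0 hs).
by move: cI; rewrite in_itv/= => /andP[xc _]; rewrite (le_trans x0)// ltW.
Qed.

Lemma S_gt0 y : 0 < y -> 0 < S y.
Proof. by move=> y0; rewrite -(sc_S0 hs); exact: S_lt. Qed.

Definition rS y := Num.sqrt (S y).

Lemma rS_ge0 y : 0 <= rS y. Proof. exact: sqrtr_ge0. Qed.

Lemma rS_gt0 y : 0 < y -> 0 < rS y. Proof. by move=> y0; rewrite sqrtr_gt0 S_gt0. Qed.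

Lemma rS_sqr y : 0 <= y -> rS y * rS y = S y.
Proof. by move=> y0; rewrite -expr2 sqr_sqrtr// S_ge0. Qed.

Lemma rS_le x y : 0 <= x -> x <= y -> rS x <= rS y.
Proof. by move=> x0 xy; rewrite ler_wsqrtr// S_le. Qed.

Lemma rS_continuous : continuous rS.
Proof.
by move=> y; apply: continuous_comp; [exact: S_continuous|exact: sqrt_continuous].
Qed.

(** The default 0 off the positive half-line also fixes the value of [dens] at 0. *)
Definition mb y := if 0 < y then 2 / (a y * s y) else 0.

Lemma mbE y : 0 < y -> mb y = 2 / (a y * s y). Proof. by rewrite /mb => ->. Qed.

Lemma mb_gt0 y : 0 < y -> 0 < mb y.
Proof.
move=> y0; rewrite mbE// divr_gt0// mulr_gt0 ?speed_a_gt0//.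
by apply: (sc_gt0 hs); exact: ltW.
Qed.

Lemma mb_ge0 y : 0 <= mb y.
Proof. by have [y0|y0] := ltP 0 y; [exact/ltW/mb_gt0|rewrite /mb ltNge y0]. Qed.

Lemma mb_continuous y : 0 < y -> {for y, continuous mb}.
Proof.
move=> y0; rewrite /prop_for /continuous_at.
have : 2 / (a z * s z) @[z --> y] --> 2 / (a y * s y).
  apply: cvgM; first exact: cvg_cst.
  apply: cvgV; first by rewrite gt_eqF// mulr_gt0 ?speed_a_gt0//; apply: (sc_gt0 hs); exact: ltW.
  by apply: cvgM; [exact: ca|exact: s_continuous].
rewrite mbE//; apply: cvg_trans; apply: near_eq_cvg; near=> z.
by rewrite mbE//; near: z; exact: lt_nbhsr.
Unshelve. all: by end_near. Qed.

Lemma mb_measurable : measurable_fun setT mb.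
Proof.
have -> : mb = mb \_ D.
  apply/funext => y; rewrite patchE; case: ifPn => // /negP yD.
  rewrite /mb; case: ifP => // y0; exfalso; apply: yD; apply/mem_set.
  by apply/posP.
apply/(measurable_restrictT _ measurable_pos).
exact: continuous_pos_measurable mb_continuous.
Qed.

Definition mm : {measure set R -> \bar R} := density mb_ge0 mb_measurable.

(** The right-hand sides have explicit bounded primitives, 2 atan (sqrt S) and - 1 / (1 + y). The
    first bound makes mb sqrt S integrable in spite of the singularity of [mb] at 0, the second does
    so for mb S. They follow from S <= C y s, S <= C s, 1 + S <= 2 C s and a >= k y (1 + y). *)
Let sS : exists2 C, 0 < C & forall y, 0 < y ->
  mb y * rS y <= C * (s y / (rS y * (1 + S y))) /\ mb y * S y <= C * (1 + y) ^- 2.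
Proof.
have [C C0 CP] := sc_bound hs.
exists (4 * C ^+ 2 / k + 4 * C / k) => [|y y0].
  by rewrite addr_gt0// divr_gt0// !mulr_gt0// exprn_gt0.
have y0' := ltW y0; have [H1 H2 H3] := CP y y0'.
have s0 := sc_gt0 hs y0'; have a0 := speed_a_gt0 y0; have r0 := rS_gt0 y0; have S0 := S_gt0 y0.
have ay := ak y0'; rewrite mbE//; split.
  apply: (@le_trans _ _ (4 * C ^+ 2 / k * (s y / (rS y * (1 + S y))))); last first.
    rewrite ler_wpM2r ?lerDl//; first by rewrite divr_ge0 ?mulr_ge0// ltW// ltr_pwDl// ltW.
    by rewrite divr_ge0 ?mulr_ge0// ltW.
  have -> : 4 * C ^+ 2 / k * (s y / (rS y * (1 + S y))) = (4 * C ^+ 2 * s y) / (k * (rS y * (1 + S y))).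
    by field; rewrite !gt_eqF//= ltr_pwDl// ltW.
  have kk : 0 < k * (rS y * (1 + S y)) by rewrite !mulr_gt0// ltr_pwDl// ltW.
  rewrite ler_pdivlMr// [leLHS](_ : _ = 2 * rS y * (k * (rS y * (1 + S y))) / (a y * s y)); last by ring.
  rewrite ler_pdivrMr ?mulr_gt0//.
  have -> : 2 * rS y * (k * (rS y * (1 + S y))) = 2 * k * (rS y * rS y) * (1 + S y) by ring.
  rewrite rS_sqr//.
  have E1 : S y * (1 + S y) <= (C * y * s y) * (2 * (C * s y)).
    by apply: ler_pM => //; [exact: ltW|rewrite addr_ge0// ltW|rewrite mulr_natl mulr2n lerD].
  have E2 : k * y <= a y by apply: le_trans ay; rewrite ler_wpM2l ?(ltW k0)// ler_peMr ?lerDl.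
  have E3 : 0 <= 4 * C ^+ 2 * s y * s y by rewrite !mulr_ge0 ?exprn_ge0 ?ltW.
  have E4 := ler_wpM2l E3 E2.
  have k2 : 0 <= 2 * k by rewrite mulr_ge0// ltW.
  have E5 := ler_wpM2l k2 E1.
  rewrite -mulrA; apply: (le_trans E5); apply: le_trans _ (le_trans E4 _); last by rewrite le_eqVlt; apply/orP; left; apply/eqP; ring.
  by rewrite le_eqVlt; apply/orP; left; apply/eqP; ring.
apply: (@le_trans _ _ (4 * C / k * (1 + y) ^- 2)); last first.
  by rewrite ler_wpM2r ?lerDr// ?divr_ge0 ?mulr_ge0 ?exprn_ge0 ?invr_ge0 ?exprn_ge0 ?addr_ge0 ?ltW.
have y1 : 0 < 1 + y by rewrite ltr_pwDl// ltW.
have -> : 4 * C / k * (1 + y) ^- 2 = (4 * C) / (k * (1 + y) ^+ 2).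
  by field; rewrite !gt_eqF.
rewrite ler_pdivlMr ?mulr_gt0 ?exprn_gt0// [leLHS](_ : _ = 2 * S y * (k * (1 + y) ^+ 2) / (a y * s y)); last by ring.
rewrite ler_pdivrMr ?mulr_gt0//.
have E1 : S y * (1 + y) <= 2 * (C * y * s y).
  by have := ler_wpM2r y0' H1; lra.
have kk : 0 <= 2 * (k * (1 + y)) by rewrite !mulr_ge0// ltW.
have E2 := ler_wpM2l kk E1.
have E3 : 0 <= 4 * C * s y by rewrite !mulr_ge0// ltW.
have E4 := ler_wpM2l E3 ay.
lra.
Qed.

Definition Phi y := rS y + S y.

Lemma mb_Phi_integrable : mu.-integrable D (EFin \o (fun y => mb y * Phi y)).
Proof.
have [C C0 CP] := sS.
have S1 y : 0 < y -> 0 < 1 + S y by move=> y0; rewrite ltr_pwDl// ltW// S_gt0.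
have i1 : mu.-integrable D (EFin \o (fun y => s y / (rS y * (1 + S y)))).
  apply: (@ge0_deriv_integrable _ _ (fun y => 2 * atan (rS y)) (pi + pi)) => y y0.
  - have H1 := @is_derive1_comp R Num.sqrt S y _ _ (is_derive1_sqrt (S_gt0 y0)) (sc_S hs y).
    have H2 := @is_derive1_comp R (@atan R) rS y _ _ (is_derive1_atan (rS y)) H1.
    have := is_deriveZ (2 : R) H2; rewrite (_ : _ *: _ = s y / (rS y * (1 + S y)))//.
    rewrite /GRing.scale/= expr2 (rS_sqr (ltW y0)) -/(rS y).
    by field; rewrite !gt_eqF//= ?rS_gt0// S1.
  - by rewrite divr_ge0 ?mulr_ge0 ?rS_ge0// ltW ?S1//; apply: (sc_gt0 hs); exact: ltW.
  - apply: cvgM; first exact: s_continuous.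
    apply: cvgV; first by rewrite gt_eqF// mulr_gt0 ?rS_gt0 ?S1.
    apply: cvgM; first exact: rS_continuous.
    by apply: cvgD; [exact: cvg_cst|exact: S_continuous].
  - have /andP[l u] : - (pi / 2) < atan (rS y) < pi / 2 by rewrite atan_gtNpi2 atan_ltpi2.
    have pi0 := pi_ge0 R.
    rewrite ler_norml; apply/andP; split; lra.
have i2 : mu.-integrable D (EFin \o (fun y : R => (1 + y) ^- 2)).
  apply: (@ge0_deriv_integrable _ _ (fun y => - (1 + y)^-1) 1) => y y0.
  - have y1 : 1 + y != 0 by rewrite gt_eqF// ltr_pwDl// ltW.
    have H := is_deriveD (is_derive_cst (1 : R) y (1 : R)) (is_derive_id y (1 : R)).
    have := is_deriveN (is_deriveV y1 H); rewrite add0r /GRing.scale/= mulr1.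
    by rewrite opprK.
  - by rewrite invr_ge0 exprn_ge0// addr_ge0// ltW.
  - apply: cvgV; first by rewrite gt_eqF// exprn_gt0// ltr_pwDl// ltW.
    by apply: cvgM; apply: cvgD => //; exact: cvg_cst.
  - have y1 : 1 <= 1 + y by rewrite lerDl ltW.
    by rewrite normrN ger0_norm ?invr_ge0 ?invf_le1// ?(le_trans ler01)// (lt_le_trans ltr01).
have iC : mu.-integrable D (EFin \o (fun y => C * (s y / (rS y * (1 + S y))) + C * (1 + y) ^- 2)).
  have := integrableD measurable_posL (integrableZl measurable_posL C i1) (integrableZl measurable_posL C i2).
  by apply: eq_integrable; [exact: measurable_posL|].
apply: (le_integrable measurable_posL _ _ iC).
  apply/measurable_EFinP; apply: measurable_funM; first exact: measurable_funTS mb_measurable.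
  apply: measurable_funTS; apply: continuous_measurable_fun => y.
  by apply: cvgD; [exact: rS_continuous|exact: S_continuous].
move=> y /posP y0; rewrite /= lee_fin; have [H1 H2] := CP y y0.
rewrite ger0_norm; last by rewrite mulr_ge0 ?mb_ge0// addr_ge0 ?rS_ge0// ltW// S_gt0.
by rewrite mulrDr; apply: le_trans (ler_norm _); exact: lerD.
Qed.

(** [dom] is a class the speed measure integrates; in [sub] the growth is that of sqrt S. A product
    of two members of [sub] is at most a multiple of [S], hence in [dom] ([subM]), which is how the
    pairings below become finite. *)
Definition dom (f : R -> R) := measurable_fun D f /\ exists C, forall v, 0 < v -> `|f v| <= C * Phi v.

Definition sub (f : R -> R) := measurable_fun D f /\ exists C, forall v, 0 < v -> `|f v| <= C * rS v.

Lemma mm_restrict (f : R -> R) : mm.-integrable D (EFin \o (f \_ D)) -> mm.-integrable D (EFin \o f).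
Proof.
apply: eq_integrable; first exact: measurable_pos.
by move=> x xD /=; rewrite patchE xD.
Qed.

Lemma dom_integrable f : dom f -> mm.-integrable D (EFin \o f).
Proof.
move=> [mf [C fC]]; apply: mm_restrict.
have mf' : measurable_fun setT (f \_ D) by apply/(measurable_restrictT _ measurable_pos).
apply: integrable_density => //.
have := integrableZl measurable_posL C mb_Phi_integrable.
apply: le_integrable; first exact: measurable_posL.
  apply/measurable_EFinP; apply: measurable_funM; first exact: measurable_funTS mb_measurable.
  exact: measurable_funTS.
move=> y yD; rewrite /= lee_fin patchE mem_set//.
have /posP y0 := yD.
have -> : C * (mb y * Phi y) = mb y * (C * Phi y) by ring.
rewrite (normrM (mb y) (f y)) (normrM (mb y) (C * Phi y)) (ger0_norm (mb_ge0 y)) ler_wpM2l ?mb_ge0//.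
exact: le_trans (fC y y0) (ler_norm _).
Qed.

Lemma dom_le (f g : R -> R) : measurable_fun D f -> dom g -> (forall v, 0 < v -> `|f v| <= `|g v|) -> dom f.
Proof. by move=> mf [_ [C gC]] fg; split => //; exists C => v v0; exact: le_trans (fg v v0) (gC v v0). Qed.

Lemma sub_dom f : sub f -> dom f.
Proof.
move=> [mf [C fC]]; split => //; exists `|C| => v v0; rewrite (le_trans (fC v v0))//.
rewrite /Phi mulrDr (le_trans (ler_wpM2r (rS_ge0 v) (ler_norm C)))// lerDl mulr_ge0//.
by apply: S_ge0; exact: ltW.
Qed.

Lemma subM f g : sub f -> sub g -> dom (fun v => f v * g v).
Proof.
move=> [mf [C fC]] [mg [C' gC]]; split; first exact: measurable_funM.
exists `|C * C'| => v v0; rewrite normrM.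
apply: (le_trans (ler_pM (normr_ge0 _) (normr_ge0 _) (fC v v0) (gC v v0))).
rewrite mulrACA (rS_sqr (ltW v0)).
have Sv := S_ge0 (ltW v0).
apply: (le_trans (ler_wpM2r Sv (ler_norm _))).
by rewrite /Phi mulrDr lerDr mulr_ge0// rS_ge0.
Qed.

Lemma domD f g : dom f -> dom g -> dom (fun v => f v + g v).
Proof.
move=> [mf [C fC]] [mg [C' gC]]; split; first exact: measurable_funD.
by exists (C + C') => v v0; rewrite mulrDl (le_trans (ler_normD _ _))// lerD ?fC ?gC.
Qed.

Lemma domZ c f : dom f -> dom (fun v => c * f v).
Proof.
move=> [mf [C fC]]; split; first exact: measurable_funM.
by exists (`|c| * C) => v v0; rewrite normrM -mulrA ler_wpM2l// fC.
Qed.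

Lemma domN f : dom f -> dom (fun v => - f v).
Proof.
move=> [mf [C fC]]; split; first exact: measurableT_comp.
by exists C => v v0; rewrite normrN fC.
Qed.

Lemma domB f g : dom f -> dom g -> dom (fun v => f v - g v).
Proof. by move=> df dg; apply: domD => //; exact: domN. Qed.

Lemma subD f g : sub f -> sub g -> sub (fun v => f v + g v).
Proof.
move=> [mf [C fC]] [mg [C' gC]]; split; first exact: measurable_funD.
by exists (C + C') => v v0; rewrite mulrDl (le_trans (ler_normD _ _))// lerD ?fC ?gC.
Qed.

Lemma subZ c f : sub f -> sub (fun v => c * f v).
Proof.
move=> [mf [C fC]]; split; first exact: measurable_funM.
by exists (`|c| * C) => v v0; rewrite normrM -mulrA ler_wpM2l// fC.
Qed.

Lemma subB f g : sub f -> sub g -> sub (fun v => f v - g v).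
Proof.
move=> sf sg; have := subD sf (subZ (- 1) sg).
by under eq_fun do rewrite mulN1r.
Qed.

Definition Im (f : R -> R) : R := \int[mm]_(v in D) f v.

Lemma ImD f g : dom f -> dom g -> Im (fun v => f v + g v) = Im f + Im g.
Proof.
move=> df dg; apply: RintegralD; [exact: measurable_pos|exact: dom_integrable|exact: dom_integrable].
Qed.

Lemma ImB f g : dom f -> dom g -> Im (fun v => f v - g v) = Im f - Im g.
Proof.
move=> df dg; apply: RintegralB; [exact: measurable_pos|exact: dom_integrable|exact: dom_integrable].
Qed.

Lemma ImZ c f : dom f -> Im (fun v => c * f v) = c * Im f.
Proof.
by move=> df; apply: RintegralZl; [exact: measurable_pos|exact: dom_integrable].
Qed.

Lemma eq_Im (f g : R -> R) : (forall v, 0 < v -> f v = g v) -> Im f = Im g.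
Proof. by move=> fg; apply: eq_Rintegral => v /set_mem/posP; exact: fg. Qed.

Lemma Im_ge0 (f : R -> R) : (forall v, 0 < v -> 0 <= f v) -> 0 <= Im f.
Proof. by move=> f0; apply: Rintegral_ge0 => v /posP; exact: f0. Qed.

Lemma Im_le (f g : R -> R) : dom f -> dom g -> (forall v, 0 < v -> f v <= g v) -> Im f <= Im g.
Proof.
move=> df dg fg; apply: le_Rintegral; [exact: measurable_pos|exact: dom_integrable|exact: dom_integrable|].
by move=> v /posP; exact: fg.
Qed.

Lemma normr_Im (f g : R -> R) : dom f -> dom g -> (forall v, 0 < v -> `|f v| <= g v) -> `|Im f| <= Im g.
Proof.
move=> df dg fg; rewrite ler_norml -[- Im g]mulN1r -ImZ//; apply/andP; split; apply: Im_le => //.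
- exact: domZ.
- by move=> v v0; rewrite mulN1r; have := fg v v0; rewrite ler_norml => /andP[].
- by move=> v v0; apply: le_trans (fg v v0); exact: ler_norm.
Qed.

Lemma Im_cvg (f : nat -> R -> R) (g h : R -> R) : (forall n, measurable_fun D (f n)) ->
  (forall v, 0 < v -> f n v @[n --> \oo] --> g v) -> dom h ->
  (forall n v, 0 < v -> `|f n v| <= h v) -> Im (f n) @[n --> \oo] --> Im g.
Proof.
move=> mf fg dh fh.
have [|||] := @Rintegral_dct R _ R mm D measurable_pos f g h mf.
- by move=> v /posP; exact: fg.
- exact: dom_integrable.
- by move=> n v /posP; exact: fh.
by [].
Qed.

Lemma rS_sub : sub rS.
Proof.
split; first by apply: measurable_funTS; apply: continuous_measurable_fun; exact: rS_continuous.
by exists 1 => v v0; rewrite mul1r ger0_norm// rS_ge0.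
Qed.

Definition kappa := Im (fun v => rS v * rS v).
Definition Jint := Im rS.

Lemma kappa_ge0 : 0 <= kappa.
Proof. by apply: Im_ge0 => v v0; rewrite mulr_ge0 ?rS_ge0. Qed.

Lemma Jint_ge0 : 0 <= Jint. Proof. by apply: Im_ge0 => v v0; exact: rS_ge0. Qed.

(** The Green function S (min v y), cut at 0 so that it is nonnegative and vanishes when an argument
    is negative. *)
Definition G v y := S (Num.max 0 (Num.min v y)).

Lemma GC v y : G v y = G y v. Proof. by rewrite /G minC. Qed.

Lemma G_ge0 v y : 0 <= G v y. Proof. by apply: S_ge0; rewrite le_max lexx. Qed.

Lemma G_le_S v y : 0 <= y -> G v y <= S y.
Proof. by move=> y0; apply: S_le; rewrite ?le_max ?lexx// ge_max y0 ge_min lexx orbT. Qed.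

Lemma G_neg v y : v <= 0 -> G v y = 0.
Proof. by move=> v0; rewrite /G (max_idPl _) ?(sc_S0 hs)// ge_min v0. Qed.

Lemma G_le v y y' : y <= y' -> G v y <= G v y'.
Proof.
move=> yy; apply: S_le; first by rewrite le_max lexx.
by rewrite ge_max le_max lexx/= le_max; apply/orP; right; rewrite le_min !ge_min lexx/= yy orbT.
Qed.

(** S (min v y) is at most S v and at most S y, hence at most their geometric mean. *)
Lemma G_rS v y : 0 <= v -> 0 <= y -> G v y <= rS y * rS v.
Proof.
move=> v0 y0; rewrite -sqrtrM ?S_ge0// -[leLHS]ger0_norm ?G_ge0// -sqrtr_sqr ler_wsqrtr// expr2.
by apply: ler_pM; rewrite ?G_ge0// ?G_le_S// GC G_le_S.
Qed.

Lemma GE v y : 0 <= v -> 0 <= y -> G v y = S (Num.min v y).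
Proof. by move=> v0 y0; rewrite /G (max_idPr _)// le_min v0. Qed.

Lemma G_lip v y y' : 0 <= y -> y <= y' -> 0 <= G v y' - G v y <= S y' - S y.
Proof.
move=> y0 yy; rewrite subr_ge0 G_le//=.
have [v0|v0] := leP v 0; first by rewrite !G_neg// subrr subr_ge0 S_le.
have y'0 := le_trans y0 yy.
have v0' := ltW v0; rewrite !GE//; have [vy|yv] := leP v y.
  by rewrite (min_idPl (le_trans vy yy)) subrr subr_ge0 S_le.
by rewrite lerB// S_le// ?le_min ?v0'// ge_min lexx orbT.
Qed.

Lemma G_continuous y : continuous (G y).
Proof.
move=> v; apply: (@continuous_comp _ _ _ (fun v => Num.max 0 (Num.min y v)) S); last exact: S_continuous.
have minE (p q : R) : Num.min p q = 2^-1 * (p + q - `|p - q|).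
  case: (leP p q) => H; first by rewrite ler0_norm ?subr_le0//; field.
  by rewrite gtr0_norm ?subr_gt0//; field.
apply: cvg_max0; rewrite minE; under eq_fun do rewrite minE.
apply: cvgM; first exact: cvg_cst.
apply: cvgB; first by apply: cvgD; [exact: cvg_cst|exact: cvg_id].
by apply: cvg_norm; apply: cvgB; [exact: cvg_cst|exact: cvg_id].
Qed.

Lemma G_measurable y : measurable_fun setT (G y).
Proof. by apply: continuous_measurable_fun; exact: G_continuous. Qed.

Lemma G_measurable_l y : measurable_fun setT (G ^~ y).
Proof. by have := G_measurable y; under eq_fun do rewrite GC. Qed.

Lemma G_measurable2 : measurable_fun [set: R * R] (fun p => G p.1 p.2).
Proof.
apply: (@measurableT_comp _ _ _ _ _ _ S); first by apply: continuous_measurable_fun; exact: S_continuous.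
apply: measurable_maxr => //; exact: measurable_minr.
Qed.

Lemma G_sub y : 0 <= y -> sub (G y).
Proof.
move=> y0; split; first by apply: measurable_funTS; exact: G_measurable.
by exists (rS y) => v v0; rewrite ger0_norm ?G_ge0// GC G_rS// ltW.
Qed.

End Speed.

(** * Functions determined by two-sided bounds on their increments *)

Section Sandwich.
Context {R : realType}.

Lemma le0_of_le_inv (x M : R) : (forall n, x <= M / n.+1%:R) -> x <= 0.
Proof.
move=> H; rewrite leNgt; apply/negP => x0.
have M1 : 0 < `|M| + 1 by rewrite ltr_wpDl.
have [n nP] := filter_ex (near_invS_lt (divr_gt0 x0 M1)).
suff : M / n.+1%:R < x by rewrite ltNge H.
apply: (@le_lt_trans _ _ ((`|M| + 1) / n.+1%:R)).
  by rewrite ler_wpM2r// (le_trans (ler_norm M))// lerDl.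
by rewrite mulrC -ltr_pdivlMr.
Qed.

Lemma telescope_le (f g : nat -> R) n : (forall i, `|f i.+1 - f i| <= g i) ->
  `|f n - f 0%N| <= \sum_(i < n) g i.
Proof.
move=> fg; elim: n => [|n ih]; first by rewrite subrr normr0 big_ord0.
rewrite big_ord_recr/= (_ : f n.+1 - f 0%N = (f n - f 0%N) + (f n.+1 - f n)); last by ring.
by rewrite (le_trans (ler_normD _ _))// lerD.
Qed.

(** Both functions behave like a primitive of the nonincreasing [w]. On a mesh of n + 1 cells the
    cell increments differ by at most the length times the drop of [w], and the drops telescope to r
    (w 0 - w r) / (n + 1). *)
Lemma sandwich_eq (f1 f2 w : R -> R) :
  (forall r h, 0 <= r -> 0 <= h -> h * w (r + h) <= f1 (r + h) - f1 r <= h * w r) ->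
  (forall r h, 0 <= r -> 0 <= h -> h * w (r + h) <= f2 (r + h) - f2 r <= h * w r) ->
  forall r, 0 <= r -> f1 r - f1 0 = f2 r - f2 0.
Proof.
move=> H1 H2 r r0; apply/eqP; rewrite -subr_eq0 -normr_le0.
apply: (@le0_of_le_inv _ (r * (w 0 - w r))) => n.
pose h := r / n.+1%:R.
have h0 : 0 <= h by rewrite divr_ge0.
pose d i := f1 (i%:R * h) - f2 (i%:R * h).
have := @telescope_le d (fun i => h * (w (i%:R * h) - w (i.+1%:R * h))) n.+1.
have -> : d n.+1 - d 0%N = f1 r - f1 0 - (f2 r - f2 0).
  by rewrite /d mul0r /h mulrC divfK//; ring.
have -> : \sum_(i < n.+1) h * (w (i%:R * h) - w (i.+1%:R * h)) = r * (w 0 - w r) / n.+1%:R.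
  rewrite -mulr_sumr -[in LHS](big_mkord xpredT (fun i => w (i%:R * h) - w (i.+1%:R * h))).
  have -> : \sum_(0 <= i < n.+1) (w (i%:R * h) - w (i.+1%:R * h)) = w 0 - w r.
    under eq_bigr do rewrite -opprB; rewrite sumrN telescope_sumr// opprB mul0r.
    by rewrite /h mulrC divfK.
  by rewrite /h mulrAC.
apply => i; have i0 : 0 <= i%:R * h by rewrite mulr_ge0.
have := H1 _ _ i0 h0; have := H2 _ _ i0 h0; rewrite /d -[i.+1%:R]natr1 mulrDl mul1r.
move=> /andP[u1 u2] /andP[v1 v2].
by rewrite ler_norml; apply/andP; split; lra.
Qed.

Lemma slope_derive (g w : R -> R) (t l : R) : 0 < t -> is_derive t 1 g (- l) ->
  (forall h, 0 < h -> h * w (t + h) <= g t - g (t + h) <= h * w t) ->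
  w (t + n.+1%:R^-1) @[n --> \oo] --> w t -> l = w t.
Proof.
move=> t0 dg H cw.
have L : (g t - g (t + n.+1%:R^-1)) * n.+1%:R @[n --> \oo] --> l.
  have := @is_derive_cvg_seq _ g t (- l) (fun n => n.+1%:R^-1) dg (@invS_cvg0 R) _.
  move=> /(_ (fun n => _)); have nz n : (n.+1%:R^-1 : R) != 0 by rewrite invr_eq0.
  move=> /(_ nz) /cvgN; rewrite opprK; apply: eq_cvgn => n /=.
  by rewrite invrK -mulNr opprB.
apply: (cvg_unique _ L) => //.
apply: (squeeze_cvgr _ cw); last exact: cvg_cst.
apply: nearW => n; have n0 : (0 : R) < n.+1%:R^-1 by rewrite invr_gt0.
have /andP[h1 h2] := H _ n0.
by rewrite [_ * n.+1%:R]mulrC -ler_pdivrMl// h1/= -ler_pdivlMl// h2.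
Qed.

Lemma sandwich_diff (L0 L1 L2 n0 n1 n2 e : R) : n1 <= L0 - L1 <= n0 -> n2 <= L0 - L2 <= n0 ->
  n0 - n1 <= e -> n0 - n2 <= e -> `|L2 - L1| <= e.
Proof. by move=> /andP[? ?] /andP[? ?] ? ?; rewrite ler_norml; apply/andP; split; lra. Qed.

Lemma div_exp_le (c t u : R) j : 0 <= c -> 0 < t -> t <= u -> c / u ^+ j <= c / t ^+ j.
Proof.
move=> c0 t0 tu; have u0 := lt_le_trans t0 tu.
rewrite ler_wpM2l// lef_pV2 ?posrE ?exprn_gt0//.
by rewrite lerXn2r// nnegrE; exact: ltW.
Qed.

End Sandwich.

(** * Iterated kernels *)

Section Kernel.
Context {R : realType}.
Notation mu := (@lebesgue_measure R).
Notation D := (`]0, +oo[%classic : set R).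
Variables (a b s sd S : R -> R).
Hypothesis hs : scale_fun a b s sd S.
Hypothesis ca : continuous a.
Variable k : R.
Hypotheses (k0 : 0 < k) (ak : forall y, 0 <= y -> k * (y * (1 + y)) <= a y).
Local Notation rS := (rS S).
Local Notation G := (G S).
Local Notation sub := (sub S).
Local Notation dom := (dom S).
Local Notation mm := (mm hs ca k0 ak).
Local Notation Im := (Im hs ca k0 ak).
Local Notation ImD := (ImD hs ca k0 ak).
Local Notation ImB := (ImB hs ca k0 ak).
Local Notation ImZ := (ImZ hs ca k0 ak).
Local Notation eq_Im := (eq_Im hs ca k0 ak).
Local Notation Im_ge0 := (Im_ge0 hs ca k0 ak).
Local Notation Im_le := (Im_le hs ca k0 ak).
Local Notation normr_Im := (normr_Im hs ca k0 ak).
Local Notation kappa := (kappa hs ca k0 ak).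
Local Notation Jint := (Jint hs ca k0 ak).
Local Notation subM := (subM hs).
Local Notation G_ge0 := (G_ge0 hs).
Local Notation G_rS := (G_rS hs).
Local Notation G_neg := (G_neg hs).
Local Notation G_sub := (G_sub hs).
Local Notation rS_gt0 := (rS_gt0 hs).
Local Notation rS_ge0 := (rS_ge0 S).
Lemma G_lip_abs u v v' : 0 <= v -> 0 <= v' -> `|G v u - G v' u| <= `|S v - S v'|.
Proof.
move=> v0 v'0; rewrite !(GC _ _ u); have [vv|/ltW vv] := leP v v'.
  have /andP[h1 h2] := G_lip hs u v0 vv.
  by rewrite distrC (distrC (S v)) ger0_norm// (le_trans h2)// ler_norm.
have /andP[h1 h2] := G_lip hs u v'0 vv.
by rewrite ger0_norm// (le_trans h2)// ler_norm.
Qed.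

Lemma S_lip_continuous (f : R -> R) A : (forall v v', 0 < v -> 0 < v' -> `|f v - f v'| <= A * `|S v - S v'|) ->
  forall v : R, 0 < v -> {for v, continuous f}.
Proof.
move=> H v v0; rewrite /prop_for /continuous_at; apply/cvgrPdist_le => e e0.
have e1 : 0 < e / (`|A| + 1) by rewrite divr_gt0// ltr_wpDl.
near=> v'.
have v'0 : 0 < v' by near: v'; exact: lt_nbhsr.
have SS : `|S v - S v'| <= e / (`|A| + 1).
  by near: v'; have /cvgrPdist_le := S_continuous hs (x := v); exact.
apply: (le_trans (H _ _ v0 v'0)); apply: le_trans (ler_wpM2r (normr_ge0 _) (ler_norm A)) _.
apply: le_trans (ler_wpM2l (normr_ge0 _) SS) _.
by apply: mulr_frac_le => //; exact: ltW.
Unshelve. all: by end_near. Qed.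

Lemma Im_mul_le (f g : R -> R) A B : sub f -> sub g ->
  (forall v, 0 < v -> 0 <= f v <= A * rS v) -> (forall v, 0 < v -> 0 <= g v <= B * rS v) ->
  0 <= Im (fun v => f v * g v) <= A * B * kappa.
Proof.
move=> sf sg fA gB; apply/andP; split.
  by apply: Im_ge0 => v v0; have /andP[? _] := fA v v0; have /andP[? _] := gB v v0; exact: mulr_ge0.
rewrite -ImZ; last by apply: subM; exact: (rS_sub hs).
apply: Im_le; [exact: subM|by apply: domZ; apply: subM; exact: (rS_sub hs)|].
move=> v v0; rewrite mulrACA.
by have /andP[? ?] := fA v v0; have /andP[? ?] := gB v v0; exact: ler_pM.
Qed.

Variable W : R -> R -> R -> R.
Hypothesis W_meas1 : forall t y, 0 <= t -> measurable_fun setT (fun v => W t v y).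
Hypothesis W_meas2 : forall t z, 0 <= t -> 0 <= z -> measurable_fun setT (W t z).
Hypothesis W_ge0 : forall t z y, 0 <= t -> 0 <= z -> 0 <= W t z y.
Hypothesis W_le : forall t z y, 0 <= t -> 0 <= z -> 0 <= y -> W t z y <= G z y.
Hypothesis W0 : forall z y, 0 <= z -> W 0 z y = G z y.
Hypothesis W_dec : forall t t' z y, 0 <= t -> t <= t' -> 0 <= z -> 0 <= y -> W t' z y <= W t z y.
Hypothesis W_occ : forall t r h z y, 0 <= t -> 0 <= r -> 0 <= h -> 0 <= z -> 0 <= y ->
  h * W (t + r + h) z y <=
  Im (fun v => W r z v * W t v y) - Im (fun v => W (r + h) z v * W t v y) <= h * W (t + r) z y.
Hypothesis W_rc : forall t z y, 0 <= t -> 0 <= z -> 0 <= y ->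
  W (t + n.+1%:R^-1) z y @[n --> \oo] --> W t z y.

(** Formally the kernel of P_(r + t) G^2, that is, the integral of [W u z y] over u >= r + t;
    [W_occ] is the increment form of this. *)
Let comp r t z y := Im (fun v => W r z v * W t v y).

Lemma W_rS t z y : 0 <= t -> 0 <= z -> 0 <= y -> 0 <= W t z y <= rS z * rS y.
Proof.
move=> t0 z0 y0; rewrite W_ge0//= (le_trans (W_le _ _ _))// mulrC; exact: G_rS.
Qed.

Lemma W_sub1 t y : 0 <= t -> 0 <= y -> sub (fun v => W t v y).
Proof.
move=> t0 y0; split; first exact: measurable_funTS (W_meas1 y t0).
exists (rS y) => v /ltW v0; have /andP[W1 W2] := W_rS t0 v0 y0.
by rewrite ger0_norm// mulrC.
Qed.

Lemma W_sub2 t z : 0 <= t -> 0 <= z -> sub (W t z).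
Proof.
move=> t0 z0; split; first exact: measurable_funTS (W_meas2 t0 z0).
by exists (rS z) => v /ltW v0; have /andP[W1 W2] := W_rS t0 z0 v0; rewrite ger0_norm.
Qed.

Lemma comp_bound r t z y A : 0 <= r -> 0 <= t -> 0 <= z -> 0 <= y ->
  (forall v, 0 < v -> W r z v <= A * rS v) -> 0 <= comp r t z y <= A * rS y * kappa.
Proof.
move=> r0 t0 z0 y0 H; apply: Im_mul_le; [exact: W_sub2|exact: W_sub1| |].
- by move=> v /[dup] v0 /ltW v0'; rewrite W_ge0//= H.
- by move=> v /ltW v0; rewrite mulrC; apply: W_rS.
Qed.

(** [W_occ] started from r = t = 0 bounds r W r by comp 0 0, at most kappa times the product of the
    weights. *)
Lemma W_decay r z y : 0 < r -> 0 <= z -> 0 <= y -> W r z y <= kappa * rS z * rS y / r.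
Proof.
move=> r0 z0 y0; rewrite ler_pdivlMr// mulrC.
have /andP[+ _] := @W_occ 0 0 r z y (lexx _) (lexx _) (ltW r0) z0 y0.
rewrite !add0r => /le_trans; apply.
have /andP[_ H1] : 0 <= comp 0 0 z y <= rS z * rS y * kappa.
  by apply: comp_bound => // v /ltW v0; have /andP[] := @W_rS 0 z v (lexx _) z0 v0.
have /andP[H2 _] : 0 <= comp r 0 z y <= rS z * rS y * kappa.
  by apply: comp_bound => //; [exact: ltW|move=> v /ltW v0; have /andP[] := @W_rS r z v (ltW r0) z0 v0].
rewrite -mulrA mulrC lerBlDr (le_trans H1)// lerDl; exact: H2.
Qed.

Definition Ker t z y := Im (fun v => G z v * W t v y).

Lemma Ker_comp t z y : 0 <= z -> Ker t z y = comp 0 t z y.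
Proof. by move=> z0; apply: eq_Im => v v0; rewrite W0. Qed.

(** In a further time r, [comp r t] and [comp (t + r) 0] have increments squeezed by the same W (t +
    r), and both vanish as r grows by [W_decay]; so they agree at r = 0. This is the commutation of
    P_t with G, obtained before any symmetry of [W]. *)
Lemma comp_swap t z y : 0 <= t -> 0 <= z -> 0 <= y -> comp 0 t z y = comp t 0 z y.
Proof.
move=> t0 z0 y0; apply/eqP; rewrite -subr_eq0 -normr_le0.
pose M := kappa * rS z * rS y * kappa.
have dec r t' : 0 < r -> 0 <= t' -> 0 <= comp r t' z y <= M / r.
  move=> r0 t'0; have := @comp_bound r t' z y (kappa * rS z / r) (ltW r0) t'0 z0 y0 _.
  have -> : kappa * rS z / r * rS y * kappa = M / r by rewrite /M; ring.
  apply => v /ltW v0; have := W_decay r0 z0 v0; rewrite mulrAC; apply: le_trans.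
  by rewrite le_eqVlt; apply/orP; left; apply/eqP; ring.
apply: (@le0_of_le_inv _ _ (M + M)) => n.
apply: (@le_trans _ _ ((M + M) / n.+1%:R)) => //.
pose r : R := n.+1%:R; have r0 : 0 < r by [].
have E : comp 0 t z y - comp r t z y = comp t 0 z y - comp (t + r) 0 z y.
  have := @sandwich_eq _ (fun r => - comp r t z y) (fun r => - comp (t + r) 0 z y) (fun r => W (t + r) z y) _ _ r (ltW r0).
  rewrite addr0 => H; suff : - comp r t z y - - comp 0 t z y = - comp (t + r) 0 z y - - comp t 0 z y by lra.
  apply: H => r' h r'0 h0; rewrite opprK [X in _ <= X <= _]addrC.
    by have := @W_occ t r' h z y t0 r'0 h0 z0 y0; rewrite -addrA.
  have := @W_occ 0 (t + r') h z y (lexx _) (addr_ge0 t0 r'0) h0 z0 y0.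
  by rewrite !add0r !addrA.
have /andP[a1 a2] := dec r t r0 t0.
have tr0 : 0 < t + r by rewrite ltr_wpDl.
have /andP[a3 a4] := dec (t + r) 0 tr0 (lexx _).
have M0 : 0 <= M by rewrite /M !mulr_ge0 ?kappa_ge0 ?rS_ge0.
have a5 : M / (t + r) <= M / r by rewrite ler_wpM2l// lef_pV2 ?posrE// lerDr.
rewrite mulrDl -/r; move: E a1 a2 a3 a4 a5; move: (M / r) (M / (t + r)) (comp _ _ _ _) (comp _ _ _ _) (comp r _ _ _) (comp (t + r) _ _ _) => q1 q2 q3 q4 q5 q6 *.
rewrite ler_norml; apply/andP; split; lra.
Qed.

Lemma KerE t z y : 0 <= t -> 0 <= z -> 0 <= y -> Ker t z y = Im (fun v => W t z v * G v y).
Proof.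
move=> t0 z0 y0; rewrite Ker_comp// comp_swap//.
by apply: eq_Im => v /ltW v0; rewrite W0.
Qed.

Lemma Ker_occ t h z y : 0 <= t -> 0 <= h -> 0 <= z -> 0 <= y ->
  h * W (t + h) z y <= Ker t z y - Ker (t + h) z y <= h * W t z y.
Proof.
move=> t0 h0 z0 y0; have th := addr_ge0 t0 h0.
have := @W_occ 0 t h z y (lexx _) t0 h0 z0 y0; rewrite !add0r.
by rewrite !Ker_comp// !comp_swap.
Qed.

Lemma Ker_rS t z y : 0 <= t -> 0 <= z -> 0 <= y -> 0 <= Ker t z y <= kappa * rS z * rS y.
Proof.
move=> t0 z0 y0; rewrite Ker_comp//.
have -> : kappa * rS z * rS y = rS z * rS y * kappa by ring.
by apply: comp_bound => // v /ltW v0; have /andP[] := @W_rS 0 z v (lexx _) z0 v0.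
Qed.

Lemma Im_G_lip (f : R -> R) v v' : sub f -> 0 < v -> 0 < v' ->
  `|Im (fun u => G v u * f u) - Im (fun u => G v' u * f u)| <= Im (fun u => `|f u|) * `|S v - S v'|.
Proof.
move=> sf v0 v'0.
have d1 := subM (G_sub (ltW v0)) sf; have d2 := subM (G_sub (ltW v'0)) sf.
rewrite -ImB// mulrC -ImZ; last first.
  have [mf [C fC]] := sub_dom hs sf; split; first exact: measurableT_comp.
  by exists C => w w0; rewrite normr_id fC.
apply: normr_Im; first exact: domB.
  apply: domZ; have [mf [C fC]] := sub_dom hs sf; split; first exact: measurableT_comp.
  by exists C => w w0; rewrite normr_id fC.
move=> u u0; rewrite -mulrBl normrM ler_wpM2r//.
by apply: G_lip_abs; exact: ltW.
Qed.

Lemma Ker_sub t y : 0 <= t -> 0 <= y -> sub (fun v => Ker t v y).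
Proof.
move=> t0 y0; split; last first.
  exists (kappa * rS y) => v /ltW v0; have /andP[H1 H2] := Ker_rS t0 v0 y0.
  by rewrite ger0_norm// mulrAC.
apply: continuous_pos_measurable; apply: (@S_lip_continuous _ (Im (fun u => `|W t u y|))) => v v' v0 v'0.
by apply: Im_G_lip => //; exact: W_sub1.
Qed.

Definition Nfun p r x y := Im (fun v => W p v x * Ker r v y).
Definition Lfun p r x y := Im (fun v => Ker p v x * Ker r v y).

Lemma Im_EFin (f : R -> R) : dom f -> (forall v, 0 < v -> 0 <= f v) ->
  (Im f)%:E = (\int[mu]_v (mb a s v * f v)%:E)%E.
Proof.
move=> df f0; have [mf _] := df.
rewrite EFin_Rintegral; [|exact: measurable_pos|exact: dom_integrable].
have -> : (\int[mm]_(v in D) (f v)%:E = \int[mm]_(v in D) ((f \_ D) v)%:E)%E.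
  by apply: eq_integral => v vD; rewrite patchE vD.
rewrite (@integral_density _ _ _ _ (fun v => ((f \_ D) v)%:E)); last first.
  split; last by apply/measurable_EFinP; apply/(measurable_restrictT _ measurable_pos).
  move=> v; rewrite lee_fin patchE; case: ifPn => [/set_mem/posP|//]; exact: f0.
rewrite integral_mkcond; apply: eq_integral => v _; rewrite patchE; case: ifPn => [vD|/negP vD].
  by rewrite patchE vD.
rewrite /mb; case: ifP => [v0|_]; last by rewrite mul0r.
by exfalso; apply: vD; apply/mem_set/posP.
Qed.

Lemma mb_mul_ge0 (h : R -> R) v : (forall v, 0 < v -> 0 <= h v) -> 0 <= mb a s v * h v.
Proof.
move=> h0; have [v0|v0] := ltP 0 v; first by rewrite mulr_ge0 ?h0// (mb_ge0 hs k0 ak).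
by rewrite /mb ltNge v0 mul0r.
Qed.

(** Tonelli and the symmetry of [G]; self-adjointness with respect to the speed measure enters
    here. *)
Lemma Im_G_swap (f g : R -> R) : measurable_fun setT f -> measurable_fun setT g -> sub f -> sub g ->
  (forall v, 0 < v -> 0 <= f v) -> (forall v, 0 < v -> 0 <= g v) ->
  Im (fun v => f v * Im (fun u => G v u * g u)) = Im (fun u => g u * Im (fun v => G u v * f v)).
Proof.
move=> mf mg sf sg f0 g0.
have sG (h : R -> R) : sub h -> sub (fun v => Im (fun u => G v u * h u)).
  move=> sh; have dh : dom (fun u => rS u * `|h u|).
    apply: subM; [exact: rS_sub hs|have [mh [C hC]] := sh; split; first exact: measurableT_comp].
    by exists C => w w0; rewrite normr_id hC.
  split.
    apply: continuous_pos_measurable; apply: (@S_lip_continuous _ (Im (fun u => `|h u|))) => v v' v0 v'0.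
    exact: Im_G_lip.
  exists (Im (fun u => rS u * `|h u|)) => v v0; rewrite mulrC -ImZ//; apply: normr_Im.
  - by apply: subM => //; apply: G_sub; exact: ltW.
  - exact: domZ.
  - by move=> u /ltW u0; rewrite normrM mulrA ler_wpM2r// ger0_norm ?G_ge0// [leRHS]mulrC; apply: G_rS => //; exact: ltW.
have iter (h1 h2 : R -> R) : sub h1 -> sub h2 -> (forall v, 0 < v -> 0 <= h1 v) -> (forall v, 0 < v -> 0 <= h2 v) ->
    measurable_fun setT h2 ->
    (Im (fun v => h1 v * Im (fun u => G v u * h2 u)))%:E =
    (\int[mu]_v \int[mu]_u (mb a s v * h1 v * (mb a s u * h2 u) * G v u)%:E)%E.
  move=> s1 s2 p1 p2 m2; rewrite Im_EFin; last 2 first.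
  - by apply: subM => //; exact: sG.
  - by move=> v v0; rewrite mulr_ge0 ?p1//; apply: Im_ge0 => u u0; rewrite mulr_ge0 ?p2 ?G_ge0.
  apply: eq_integral => v _; have [v0|v0] := ltP 0 v; last first.
    by rewrite /mb ltNge v0 mul0r; under eq_integral do rewrite !mul0r; rewrite integral0.
  rewrite mulrA EFinM Im_EFin; last 2 first.
  - by apply: subM => //; apply: G_sub; exact: ltW.
  - by move=> u u0; rewrite mulr_ge0 ?p2 ?G_ge0.
  have c0 : 0 <= mb a s v * h1 v by rewrite mulr_ge0 ?p1// (mb_ge0 hs k0 ak).
  rewrite -ge0_integralZl_EFin//.
  - by apply: eq_integral => u _; rewrite -EFinM; congr EFin; ring.
  - move=> u _; rewrite lee_fin; apply: (mb_mul_ge0 (h := fun u => G v u * h2 u)) => w w0.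
    by rewrite mulr_ge0 ?G_ge0 ?p2.
  - apply/measurable_EFinP; apply: measurable_funM; first exact: (mb_measurable hs ca k0 ak).
    by apply: measurable_funM => //; exact: (G_measurable hs).
apply: EFin_inj; rewrite (iter f g sf sg f0 g0 mg) (iter g f sg sf g0 f0 mf).
pose kk (p : measurableTypeR R * measurableTypeR R) : \bar R :=
  (mb a s p.1 * f p.1 * (mb a s p.2 * g p.2) * G p.1 p.2)%:E.
have mk : measurable_fun [set: measurableTypeR R * measurableTypeR R] kk.
  have mc (h : R -> R) : measurable_fun setT h -> measurable_fun setT (fun v : R => mb a s v * h v).
    by move=> mh; apply: measurable_funM => //; exact: (mb_measurable hs ca k0 ak).
  have M : measurable_fun [set: R * R] (fun p : R * R => mb a s p.1 * f p.1 * (mb a s p.2 * g p.2) * G p.1 p.2).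
    apply: measurable_funM; last exact: (G_measurable2 hs).
    apply: measurable_funM.
      by apply: (measurableT_comp (mc f mf)).
    by apply: (measurableT_comp (mc g mg)).
  by apply/measurable_EFinP; exact: M.
have kk0 p : (0 <= kk p)%E.
  by rewrite lee_fin; apply: mulr_ge0 (G_ge0 _ _); apply: mulr_ge0; exact: mb_mul_ge0.
have := @fubini_tonelli _ _ _ _ R mu mu kk mk kk0; rewrite /kk/= => ->.
by apply: eq_integral => u _; apply: eq_integral => v _; rewrite GC; congr EFin; ring.
Qed.

Lemma Nfun_swap p r x y : 0 <= p -> 0 <= r -> 0 <= x -> 0 <= y -> Nfun p r x y = Nfun r p y x.
Proof.
move=> p0 r0 x0 y0; apply: Im_G_swap.
- exact: W_meas1.
- exact: W_meas1.
- exact: W_sub1.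
- exact: W_sub1.
- by move=> v /ltW v0; exact: W_ge0.
- by move=> v /ltW v0; exact: W_ge0.
Qed.

Lemma LfunC p r x y : Lfun p r x y = Lfun r p y x.
Proof. by apply: eq_Im => v _; rewrite mulrC. Qed.

Lemma Lfun_occ p r h x y : 0 <= p -> 0 <= r -> 0 <= h -> 0 <= x -> 0 <= y ->
  h * Nfun p (r + h) x y <= Lfun p r x y - Lfun p (r + h) x y <= h * Nfun p r x y.
Proof.
move=> p0 r0 h0 x0 y0; have rh := addr_ge0 r0 h0.
have sK := Ker_sub p0 x0; have s1 := Ker_sub r0 y0; have s2 := Ker_sub rh y0.
have w1 := W_sub1 r0 y0; have w2 := W_sub1 rh y0.
rewrite Nfun_swap// (Nfun_swap p0 r0 x0 y0) /Nfun -!ImZ; try exact: subM.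
rewrite /Lfun -ImB; try exact: subM.
have dB : dom (fun v => Ker p v x * Ker r v y - Ker p v x * Ker (r + h) v y).
  by apply: domB; exact: subM.
apply/andP; split; apply: Im_le => //; try (by apply: domZ; exact: subM).
- move=> v /ltW v0; rewrite -mulrBr mulrA mulrC; have /andP[h1 _] := Ker_occ r0 h0 v0 y0.
  by rewrite ler_wpM2l//; have /andP[] := Ker_rS p0 v0 x0.
- move=> v /ltW v0; rewrite -mulrBr mulrA [leRHS]mulrC; have /andP[_ h1] := Ker_occ r0 h0 v0 y0.
  by rewrite ler_wpM2l//; have /andP[] := Ker_rS p0 v0 x0.
Qed.

Lemma Lfun_occ1 p r h x y : 0 <= p -> 0 <= r -> 0 <= h -> 0 <= x -> 0 <= y ->
  h * Nfun (p + h) r x y <= Lfun p r x y - Lfun (p + h) r x y <= h * Nfun p r x y.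
Proof.
move=> p0 r0 h0 x0 y0; have ph := addr_ge0 p0 h0.
by rewrite !(LfunC _ r) (Nfun_swap ph)// (Nfun_swap p0)//; exact: Lfun_occ.
Qed.

Lemma Nfun_occ p r h x y : 0 <= p -> 0 <= r -> 0 <= h -> 0 <= x -> 0 <= y ->
  h * Im (fun v => W p v x * W (r + h) v y) <= Nfun p r x y - Nfun p (r + h) x y
  <= h * Im (fun v => W p v x * W r v y).
Proof.
move=> p0 r0 h0 x0 y0; have rh := addr_ge0 r0 h0.
have sK := W_sub1 p0 x0; have s1 := Ker_sub r0 y0; have s2 := Ker_sub rh y0.
have w1 := W_sub1 r0 y0; have w2 := W_sub1 rh y0.
rewrite /Nfun -!ImZ; try exact: subM.
rewrite -ImB; try exact: subM.
have dB : dom (fun v => W p v x * Ker r v y - W p v x * Ker (r + h) v y).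
  by apply: domB; exact: subM.
apply/andP; split; apply: Im_le => //; try (by apply: domZ; exact: subM).
- move=> v /ltW v0; rewrite -mulrBr mulrCA; have /andP[h1 _] := Ker_occ r0 h0 v0 y0.
  by rewrite ler_wpM2l// W_ge0.
- move=> v /ltW v0; rewrite -mulrBr mulrCA; have /andP[_ h1] := Ker_occ r0 h0 v0 y0.
  by rewrite ler_wpM2l// W_ge0.
Qed.

Lemma Nfun_lip p r h x y : 0 <= p -> 0 <= r -> 0 <= h -> 0 <= x -> 0 <= y ->
  0 <= Nfun p r x y - Nfun p (r + h) x y <= h * (kappa * rS x * rS y).
Proof.
move=> p0 r0 h0 x0 y0; have rh := addr_ge0 r0 h0.
have bd r' : 0 <= r' -> 0 <= Im (fun v => W p v x * W r' v y) <= rS x * rS y * kappa.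
  move=> r'0; apply: Im_mul_le; [exact: W_sub1|exact: W_sub1| |].
  - by move=> v /ltW v0; rewrite mulrC; exact: W_rS.
  - by move=> v /ltW v0; rewrite mulrC; exact: W_rS.
have /andP[h1 h2] := Nfun_occ p0 r0 h0 x0 y0.
have /andP[b1 _] := bd _ rh; have /andP[_ b2] := bd _ r0.
apply/andP; split; first by apply: le_trans h1; exact: mulr_ge0.
by apply: (le_trans h2); rewrite ler_wpM2l// (le_trans b2)// le_eqVlt; apply/orP; left; apply/eqP; ring.
Qed.

(** Moving a time h from one slot to the other costs at most h times the variation of [Nfun] over h,
    that is h^2 B; n + 1 moves of size q / (n + 1) cost q^2 B / (n + 1) in all. *)
Lemma Lfun_shift p r q x y : 0 <= p -> 0 <= r -> 0 <= q -> 0 <= x -> 0 <= y ->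
  Lfun p (r + q) x y = Lfun (p + q) r x y.
Proof.
move=> p0 r0 q0 x0 y0; apply/eqP; rewrite eq_sym -subr_eq0 -normr_le0.
pose B := kappa * rS x * rS y.
apply: (@le0_of_le_inv _ _ (q ^+ 2 * B)) => n.
pose h := q / n.+1%:R.
have h0 : 0 <= h by rewrite divr_ge0.
have nh : n.+1%:R * h = q by rewrite /h mulrC divfK.
pose d (i : nat) := Lfun (p + i%:R * h) (r + (n.+1 - i)%:R * h) x y.
have -> : Lfun (p + q) r x y - Lfun p (r + q) x y = d n.+1 - d 0%N.
  by rewrite /d subnn subn0 !mul0r !addr0 nh.
have -> : q ^+ 2 * B / n.+1%:R = \sum_(i < n.+1) h * (h * B).
  rewrite sumr_const card_ord -[RHS]mulr_natl [RHS]mulrA nh /h expr2; ring.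
have step (p' r' : R) : 0 <= p' -> 0 <= r' -> `|Lfun (p' + h) r' x y - Lfun p' (r' + h) x y| <= h * (h * B).
  move=> p'0 r'0.
  have occ0 := Lfun_occ p'0 r'0 h0 x0 y0.
  have occ1 := Lfun_occ1 p'0 r'0 h0 x0 y0.
  have /andP[_ e2] := Nfun_lip p'0 r'0 h0 x0 y0.
  have /andP[_ f2] := Nfun_lip r'0 p'0 h0 y0 x0.
  rewrite -(Nfun_swap p'0 r'0 x0 y0) -(Nfun_swap (addr_ge0 p'0 h0) r'0 x0 y0) in f2.
  have BE : kappa * rS y * rS x = B by rewrite /B mulrAC.
  rewrite BE in f2; rewrite -/B in e2.
  have e2' := ler_wpM2l h0 e2; have f2' := ler_wpM2l h0 f2.
  rewrite mulrBr in e2'; rewrite mulrBr in f2'.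
  exact: sandwich_diff occ0 occ1 e2' f2'.
(* beyond the last index the truncated difference is useless, hence the cut-off *)
pose d' (i : nat) := d (minn i n.+1).
have := @telescope_le _ d' (fun=> h * (h * B)) n.+1; rewrite /d' minnn min0n; apply => i.
have [iN|iN] := ltnP i n.+1; last first.
  rewrite (minn_idPr (leqW iN)) subrr normr0.
  by rewrite !mulr_ge0// /B ?mulr_ge0 ?kappa_ge0 ?rS_ge0.
rewrite (minn_idPl iN) /d.
have -> : p + i.+1%:R * h = (p + i%:R * h) + h by rewrite -natr1; ring.
have -> : r + (n.+1 - i)%:R * h = (r + (n.+1 - i.+1)%:R * h) + h by rewrite -(subnSK iN) -natr1; ring.
by apply: step; rewrite addr_ge0// mulr_ge0.
Qed.

Definition ell t x y := Lfun 0 t x y.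

Lemma Lfun_ell p r x y : 0 <= p -> 0 <= r -> 0 <= x -> 0 <= y -> Lfun p r x y = ell (p + r) x y.
Proof.
move=> p0 r0 x0 y0; have := Lfun_shift (lexx 0) r0 p0 x0 y0.
by rewrite add0r addrC => <-.
Qed.

Lemma ellC t x y : 0 <= t -> 0 <= x -> 0 <= y -> ell t x y = ell t y x.
Proof.
move=> t0 x0 y0; have H := Lfun_ell t0 (lexx 0) y0 x0.
by rewrite addr0 LfunC in H; exact: H.
Qed.

(** An inner-product form at p + r makes [g] positive definite on the semigroup of positive times.
    It is stable under double differences, with V p - V (p + h) as new vector. *)
Definition gram (g : R -> R) := exists V : R -> R -> R,
  [/\ exists C, forall p v, 0 < p -> 0 < v -> `|V p v| <= C * rS v,
      forall p, 0 < p -> measurable_fun D (V p)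
    & forall p r, 0 < p -> 0 < r -> g (p + r) = Im (fun v => V p v * V r v)].

Lemma gram_dec2 g h : 0 < h -> gram g -> gram (dec h (dec h g)).
Proof.
move=> h0 [V [[C VC] mV gV]].
have sV p : 0 < p -> sub (V p) by move=> p0; split; [exact: mV|exists C => v; exact: VC].
exists (fun p v => V p v - V (p + h) v); split.
- exists (C + C) => p v p0 v0; rewrite mulrDl (le_trans (ler_normB _ _))// lerD ?VC//.
  exact: addr_gt0.
- by move=> p p0; apply: measurable_funB; apply: mV => //; exact: addr_gt0.
move=> p r p0 r0; have ph := addr_gt0 p0 h0; have rh := addr_gt0 r0 h0.
have d p' r' : 0 < p' -> 0 < r' -> dom (fun v => V p' v * V r' v).
  by move=> p'0 r'0; apply: subM; exact: sV.
rewrite /dec.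
have -> : g (p + r) - g (p + r + h) - (g (p + r + h) - g (p + r + h + h)) =
  (g (p + r) - g (p + (r + h))) - (g ((p + h) + r) - g ((p + h) + (r + h))).
  have -> : p + h + (r + h) = p + r + h + h by ring.
  have -> : p + h + r = p + r + h by ring.
  by rewrite addrA.
rewrite !gV// -!ImB; try exact: d; try (by apply: domB; exact: d).
by apply: eq_Im => v _; ring.
Qed.

Lemma gram_posdef g : gram g -> posdef g.
Proof.
move=> gg hs0 hs0P.
have {gg} : gram (sqdecs hs0 g).
  elim: hs0 hs0P => //= h l ih /andP[h0 lP]; apply: gram_dec2 => //; exact: ih.
move=> [V [[C VC] mV gV]]; exists (C * C * kappa) => t t0.
have t20 : 0 < t / 2 by rewrite divr_gt0.
have sV : sub (V (t / 2)) by split; [exact: mV|exists C => v; exact: VC].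
rewrite {1 2}(splitr t) gV//; apply/andP; split.
  by apply: Im_ge0 => v _; rewrite -expr2 sqr_ge0.
rewrite -ImZ; last by apply: subM; exact: (rS_sub hs).
apply: Im_le; [exact: subM|by apply: domZ; apply: subM; exact: (rS_sub hs)|].
move=> v v0; rewrite mulrACA (le_trans (ler_norm _))// normrM.
by apply: ler_pM => //; exact: VC.
Qed.

(** The quadratic form of the matrix of [ell] at the vector (c, 1): a Gram function for every real
    [c], from which the values at c and - c recover the off-diagonal entry. *)
Definition ellc c x y t := c ^+ 2 * ell t x x + 2 * c * ell t x y + ell t y y.

Lemma ellc_cmono c x y : 0 <= x -> 0 <= y -> cmono (ellc c x y).
Proof.
move=> x0 y0; apply: posdef_cmono; apply: gram_posdef.
exists (fun p v => c * Ker p v x + Ker p v y); split.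
- exists (`|c| * (kappa * rS x) + kappa * rS y) => p v /ltW p0 /ltW v0.
  have /andP[a1 a2] := Ker_rS p0 v0 x0; have /andP[b1 b2] := Ker_rS p0 v0 y0.
  rewrite mulrDl (le_trans (ler_normD _ _))// lerD//.
    by rewrite normrM -mulrA ler_wpM2l// ger0_norm// mulrAC.
  by rewrite ger0_norm// mulrAC.
- move=> p /ltW p0; apply: measurable_funD; last by have [] := Ker_sub p0 y0.
  by apply: measurable_funM => //; have [] := Ker_sub p0 x0.
move=> p r /ltW p0 /ltW r0.
have d x' y' p' r' : 0 <= x' -> 0 <= y' -> 0 <= p' -> 0 <= r' -> dom (fun v => Ker p' v x' * Ker r' v y').
  by move=> *; apply: subM; exact: Ker_sub.
rewrite /ellc -!Lfun_ell//.
have -> : 2 * c * Lfun p r x y = c * Lfun p r x y + c * Lfun p r y x.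
  by rewrite !Lfun_ell// (@ellC _ y x)// ?addr_ge0//; ring.
have d1 := d x x p r x0 x0 p0 r0; have d2 := d x y p r x0 y0 p0 r0.
have d3 := d y x p r y0 x0 p0 r0; have d4 := d y y p r y0 y0 p0 r0.
have d23 := domD (domZ c d2) (domZ c d3).
have E1 := ImD (domZ c d2) (domZ c d3).
have E2 := ImD (domZ (c ^+ 2) d1) d23.
have E3 := ImD (domD (domZ (c ^+ 2) d1) d23) d4.
rewrite E2 E1 (ImZ _ d1) (ImZ _ d2) (ImZ _ d3) in E3.
rewrite -[LHS]E3; by apply: eq_Im => v _; ring.
Qed.

Lemma ell_rS t x y : 0 <= t -> 0 <= x -> 0 <= y -> 0 <= ell t x y <= kappa ^+ 3 * rS x * rS y.
Proof.
move=> t0 x0 y0.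
have -> : kappa ^+ 3 * rS x * rS y = (kappa * rS x) * (kappa * rS y) * kappa by ring.
apply: Im_mul_le; [exact: Ker_sub|exact: Ker_sub| |].
- by move=> v /ltW v0; rewrite mulrAC; exact: Ker_rS.
- by move=> v /ltW v0; rewrite mulrAC; exact: Ker_rS.
Qed.

Lemma ellc_bound c x y t : 0 <= x -> 0 <= y -> 0 < t -> ellc c x y t <= kappa ^+ 3 * (`|c| * rS x + rS y) ^+ 2.
Proof.
move=> x0 y0 /ltW t0; have /andP[_ a1] := ell_rS t0 x0 x0; have /andP[b0 b1] := ell_rS t0 x0 y0.
have /andP[_ c1] := ell_rS t0 y0 y0.
have -> : kappa ^+ 3 * (`|c| * rS x + rS y) ^+ 2 =
  `|c| ^+ 2 * (kappa ^+ 3 * rS x * rS x) + 2 * (`|c| * (kappa ^+ 3 * rS x * rS y)) + kappa ^+ 3 * rS y * rS y by ring.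
rewrite /ellc; apply: lerD => //; apply: lerD.
  by rewrite real_normK ?num_real// ler_wpM2l// sqr_ge0.
rewrite -mulrA ler_wpM2l// (le_trans (ler_norm _))// normrM ler_wpM2l//.
by rewrite ger0_norm.
Qed.

Definition kapp j t x y := iter j nderive (fun u => ell u x y) t.

(** Polarisation; [c] is left free because [kapp_bound] tunes it to [x] and [y]. *)
Lemma kapp_split c x y j (t : R) : 0 <= x -> 0 <= y -> 0 < c -> 0 < t ->
  kapp j t x y = (iter j nderive (ellc c x y) t - iter j nderive (ellc (- c) x y) t) / (4 * c) /\
  is_derive t 1 (fun u => kapp j u x y)
    (- ((iter j.+1 nderive (ellc c x y) t - iter j.+1 nderive (ellc (- c) x y) t) / (4 * c))).
Proof.
move=> x0 y0 c0.
have cm1 := ellc_cmono c x0 y0; have cm2 := ellc_cmono (- c) x0 y0.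
have step i : (forall t, 0 < t -> kapp i t x y = (iter i nderive (ellc c x y) t - iter i nderive (ellc (- c) x y) t) / (4 * c)) ->
    forall t : R, 0 < t -> is_derive t 1 (fun u => kapp i u x y)
    (- ((iter i.+1 nderive (ellc c x y) t - iter i.+1 nderive (ellc (- c) x y) t) / (4 * c))).
  move=> E u u0.
  have H := is_deriveZ (4 * c)^-1 (is_deriveB (is_derive_iter_nderive i cm1 u0) (is_derive_iter_nderive i cm2 u0)).
  have {H} H : is_derive u 1 (fun v => (4 * c)^-1 * (iter i nderive (ellc c x y) v - iter i nderive (ellc (- c) x y) v))
    (- ((iter i.+1 nderive (ellc c x y) u - iter i.+1 nderive (ellc (- c) x y) u) / (4 * c))).
    have -> : - ((iter i.+1 nderive (ellc c x y) u - iter i.+1 nderive (ellc (- c) x y) u) / (4 * c)) =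
      (4 * c)^-1 *: (- iter i.+1 nderive (ellc c x y) u - - iter i.+1 nderive (ellc (- c) x y) u).
      by rewrite /GRing.scale/=; ring.
    exact: H.
  apply: near_eq_is_derive H; near=> v.
  have v0 : 0 < v by near: v; exact: lt_nbhsr.
  by rewrite E// mulrC.
elim: j t => [|j ih] t t0.
  have E u : 0 < u -> kapp 0 u x y = (iter 0 nderive (ellc c x y) u - iter 0 nderive (ellc (- c) x y) u) / (4 * c).
    have c1 : 4 * c != 0 by rewrite gt_eqF// mulr_gt0.
    move=> u0; change (ell u x y = (ellc c x y u - ellc (- c) x y u) / (4 * c)); rewrite /ellc.
    move: (ell u x y) (ell u x x) (ell u y y) => p1 p2 p3.
    by rewrite (_ : _ - _ = p1 * (4 * c)) ?mulfK//; ring.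
  by split; [exact: E|exact: step].
have E u : 0 < u -> kapp j.+1 u x y = (iter j.+1 nderive (ellc c x y) u - iter j.+1 nderive (ellc (- c) x y) u) / (4 * c).
  move=> u0; have [_ [_ du]] := ih u u0.
  by rewrite /kapp iterS {1}/nderive derive1E [X in - X]du opprK.
by split; [exact: E|exact: step].
Unshelve. all: by end_near. Qed.

Lemma kapp_derive j (t x y : R) : 0 <= x -> 0 <= y -> 0 < t ->
  is_derive t 1 (fun u => kapp j u x y) (- kapp j.+1 t x y).
Proof.
move=> x0 y0 t0; have [_ H] := @kapp_split 1 x y j t x0 y0 ltr01 t0.
by have [-> _] := @kapp_split 1 x y j.+1 t x0 y0 ltr01 t0.
Qed.

Lemma kapp_bound j : exists2 c, 0 <= c & forall t x y, 0 < x -> 0 < y -> 0 < t ->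
  `|kapp j t x y| <= c / t ^+ j * (rS x * rS y).
Proof.
have [c c0 cP] := @iter_nderive_le R j.
exists (c * kappa ^+ 3) => [|t x y x0 y0 t0].
  by rewrite mulr_ge0// exprn_ge0// kappa_ge0.
have rx := rS_gt0 x0; have ry := rS_gt0 y0.
(* Balances the two terms: e rS x + rS y = 2 rS y, and (2 rS y)^2 / (4 e) is the product of the two
   weights. *)
pose e := rS y / rS x; have e0 : 0 < e by rewrite divr_gt0.
have [-> _] := @kapp_split e x y j t (ltW x0) (ltW y0) e0 t0.
have bd e' : `|e'| = e -> 0 <= iter j nderive (ellc e' x y) t <= c / t ^+ j * (kappa ^+ 3 * (2 * rS y) ^+ 2).
  move=> ee; have cm := ellc_cmono e' (ltW x0) (ltW y0); apply/andP; split.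
    by apply: cmono_ge0 => //; exact: cmono_iter.
  apply: cP => // u u0; have := ellc_bound e' (ltW x0) (ltW y0) u0; rewrite ee.
  by have -> : e * rS x + rS y = 2 * rS y by rewrite /e divfK ?gt_eqF//; ring.
have /andP[p1 p2] := bd e (gtr0_norm e0).
have /andP[q1 q2] : 0 <= iter j nderive (ellc (- e) x y) t <= c / t ^+ j * (kappa ^+ 3 * (2 * rS y) ^+ 2).
  by apply: bd; rewrite normrN gtr0_norm.
set P := iter j _ _ _ in p1 p2 *; set Q := iter j _ _ _ in q1 q2 *.
have e40 : 0 < 4 * e by exact: mulr_gt0.
rewrite normrM normfV (gtr0_norm e40) ler_pdivrMr//.
apply: (@le_trans _ _ (c / t ^+ j * (kappa ^+ 3 * (2 * rS y) ^+ 2))).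
  by rewrite ler_norml; apply/andP; split; lra.
rewrite le_eqVlt; apply/orP; left; apply/eqP; rewrite /e; field.
by rewrite !gt_eqF// exprn_gt0.
Qed.

Lemma kapp_lip j : exists2 c, 0 <= c & forall t t' x y, 0 < x -> 0 < y -> 0 < t -> t <= t' ->
  `|kapp j t' x y - kapp j t x y| <= c / t ^+ j.+1 * (rS x * rS y) * (t' - t).
Proof.
have [c c0 cP] := kapp_bound j.+1; exists c => // t t' x y x0 y0 t0 tt.
have xx := ltW x0; have yy := ltW y0.
have cf : {within `[t, t'], continuous (fun u => kapp j u x y)}.
  apply: continuous_in_subspaceT => u /set_mem; rewrite /= in_itv/= => /andP[tu _].
  apply: differentiable_continuous; apply/derivable1_diffP.
  by have [] := @kapp_derive j u x y xx yy (lt_le_trans t0 tu).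
have [|u uI ->] := @MVT_segment R (fun u => kapp j u x y) (fun u => - kapp j.+1 u x y) t t' tt _ cf.
  by move=> u; rewrite in_itv/= => /andP[tu _]; apply: kapp_derive => //; exact: lt_trans tu.
move: uI; rewrite in_itv/= => /andP[tu _]; have u0 := lt_le_trans t0 tu.
rewrite normrM normrN (ger0_norm (_ : 0 <= t' - t)) ?subr_ge0// ler_wpM2r ?subr_ge0//.
apply: (le_trans (cP _ _ _ x0 y0 u0)); apply: ler_wpM2r; first by rewrite mulr_ge0 ?rS_ge0.
exact: div_exp_le.
Qed.

Let cvg_invS (f : R -> R) t : 0 <= t -> (exists C, forall h, 0 <= h -> `|f t - f (t + h)| <= h * C) ->
  f (t + n.+1%:R^-1) @[n --> \oo] --> f t.
Proof.
move=> t0 [C CP]; apply/cvgrPdist_le => e e0.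
have e1 : 0 < e / (`|C| + 1) by rewrite divr_gt0// ltr_wpDl.
have := near_invS_lt e1; apply: filterS => n nP.
have n0 : (0 : R) <= n.+1%:R^-1 by rewrite invr_ge0.
apply: (le_trans (CP _ n0)); apply: (le_trans (ler_wpM2l n0 (ler_norm C))).
rewrite mulrC; apply: le_trans (ler_wpM2l (normr_ge0 C) (ltW nP)) _.
by apply: mulr_frac_le => //; exact: ltW.
Qed.

(** Each differentiation removes one Green factor: [Lfun], [Nfun], [Ker] and [W] succeed one another
    by [slope_derive]. So [W], known so far to be monotone and right-continuous in time, is up to
    sign the third derivative of a smooth function. *)
Lemma kapp1 t x y : 0 <= x -> 0 <= y -> 0 < t -> kapp 1 t x y = Nfun 0 t x y.
Proof.
move=> x0 y0 t0.
apply: (@slope_derive _ (fun u => ell u x y) (fun u => Nfun 0 u x y) t _ t0 (kapp_derive 0 x0 y0 t0)).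
  by move=> h /ltW h0; apply: Lfun_occ => //; exact: ltW.
apply: (@cvg_invS (fun u => Nfun 0 u x y) t (ltW t0)).
exists (kappa * rS x * rS y) => h h0.
by have /andP[a1 a2] := @Nfun_lip 0 t h x y (lexx _) (ltW t0) h0 x0 y0; rewrite ger0_norm.
Qed.

Lemma kapp2 t x y : 0 <= x -> 0 <= y -> 0 < t -> kapp 2 t x y = Ker t x y.
Proof.
move=> x0 y0 t0.
have dN : is_derive t 1 (fun u => Nfun 0 u x y) (- kapp 2 t x y).
  apply: near_eq_is_derive (kapp_derive 1 x0 y0 t0); near=> u.
  by apply: kapp1 => //; near: u; exact: lt_nbhsr.
apply: (slope_derive (w := fun u => Ker u x y) t0 dN).
  move=> h /ltW h0; have := @Nfun_occ 0 t h x y (lexx _) (ltW t0) h0 x0 y0.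
  have E u : Im (fun v => W 0 v x * W u v y) = Ker u x y.
    by apply: eq_Im => v /ltW v0; rewrite W0// GC.
  by rewrite !E.
apply: (@cvg_invS (fun u => Ker u x y) t (ltW t0)).
exists (rS x * rS y) => h h0.
have /andP[a1 a2] := @Ker_occ t h x y (ltW t0) h0 x0 y0.
have th : 0 <= t + h by rewrite addr_ge0// ltW.
rewrite ger0_norm; last by apply: le_trans a1; rewrite mulr_ge0// W_ge0.
by apply: (le_trans a2); rewrite ler_wpM2l//; have /andP[] := W_rS (ltW t0) x0 y0.
Unshelve. all: by end_near. Qed.

Lemma kapp3 t x y : 0 <= x -> 0 <= y -> 0 < t -> kapp 3 t x y = W t x y.
Proof.
move=> x0 y0 t0.
have dK : is_derive t 1 (fun u => Ker u x y) (- kapp 3 t x y).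
  apply: near_eq_is_derive (kapp_derive 2 x0 y0 t0); near=> u.
  by apply: kapp2 => //; near: u; exact: lt_nbhsr.
apply: (slope_derive (w := fun u => W u x y) t0 dK).
  by move=> h /ltW h0; apply: Ker_occ => //; exact: ltW.
by apply: W_rc => //; exact: ltW.
Unshelve. all: by end_near. Qed.

Lemma kapp_quot_cvg j t x y : 0 < x -> 0 < y -> 0 < t ->
  (kapp j t x y - kapp j (t + n.+1%:R^-1) x y) * n.+1%:R @[n --> \oo] --> kapp j.+1 t x y.
Proof.
move=> x0 y0 t0; have nz n : (n.+1%:R^-1 : R) != 0 by rewrite invr_eq0.
have := @is_derive_cvg_seq _ _ t _ _ (kapp_derive j (ltW x0) (ltW y0) t0) (@invS_cvg0 R) nz.
move=> /cvgN; rewrite opprK; apply: eq_cvgn => n /=.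
by rewrite invrK -mulNr opprB.
Qed.

Lemma kapp_sub j t x : 0 < x -> 0 < t -> sub (kapp j.+3 t x).
Proof.
move=> x0; elim: j t => [|j ih] t t0; split.
- have [mW _] := W_sub2 (ltW t0) (ltW x0).
  by apply: eq_measurable_fun mW => v /set_mem/posP/ltW v0; rewrite kapp3// ltW.
- have [c _ cP] := kapp_bound 3; exists (c / t ^+ 3 * rS x) => v v0.
  by rewrite -[leRHS]mulrA; apply: cP.
- apply: (@measurable_fun_cvg _ _ _ _ (fun n v => (kapp j.+3 t x v - kapp j.+3 (t + n.+1%:R^-1) x v) * n.+1%:R)) => [n|v /posP v0].
    apply: measurable_funM => //; apply: measurable_funB; first by have [] := ih t t0.
    by have [] := ih (t + n.+1%:R^-1) (addr_gt0 t0 _).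
  by exact: kapp_quot_cvg.
- have [c _ cP] := kapp_bound j.+4; exists (c / t ^+ j.+4 * rS x) => v v0.
  by rewrite -[leRHS]mulrA; apply: cP.
Qed.

(** The case of [W] is [KerE]; then difference quotients in time pass under the integral, dominated
    through [kapp_lip]. *)
Lemma kapp_Im j t x y : 0 < x -> 0 < y -> 0 < t ->
  kapp j.+2 t x y = Im (fun v => G y v * kapp j.+3 t x v).
Proof.
move=> x0 y0; elim: j t => [|j ih] t t0.
  rewrite kapp2 ?ltW// KerE; [|exact: ltW|exact: ltW|exact: ltW].
  by apply: eq_Im => v /ltW v0; rewrite kapp3// ?(ltW x0)// mulrC GC.
have L1 := @kapp_quot_cvg j.+2 t x y x0 y0 t0.
have sG := G_sub (ltW y0).
have dG u : 0 < u -> dom (fun v => G y v * kapp j.+3 u x v) by move=> u0; apply: subM => //; exact: kapp_sub.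
have L2 : Im (fun v => G y v * ((kapp j.+3 t x v - kapp j.+3 (t + n.+1%:R^-1) x v) * n.+1%:R)) @[n --> \oo]
    --> Im (fun v => G y v * kapp j.+4 t x v).
  have [c c0 cP] := kapp_lip j.+3.
  apply: (Im_cvg (h := fun v => (c / t ^+ j.+4 * rS x) * (G y v * rS v))).
  - move=> n; apply: measurable_funM; first by have [] := sG.
    have n0 : 0 < t + n.+1%:R^-1 by rewrite addr_gt0.
    apply: measurable_funM => //; apply: measurable_funB; first by have [] := kapp_sub j x0 t0.
    by have [] := kapp_sub j x0 n0.
  - move=> v v0; apply: cvgM; first exact: cvg_cst.
    exact: kapp_quot_cvg.
  - by apply: domZ; apply: subM => //; exact: rS_sub hs.
  - move=> n v v0; rewrite normrM ger0_norm ?G_ge0// mulrCA ler_wpM2l ?G_ge0//.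
    have n0 : (0 : R) <= n.+1%:R^-1 by rewrite invr_ge0.
    have tn : t <= t + n.+1%:R^-1 by rewrite lerDl.
    have H := cP t _ x v x0 v0 t0 tn.
    rewrite (_ : t + _ - t = n.+1%:R^-1) in H; last by rewrite addrAC subrr add0r.
    rewrite (mulrA (c / t ^+ j.+4)) in H.
    rewrite normrM (ger0_norm (ler0n R n.+1)) distrC -ler_pdivlMr ?ltr0n//.
apply: (cvg_unique _ L1) => //; apply: eq_cvgn L2 => n.
have n0 : 0 < t + n.+1%:R^-1 by rewrite addr_gt0.
rewrite !ih// mulrC -ImB; [|exact: dG|exact: dG].
rewrite -ImZ; last by apply: domB; exact: dG.
apply: eq_Im => v _; move: (kapp j.+3 t x v) (kapp j.+3 (t + n.+1%:R^-1) x v) => p1 p2.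
ring.
Qed.

Lemma density_family x : 0 < x -> exists kp : nat -> R -> R -> R,
  [/\ forall j (t y : R), 0 < t -> 0 < y -> is_derive t 1 (fun u => kp j u y) (- kp j.+1 t y),
      forall j t0, 0 < t0 -> exists2 C, 0 <= C & forall t y, t0 <= t -> 0 < y -> `|kp j t y| <= C * rS y,
      forall j t, 0 < t -> measurable_fun D (kp j t),
      forall j t y, 0 < t -> 0 < y -> kp j t y = Im (fun z => G y z * kp j.+1 t z)
    & forall t y, 0 < t -> 0 < y -> W t x y = Im (fun z => G y z * kp 0%N t z)].
Proof.
move=> x0; exists (fun j t y => kapp j.+4 t x y); split.
- by move=> j t y t0 y0; apply: kapp_derive => //; exact: ltW.
- move=> j t0 t00; have [c c0 cP] := kapp_bound j.+4.
  exists (c / t0 ^+ j.+4 * rS x); first by apply: mulr_ge0 (rS_ge0 _); apply: divr_ge0 => //; apply: exprn_ge0; exact: ltW.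
  move=> t y tt y0; have t1 := lt_le_trans t00 tt.
  rewrite -[leRHS]mulrA (le_trans (cP t x y x0 y0 t1))// ler_wpM2r ?mulr_ge0 ?rS_ge0//.
  exact: div_exp_le.
- by move=> j t t0; have [] := kapp_sub j.+1 x0 t0.
- by move=> j t y t0 y0; exact: kapp_Im.
- by move=> t y t0 y0; rewrite -kapp3 ?ltW//; exact: kapp_Im.
Qed.
End Kernel.

(** * Regularity of the density *)

Section Regularity.
Context {R : realType}.
Notation mu := (@lebesgue_measure R).
Notation D := (`]0, +oo[%classic : set R).
Variables (a b s sd S : R -> R).
Hypothesis hs : scale_fun a b s sd S.
Hypothesis ca : continuous a.
Variable k : R.
Hypotheses (k0 : 0 < k) (ak : forall y, 0 <= y -> k * (y * (1 + y)) <= a y).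
Local Notation rS := (rS S).
Local Notation G := (G S).
Local Notation sub := (sub S).
Local Notation dom := (dom S).
Local Notation mm := (mm hs ca k0 ak).
Local Notation Im := (Im hs ca k0 ak).
Local Notation ImD := (ImD hs ca k0 ak).
Local Notation ImB := (ImB hs ca k0 ak).
Local Notation ImZ := (ImZ hs ca k0 ak).
Local Notation eq_Im := (eq_Im hs ca k0 ak).
Local Notation Im_ge0 := (Im_ge0 hs ca k0 ak).
Local Notation Im_le := (Im_le hs ca k0 ak).
Local Notation normr_Im := (normr_Im hs ca k0 ak).
Local Notation kappa := (kappa hs ca k0 ak).
Local Notation Jint := (Jint hs ca k0 ak).
Local Notation subM := (subM hs).
Local Notation G_ge0 := (G_ge0 hs).
Local Notation G_rS := (G_rS hs).
Local Notation G_neg := (G_neg hs).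
Local Notation G_sub := (G_sub hs).
Local Notation rS_gt0 := (rS_gt0 hs).
Local Notation rS_ge0 := (rS_ge0 S).
Lemma is_derive_quad_near (f : R -> R) (u l C del : R) : 0 < del -> 0 <= C ->
  (forall h, `|h| <= del -> `|f (u + h) - f u - l * h| <= C * h ^+ 2) -> is_derive u 1 f l.
Proof.
move=> del0 C0 H.
have L : h^-1 *: ((f \o shift u) (h *: 1) - f u) @[h --> 0^'] --> l.
  apply/cvgrPdist_le => e e0; near=> h.
  have h0 : h != 0 by near: h; exact: nbhs_dnbhs_neq.
  have hs' : `|h| <= e / (C + 1) by near: h; apply: dnbhs0_le; rewrite divr_gt0// ltr_wpDl.
  have hd : `|h| <= del by near: h; exact: dnbhs0_le.
  rewrite /= /GRing.scale/= mulr1 (addrC h u) distrC.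
  have -> : h^-1 * (f (u + h) - f u) - l = h^-1 * (f (u + h) - f u - l * h) by field.
  rewrite normrM normfV ler_pdivrMl ?normr_gt0//; apply: (le_trans (H h hd)).
  rewrite -real_normK ?num_real// expr2 mulrCA ler_wpM2l//.
  apply: (le_trans (ler_wpM2l C0 hs')); apply: mulr_frac_le => //; exact: ltW.
by split; [apply/cvg_ex; exists l; exact: L|apply/cvg_lim => //; exact: L].
Unshelve. all: by end_near. Qed.

(** Dominated convergence is sequential, so derivatives are tested along sequences; the shift by [N]
    brings them within [del] from the start. *)
Lemma is_derive_seq (f : R -> R) (u l del : R) : 0 < del ->
  (forall h : nat -> R, (forall n, h n != 0) -> (forall n, `|h n| <= del) -> h n @[n --> \oo] --> 0 ->
     (h n)^-1 * (f (u + h n) - f u) @[n --> \oo] --> l) -> is_derive u 1 f l.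
Proof.
move=> del0 H.
have L : h^-1 *: ((f \o shift u) (h *: 1) - f u) @[h --> 0^'] --> l.
  apply/cvgr_dnbhsP => h [hn0 h0].
  have h0' : h n @[n --> \oo] --> (0 : R) by exact: h0.
  have [N _ NP] : \forall n \near \oo, `|h n| <= del.
    by have /cvgrPdist_le/(_ _ del0) := h0'; apply: filterS => n; rewrite sub0r normrN.
  have := H (fun n => h (n + N)%N) (fun n => hn0 _) (fun n => NP _ (leq_addl _ _)).
  have hN : h (n + N)%N @[n --> \oo] --> (0 : R) by rewrite -(cvg_shiftn N) in h0'; exact: h0'.
  move=> /(_ hN) L; rewrite -(cvg_shiftn N); apply: eq_cvgn L => n.
  by rewrite /= /GRing.scale/= mulr1 (addrC (h _) u).
by split; [apply/cvg_ex; exists l; exact: L|apply/cvg_lim => //; exact: L].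
Qed.

Let point_integral (y r : R) : (\int[mu]_v ((if v == y then r else 0) : R)%:E = 0)%E.
Proof.
rewrite (_ : (fun v : measurableTypeR R => _) = ((fun=> r%:E) \_ [set y])).
  by rewrite -integral_mkcond integral_set1.
apply/funext => v; rewrite patchE; case: eqVneq => [->|vy]; first by rewrite mem_set.
by rewrite memNset// => /eqP; rewrite (negbTE vy).
Qed.

Lemma Im_neq (f : R -> R) y : dom f -> Im (fun z => (z != y)%:R * f z) = Im f.
Proof.
move=> df; have [mf [C fC]] := df.
have mi : measurable_fun D (fun z : R => (z != y)%:R : R).
  have -> : (fun z : R => (z != y)%:R : R) = \1_(~` [set y]).
    apply/funext => z; rewrite indicE; case: eqVneq => [->|zy].
      by rewrite memNset// => /(_ erefl).
    by rewrite mem_set// => /eqP; rewrite (negbTE zy).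
  by apply: measurable_funTS; apply: measurable_indic; exact: measurableC.
have d1 : dom (fun z => (z != y)%:R * f z).
  apply: (dom_le _ df); first exact: measurable_funM.
  by move=> v _; case: (_ != _); rewrite ?mul1r// mul0r normr0.
apply/esym/eqP; rewrite -subr_eq0 -ImB// -normr_eq0 eq_le normr_ge0 andbT.
have d2 := domB df d1.
have d3 : dom (fun z => `|f z - (z != y)%:R * f z|).
  apply: (dom_le _ d2); last by move=> v _; rewrite normr_id.
  by apply: measurableT_comp => //; case: d2.
apply: (le_trans (normr_Im d2 d3 (fun v _ => lexx _))).
have E : (Im (fun z => `|f z - (z != y)%:R * f z|))%:E = 0%:E.
  rewrite Im_EFin// -[RHS](point_integral y (mb a s y * `|f y|)).
  apply: eq_integral => v _; congr EFin.
  by case: (eqVneq v y) => [->|_]; rewrite ?mul0r ?subr0// mul1r subrr normr0 mulr0.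
by case: E => ->.
Qed.

Definition tail (f : R -> R) (y : R) := Im (fun z => (y < z)%R%:R * f z).

Let mlt (y : R) : measurable_fun D (fun z : R => (y < z)%R%:R : R).
Proof.
have -> : (fun z : R => (y < z)%R%:R : R) = \1_(`]y, +oo[).
  apply/funext => z; rewrite indicE; congr (nat_of_bool _)%:R; apply/idP/idP.
    by move=> yz; apply/mem_set; rewrite /= in_itv/= yz.
  by move=> /set_mem; rewrite /= in_itv/= andbT.
by apply: measurable_funTS; apply: measurable_indic; exact: measurable_itv.
Qed.

Lemma tail_sub (f : R -> R) (y : R) : sub f -> sub (fun z => (y < z)%R%:R * f z).
Proof.
move=> [mf [C fC]]; split; first exact: measurable_funM.
exists C => v v0; case: (_ < _); rewrite ?mul1r ?fC// mul0r normr0.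
exact: le_trans (normr_ge0 _) (fC v v0).
Qed.

(** For z apart from [y] and small steps, the minimum with z is either z in both terms or the moving
    point in both, so the quotient is exactly 0 or 1. *)
Lemma quot_cvg (h : nat -> R) (y z : R) : 0 <= y -> (forall n, h n != 0) -> (forall n, 0 <= y + h n) ->
  h n @[n --> \oo] --> 0 -> 0 < z -> z != y ->
  (G (y + h n) z - G y z) / (S (y + h n) - S y) @[n --> \oo] --> ((y < z)%R%:R : R).
Proof.
move=> y0 hn yh h0 z0 zy; apply: cvg_near_cst.
have Sn n : S (y + h n) - S y != 0.
  have [hp|hm] := ltP 0 (h n).
    by rewrite gt_eqF// subr_gt0; apply: (S_lt hs) => //; rewrite ltrDl.
  rewrite lt_eqF// subr_lt0; apply: (S_lt hs) => //; rewrite gtrDl lt_neqAle hm andbT; exact: hn.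
have zpos := ltW z0.
have zy0 : 0 < `|z - y| by rewrite normr_gt0 subr_eq0.
have /cvgrPdist_lt/(_ _ zy0) := h0; apply: filterS => n; rewrite sub0r normrN => hz.
rewrite !GE//; have [yz|zy'] := ltP y z.
  have yhz : y + h n <= z.
    rewrite -lerBrDl (le_trans (ler_norm _))// (le_trans (ltW hz))// ger0_norm// subr_ge0; exact: ltW.
  by rewrite (min_idPl yhz) divff.
have zyh : z <= y + h n.
  rewrite distrC (ger0_norm (_ : 0 <= y - z)) ?subr_ge0// in hz.
  have : - `|h n| <= h n by rewrite lerNl -normrN ler_norm.
  by move: hz; move: (`|h n|) => q ? ?; lra.
by rewrite (min_idPr zyh) subrr mul0r.
Qed.

Lemma Im_quot_cvg (f : R -> R) (h : nat -> R) (y : R) : sub f -> 0 <= y -> (forall n, h n != 0) ->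
  (forall n, 0 <= y + h n) -> h n @[n --> \oo] --> 0 ->
  (Im (fun z => G (y + h n) z * f z) - Im (fun z => G y z * f z)) / (S (y + h n) - S y)
    @[n --> \oo] --> tail f y.
Proof.
move=> sf y0 hn yh h0.
have dq n : dom (fun z => (G (y + h n) z - G y z) / (S (y + h n) - S y) * f z).
  apply: subM => //; have := subZ (S (y + h n) - S y)^-1 (subB (G_sub (yh n)) (G_sub y0)).
  by under eq_fun do rewrite mulrC.
have dt := sub_dom hs (tail_sub y sf).
have L : Im (fun z => (z != y)%:R * ((G (y + h n) z - G y z) / (S (y + h n) - S y) * f z)) @[n --> \oo]
    --> Im (fun z => (z != y)%:R * ((y < z)%R%:R * f z)).
  have [mf [C fC]] := sf.
  apply: (Im_cvg (h := fun z => `|f z|)).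
  - move=> n; apply: measurable_funM; last by have [] := dq n.
    have -> : (fun z : R => (z != y)%:R : R) = \1_(~` [set y]).
      apply/funext => z; rewrite indicE; case: eqVneq => [->|zy].
        by rewrite memNset// => /(_ erefl).
      by rewrite mem_set// => /eqP; rewrite (negbTE zy).
    by apply: measurable_funTS; apply: measurable_indic; exact: measurableC.
  - move=> v v0; case: (eqVneq v y) => [_|vy] /=.
      by rewrite mul0r; apply: (@eq_cvgn _ (fun=> 0)); [move=> n; rewrite mul0r|exact: cvg_cst].
    apply: cvgM; first exact: cvg_cst.
    by apply: cvgM; [exact: quot_cvg|exact: cvg_cst].
  - apply: (dom_le _ (sub_dom hs sf)); first exact: measurableT_comp.
    by move=> v _; rewrite normr_id.
  - move=> n v v0; rewrite normrM normrM mulrA -[leRHS]mul1r ler_wpM2r// -[leRHS]mul1r.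
    apply: ler_pM => //; first by case: (_ != _); rewrite ?normr1 ?normr0.
    rewrite normrM normfV; have := G_lip_abs hs v (yh n) y0.
    have [->|nz] := eqVneq (S (y + h n) - S y) 0; first by rewrite normr0 invr0 mulr0.
    by rewrite ler_pdivrMr ?normr_gt0// mul1r.
rewrite Im_neq// in L; apply: eq_cvgn L => n; rewrite Im_neq//.
rewrite -ImB; [|exact: (subM (G_sub (yh n)) sf)|exact: (subM (G_sub y0) sf)].
rewrite [RHS]mulrC -ImZ; last by apply: domB; [exact: (subM (G_sub (yh n)) sf)|exact: (subM (G_sub y0) sf)].
by apply: eq_Im => z _; ring.
Qed.

(** The quotient is factored through the increment of [S]: with respect to [S] the function [G] is
    1-Lipschitz, which gives the domination, and the remaining factor tends to [s y]. *)
Lemma Im_G_derive (f : R -> R) (y : R) : sub f -> 0 < y ->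
  is_derive y 1 (fun y => Im (fun z => G y z * f z)) (s y * tail f y).
Proof.
move=> sf y0; apply: (is_derive_seq y0) => h hn hd h0.
have yh n : 0 <= y + h n.
  by have := hd n; rewrite ler_norml => /andP[]; rewrite -subr_ge0 opprK addrC.
have H1 := Im_quot_cvg sf (ltW y0) hn yh h0.
have H2 := is_derive_cvg_seq (sc_S hs y) h0 hn.
have L : (S (y + h n) - S y) / h n * ((Im (fun z => G (y + h n) z * f z) - Im (fun z => G y z * f z)) / (S (y + h n) - S y)) @[n --> \oo]
    --> s y * tail f y by exact: cvgM H2 H1.
apply: eq_cvgn L => n /=.
have Sn : S (y + h n) - S y != 0.
  have [hp|hm] := ltP 0 (h n).
    by rewrite gt_eqF// subr_gt0; apply: (S_lt hs); [exact: ltW|rewrite ltrDl].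
  rewrite lt_eqF// subr_lt0; apply: (S_lt hs) => //; rewrite gtrDl lt_neqAle hm andbT; exact: hn.
by field; rewrite hn Sn.
Qed.

Lemma tail_diff (f : R -> R) (y y' : R) : sub f -> y <= y' ->
  tail f y - tail f y' = Im (fun z => (y < z <= y')%R%:R * f z).
Proof.
move=> sf yy; rewrite /tail -ImB; [|exact: (sub_dom hs (tail_sub y sf))|exact: (sub_dom hs (tail_sub y' sf))].
apply: eq_Im => z _; rewrite -mulrBl; congr (_ * _).
rewrite leNgt; case: (ltP y' z) => zy /=; rewrite ?andbF ?andbT ?subr0//.
by rewrite (le_lt_trans yy zy) subrr.
Qed.

Let mbtw (y y' : R) : measurable_fun D (fun z : R => (y < z <= y')%R%:R : R).
Proof.
have -> : (fun z : R => (y < z <= y')%R%:R : R) = (fun z => (y < z)%R%:R * (1 - (y' < z)%R%:R)).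
  apply/funext => z; rewrite leNgt; case: (y < z) => /=; rewrite ?mul0r// mul1r.
  by case: (_ < _); rewrite /= ?subrr ?subr0.
by apply: measurable_funM => //; exact: measurable_funB.
Qed.

(** The tail of the weight serves as a modulus of continuity common to all [f] with the same [C], in
    particular uniform in time for the densities. *)
Lemma tail_lip (f : R -> R) C (y y' : R) : sub f -> (forall v, 0 < v -> `|f v| <= C * rS v) ->
  `|tail f y - tail f y'| <= C * `|tail rS y - tail rS y'|.
Proof.
move=> sf fC; wlog yy : y y' / y <= y'.
  move=> H; have [yy|/ltW yy] := leP y y'; first exact: H.
  by rewrite distrC (distrC (tail rS y)); exact: H.
have srS := rS_sub hs.
have db (g : R -> R) : sub g -> dom (fun z => (y < z <= y')%R%:R * g z).
  move=> sg; have [mg _] := sg; apply: (dom_le _ (sub_dom hs sg)); first exact: measurable_funM.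
  by move=> v _; case: (_ && _); rewrite ?mul1r// mul0r normr0.
have T0 : 0 <= Im (fun z => (y < z <= y')%R%:R * rS z).
  by apply: Im_ge0 => v _; rewrite mulr_ge0// rS_ge0.
rewrite !tail_diff// (ger0_norm T0).
rewrite -ImZ; last exact: db.
apply: normr_Im; [exact: db|by apply: domZ; exact: db|].
move=> v v0; rewrite mulrCA normrM (ger0_norm (_ : 0 <= (_ && _)%:R))// ler_wpM2l//.
exact: fC.
Qed.

Lemma tail_rS_continuous : continuous (tail rS).
Proof.
move=> y; apply/(@cvg_nbhsP _ R^o) => u uy.
have srS := rS_sub hs.
have dt w := sub_dom hs (tail_sub w srS).
rewrite /tail -(Im_neq y (dt y)); apply: (@eq_cvgn _ (fun n => Im (fun z => (z != y)%:R * ((u n < z)%R%:R * rS z)))).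
  by move=> n; rewrite Im_neq//.
have ne : measurable_fun D (fun z : R => (z != y)%:R : R).
  have -> : (fun z : R => (z != y)%:R : R) = \1_(~` [set y]).
    apply/funext => z; rewrite indicE; case: eqVneq => [->|zy].
      by rewrite memNset// => /(_ erefl).
    by rewrite mem_set// => /eqP; rewrite (negbTE zy).
  by apply: measurable_funTS; apply: measurable_indic; exact: measurableC.
apply: (Im_cvg (h := rS)).
- by move=> n; apply: measurable_funM => //; have [] := dt (u n).
- move=> v v0; case: (eqVneq v y) => [_|vy] /=.
    by rewrite mul0r; apply: (@eq_cvgn _ (fun=> 0)); [move=> n; rewrite mul0r|exact: cvg_cst].
  apply: cvgM; first exact: cvg_cst.
  apply: cvgM; last exact: cvg_cst.
  apply: cvg_near_cst; have vy0 : 0 < `|v - y| by rewrite normr_gt0 subr_eq0.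
  have uy' : u n @[n --> \oo] --> y by exact: uy.
  have /cvgrPdist_lt/(_ _ vy0) := uy'; apply: filterS => n un; congr (nat_of_bool _)%:R.
  move: un; rewrite ltr_norml => /andP[]; case: (ltP y v) => yv; last first.
    by rewrite ler0_norm ?subr_le0// => *; apply/negbTE; rewrite -leNgt; lra.
  by rewrite gtr0_norm ?subr_gt0// => *; lra.
- exact: (sub_dom hs srS).
- move=> n v v0; rewrite !normrM (ger0_norm (rS_ge0 v)) -[leRHS]mul1r mulrA ler_wpM2r ?rS_ge0//.
  by case: (_ != _); case: (_ < _); rewrite ?normr1 ?normr0 ?mulr0 ?mul0r ?mulr1.
Qed.

(** Dividing by [mb] turns the speed measure back into Lebesgue measure; this exact length
    normalises the mean-value estimate [tail_step]. *)
Lemma Im_mbV (y y' : R) : 0 < y -> y <= y' ->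
  dom (fun z => (y < z <= y')%R%:R * (mb a s z)^-1) /\ Im (fun z => (y < z <= y')%R%:R * (mb a s z)^-1) = y' - y.
Proof.
move=> y0 yy; have y'0 := lt_le_trans y0 yy.
have mbn z : 0 < z -> mb a s z != 0 by move=> z0; rewrite gt_eqF// (mb_gt0 hs k0 ak).
have cm (z : R) : 0 < z -> {for z, continuous (fun z => (mb a s z)^-1)}.
  by move=> z0; apply: cvgV; [exact: mbn|exact: (mb_continuous hs ca k0 ak)].
have mI : measurable_fun D (fun z => (mb a s z)^-1) by exact: continuous_pos_measurable.
have d : dom (fun z => (y < z <= y')%R%:R * (mb a s z)^-1).
  apply: (sub_dom hs); split; first exact: measurable_funM.
  have cI : {within `[y, y'], continuous (fun z => (mb a s z)^-1)}.
    apply: continuous_in_subspaceT => z /set_mem; rewrite /= in_itv/= => /andP[yz _].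
    by apply: cm; exact: lt_le_trans yz.
  have [c cI' cM] := EVT_max yy cI.
  have c0 : 0 < c by move: cI'; rewrite in_itv/= => /andP[yc _]; exact: lt_le_trans yc.
  exists ((mb a s c)^-1 / rS y) => v v0; case: (boolP (y < v <= y')) => [/andP[yv vy]|_]; last first.
    by rewrite mul0r normr0 !mulr_ge0 ?invr_ge0 ?rS_ge0// (mb_ge0 hs k0 ak).
  rewrite mul1r ger0_norm ?invr_ge0 ?(mb_ge0 hs k0 ak)//.
  have H : (mb a s v)^-1 <= (mb a s c)^-1 by apply: cM; rewrite in_itv/= (ltW yv).
  rewrite -mulrA -[leLHS]mulr1; apply: ler_pM => //; first by rewrite invr_ge0 (mb_ge0 hs k0 ak).
  rewrite mulrC ler_pdivlMr ?rS_gt0// mul1r; apply: (rS_le hs); exact: ltW.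
split => //; apply: EFin_inj; rewrite Im_EFin//; last first.
  by move=> v v0; rewrite mulr_ge0// invr_ge0 (mb_ge0 hs k0 ak).
transitivity (\int[mu]_(v in `]y, y']) (cst 1%E v))%E.
  rewrite [RHS]integral_mkcond; apply: eq_integral => v _; rewrite patchE.
  have -> : (v \in `]y, y']%classic) = (y < v <= y').
    by apply/idP/idP => [/set_mem|H]; [rewrite /= in_itv|apply/mem_set; rewrite /= in_itv].
  case: ifP => [/andP[yv _]|_]; last by rewrite mul0r mulr0.
  by rewrite mul1r mulfV// mbn// (lt_trans y0).
rewrite integral_cst//= mul1e lebesgue_measure_itv/= lte_fin.
by case: ltP => [_|y'y]; [rewrite EFinB|rewrite (@le_anti _ _ y y') ?subrr// yy].
Qed.

Lemma tail_step (f : R -> R) (u u' m e : R) : sub f -> 0 < u -> u <= u' ->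
  (forall z, u < z -> z <= u' -> `|mb a s z * f z - m| <= e) ->
  `|tail f u - tail f u' - m * (u' - u)| <= e * (u' - u).
Proof.
move=> sf u0 uu H; have [d E] := Im_mbV u0 uu.
have [mf [C fC]] := sf.
have d2 : dom (fun z => (u < z <= u')%R%:R * f z).
  apply: (dom_le _ (sub_dom hs sf)); first exact: measurable_funM.
  by move=> v _; case: (_ && _); rewrite ?mul1r// mul0r normr0.
rewrite tail_diff// -E -ImZ// -ImB//; last exact: domZ.
rewrite -ImZ//; apply: normr_Im; [by apply: domB => //; exact: domZ|exact: domZ|].
move=> v v0; have mv : 0 < mb a s v by exact: (mb_gt0 hs k0 ak).
case: (boolP (u < v <= u')) => [/andP[uv vu]|_]; last by rewrite !mul0r !mulr0 subrr normr0.
rewrite !mul1r; have -> : f v - m * (mb a s v)^-1 = (mb a s v * f v - m) * (mb a s v)^-1.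
  by rewrite mulrBl mulrAC mulfV ?mul1r// gt_eqF.
rewrite normrM (ger0_norm (_ : 0 <= (mb a s v)^-1)) ?invr_ge0 ?(ltW mv)//.
by rewrite ler_wpM2r ?invr_ge0 ?(ltW mv)// H.
Qed.

Lemma tail_derive (f : R -> R) (y : R) : sub f -> 0 < y -> {for y, continuous f} ->
  is_derive y 1 (tail f) (- (mb a s y * f y)).
Proof.
move=> sf y0 cf.
have cm : mb a s z * f z @[z --> y] --> mb a s y * f y.
  by apply: cvgM; [exact: (mb_continuous hs ca k0 ak)|exact: cf].
have L : h^-1 *: ((tail f \o shift y) (h *: 1) - tail f y) @[h --> 0^'] --> - (mb a s y * f y).
  apply/cvgrPdist_le => e e0.
  have /cvgrPdist_le/(_ _ e0)/nbhs_ballP[del /= del0 H] := cm.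
  near=> h.
  have h0 : h != 0 by near: h; exact: nbhs_dnbhs_neq.
  have hd : `|h| < del by near: h; exact: dnbhs0_lt.
  have hy : `|h| < y by near: h; exact: dnbhs0_lt.
  have Hz z : `|y - z| <= `|h| -> `|mb a s z * f z - mb a s y * f y| <= e.
    by move=> yz; rewrite distrC; apply: H; exact: le_lt_trans hd.
  rewrite /= /GRing.scale/= mulr1 (addrC h y).
  have -> : - (mb a s y * f y) - h^-1 * (tail f (y + h) - tail f y) =
    h^-1 * (tail f y - tail f (y + h) - mb a s y * f y * h) by field.
  rewrite normrM normfV ler_pdivrMl ?normr_gt0// [leRHS]mulrC.
  have [hp|hm] := ltP 0 h.
    have P1 z : y < z -> z <= y + h -> `|mb a s z * f z - mb a s y * f y| <= e.
      move=> yz zy; apply: Hz; rewrite (gtr0_norm hp) ltr0_norm ?subr_lt0//.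
      by rewrite opprB lerBlDl.
    have yyh : y <= y + h by rewrite lerDl ltW.
    have := tail_step sf y0 yyh P1.
    by rewrite (_ : y + h - y = h) ?(gtr0_norm hp)//; ring.
  have hm' : h < 0 by rewrite lt_neqAle h0.
  have yh0 : 0 < y + h by rewrite (ltr0_norm hm') in hy; lra.
  have P1 z : y + h < z -> z <= y -> `|mb a s z * f z - mb a s y * f y| <= e.
    move=> yz zy; apply: Hz; rewrite (ltr0_norm hm') ger0_norm ?subr_ge0//; lra.
  have yyh : y + h <= y by rewrite gerDl.
  have := tail_step sf yh0 yyh P1.
  rewrite (_ : y - (y + h) = - h); last by ring.
  rewrite (ltr0_norm hm') -normrN.
  by rewrite (_ : - (tail f (y + h) - tail f y - mb a s y * f y * - h) =
    tail f y - tail f (y + h) - mb a s y * f y * h) //; ring.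
by split; [apply/cvg_ex; exists (- (mb a s y * f y)); exact: L|apply/cvg_lim => //; exact: L].
Unshelve. all: by end_near. Qed.

Variable kp : nat -> R -> R -> R.
Hypothesis kpD : forall j (t y : R), 0 < t -> 0 < y -> is_derive t 1 (fun u => kp j u y) (- kp j.+1 t y).
Hypothesis kpB : forall j t0, 0 < t0 -> exists2 C, 0 <= C & forall t y, t0 <= t -> 0 < y -> `|kp j t y| <= C * rS y.
Hypothesis kpM : forall j t, 0 < t -> measurable_fun D (kp j t).
Hypothesis kpI : forall j t y, 0 < t -> 0 < y -> kp j t y = Im (fun z => G y z * kp j.+1 t z).

Lemma kp_sub j t : 0 < t -> sub (kp j t).
Proof.
move=> t0; split; first exact: kpM.
by have [C C0 CP] := kpB j t0; exists C => v v0; exact: CP.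
Qed.

Lemma kp_mvt j t t' y : 0 < t -> t <= t' -> 0 < y ->
  exists2 u, t <= u <= t' & kp j t' y - kp j t y = - kp j.+1 u y * (t' - t).
Proof.
move=> t0 tt y0.
have cf : {within `[t, t'], continuous (fun u => kp j u y)}.
  apply: continuous_in_subspaceT => u /set_mem; rewrite /= in_itv/= => /andP[tu _].
  apply: differentiable_continuous; apply/derivable1_diffP.
  by have [] := @kpD j u y (lt_le_trans t0 tu) y0.
have [|u uI E] := @MVT_segment R (fun u => kp j u y) (fun u => - kp j.+1 u y) t t' tt _ cf.
  by move=> u; rewrite in_itv/= => /andP[tu _]; apply: kpD => //; exact: lt_trans tu.
by exists u => //; move: uI; rewrite in_itv.
Qed.

Lemma kp_lip j t0 : 0 < t0 -> exists2 C, 0 <= C & forall t t' y, t0 <= t -> t0 <= t' -> 0 < y ->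
  `|kp j t y - kp j t' y| <= C * `|t - t'| * rS y.
Proof.
move=> t00; have [C C0 CP] := kpB j.+1 t00; exists C => // t t' y tt tt' y0.
wlog le : t t' tt tt' / t <= t'.
  move=> H; have [le|/ltW le] := leP t t'; first exact: H.
  by rewrite distrC (distrC t); exact: H.
have [u /andP[tu _] E] := kp_mvt j (lt_le_trans t00 tt) le y0.
rewrite distrC E normrM normrN (distrC t) mulrAC ler_wpM2r//.
by apply: CP => //; exact: le_trans tu.
Qed.

Lemma kp_dy j (t y : R) : 0 < t -> 0 < y -> is_derive y 1 (kp j t) (s y * tail (kp j.+1 t) y).
Proof.
move=> t0 y0; have := Im_G_derive (kp_sub j.+1 t0) y0.
apply: near_eq_is_derive; near=> z; rewrite kpI//; near: z; exact: lt_nbhsr.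
Unshelve. all: by end_near. Qed.

Lemma kp_cont_y j (t y : R) : 0 < t -> 0 < y -> {for y, continuous (kp j t)}.
Proof.
move=> t0 y0; apply: differentiable_continuous; apply/derivable1_diffP.
by have [] := kp_dy j t0 y0.
Qed.

(** Separate continuity is enough because the modulus in the second variable is uniform over times
    near [t]. *)
Lemma joint_continuous (g : R -> R -> R) (w : R -> R) (t y C : R) : 0 < t -> 0 < y ->
  {for y, continuous w} -> {for t, continuous (g ^~ y)} ->
  (forall t' y', t / 2 <= t' -> 0 < y' -> `|g t' y - g t' y'| <= C * `|w y - w y'|) ->
  {for (t, y), continuous (fun z : R * R => g z.1 z.2)}.
Proof.
move=> t0 y0 cw cg gC; apply/cvgrPdist_le => e e0.
have e20 : 0 < e / 2 by rewrite divr_gt0.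
have eC : 0 < e / 2 / (`|C| + 1) by rewrite divr_gt0// ltr_wpDl.
have t2 : t / 2 < t by rewrite ltr_pdivrMr// ltr_pMr// ltr1n.
have F1 : fst z @[z --> (t, y)] --> t by exact: cvg_fst.
have F2 : snd z @[z --> (t, y)] --> y by exact: cvg_snd.
have /cvgr_gt /(_ _ t2) N1 := F1.
have /cvgr_gt /(_ _ y0) N2 := F2.
have N3 : \forall z \near (t, y), `|w y - w z.2| <= e / 2 / (`|C| + 1).
  have cw2 : (w \o snd) z @[z --> (t, y)] --> w y by exact: cvg_comp F2 cw.
  by move/cvgrPdist_le: cw2 => /(_ _ eC).
have N4 : \forall z \near (t, y), `|g t y - g z.1 y| <= e / 2.
  have cg2 : ((g ^~ y) \o fst) z @[z --> (t, y)] --> g t y by exact: cvg_comp F1 cg.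
  by move/cvgrPdist_le: cg2 => /(_ _ e20).
near=> z.
have z1 : t / 2 <= z.1 by apply: ltW; near: z; exact: N1.
have z2 : 0 < z.2 by near: z; exact: N2.
have E1 : `|w y - w z.2| <= e / 2 / (`|C| + 1) by near: z; exact: N3.
have E2 : `|g t y - g z.1 y| <= e / 2 by near: z; exact: N4.
have -> : g t y - g z.1 z.2 = (g t y - g z.1 y) + (g z.1 y - g z.1 z.2) by ring.
rewrite (le_trans (ler_normD _ _))// [leRHS]splitr lerD//.
apply: (le_trans (gC _ _ z1 z2)); apply: (le_trans (ler_wpM2r (normr_ge0 _) (ler_norm C))).
apply: (le_trans (ler_wpM2l (normr_ge0 _) E1)); apply: mulr_frac_le => //; exact: ltW.
Unshelve. all: by end_near. Qed.

Lemma kp_joint j (t y : R) : 0 < t -> 0 < y -> {for (t, y), continuous (fun z : R * R => kp j z.1 z.2)}.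
Proof.
move=> t0 y0; have t20 : 0 < t / 2 by rewrite divr_gt0.
have [C C0 CP] := kpB j.+1 t20.
apply: (@joint_continuous _ S t y (C * Jint)) => //.
- exact: (S_continuous hs).
- apply: differentiable_continuous; apply/derivable1_diffP.
  by have [] := kpD j t0 y0.
move=> t' y' tt y'0; have t'0 := lt_le_trans t20 tt; have sk := kp_sub j.+1 t'0.
rewrite !kpI// (le_trans (Im_G_lip hs ca k0 ak sk y0 y'0))// ler_wpM2r// -ImZ; last exact: (sub_dom hs (rS_sub hs)).
apply: Im_le.
- apply: (dom_le _ (sub_dom hs sk)); first by apply: measurableT_comp => //; case: sk.
  by move=> v _; rewrite normr_id.
- by apply: domZ; exact: (sub_dom hs (rS_sub hs)).
- by move=> v v0; exact: CP.
Qed.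

Lemma tail_kp_lip j t0 (y : R) : 0 < t0 -> exists2 C, 0 <= C & forall t t', t0 <= t -> t0 <= t' ->
  `|tail (kp j t) y - tail (kp j t') y| <= C * `|t - t'|.
Proof.
move=> t00; have [C C0 CP] := kp_lip j t00; have srS := rS_sub hs.
have T0 : 0 <= tail rS y by apply: Im_ge0 => v _; rewrite mulr_ge0// rS_ge0.
exists (C * tail rS y) => [|t t' tt tt']; first exact: mulr_ge0.
have s1 := kp_sub j (lt_le_trans t00 tt); have s2 := kp_sub j (lt_le_trans t00 tt').
have d1 := sub_dom hs (tail_sub y s1); have d2 := sub_dom hs (tail_sub y s2).
rewrite -ImB// mulrAC /tail -ImZ; last exact: (sub_dom hs (tail_sub y srS)).
apply: normr_Im; [exact: domB|by apply: domZ; exact: (sub_dom hs (tail_sub y srS))|].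
move=> v v0; rewrite -mulrBr normrM (ger0_norm (_ : 0 <= _%:R))// mulrCA ler_wpM2l//.
exact: CP.
Qed.

Lemma tail_kp_joint j (t y : R) : 0 < t -> 0 < y ->
  {for (t, y), continuous (fun z : R * R => tail (kp j z.1) z.2)}.
Proof.
move=> t0 y0; have t20 : 0 < t / 2 by rewrite divr_gt0.
have t2 : t / 2 < t by rewrite ltr_pdivrMr// ltr_pMr// ltr1n.
have [C C0 CP] := kpB j t20.
apply: (@joint_continuous (fun t y => tail (kp j t) y) (tail rS) t y C) => //.
- exact: tail_rS_continuous.
- have [K K0 KP] := tail_kp_lip j y t20.
  apply/cvgrPdist_le => e e0; near=> t'.
  have tt' : t / 2 <= t' by apply: ltW; near: t'; exact: lt_nbhsr.
  apply: (le_trans (KP t t' (ltW t2) tt')).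
  have tt : `|t - t'| <= e / (K + 1).
    by near: t'; apply: cvgr_dist_le => //; rewrite divr_gt0// ltr_wpDl.
  apply: (le_trans (ler_wpM2l K0 tt)); apply: mulr_frac_le => //; exact: ltW.
move=> t' y' tt y'0; have t'0 := lt_le_trans t20 tt.
by apply: tail_lip; [exact: kp_sub|move=> v v0; exact: CP].
Unshelve. all: by end_near. Qed.

(** The mean value theorem and the Lipschitz bound of the next derivative give a pointwise remainder
    of order h^2 times the weight, which the speed measure integrates. *)
Lemma Im_kp_derive j (t : R) : 0 < t -> is_derive t 1 (fun u => Im (kp j u)) (- Im (kp j.+1 t)).
Proof.
move=> t0; have t20 : 0 < t / 2 by rewrite divr_gt0.
have t2 : t / 2 <= t by rewrite ler_pdivrMr// ler_peMr ?ler1n// ltW.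
have [C C0 CP] := kp_lip j.+1 t20.
have J0 : 0 <= Jint by exact: Jint_ge0.
apply: (@is_derive_quad_near _ t _ (C * Jint) (t / 2)) => //; first exact: mulr_ge0.
move=> h; rewrite ler_norml => /andP[h1 h2].
have th : t / 2 <= t + h by rewrite {2}(splitr t); lra.
have th0 := lt_le_trans t20 th.
have s1 := kp_sub j th0; have s2 := kp_sub j t0; have s3 := kp_sub j.+1 t0.
have d1 := sub_dom hs s1; have d2 := sub_dom hs s2; have d3 := sub_dom hs s3.
have -> : Im (kp j (t + h)) - Im (kp j t) - - Im (kp j.+1 t) * h =
    Im (fun v => (kp j (t + h) v - kp j t v) - (- h) * kp j.+1 t v).
  rewrite (ImB (domB d1 d2) (domZ _ d3)) (ImB d1 d2) (ImZ _ d3); ring.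
rewrite mulrAC -ImZ; last exact: (sub_dom hs (rS_sub hs)).
apply: normr_Im; [by apply: domB; [exact: domB|exact: domZ]|by apply: domZ; exact: (sub_dom hs (rS_sub hs))|].
move=> v v0.
have key u : t / 2 <= u -> `|t - u| <= `|h| -> `|- kp j.+1 u v * h - - h * kp j.+1 t v| <= C * h ^+ 2 * rS v.
  move=> tu uh; have -> : - kp j.+1 u v * h - - h * kp j.+1 t v = (kp j.+1 t v - kp j.+1 u v) * h by ring.
  rewrite normrM -real_normK ?num_real// expr2 mulrA [leRHS]mulrAC ler_wpM2r//.
  by apply: (le_trans (CP _ _ _ t2 tu v0)); rewrite ler_wpM2r ?rS_ge0// ler_wpM2l.
have [hp|hm] := leP 0 h.
  have tth : t <= t + h by rewrite lerDl.
  have [u /andP[u1 u2] ->] := kp_mvt j t0 tth v0.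
  rewrite (addrC t) addrK; apply: key; first exact: le_trans u1.
  by rewrite (ger0_norm hp) ler0_norm ?subr_le0// opprB lerBlDl.
have tth : t + h <= t by rewrite gerDl ltW.
have [u /andP[u1 u2] E] := kp_mvt j th0 tth v0.
have -> : kp j (t + h) v - kp j t v = - kp j.+1 u v * h.
  by rewrite -opprB E; ring.
apply: key; first exact: le_trans u1.
by rewrite (ltr0_norm hm) ger0_norm ?subr_ge0//; lra.
Qed.

Variables a1 a2 b1 : R -> R.
Hypothesis ad : forall y : R, is_derive y 1 a (a1 y).
Hypothesis ad2 : forall y : R, is_derive y 1 a1 (a2 y).
Hypothesis bd : forall y : R, is_derive y 1 b (b1 y).
Hypotheses (ca2 : continuous a2) (cb1 : continuous b1).

Definition dens t y := mb a s y * kp 0%N t y.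
(** Logarithmic derivative of [mb]: the scale equation turns s' / s into - 2 b / a. *)
Let q y := (2 * b y - a1 y) / a y.
Let q1 y := ((2 * b1 y - a2 y) * a y - (2 * b y - a1 y) * a1 y) / a y ^+ 2.
Let T1 t y := tail (kp 1%N t) y.
(** First derivative of the density in y, and [P2] the second. No derivative of [s] remains: that of
    [kp 0] is s T1, and mb s = 2 / a. *)
Let P1 t y := q y * dens t y + 2 / a y * T1 t y.
Let P2 t y := q1 y * dens t y + q y * P1 t y - 2 * a1 y / a y ^+ 2 * T1 t y
  - 2 / a y * (mb a s y * kp 1%N t y).

Let an0 y : 0 < y -> a y != 0. Proof. by move=> y0; rewrite gt_eqF// (speed_a_gt0 k0 ak). Qed.
Let sn0 y : 0 < y -> s y != 0. Proof. by move=> y0; rewrite gt_eqF// (sc_gt0 hs)// ltW. Qed.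

Let cont_d (f : R -> R) (y l : R) : is_derive y 1 f l -> {for y, continuous f}.
Proof. by move=> [df _]; apply: differentiable_continuous; exact/derivable1_diffP. Qed.

Lemma mb_dy (y : R) : 0 < y -> is_derive y 1 (mb a s) (mb a s y * q y).
Proof.
move=> y0; have n1 := an0 y0; have n2 := sn0 y0.
have H1 := is_deriveM (ad y) (sc_s hs y).
have nn : (a * s) y != 0 by rewrite mulf_neq0.
have H2 := is_deriveZ (2 : R) (is_deriveV nn H1).
have ode := sc_ode hs (ltW y0).
have sdE : sd y = - 2 * b y * s y / a y.
  have n3 : 2^-1 * a y != 0 by rewrite mulf_neq0// invr_neq0.
  apply: (mulfI n3); have -> : 2^-1 * a y * (- 2 * b y * s y / a y) = - (b y * s y) by field.
  by apply/eqP; rewrite -addr_eq0 addrC ode.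
have E : 2 *: (- (a * s) y ^- 2 *: (a y *: sd y + s y *: a1 y)) = mb a s y * q y.
  change (2 * (- ((a y * s y) ^- 2) * (a y * sd y + s y * a1 y)) = mb a s y * q y).
  by rewrite mbE// /q sdE; field; rewrite n1 n2.
rewrite E in H2; apply: near_eq_is_derive H2; near=> z.
have z0 : 0 < z by near: z; exact: lt_nbhsr.
by rewrite mbE.
Unshelve. all: by end_near. Qed.

Lemma dens_dy (t y : R) : 0 < t -> 0 < y -> is_derive y 1 (dens t) (P1 t y).
Proof.
move=> t0 y0; have := is_deriveM (mb_dy y0) (kp_dy 0%N t0 y0).
rewrite (_ : _ *: _ + _ *: _ = P1 t y)//.
rewrite /P1 /dens /T1 /GRing.scale/= (mulrA (mb a s y)) {1}mbE//.
have -> : 2 / (a y * s y) * s y = 2 / a y by field; rewrite an0// sn0.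
ring.
Qed.

Lemma dens_dt (t y : R) : 0 < t -> 0 < y -> is_derive t 1 (dens ^~ y) (- (mb a s y * kp 1%N t y)).
Proof.
move=> t0 y0; have := is_deriveZ (mb a s y) (kpD 0%N t0 y0).
by rewrite /GRing.scale/= mulrN.
Qed.

Let q_dy (y : R) : 0 < y -> is_derive y 1 q (q1 y).
Proof.
move=> y0; have n1 := an0 y0.
have H := is_deriveM (is_deriveB (is_deriveZ (2 : R) (bd y)) (ad2 y)) (is_deriveV n1 (ad y)).
move: H; rewrite (_ : _ *: _ + _ *: _ = q1 y)//.
change ((2 * b y - a1 y) * (- (a y ^- 2) * a1 y) + (a y)^-1 * (2 * b1 y - a2 y) = q1 y).
by rewrite /q1; field; rewrite n1.
Qed.

Let T1_dy (t y : R) : 0 < t -> 0 < y -> is_derive y 1 (T1 t) (- (mb a s y * kp 1%N t y)).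
Proof. by move=> t0 y0; apply: tail_derive => //; [exact: kp_sub|exact: kp_cont_y]. Qed.

Let inv_dy (y : R) : 0 < y -> is_derive y 1 (fun z => 2 / a z) (- 2 * a1 y / a y ^+ 2).
Proof.
move=> y0; have n1 := an0 y0; have := is_deriveZ (2 : R) (is_deriveV n1 (ad y)).
rewrite (_ : 2 *: _ = - 2 * a1 y / a y ^+ 2)//.
by rewrite /GRing.scale/=; ring.
Qed.

Lemma P1_dy (t y : R) : 0 < t -> 0 < y -> is_derive y 1 (P1 t) (P2 t y).
Proof.
move=> t0 y0.
have := is_deriveD (is_deriveM (q_dy y0) (dens_dy t0 y0)) (is_deriveM (inv_dy y0) (T1_dy t0 y0)).
rewrite (_ : _ + _ = P2 t y)//.
by rewrite /P2 /GRing.scale/=; ring.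
Qed.

Let posnear (t y : R) : 0 < t -> 0 < y -> \forall z \near (t, y), 0 < z.1 /\ 0 < z.2.
Proof.
move=> t0 y0.
have F1 : fst z @[z --> (t, y)] --> t by exact: cvg_fst.
have F2 : snd z @[z --> (t, y)] --> y by exact: cvg_snd.
have /cvgr_gt /(_ _ t0) N1 := F1; have /cvgr_gt /(_ _ y0) N2 := F2.
by apply: filterS2 N1 N2.
Qed.

Let near_continuous (f g : R * R -> R) (x : R * R) : (\forall z \near x, f z = g z) ->
  {for x, continuous f} -> {for x, continuous g}.
Proof.
move=> fg cf; rewrite /prop_for /continuous_at -(nbhs_singleton fg).
apply: cvg_trans cf; apply: near_eq_cvg.
by apply: filterS fg => z ->.
Qed.

Let c_snd (u : R -> R) (t y : R) : {for y, continuous u} -> {for (t, y), continuous (fun z : R * R => u z.2)}.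
Proof.
move=> cu; have F2 : snd z @[z --> (t, y)] --> y by exact: cvg_snd.
exact: cvg_comp F2 cu.
Qed.

Let c_mul (f g : R * R -> R) x : {for x, continuous f} -> {for x, continuous g} ->
  {for x, continuous (fun z => f z * g z)}.
Proof. by move=> cf cg; exact: cvgM cf cg. Qed.

Let c_add (f g : R * R -> R) x : {for x, continuous f} -> {for x, continuous g} ->
  {for x, continuous (fun z => f z + g z)}.
Proof. by move=> cf cg; exact: cvgD cf cg. Qed.

Let c_opp (f : R * R -> R) x : {for x, continuous f} -> {for x, continuous (fun z => - f z)}.
Proof. by move=> cf; exact: cvgN cf. Qed.

Let c_dens (t y : R) : 0 < t -> 0 < y -> {for (t, y), continuous (fun z : R * R => dens z.1 z.2)}.
Proof.
move=> t0 y0; apply: c_mul; last exact: kp_joint.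
by apply: c_snd; exact: (mb_continuous hs ca k0 ak).
Qed.

Let c_mkp (t y : R) : 0 < t -> 0 < y -> {for (t, y), continuous (fun z : R * R => mb a s z.2 * kp 1%N z.1 z.2)}.
Proof.
move=> t0 y0; apply: c_mul; last exact: kp_joint.
by apply: c_snd; exact: (mb_continuous hs ca k0 ak).
Qed.

Let c_q1 (y : R) : 0 < y -> {for y, continuous q1}.
Proof.
move=> y0; have n1 := an0 y0.
have cb0 : b z @[z --> y] --> b y by exact: (cont_d (bd y)).
have ca1 : a1 z @[z --> y] --> a1 y by exact: (cont_d (ad2 y)).
have cc2 : 2 * b z - a1 z @[z --> y] --> 2 * b y - a1 y by apply: cvgB => //; apply: cvgM => //; exact: cvg_cst.
rewrite /prop_for /continuous_at /q1; apply: cvgM.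
  apply: cvgB; last exact: cvgM.
  apply: cvgM; last exact: ca.
  apply: cvgB; last exact: ca2.
  by apply: cvgM; [exact: cvg_cst|exact: cb1].
apply: cvgV; first by rewrite expf_neq0.
by rewrite expr2; apply: cvgM; exact: ca.
Qed.

Let c_P1 (t y : R) : 0 < t -> 0 < y -> {for (t, y), continuous (fun z : R * R => P1 z.1 z.2)}.
Proof.
move=> t0 y0; apply: c_add; apply: c_mul.
- by apply: c_snd; exact: (cont_d (q_dy y0)).
- exact: c_dens.
- by apply: (@c_snd (fun y => 2 / a y)); exact: (cont_d (inv_dy y0)).
- exact: tail_kp_joint.
Qed.

Let c_P2 (t y : R) : 0 < t -> 0 < y -> {for (t, y), continuous (fun z : R * R => P2 z.1 z.2)}.
Proof.
move=> t0 y0; apply: c_add; last first.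
  apply: c_opp; apply: c_mul; last exact: c_mkp.
  by apply: (@c_snd (fun y => 2 / a y)); exact: (cont_d (inv_dy y0)).
apply: c_add; last first.
  apply: c_opp; apply: c_mul; last exact: tail_kp_joint.
  apply: (@c_snd (fun y => 2 * a1 y / a y ^+ 2)); apply: cvgM.
    by apply: cvgM; [exact: cvg_cst|exact: (cont_d (ad2 y))].
  apply: cvgV; first by rewrite expf_neq0// an0.
  by rewrite expr2; apply: cvgM; exact: ca.
apply: c_add; apply: c_mul.
- by apply: c_snd; exact: c_q1.
- exact: c_dens.
- by apply: c_snd; exact: (cont_d (q_dy y0)).
- exact: c_P1.
Qed.

Let derive1_dens (t y : R) : 0 < t -> 0 < y -> derive1 (dens t) y = P1 t y.
Proof. by move=> t0 y0; rewrite derive1E; have [] := dens_dy t0 y0. Qed.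

Let derive1_dens_near (t y : R) : 0 < t -> 0 < y -> \forall z \near y, P1 t z = derive1 (dens t) z.
Proof.
move=> t0 y0; near=> z; rewrite derive1_dens//; near: z; exact: lt_nbhsr.
Unshelve. all: by end_near. Qed.

Let derive1_dens_dy (t y : R) : 0 < t -> 0 < y -> is_derive y 1 (derive1 (dens t)) (P2 t y).
Proof. by move=> t0 y0; apply: near_eq_is_derive (derive1_dens_near t0 y0) (P1_dy t0 y0). Qed.

Lemma dens_C12 : C12 dens.
Proof.
move=> t y t0 y0; split; first split.
- by have [] := dens_dt t0 y0.
- by have [] := dens_dy t0 y0.
- by have [] := derive1_dens_dy t0 y0.
have N := posnear t0 y0; split.
- exact: c_dens.
- apply: (@near_continuous (fun z : R * R => - (mb a s z.2 * kp 1%N z.1 z.2))); last first.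
    by apply: c_opp; exact: c_mkp.
  apply: filterS N => z [z1 z2]; rewrite derive1E.
  by have [_ ->] := dens_dt z1 z2.
- apply: (@near_continuous (fun z : R * R => P1 z.1 z.2)); last exact: c_P1.
  by apply: filterS N => z [z1 z2]; rewrite derive1_dens.
- apply: (@near_continuous (fun z : R * R => P2 z.1 z.2)); last exact: c_P2.
  apply: filterS N => z [z1 z2]; rewrite /derive1n/= derive1E.
  by have [_ ->] := derive1_dens_dy z1 z2.
Qed.

(** Subtracting 2 b p leaves 2 T1: up to sign, the probability flux is the tail of [kp 1]. *)
Let ap_dy (t y : R) : 0 < t -> 0 < y ->
  is_derive y 1 (fun z => a z * dens t z) (2 * (b y * dens t y) + 2 * T1 t y).
Proof.
move=> t0 y0; have := is_deriveM (ad y) (dens_dy t0 y0).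
rewrite (_ : _ *: _ + _ *: _ = 2 * (b y * dens t y) + 2 * T1 t y)//.
by rewrite /P1 /q /GRing.scale/=; field; rewrite an0.
Qed.

Let bp_dy (t y : R) : 0 < t -> 0 < y ->
  is_derive y 1 (fun z => b z * dens t z) (b1 y * dens t y + b y * P1 t y).
Proof.
move=> t0 y0; have := is_deriveM (bd y) (dens_dy t0 y0).
rewrite (_ : _ *: _ + _ *: _ = b1 y * dens t y + b y * P1 t y)//.
by rewrite /GRing.scale/=; ring.
Qed.

(** By [ap_dy] the right-hand side collapses to the derivative of the tail [T1], which is - mb kp 1,
    the time derivative of the density. *)
Lemma dens_Fokker_Planck (t y : R) : 0 < t -> 0 < y ->
  derive1 (dens ^~ y) t = - derive1 (fun z => b z * dens t z) y
    + 2^-1 * derive1n 2 (fun z => a z * dens t z) y.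
Proof.
move=> t0 y0; rewrite derive1E; have [_ ->] := dens_dt t0 y0.
rewrite derive1E; have [_ ->] := bp_dy t0 y0.
have H : is_derive y 1 (derive1 (fun z => a z * dens t z))
    (2 * (b1 y * dens t y + b y * P1 t y) + 2 * - (mb a s y * kp 1%N t y)).
  have H := is_deriveD (is_deriveZ (2 : R) (bp_dy t0 y0)) (is_deriveZ (2 : R) (T1_dy t0 y0)).
  apply: near_eq_is_derive H; near=> z.
  have z0 : 0 < z by near: z; exact: lt_nbhsr.
  by rewrite derive1E; have [_ ->] := ap_dy t0 z0.
rewrite /derive1n/= derive1E; have [_ ->] := H.
by field.
Unshelve. all: by end_near. Qed.

Lemma tail0 (f : R -> R) : tail f 0 = Im f.
Proof. by apply: eq_Im => v v0; rewrite v0 mul1r. Qed.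

(** As a mb = 2 / s, the function is 2 / s times the potential of [kp 1], and near 0 that potential
    is equivalent to S times the full mass of [kp 1]. At 0 the default value of [mb] makes it
    vanish, in agreement with the limit. *)
Lemma dens_boundary (t : R) : 0 < t -> is_right_derive (fun y => a y * dens t y) 0 (2 * Im (kp 1%N t)).
Proof.
move=> t0; rewrite /is_right_derive; apply/cvg_at_rightP => u [u0 ul].
have un n : u n != 0 by rewrite gt_eqF.
have uh n : 0 <= 0 + u n by rewrite add0r ltW.
have H1 := Im_quot_cvg (kp_sub 1%N t0) (lexx 0) un uh ul.
have H2 := is_derive_cvg_seq (sc_S hs 0) ul un.
have s0 : s 0 != 0 by rewrite gt_eqF// (sc_gt0 hs).
have us : (s (u n))^-1 @[n --> \oo] --> (s 0)^-1.
  apply: cvgV => //; have cs := s_continuous hs (x := 0).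
  by apply: continuous_cvg => //; exact: cs.
have L : 2 * (s (u n))^-1 * ((S (0 + u n) - S 0) / u n * ((Im (fun z => G (0 + u n) z * kp 1%N t z) - Im (fun z => G 0 z * kp 1%N t z)) / (S (0 + u n) - S 0))) @[n --> \oo]
   --> 2 * (s 0)^-1 * (s 0 * tail (kp 1%N t) 0).
  by apply: cvgM; [apply: cvgM => //; exact: cvg_cst|exact: cvgM H2 H1].
have <- : 2 * (s 0)^-1 * (s 0 * tail (kp 1%N t) 0) = 2 * Im (kp 1%N t) by rewrite tail0; field.
apply: eq_cvgn L => n.
have d0 : dens t 0 = 0 by rewrite /dens /mb ltxx mul0r.
have I0 : Im (fun z => G 0 z * kp 1%N t z) = 0.
  transitivity (Im (fun z => 0 * rS z)); first by apply: eq_Im => z z0; rewrite G_neg// !mul0r.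
  by rewrite ImZ ?mul0r//; apply: (sub_dom hs); exact: (rS_sub hs).
rewrite I0 (sc_S0 hs) !subr0 !add0r d0 mulr0 subr0 /dens -kpI// mbE//.
have Sn : S (u n) != 0 by rewrite gt_eqF// (S_gt0 hs).
by field; rewrite un Sn an0// sn0.
Qed.
End Regularity.

(** * Occupation formula *)

Section Occupation.
Context {R : realType}.
Notation mu := (@lebesgue_measure R).
Notation D := (`]0, +oo[%classic : set R).
Variables (a b s sd S : R -> R).
Hypothesis hs : scale_fun a b s sd S.
Hypothesis ca : continuous a.
Variable k : R.
Hypotheses (k0 : 0 < k) (ak : forall y, 0 <= y -> k * (y * (1 + y)) <= a y).
Local Notation rS := (rS S).
Local Notation G := (G S).
Local Notation sub := (sub S).
Local Notation dom := (dom S).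
Local Notation mm := (mm hs ca k0 ak).
Local Notation Im := (Im hs ca k0 ak).
Local Notation ImD := (ImD hs ca k0 ak).
Local Notation ImB := (ImB hs ca k0 ak).
Local Notation ImZ := (ImZ hs ca k0 ak).
Local Notation eq_Im := (eq_Im hs ca k0 ak).
Local Notation Im_ge0 := (Im_ge0 hs ca k0 ak).
Local Notation Im_le := (Im_le hs ca k0 ak).
Local Notation normr_Im := (normr_Im hs ca k0 ak).
Local Notation kappa := (kappa hs ca k0 ak).
Local Notation Jint := (Jint hs ca k0 ak).
Local Notation subM := (subM hs).
Local Notation G_ge0 := (G_ge0 hs).
Local Notation G_rS := (G_rS hs).
Local Notation G_neg := (G_neg hs).
Local Notation G_sub := (G_sub hs).
Local Notation rS_gt0 := (rS_gt0 hs).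
Local Notation rS_ge0 := (rS_ge0 S).
Context {d : measure_display} {T : measurableType d}.
Variables (P : probability T R) (F : R -> set (set T)) (B : R -> T -> R) (Q : R -> R.-pker R ~> R) (sigma : R -> R).
Hypotheses (hF : is_filtration F) (hB : is_brownian_motion P F B).
Hypotheses (cb : continuous b) (csigma : continuous sigma).
Hypothesis sa : forall y, 0 <= y -> sigma y ^+ 2 = a y.
Hypothesis hW : well_posed_absorbed P F B b sigma.
Hypothesis hQ : is_transition_kernel P F B b sigma Q.
Local Notation tail := (tail hs ca k0 ak).
Local Notation mb := (mb a s).
Lemma tail_lo (f : R -> R) (y0 y : R) : (forall v, v <= y0 -> f v = 0) -> y <= y0 -> tail f y = Im f.
Proof.
move=> f0 yy; apply: eq_Im => v v0; have [//|vy] := ltP y v; first by rewrite mul1r.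
by rewrite mul0r f0// (le_trans vy).
Qed.

Lemma tail_derive_all (f : R -> R) (y0 : R) : sub f -> continuous f -> 0 < y0 ->
  (forall v, v <= y0 -> f v = 0) -> forall y : R, is_derive y 1 (tail f) (- (mb y * f y)).
Proof.
move=> sf cf y00 f0 y; have [yp|yn] := ltP 0 y.
  by apply: (tail_derive hs ca k0 ak sf yp); exact: cf.
rewrite f0 ?mulr0 ?oppr0; last exact: le_trans yn (ltW y00).
have H := @is_derive_cst R R^o R^o (Im f) y 1; apply: near_eq_is_derive H.
near=> v; rewrite (tail_lo f0)//; apply: ltW; near: v.
exact: lt_nbhsl (le_lt_trans yn y00).
Unshelve. all: by end_near. Qed.

Section Potential.
Variables (f0 : R -> R) (y0 N : R).
Hypotheses (cf0 : continuous f0) (f0b : forall v, 0 <= f0 v <= 1) (y00 : 0 < y0).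
Hypotheses (f0l : forall v, v <= y0 -> f0 v = 0) (f0r : forall v, N <= v -> f0 v = 0).

Lemma f0_rS v : 0 < v -> f0 v <= (rS y0)^-1 * rS v.
Proof.
move=> v0; have [h|h] := leP v y0.
  by rewrite f0l// mulr_ge0 ?rS_ge0// invr_ge0 rS_ge0.
have /andP[_ f1] := f0b v; apply: (le_trans f1).
rewrite mulrC ler_pdivlMr ?rS_gt0// mul1r.
by apply: (rS_le hs); exact: ltW.
Qed.

Lemma f0_sub : sub f0.
Proof.
split; first exact: measurable_funTS (continuous_measurable_fun cf0).
exists (rS y0)^-1 => v v0; rewrite ger0_norm; first exact: f0_rS.
by have /andP[] := f0b v.
Qed.

Lemma Sf0_sub : sub (fun v => S v * f0 v).
Proof.
have cS := S_continuous hs.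
split.
  apply: measurable_funM; apply: measurable_funTS; exact: continuous_measurable_fun.
exists (S (Num.max 0 N) * (rS y0)^-1) => v v0.
have /andP[f0v _] := f0b v.
have Sv : 0 <= S v by apply: (S_ge0 hs); exact: ltW.
rewrite ger0_norm ?mulr_ge0//.
have m0 : 0 <= Num.max 0 N by rewrite le_max lexx.
have [h|h] := leP N v.
  rewrite f0r// mulr0 mulr_ge0 ?rS_ge0// mulr_ge0 ?invr_ge0 ?rS_ge0//; exact: (S_ge0 hs).
rewrite -mulrA ler_pM//; last exact: f0_rS.
by apply: (S_le hs); [exact: ltW|rewrite le_max (ltW h) orbT].
Qed.

(** The potential of [f0] for nonnegative arguments ([potE]). The form by tails is C^2 on the whole
    line, with derivatives vanishing far out: on the right because [f0] does, on the left because
    [s] is cut off. *)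
Definition pot v := S v * tail f0 v + (Im (fun u => S u * f0 u) - tail (fun u => S u * f0 u) v).

Lemma potE v : 0 <= v -> pot v = Im (fun u => G v u * f0 u).
Proof.
move=> v0; rewrite /pot /Submission.tail.
have t1 := sub_dom hs (tail_sub v f0_sub).
have t2 := sub_dom hs (tail_sub v Sf0_sub).
have t3 := sub_dom hs Sf0_sub.
rewrite -ImZ// -ImB// -ImD; [|exact: domZ|exact: domB].
apply: eq_Im => u u0; rewrite GE ?(ltW u0)//; have [vu|vu] := ltP v u.
  by rewrite !mul1r subrr addr0.
by rewrite !mul0r mulr0 add0r subr0.
Qed.

Lemma f0_mb_continuous : continuous (fun v => mb v * f0 v).
Proof.
move=> v; have [vp|vn] := ltP 0 v; first by apply: cvgM; [exact: (mb_continuous hs ca k0 ak vp)|exact: cf0].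
rewrite /continuous_at f0l ?mulr0; last exact: le_trans vn (ltW y00).
apply: cvg_near_cst; near=> u; apply/eqP; rewrite f0l ?mulr0//; apply: ltW; near: u.
exact: lt_nbhsl (le_lt_trans vn y00).
Unshelve. all: by end_near. Qed.

Lemma pot_test_fun : exists C, test_fun pot (fun v => s v * tail f0 v)
  (fun v => sd v * tail f0 v + s v * - (mb v * f0 v)) C.
Proof.
have dT := tail_derive_all f0_sub cf0 y00 f0l.
have Sf0l v : v <= y0 -> S v * f0 v = 0 by move=> h; rewrite f0l// mulr0.
have cS := S_continuous hs.
have cSf : continuous (fun v => S v * f0 v) by move=> v; apply: cvgM; [exact: cS|exact: cf0].
have dT2 := tail_derive_all Sf0_sub cSf y00 Sf0l.
have cT := continuous_deriv dT.
apply: (@test_fun_compact R _ _ _ (`|N| + 1)).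
- move=> y; have H := is_deriveD (is_deriveM (sc_S hs y) (dT y)) (is_deriveB (is_derive_cst (Im (fun u => S u * f0 u)) y 1) (dT2 y)).
  by apply: is_derive_eq H _; rewrite /GRing.scale/=; ring.
- move=> y; have H := is_deriveM (sc_s hs y) (dT y).
  by apply: is_derive_eq H _; rewrite /GRing.scale/=; ring.
- have csd := sc_sd hs; have cs := continuous_deriv (sc_s hs); have cm := f0_mb_continuous.
  move=> y; apply: cvgD; apply: cvgM; [exact: csd|exact: cT|exact: cs|apply: cvgN; exact: cm].
- move=> y yN; have [h|h] := leP 0 y.
    rewrite /Submission.tail (_ : Im _ = Im (fun=> 0))//.
      by rewrite /Submission.Im Rintegral_cst ?mul0r ?mulr0//; exact: measurable_pos.
    apply: eq_Im => u u0; have [yu|_] := ltP y u; rewrite ?mul0r// mul1r f0r//.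
    apply: ltW; apply: le_lt_trans yu; rewrite (ger0_norm h) in yN; apply: le_trans yN.
    by rewrite (le_trans (ler_norm N))// lerDl.
  suff [-> _] : s y = 0 /\ sd y = 0 by rewrite mul0r.
  by apply: (sc_cut hs); rewrite (ltr0_norm h) in yN; rewrite lerNr (le_trans _ yN)// lerDr.
- move=> y yN; have [h|h] := leP 0 y.
    have yN' : N <= y by rewrite (ger0_norm h) in yN; apply: le_trans yN; rewrite (le_trans (ler_norm N))// lerDl.
    rewrite f0r// mulr0 oppr0 mulr0 addr0.
    rewrite /Submission.tail (_ : Im _ = Im (fun=> 0)).
      by rewrite /Submission.Im Rintegral_cst ?mul0r ?mulr0//; exact: measurable_pos.
    apply: eq_Im => u u0; have [yu|_] := ltP y u; rewrite ?mul0r// mul1r f0r//.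
    by apply: ltW; apply: le_lt_trans yu.
  suff [-> ->] : s y = 0 /\ sd y = 0 by rewrite !mul0r addr0.
  by apply: (sc_cut hs); rewrite (ltr0_norm h) in yN; rewrite lerNr (le_trans _ yN)// lerDr.
Qed.

(** The scale equation removes the terms in [tail f0], and mb = 2 / (a s) normalises the rest; the
    generator is thus bounded, as [dynkin] requires. *)
Lemma pot_gen v : 0 <= v -> gen b sigma (fun v => s v * tail f0 v)
  (fun v => sd v * tail f0 v + s v * - (mb v * f0 v)) v = - f0 v.
Proof.
move=> v0; rewrite /gen sa//.
have E : s v * (2^-1 * a v) * (mb v * f0 v) = f0 v.
  have [vp|vn] := ltP 0 v; last first.
    by rewrite f0l ?mulr0//; exact: le_trans vn (ltW y00).
  rewrite /Submission.mb vp; have sv := sc_gt0 hs v0.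
  have av : 0 < a v by apply: (speed_a_gt0 k0 ak).
  by field; rewrite (gt_eqF sv) (gt_eqF av).
transitivity ((b v * s v + 2^-1 * a v * sd v) * tail f0 v - s v * (2^-1 * a v) * (mb v * f0 v)).
  move: (tail f0 v) (mb v * f0 v) => p q; ring.
by rewrite (sc_ode hs v0) mul0r sub0r E.
Qed.
End Potential.

(** Taken from the kernel, so that measurability in the starting point is immediate; solutions then
    serve to prove its other properties. *)
Definition W (t z y : R) : R := \int[Q t z]_v G v y.

Let Qmeas t (U : set R) : measurable U -> measurable_fun setT (fun x => Q t x U).
Proof. exact: measurable_kernel. Qed.

Lemma W_meas1 t y : 0 <= t -> measurable_fun setT (fun v => W t v y).
Proof.
move=> _; have H : measurable_fun setT (fun v => \int[Q t v]_u (G u y)%:E)%E.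
  apply: (measurable_fun_integral_kernel (l := fun v => Q t v) (@Qmeas t)).
    by move=> u; rewrite lee_fin G_ge0.
  apply/measurable_EFinP; exact: (G_measurable_l hs).
by apply: (measurableT_comp (f := fine)); [exact: fine_measurable|exact: H].
Qed.

Lemma G_bound v y : `|G v y| <= S (Num.max 0 y).
Proof.
rewrite ger0_norm ?G_ge0// (le_trans (G_le hs _ (_ : y <= Num.max 0 y)))// ?le_max ?lexx ?orbT//.
by apply: (G_le_S hs); rewrite le_max lexx.
Qed.

Section Solution.
Variables (X : R -> T -> R) (z : R).
Hypotheses (z0 : 0 <= z) (sX : nonneg_sde_solution P F B b sigma X) (X0 : forall w, X 0 w = z).

Lemma X_measurable t : 0 <= t -> measurable_fun setT (X t).
Proof.
move=> t0 _ A mA; rewrite setTI; have [_ Fm _] := hF; have [aX _ _ _] := sX.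
exact: (Fm t t0 _ (aX t t0 A mA)).
Qed.

(** The defining property of the transition kernel with the trivial conditioning event, extended
    from indicators to functions. *)
Lemma Chapman_Kolmogorov u t (g : R -> \bar R) : 0 <= u -> 0 <= t -> nnmeas g ->
  (\int[P]_w g (X (u + t) w) = \int[P]_w \int[Q t (X u w)]_v g v)%E.
Proof.
move=> u0 t0; move: g; have mX := X_measurable.
have ilQ y : integral_like (fun g : R -> \bar R => \int[Q t y]_v g v)%E.
  have H := il_pushforward (Q t y) measurableT (@measurable_id _ R setT); exact H.
have mQ (g : R -> \bar R) : nnmeas g -> measurable_fun setT (fun y => \int[Q t y]_v g v)%E.
  by move=> [g0 mg]; exact: (measurable_fun_integral_kernel (l := fun v => Q t v) (@Qmeas t)).
apply: il_eq.
- by apply: il_pushforward => //; apply: mX; exact: addr_ge0.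
- apply: (@il_comp R _ R _ T P setT measurableT (fun w g => \int[Q t (X u w)]_v g v)%E).
    by move=> w _; exact: ilQ.
  by move=> g ng; apply: (measurableT_comp (mQ g ng)); exact: mX.
- move=> A mA.
  have := hQ sX u0 t0 measurableT mA.
  rewrite (_ : [set w | setT (X u w)] = setT); last by apply/seteqP; split.
  rewrite setTI => H.
  have mXA : measurable [set w | A (X (u + t) w)].
    by rewrite -[X in measurable X]setTI; apply: mX => //; exact: addr_ge0.
  transitivity (P [set w | A (X (u + t) w)]).
    rewrite -(setIT [set w | A (X (u + t) w)]) -integral_indic//.
  rewrite H; apply: eq_integral => w _.
  by rewrite integral_indic// setIT.
Qed.

Lemma law_int t (g : R -> \bar R) : 0 <= t -> nnmeas g ->
  (\int[P]_w g (X t w) = \int[Q t z]_v g v)%E.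
Proof.
move=> t0 ng; have := Chapman_Kolmogorov (lexx 0) t0 ng; rewrite add0r => ->.
transitivity (\int[P]_w \int[Q t z]_v g v)%E; first by apply: eq_integral => w _; rewrite X0.
by rewrite (integral_cst P measurableT) -[RHS]mule1; congr (_ * _)%E; exact: probability_setT.
Qed.

Lemma W_E t y : 0 <= t -> (W t z y)%:E = (\int[Q t z]_v (G v y)%:E)%E.
Proof.
move=> t0; rewrite /W EFin_Rintegral//.
apply: (@bounded_integrable _ _ R (Q t z) setT measurableT _ (S (Num.max 0 y))).
- by rewrite prob_kernel ltry.
- exact: (G_measurable_l hs).
- by move=> v _; exact: G_bound.
Qed.

Lemma W_EP t y : 0 <= t -> (W t z y)%:E = (\int[P]_w (G (X t w) y)%:E)%E.
Proof.
move=> t0; rewrite W_E// -(law_int (g := fun v => (G v y)%:E) t0)//; split; first by move=> v; rewrite lee_fin G_ge0.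
by apply/measurable_EFinP; exact: (G_measurable_l hs).
Qed.

Lemma W_P t y : 0 <= t -> W t z y = \int[P]_w G (X t w) y.
Proof. by move=> t0; rewrite /Rintegral -W_EP. Qed.

Lemma W_CK u t y : 0 <= u -> 0 <= t ->
  (W (u + t) z y)%:E = (\int[P]_w (W t (X u w) y)%:E)%E.
Proof.
move=> u0 t0; rewrite W_EP ?addr_ge0// (Chapman_Kolmogorov u0 t0 (g := fun v => (G v y)%:E)).
  apply: eq_integral => w _; rewrite /W EFin_Rintegral//.
  apply: (@bounded_integrable _ _ R (Q t (X u w)) setT measurableT _ (S (Num.max 0 y))).
  + by rewrite prob_kernel ltry.
  + exact: (G_measurable_l hs).
  + by move=> v _; exact: G_bound.
split; first by move=> v; rewrite lee_fin G_ge0.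
by apply/measurable_EFinP; exact: (G_measurable_l hs).
Qed.

Let GX_integrable t y : 0 <= t -> P.-integrable setT (EFin \o (fun w => G (X t w) y)).
Proof.
move=> t0; apply: (@bounded_integrableP _ _ _ _ _ (S (Num.max 0 y))); last by move=> v; exact: G_bound.
exact: (measurableT_comp (G_measurable_l hs y) (X_measurable t0)).
Qed.

Lemma W_incr t y y' : 0 <= t -> 0 <= y -> y <= y' -> 0 <= W t z y' - W t z y <= S y' - S y.
Proof.
move=> t0 y0 yy; rewrite !W_P// -RintegralB//; try exact: GX_integrable.
have HB : P.-integrable setT (EFin \o (fun w => G (X t w) y' - G (X t w) y)).
  by have := integrableB measurableT (GX_integrable y' t0) (GX_integrable y t0).
apply/andP; split; first by apply: Rintegral_ge0 => w _; have /andP[] := G_lip hs (X t w) y0 yy.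
rewrite -(RintegralP_cst P (S y' - S y)); apply: le_Rintegral => //.
  exact: (@bounded_integrableP _ _ _ _ _ `|S y' - S y|).
by move=> w _; have /andP[] := G_lip hs (X t w) y0 yy.
Qed.

Lemma W_mono t y y' : 0 <= t -> y <= y' -> W t z y <= W t z y'.
Proof.
move=> t0 yy; rewrite !W_P//; apply: le_Rintegral => //; try exact: GX_integrable.
by move=> w _; exact: (G_le hs).
Qed.

Lemma W_measurable2 t : 0 <= t -> measurable_fun setT (W t z).
Proof.
move=> t0.
suff H : measurable_fun setT (fun y : R => \int[P]_w (G (X t w) y)%:E)%E.
  rewrite (_ : W t z = fine \o (fun y : R => \int[P]_w (G (X t w) y)%:E)%E).
    by apply: (measurableT_comp (f := fine)); [exact: fine_measurable|exact: H].
  by apply/funext => y/=; rewrite -W_EP.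
have := @measurable_fun_fubini_tonelli_F _ _ R T R P (fun p => (G (X t p.2) p.1)%:E).
apply; last by move=> p; rewrite lee_fin G_ge0.
apply/measurable_EFinP.
apply: (measurableT_comp (G_measurable2 hs) (g := fun p : R * T => (X t p.2, p.1))).
apply/measurable_fun_pairP; split => /=; last exact: measurable_fst.
by apply: (measurableT_comp (X_measurable t0)); exact: measurable_snd.
Qed.

Lemma W_zero y : W 0 z y = G z y.
Proof.
rewrite W_P//; under eq_Rintegral do rewrite X0.
by rewrite RintegralP_cst.
Qed.

Lemma X_cvg (t : R) w (v : nat -> R) : 0 <= t -> (forall n, 0 <= v n) -> v n @[n --> \oo] --> t ->
  X (v n) w @[n --> \oo] --> X t w.
Proof.
have [_ cX _ _] := sX; move=> t0 v0 vt; apply: (within_cvg_seq (cX w) _ _ vt) => /=.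
  by rewrite in_itv/= t0.
by move=> n; rewrite in_itv/= v0.
Qed.

Lemma W_right_continuous t y : 0 <= t -> W (t + n.+1%:R^-1) z y @[n --> \oo] --> W t z y.
Proof.
move=> t0; rewrite W_P//.
have tn n : 0 <= t + n.+1%:R^-1 by rewrite addr_ge0.
apply: (@eq_cvgn _ (fun n => \int[P]_w G (X (t + n.+1%:R^-1) w) y)); first by move=> n; rewrite W_P.
have := @Rintegral_dct R _ T P setT measurableT (fun n w => G (X (t + n.+1%:R^-1) w) y)
  (fun w => G (X t w) y) (fun=> S (Num.max 0 y)).
case=> //.
- by move=> n; exact: (measurableT_comp (G_measurable_l hs y) (X_measurable (tn n))).
- move=> w _; rewrite GC; apply: (@eq_cvgn _ (fun n => G y (X (t + n.+1%:R^-1) w))); first by move=> n; rewrite GC.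
  apply: (@cvg_comp _ _ _ (fun n : nat => X (t + n.+1%:R^-1) w) (G y)); last exact: (G_continuous hs).
  apply: X_cvg => //.
  have H := cvgD (@cvg_cst _ t nat \oo _) (@invS_cvg0 R).
  by rewrite addr0 in H; exact: H.
- exact: (@bounded_integrableP _ _ _ _ _ `|S (Num.max 0 y)|).
- by move=> n w _; exact: G_bound.
Qed.
Lemma W_ge0 t v y : 0 <= W t v y.
Proof. by apply: Rintegral_ge0 => u _; exact: G_ge0. Qed.

Lemma W_le_S t y : 0 <= t -> 0 <= y -> W t z y <= S y.
Proof.
move=> t0 y0; rewrite W_P// -(RintegralP_cst P (S y)); apply: le_Rintegral => //.
- exact: GX_integrable.
- exact: (@bounded_integrableP _ _ _ _ _ `|S y|).
- by move=> w _; exact: (G_le_S hs).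
Qed.

Definition mbint (h : R -> R) (g : R -> \bar R) : \bar R := (\int[mu]_v ((mb v * h v)%:E * g v))%E.

(** Only time spent at positive states is counted, since the speed density does not see the
    absorbing point 0. [Num.max 0 u] matches [measurable_process]. *)
Definition occ_time (t : R) (g : R -> \bar R) : \bar R :=
  (\int[mu]_(u in `]0%R, t]) \int[P]_w ((0 < X (Num.max 0%R u) w)%R%:R%:E * g (X (Num.max 0%R u) w)))%E.

Lemma mbint_integral_like (h : R -> R) : measurable_fun setT h -> (forall v, 0 < v -> 0 <= h v) ->
  integral_like (mbint h).
Proof.
move=> mh h0.
apply: (@il_comp R _ R _ (measurableTypeR R) mu setT measurableT (fun v g => (mb v * h v)%:E * g v)%E).
- by move=> v _; apply: il_eval; rewrite lee_fin; exact: (mb_mul_ge0 hs k0 ak).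
- move=> g [g0 mg]; apply: emeasurable_funM => //.
  by apply/measurable_EFinP; apply: measurable_funM => //; exact: (mb_measurable hs ca k0 ak).
Qed.

Lemma mbint_Im (h f : R -> R) : dom (fun v => h v * f v) -> (forall v, 0 < v -> 0 <= h v * f v) ->
  mbint h (EFin \o f) = (Im (fun v => h v * f v))%:E.
Proof.
move=> df f0; rewrite Im_EFin//; apply: eq_integral => v _ /=; by rewrite -EFinM mulrA.
Qed.

Lemma nnmeas_pos (g : R -> \bar R) : nnmeas g -> nnmeas (fun y : R => (0 < y)%R%:R%:E * g y)%E.
Proof.
move=> [g0 mg]; split; first by move=> y; rewrite mule_ge0// lee_fin.
apply: emeasurable_funM => //; apply/measurable_EFinP.
rewrite (_ : (fun y : R => (0 < y)%R%:R : R) = \1_(`]0, +oo[)); first exact: measurable_indic.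
by apply/funext => y; rewrite indicE mem_setE in_itv/= andbT.
Qed.

Lemma occ_time_measurable (g : R -> \bar R) : nnmeas g -> measurable_fun [set: measurableTypeR R]
  (fun u => \int[P]_w ((0 < X (Num.max 0%R u) w)%R%:R%:E * g (X (Num.max 0%R u) w)))%E.
Proof.
move=> ng; have [gp0 mgp] := nnmeas_pos ng.
have [_ cX _ _] := sX.
have mX := measurable_process X_measurable cX.
have := @measurable_fun_fubini_tonelli_F _ _ (measurableTypeR R) T R P
  (fun p => (0 < X (Num.max 0%R p.1) p.2)%R%:R%:E * g (X (Num.max 0%R p.1) p.2))%E.
apply; last by move=> p; exact: gp0.
exact: (measurableT_comp mgp mX).
Qed.

Lemma occ_time_integral_like t : integral_like (occ_time t).
Proof.
apply: (@il_comp R _ R _ (measurableTypeR R) mu `]0, t]%classic (measurable_itv _)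
  (fun u g => \int[P]_w ((0 < X (Num.max 0%R u) w)%R%:R%:E * g (X (Num.max 0%R u) w)))%E).
  move=> u _; apply: (@il_comp R _ R _ T P setT measurableT
    (fun w g => (0 < X (Num.max 0%R u) w)%R%:R%:E * g (X (Num.max 0%R u) w))%E).
    by move=> w _; apply: il_eval; rewrite lee_fin.
  move=> g ng; have [_ mgp] := nnmeas_pos ng.
  have u0 : 0 <= Num.max 0%R u by rewrite le_max lexx.
  exact: (measurableT_comp mgp (X_measurable u0)).
by move=> g ng; apply: measurable_funTS; exact: occ_time_measurable.
Qed.

(** Dynkin's formula gives E pot (X_t) as pot z minus the expected time integral of [f0], and
    Tonelli identifies E pot (X_t) with the speed integral of W t z f0. *)
Lemma occupation_test (f0 : R -> R) (y0 N t : R) : continuous f0 -> (forall v, 0 <= f0 v <= 1) -> 0 < y0 ->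
  (forall v, v <= y0 -> f0 v = 0) -> (forall v, N <= v -> f0 v = 0) -> 0 <= t ->
  (mbint (W t z) (EFin \o f0) + occ_time t (EFin \o f0) = mbint (G z) (EFin \o f0))%E.
Proof.
move=> cf0 f0b y00 f0l f0r t0.
have f0p v : 0 <= f0 v by have /andP[] := f0b v.
have [aX cX Xp solX] := sX.
have mf0 := continuous_measurable_fun cf0.
have domf (h : R -> R) : measurable_fun setT h -> (forall v, 0 < v -> 0 <= h v <= S v) ->
    dom (fun v => h v * f0 v).
  move=> mh hb; apply: (dom_le _ (sub_dom hs (Sf0_sub cf0 f0b y00 f0l f0r))).
    by apply: measurable_funTS; exact: measurable_funM.
  move=> v v0; have /andP[h0 h1] := hb v v0.
  by rewrite !ger0_norm ?mulr_ge0// ?ler_wpM2r//; exact: (le_trans h0).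
have Gb v u : 0 < u -> 0 <= G v u <= S u by move=> u0; rewrite G_ge0 (G_le_S hs)// ltW.
have dG v : dom (fun u => G v u * f0 u).
  by apply: domf; [exact: (G_measurable hs)|move=> u; exact: Gb].
have dW : dom (fun u => W t z u * f0 u).
  apply: domf; first exact: W_measurable2.
  by move=> u u0; rewrite W_ge0 W_le_S// ltW.
have [C tf] := pot_test_fun cf0 f0b y00 f0l f0r.
have pg := pot_gen y00 f0l.
have genC v : 0 <= v -> `|gen b sigma (fun v => s v * tail f0 v)
  (fun v => sd v * tail f0 v + s v * - (mb v * f0 v)) v| <= 1.
  by move=> v0; rewrite pg// normrN ger0_norm//; have /andP[] := f0b v.
have solX' u : 0 <= u -> exists I : T -> R, is_ito_integral P F B (fun u0 w => sigma (X u0 w)) u I /\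
    {ae P, forall w, X u w = z + \int[mu]_(v in `[0, u]) b (X v w) + I w}.
  move=> u0; have [I [hI hX]] := solX u u0; exists I; split=> //.
  by apply: filterS hX => w; rewrite X0.
have [ig E] := dynkin hF hB cb csigma aX cX Xp tf genC solX' t0.
set g' := (fun u => \int[P]_w gen _ _ _ _ _) in ig E.
pose h u := \int[P]_w f0 (X u w).
have fX_int u : 0 <= u -> P.-integrable setT (EFin \o (fun w => f0 (X u w))).
  move=> u0; apply: (@bounded_integrableP _ _ _ _ _ 1).
    exact: (measurableT_comp mf0 (X_measurable u0)).
  by move=> w; rewrite ger0_norm//; have /andP[] := f0b (X u w).
have hE : {in `]0, t[%classic, (fun u => -1 * g' u) =1 h}.
  move=> u /set_mem/=; rewrite in_itv/= => /andP[/ltW u0 _].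
  have H := RintegralZl (-1) measurableT (fX_int u u0).
  have -> : g' u = \int[P]_w (-1 * f0 (X u w)).
    by apply: eq_Rintegral => w _; rewrite pg ?mulN1r//; exact: Xp.
  by rewrite H mulrA mulrNN !mul1r.
have mI : measurable (`]0, t[%classic : set (measurableTypeR R)) by exact: measurable_itv.
have igh : mu.-integrable `]0, t[ (EFin \o h).
  have := integrableZl mI (-1) ig.
  apply: (eq_integrable mI).
  by move=> u ut; rewrite /= -hE// EFinM.
have E2 : \int[P]_w pot f0 (X t w) = pot f0 z - \int[mu]_(u in `]0, t[) h u.
  rewrite E; congr (_ + _).
  have <- : \int[mu]_(u in `]0, t[) (-1 * g' u) = \int[mu]_(u in `]0, t[) h u.
    exact: eq_Rintegral.
  by rewrite RintegralZl ?mulN1r ?opprK//; exact: measurable_itv.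
have occE : occ_time t (EFin \o f0) = (\int[mu]_(u in `]0, t[) h u)%:E.
  rewrite (EFin_Rintegral mI igh).
  have [_ /= mh] : integral_like (occ_time t) /\ measurable_fun `]0, t[ (EFin \o h).
    by split; [exact: occ_time_integral_like|by have /integrableP[] := igh].
  rewrite (integral_itv_bndo_bndc mh); apply: eq_integral => u /set_mem/=.
  rewrite in_itv/= => /andP[/ltW u0 _].
  rewrite /h EFin_Rintegral//; last exact: fX_int.
  apply: eq_integral => w _; rewrite max_r//; have [//|Xn] := ltP 0 (X u w).
    by rewrite mul1e.
  by rewrite f0l ?mule0//; exact: le_trans Xn (ltW y00).
rewrite occE (mbint_Im dW); last by move=> v v0; rewrite mulr_ge0// W_ge0.
rewrite (mbint_Im (dG z)); last by move=> v v0; rewrite mulr_ge0// G_ge0.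
rewrite -EFinD; congr EFin.
have -> : Im (fun v => G z v * f0 v) = pot f0 z by rewrite (potE cf0 f0b y00 f0l f0r).
suff -> : Im (fun v => W t z v * f0 v) = \int[P]_w pot f0 (X t w) by rewrite E2 subrK.
have GP v : 0 < v -> 0 <= W t z v * f0 v by move=> v0; rewrite mulr_ge0// W_ge0.
transitivity (fine (\int[P]_w (pot f0 (X t w))%:E)%E) => //.
rewrite -[LHS]/(fine _%:E) Im_EFin//; congr fine.
pose kk (p : T * measurableTypeR R) := (mb p.2 * (G (X t p.1) p.2 * f0 p.2))%:E.
have mk : measurable_fun setT kk.
  apply/measurable_EFinP; apply: measurable_funM.
    by apply: (measurableT_comp (mb_measurable hs ca k0 ak)); exact: measurable_snd.
  apply: measurable_funM; last by apply: (measurableT_comp mf0); exact: measurable_snd.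
  apply: (measurableT_comp (G_measurable2 hs) (g := fun p : T * measurableTypeR R => (X t p.1, p.2))).
  apply/measurable_fun_pairP; split => /=; last exact: measurable_snd.
  by apply: (measurableT_comp (X_measurable t0)); exact: measurable_fst.
have kk0 p : (0 <= kk p)%E.
  by rewrite lee_fin; apply: (mb_mul_ge0 hs k0 ak (h := fun v => G (X t p.1) v * f0 v)) => v v0; rewrite mulr_ge0// G_ge0.
have := @fubini_tonelli _ _ _ _ R P mu kk mk kk0; rewrite /kk/= => H.
transitivity (\int[mu]_y \int[P]_x (mb y * (G (X t x) y * f0 y))%:E)%E.
  apply: eq_integral => v _.
  transitivity (\int[P]_x ((mb v * f0 v)%:E * (G (X t x) v)%:E))%E; last first.
    by apply: eq_integral => w _; rewrite -EFinM; congr EFin; ring.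
  rewrite ge0_integralZl//.
  - by rewrite -W_EP// -EFinM; congr EFin; ring.
  - apply/measurable_EFinP; exact: (measurableT_comp (G_measurable_l hs v) (X_measurable t0)).
  - by move=> w _; rewrite lee_fin G_ge0.
  - by rewrite lee_fin; exact: (mb_mul_ge0 hs k0 ak).
rewrite -H; apply: eq_integral => w _.
have HI := @Im_EFin R a b s sd S hs ca k k0 ak _ (dG (X t w)) (fun v _ => mulr_ge0 (G_ge0 _ _) (f0p v)).
by rewrite -HI -(potE cf0 f0b y00 f0l f0r)//; exact: Xp.
Qed.
Lemma Gz_dom : dom (G z).
Proof. exact: (sub_dom hs (G_sub z0)). Qed.

Lemma mbint_G_fin : (mbint (G z) (fun=> 1) < +oo)%E.
Proof.
have := @mbint_Im (G z) (fun=> 1); rewrite (_ : (fun v => G z v * 1) = G z); last by apply/funext => v; rewrite mulr1.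
move=> H; rewrite [X in (X < _)%E](H Gz_dom) ?ltry// => v _; by rewrite mulr1 G_ge0.
Qed.

(** Projection onto [0, 1], written with [Num.max] alone so that [cvg_max0] yields its
    continuity. *)
Definition clamp (x : R) := 1 - Num.max 0 (1 - Num.max 0 x).

Lemma clamp01 x : 0 <= clamp x <= 1.
Proof. rewrite /clamp; have [h|h] := ltP 0 x.
  by have [h'|h'] := ltP 0 (1 - x); apply/andP; split; lra.
by have [h'|h'] := ltP 0 (1 - 0 : R); apply/andP; split; lra. Qed.

Lemma clamp_le0 x : x <= 0 -> clamp x = 0.
Proof. by move=> h; rewrite /clamp (max_l h) subr0 max_r// subrr. Qed.

Lemma clamp_ge1 x : 1 <= x -> clamp x = 1.
Proof. by move=> h; rewrite /clamp (max_r (le_trans ler01 h)) max_l ?subr0// subr_le0. Qed.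

Lemma clamp_mono x y : x <= y -> clamp x <= clamp y.
Proof.
move=> xy; rewrite /clamp lerD2l lerN2.
have le_max2 (p q : R) : p <= q -> Num.max 0 p <= Num.max 0 q.
  by move=> pq; rewrite ge_max le_max lexx/= le_max pq orbT.
by apply: (le_max2); rewrite lerD2l lerN2; exact: le_max2.
Qed.

Lemma clamp_continuous : continuous clamp.
Proof.
move=> x; apply: cvgB; first exact: cvg_cst.
by apply: cvg_max0; apply: cvgB; [exact: cvg_cst|apply: cvg_max0; exact: cvg_id].
Qed.

(** Continuous functions increasing to the indicator of ]y, +oo[: the margin 1 / (n + 1) keeps them
    null near [y], the slope [n] restores the value 1 in the limit, and the second factor cuts off
    beyond [n]. *)
Definition ray (y : R) (n : nat) (v : R) := clamp (n%:R * (v - y - n.+1%:R^-1)) * clamp (n%:R - v).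

Lemma ray_le y n v : v <= y + n.+1%:R^-1 -> ray y n v = 0.
Proof.
move=> h; rewrite /ray clamp_le0 ?mul0r// mulr_ge0_le0//.
by rewrite -addrA -opprD subr_le0.
Qed.

Lemma ray01 y n v : 0 <= ray y n v <= 1.
Proof.
have /andP[h1 h2] := clamp01 (n%:R * (v - y - n.+1%:R^-1)); have /andP[h3 h4] := clamp01 (n%:R - v).
by rewrite mulr_ge0//= mulr_ile1.
Qed.

Lemma ray_nondecreasing y v : nondecreasing_seq (fun n => ray y n v).
Proof.
apply/nondecreasing_seqP => n.
have /andP[r0 _] := ray01 y n.+1 v.
have [h|h] := leP v (y + n.+1%:R^-1); first by rewrite (ray_le h).
have i : (n.+2%:R^-1 : R) <= n.+1%:R^-1 by rewrite lef_pV2 ?posrE// ler_nat.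
have /andP[h1 _] := clamp01 (n%:R * (v - y - n.+1%:R^-1)); have /andP[h3 _] := clamp01 (n%:R - v).
rewrite /ray ler_pM//; apply: clamp_mono; last by rewrite lerD2r ler_nat.
apply: ler_pM; [by []|by rewrite -addrA -opprD subr_ge0 ltW|by rewrite ler_nat|by rewrite lerD2l lerN2].
Qed.

Lemma ray_lim y v : limn (fun n => (ray y n v)%:E) = ((y < v)%R%:R)%:E.
Proof.
have [yv|vy] := ltP y v; last first.
  rewrite (_ : (fun n => _) = fun=> 0%E); first exact: lim_cst.
  by apply/funext => n; rewrite ray_le// (le_trans vy)// lerDl.
apply/cvg_lim => //; apply: cvg_near_cst.
have d0 : 0 < (v - y) / 2 by rewrite divr_gt0// subr_gt0.
have N1 := @near_invS_lt R _ d0.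
have N2 : \forall n \near \oo, v + 1 <= n%:R by exact: nbhs_infty_ger.
have N3 : \forall n \near \oo, ((v - y) / 2)^-1 <= n%:R by exact: nbhs_infty_ger.
near=> n.
have n1 : (n.+1%:R^-1 : R) < (v - y) / 2 by near: n.
have n2 : v + 1 <= n%:R by near: n.
have n3 : ((v - y) / 2)^-1 <= n%:R by near: n.
rewrite /ray !clamp_ge1 ?mulr1//; first by lra.
apply: (@le_trans _ _ (n%:R * ((v - y) / 2))); first by rewrite -ler_pdivrMr// mul1r.
by apply: ler_wpM2l => //; move: n1; move: (n.+1%:R^-1 : R) => i; lra.
Unshelve. all: by end_near. Qed.

Lemma nnmeas_ray y n : nnmeas (fun v => (ray y n v)%:E).
Proof.
split; first by move=> v; rewrite lee_fin; have /andP[] := ray01 y n v.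
apply/measurable_EFinP; apply: continuous_measurable_fun => v.
apply: cvgM.
  apply: (@cvg_comp _ _ _ (fun v : R => n%:R * (v - y - n.+1%:R^-1)) clamp); last exact: clamp_continuous.
  by apply: cvgM; [exact: cvg_cst|apply: cvgB; [apply: cvgB; [exact: cvg_id|exact: cvg_cst]|exact: cvg_cst]].
apply: (@cvg_comp _ _ _ (fun v : R => n%:R - v) clamp); last exact: clamp_continuous.
by apply: cvgB; [exact: cvg_cst|exact: cvg_id].
Qed.

Lemma ray_continuous y n : continuous (ray y n).
Proof.
move=> v; apply: cvgM.
  apply: (@cvg_comp _ _ _ (fun v : R => n%:R * (v - y - n.+1%:R^-1)) clamp); last exact: clamp_continuous.
  by apply: cvgM; [exact: cvg_cst|apply: cvgB; [apply: cvgB; [exact: cvg_id|exact: cvg_cst]|exact: cvg_cst]].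
apply: (@cvg_comp _ _ _ (fun v : R => n%:R - v) clamp); last exact: clamp_continuous.
by apply: cvgB; [exact: cvg_cst|exact: cvg_id].
Qed.

(** Test functions must vanish near 0 and near infinity. Neither side sees nonpositive arguments, so
    a ray may be clipped to start at [Num.max 0 y], and it is then the increasing limit of [ray]. *)
Lemma occupation t (g : R -> \bar R) : 0 <= t -> nnmeas g ->
  (mbint (W t z) g + occ_time t g = mbint (G z) g)%E.
Proof.
move=> t0; move: g.
have il1 : integral_like (mbint (W t z)) by apply: mbint_integral_like; [exact: W_measurable2|move=> *; exact: W_ge0].
have ilG : integral_like (mbint (G z)) by apply: mbint_integral_like; [exact: (G_measurable hs)|move=> *; exact: G_ge0].
have il2 := il_addf il1 (occ_time_integral_like t).
have E1 h (g g' : R -> \bar R) : (forall v, 0 < v -> g v = g' v) -> mbint h g = mbint h g'.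
  move=> gg; apply: eq_integral => v _; have [v0|v0] := ltP 0 v; first by rewrite gg.
  by rewrite /Submission.mb ltNge v0/= mul0r !mul0e.
have E2 (g g' : R -> \bar R) : (forall v, 0 < v -> g v = g' v) -> occ_time t g = occ_time t g'.
  move=> gg; apply: eq_integral => u _; apply: eq_integral => w _.
  by have [v0|v0] := ltP 0 (X (Num.max 0%R u) w); rewrite ?mul0e// gg.
have ind (y v : R) : 0 < v -> (\1_`]y, +oo[%classic v)%:E = limn (fun n => (ray (Num.max 0 y) n v)%:E) :> \bar R.
  move=> v0; rewrite ray_lim indicE mem_setE in_itv/= andbT; congr ((nat_of_bool _)%:R%:E).
  by rewrite gt_max v0.
have y0 (y : R) : 0 <= Num.max 0 y by rewrite le_max lexx.
have nn (y v : R) : nondecreasing_seq (fun n => (ray (Num.max 0 y) n v)%:E).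
  by move=> m n mn; rewrite lee_fin; exact: ray_nondecreasing.
have nr (y : R) n := nnmeas_ray (Num.max 0 y) n.
move=> g ng; apply/esym; move: g ng; apply: (il_eq_rays ilG il2).
- move=> y; apply/esym; rewrite (E1 (W t z) _ _ (ind y)) (E2 _ _ (ind y)) (E1 (G z) _ _ (ind y)).
  rewrite (il_lim il2 (nr y) (nn y)) (il_lim ilG (nr y) (nn y)); congr (limn _); apply/funext => n.
  apply: (@occupation_test _ (Num.max 0 y + n.+1%:R^-1) n%:R) => //.
  + exact: ray_continuous.
  + by move=> v; exact: ray01.
  + by rewrite ltr_wpDl.
  + by move=> v; exact: ray_le.
  + by move=> v nv; rewrite /ray (clamp_le0 (x := n%:R - v)) ?mulr0// subr_le0.
- move=> y; apply: le_lt_trans mbint_G_fin; apply: (il_le ilG).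
  + by apply: nnmeas_indic; exact: measurable_itv.
  + by split => //; exact: measurable_cst.
  + by move=> v; rewrite lee_fin indicE lern1 leq_b1.
Qed.

Lemma occ_time_le t t' (g : R -> \bar R) : t <= t' -> nnmeas g -> (occ_time t g <= occ_time t' g)%E.
Proof.
move=> tt ng; have gp := nnmeas_pos ng; apply: ge0_subset_integral => //.
- by apply: measurable_funTS; exact: occ_time_measurable.
- by move=> u _; apply: integral_ge0 => w _; exact: (gp.1).
- by apply: subset_itvl; rewrite bnd_simp.
Qed.

Lemma mbint_W_le r r' (g : R -> \bar R) : 0 <= r -> r <= r' -> nnmeas g -> (mbint (G z) g < +oo)%E ->
  (mbint (W r' z) g <= mbint (W r z) g)%E.
Proof.
move=> r0 rr ng fin; have r'0 := le_trans r0 rr.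
have ge r1 : (0 <= occ_time r1 g)%E by exact: (il_ge0 (occ_time_integral_like r1)).
have ge' : (0 <= mbint (W r z) g)%E.
  apply: integral_ge0 => v _; apply: mule_ge0; last exact: (ng.1).
  by rewrite lee_fin mulr_ge0 ?W_ge0// (mb_ge0 hs k0 ak).
have E := occupation r0 ng; have E' := occupation r'0 ng.
have fo : occ_time r g \is a fin_num.
  by rewrite ge0_fin_numE//; apply: le_lt_trans fin; rewrite -E leeDr.
rewrite -(leeD2rE _ _ fo) E -E' leeD2l//; exact: occ_time_le.
Qed.

Lemma integral_bounds (A : set (measurableTypeR R)) (h : R -> R) (m M e : R) : measurable A ->
  measurable_fun A h -> (forall v, A v -> m <= h v <= M) -> 0 <= m -> mu A = e%:E ->
  ((m * e)%:E <= \int[mu]_(v in A) (h v)%:E <= (M * e)%:E)%E.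
Proof.
move=> mA mh hb m0 Ae.
have cE (c : R) : (\int[mu]_(v in A) c%:E)%E = (c * e)%:E.
  by rewrite EFinM -Ae; exact: (integral_cst mu mA c%:E).
rewrite -!cE; apply/andP; split; apply: ge0_le_integral => //.
- by apply/measurable_EFinP.
- by move=> v /hb/andP[h1 h2]; rewrite lee_fin.
- by move=> v /hb/andP[h1 h2]; rewrite lee_fin (le_trans m0).
- by apply/measurable_EFinP.
- by move=> v /hb/andP[h1 h2]; rewrite lee_fin.
Qed.

(** Occupation times grow, so the speed integral of [W t z] against any g >= 0 decreases in t. With
    g = 1 / mb on ]y, y + e[ this compares Lebesgue integrals of [W], which increases in its last
    argument by at most the increment of [S]; then e tends to 0. *)
Lemma W_dec t t' y : 0 <= t -> t <= t' -> 0 <= y -> W t' z y <= W t z y.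
Proof.
move=> t0 tt y0; have t'0 := le_trans t0 tt.
suff H e : 0 < e -> W t' z y <= W t z y + (S (y + e) - S y).
  have cS : continuous S := S_continuous hs.
  have L : W t z y + (S (y + n.+1%:R^-1) - S y) @[n --> \oo] --> W t z y.
    rewrite -[X in _ --> X]addr0 -(subrr (S y)); apply: cvgD; first exact: cvg_cst.
    apply: cvgB; last exact: cvg_cst.
    apply: (@cvg_comp _ _ _ (fun n : nat => y + n.+1%:R^-1) S); last exact: cS.
    have H1 := cvgD (@cvg_cst _ y nat \oo _) (@invS_cvg0 R).
    by rewrite addr0 in H1; exact: H1.
  rewrite -(cvg_lim _ L)//; apply: limr_ge; first by apply/cvg_ex; exists (W t z y).
  by apply: nearW => n; exact: H.
move=> e0.
pose A : set R := `]y, y + e[%classic.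
have Apos v : A v -> 0 < v by rewrite /A/= in_itv/= => /andP[/(le_lt_trans y0)].
pose g v : \bar R := (\1_A v * (mb v)^-1)%:E.
have mbp v : 0 < v -> 0 < mb v by exact: (mb_gt0 hs k0 ak).
have ng : nnmeas g.
  split; first by move=> v; rewrite lee_fin mulr_ge0 ?invr_ge0 ?(mb_ge0 hs k0 ak)// indicE.
  apply/measurable_EFinP.
  have -> : (fun v => \1_A v * (mb v)^-1) = (fun v => (mb v)^-1) \_ A.
    by apply/funext => v; rewrite patchE indicE; case: ifPn; rewrite ?mul1r ?mul0r.
  apply/(measurable_restrictT _ (measurable_itv _)).
  apply: (measurable_funS (@measurable_pos R)); first by move=> v /Apos v0; exact/posP.
  apply: continuous_pos_measurable => v v0; apply: cvgV; first by rewrite gt_eqF// mbp.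
  exact: (mb_continuous hs ca k0 ak).
have gE h : mbint h g = (\int[mu]_(v in A) (h v)%:E)%E.
  rewrite [RHS]integral_mkcond; apply: eq_integral => v _; rewrite patchE /g -EFinM indicE.
  have [vA|vA] := boolP (v \in A); last by rewrite mul0r mulr0.
  have /mbp vp := Apos _ (set_mem vA).
  by rewrite mul1r mulrAC divff ?mul1r// gt_eqF.
have muA : mu A = e%:E.
  by rewrite lebesgue_measure_itv/= lte_fin ltrDl e0 -EFinD addrAC subrr add0r.
have mA : measurable (A : set (measurableTypeR R)) by exact: measurable_itv.
have fin : (mbint (G z) g < +oo)%E.
  have hb v : A v -> 0 <= G z v <= S (y + e).
    move=> Av; rewrite G_ge0/= (le_trans (G_le hs _ (_ : v <= y + e)))//.
      by move: Av; rewrite /A/= in_itv/= => /andP[_ /ltW].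
    by apply: (G_le_S hs); rewrite addr_ge0// ltW.
  rewrite gE; have /andP[_ H] := integral_bounds mA (measurable_funTS (G_measurable hs z)) hb (lexx 0) muA.
  by apply: le_lt_trans H _; rewrite ltry.
have hW1 t1 v : 0 <= t1 -> A v -> W t1 z y <= W t1 z v <= W t1 z (y + e).
  by move=> t10; rewrite /A/= in_itv/= => /andP[/ltW h1 /ltW h2]; rewrite !W_mono.
have := mbint_W_le t0 tt ng fin; rewrite !gE => H.
have /andP[H1 _] := integral_bounds mA (measurable_funTS (W_measurable2 t'0)) (fun v => hW1 t' v t'0) (W_ge0 _ _ _) muA.
have /andP[_ H2] := integral_bounds mA (measurable_funTS (W_measurable2 t0)) (fun v => hW1 t v t0) (W_ge0 _ _ _) muA.
have := le_trans H1 (le_trans H H2); rewrite lee_fin ler_pM2r// => {}H.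
apply: (le_trans H); have /andP[_] := W_incr t0 y0 (ler_wpDr (ltW e0) (lexx y)).
by rewrite lerBlDl.
Qed.

Lemma W_le t y : 0 <= t -> 0 <= y -> W t z y <= G z y.
Proof. by move=> t0 y0; rewrite -W_zero; exact: W_dec. Qed.

(** The occupation formula for g = W t . y: by Chapman-Kolmogorov the part between r and r + h is
    the integral of W (u + t) z y, squeezed by monotonicity. Counting positive states only loses
    nothing, since [W t 0 y] is 0. *)
Lemma W_occ t r h y : 0 <= t -> 0 <= r -> 0 <= h -> 0 <= y -> (forall v, 0 <= v -> W t v y <= G v y) ->
  h * W (t + r + h) z y <=
  Im (fun v => W r z v * W t v y) - Im (fun v => W (r + h) z v * W t v y) <= h * W (t + r) z y.
Proof.
move=> t0 r0 h0 y0 Wle; have rh0 : 0 <= r + h by exact: addr_ge0.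
have [_ cX Xp _] := sX.
pose g v : \bar R := (W t v y)%:E.
have ng : nnmeas g by split; [move=> v; rewrite lee_fin W_ge0|apply/measurable_EFinP; exact: W_meas1].
have dh (q : R -> R) : measurable_fun setT q -> (forall v, 0 < v -> 0 <= q v <= S v) ->
    dom (fun v => q v * W t v y).
  move=> mq qb; split.
    by apply: measurable_funTS; apply: measurable_funM => //; exact: W_meas1.
  exists (S y) => v v0; have /andP[q0 q1] := qb v v0.
  rewrite ger0_norm ?mulr_ge0 ?W_ge0// mulrC ler_pM ?W_ge0//.
    by apply: (le_trans (Wle v (ltW v0))); exact: (G_le_S hs).
  by apply: (le_trans q1); rewrite /Phi lerDr rS_ge0.
have dW q : 0 <= q -> dom (fun v => W q z v * W t v y).
  move=> q0; apply: dh; first exact: W_measurable2.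
  by move=> v v0; rewrite W_ge0 W_le_S// ltW.
have dG : dom (fun v => G z v * W t v y).
  by apply: dh; [exact: (G_measurable hs)|move=> v v0; rewrite G_ge0 (G_le_S hs)// ltW].
have E q : 0 <= q -> ((Im (fun v => W q z v * W t v y))%:E + occ_time q g = (Im (fun v => G z v * W t v y))%:E)%E.
  move=> q0; have := occupation q0 ng.
  rewrite (mbint_Im (dW q q0)); last by move=> v _; rewrite mulr_ge0 ?W_ge0.
  by rewrite (mbint_Im dG)//; move=> v _; rewrite mulr_ge0 ?W_ge0// G_ge0.
pose om u := W (Num.max 0 u + t) z y.
have omE u : 0 <= u -> (\int[P]_w ((0 < X (Num.max 0%R u) w)%R%:R%:E * g (X (Num.max 0%R u) w)) = (om u)%:E)%E.
  move=> u0; rewrite /om max_r// W_CK//; apply: eq_integral => w _.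
  have [_|Xn] := ltP 0 (X u w); first by rewrite mul1e.
  have Xz : X u w = 0 by apply/eqP; rewrite eq_le Xn Xp.
  rewrite mul0e Xz; congr EFin; apply/eqP; rewrite eq_le W_ge0/=.
  by apply: (le_trans (Wle 0 (lexx 0))); rewrite G_neg.
have mom (A : set (measurableTypeR R)) : measurable A -> (forall u, A u -> 0 <= u) -> measurable_fun A om.
  move=> mA Ap; apply/measurable_EFinP.
  have := measurable_funTS (D := A) (occ_time_measurable ng).
  by apply: eq_measurable_fun => u /set_mem/Ap/omE.
have oE (A : set (measurableTypeR R)) : (forall u, A u -> 0 <= u) ->
   (\int[mu]_(u in A) \int[P]_w ((0 < X (Num.max 0%R u) w)%R%:R%:E * g (X (Num.max 0%R u) w))
     = \int[mu]_(u in A) (om u)%:E)%E.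
  by move=> Ap; apply: eq_integral => u /set_mem/Ap/omE.
have p1 (q q' : R) : 0 <= q -> forall u, (`]q, q']%classic : set R) u -> 0 <= u.
  by move=> q0 u/=; rewrite in_itv/= => /andP[/ltW/(le_trans q0)].
have spl : (occ_time (r + h) g = occ_time r g + \int[mu]_(u in `]r, (r + h)%R]) (om u)%:E)%E.
  rewrite /occ_time !oE; [|exact: p1|exact: p1].
  rewrite -ge0_integral_setU; [|exact: measurable_itv|exact: measurable_itv| | |].
  - congr (integral _ _ _); apply/seteqP; split => u /=; rewrite !in_itv/=.
      move=> /andP[u0 uh]; have [ur|ur] := leP u r; first by left; rewrite u0.
      by right; rewrite uh.
    case=> /andP[u0 uh]; first by rewrite u0 (le_trans uh)// lerDl.
    by rewrite uh andbT (le_lt_trans r0).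
  - apply/measurable_EFinP; apply: mom; first by apply: measurableU; exact: measurable_itv.
    by move=> u []; exact: p1.
  - by move=> u _; rewrite lee_fin W_ge0.
  - apply/eqP/seteqP; split => // u []/=; rewrite !in_itv/= => /andP[_ h1] /andP[h2 _].
    by move: (lt_le_trans h2 h1); rewrite ltxx.
have /andP[B1 B2] : ((W (t + r + h) z y * h)%:E <= \int[mu]_(u in `]r, (r + h)%R]) (om u)%:E <= (W (t + r) z y * h)%:E)%E.
  apply: integral_bounds; [exact: measurable_itv| | |exact: W_ge0|].
  - by apply: mom; [exact: measurable_itv|exact: p1].
  - move=> u /=; rewrite in_itv/= => /andP[/ltW ru uh]; have u0 := le_trans r0 ru.
    by rewrite /om max_r// !W_dec//; lra.
  - rewrite lebesgue_measure_itv/= lte_fin ltrDl; case: ifP => h1.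
      by rewrite -EFinD addrAC subrr add0r.
    by move: h1 h0; rewrite le_eqVlt => -> /orP[/eqP <-|].
have Er := E r r0; have Eh := E (r + h) rh0; rewrite spl in Eh.
move: Er Eh B1 B2; set K := integral _ _ _; set J := occ_time r g => Er Eh B1 B2.
have J0 : (0 <= J)%E by exact: (il_ge0 (occ_time_integral_like r)).
have K0 : (0 <= K)%E by apply: integral_ge0 => u _; rewrite lee_fin W_ge0.
have Kf : K \is a fin_num by rewrite ge0_fin_numE// (le_lt_trans B2)// ltry.
have Jf : J \is a fin_num.
  by rewrite ge0_fin_numE// ltey; apply/eqP => JE; move: Er; rewrite JE addey.
move: Er Eh B1 B2; rewrite -(fineK Kf) -(fineK Jf); move: (fine K) (fine J) => K' J'.
rewrite -!EFinD !lee_fin => -[Er] [Eh] B1 B2.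
rewrite ![h * _]mulrC; apply/andP; split; move: Er Eh B1 B2.
  by move: (Im _) (Im _) (Im _) (W _ z y * h) (W _ z y * h) => *; lra.
by move: (Im _) (Im _) (Im _) (W _ z y * h) (W _ z y * h) => *; lra.
Qed.
End Solution.

Lemma kernel_density_family x : 0 < x -> exists kp : nat -> R -> R -> R,
  [/\ forall j (t y : R), 0 < t -> 0 < y -> is_derive t 1 (fun u => kp j u y) (- kp j.+1 t y),
      forall j t0, 0 < t0 -> exists2 C, 0 <= C & forall t y, t0 <= t -> 0 < y -> `|kp j t y| <= C * rS y,
      forall j t, 0 < t -> measurable_fun D (kp j t),
      forall j t y, 0 < t -> 0 < y -> kp j t y = Im (fun z => G y z * kp j.+1 t z)
    & forall t y, 0 < t -> 0 < y -> W t x y = Im (fun z => G y z * kp 0%N t z)].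
Proof.
have ex z : 0 <= z -> exists X, nonneg_sde_solution P F B b sigma X /\ forall w, X 0 w = z.
  by move=> /hW[X [sX X0 _ _]]; exists X.
have Wle t z y : 0 <= t -> 0 <= z -> 0 <= y -> W t z y <= G z y.
  by move=> t0 z0 y0; have [X [sX X0]] := ex z z0; eapply W_le; eassumption.
apply: (@density_family R a b s sd S hs ca k k0 ak W).
- exact: W_meas1.
- by move=> t z t0 z0; have [X [sX X0]] := ex z z0; eapply W_measurable2; eassumption.
- by move=> *; exact: W_ge0.
- exact: Wle.
- by move=> z y z0; have [X [sX X0]] := ex z z0; eapply W_zero; eassumption.
- move=> t r h z y t0 r0 h0 z0 y0; have [X [sX X0]] := ex z z0.
  by eapply W_occ; try eassumption; move=> v v0; exact: Wle.
- by move=> t z y t0 z0 y0; have [X [sX X0]] := ex z z0; eapply W_right_continuous; eassumption.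
Qed.
End Occupation.

(** * The transition kernel *)

Section Conclusion.
Context {R : realType}.
Notation mu := (@lebesgue_measure R).
Notation D := (`]0, +oo[%classic : set R).
Variables (a b s sd S : R -> R).
Hypothesis hs : scale_fun a b s sd S.
Hypothesis ca : continuous a.
Variable k : R.
Hypotheses (k0 : 0 < k) (ak : forall y, 0 <= y -> k * (y * (1 + y)) <= a y).
Local Notation rS := (rS S).
Local Notation G := (G S).
Local Notation sub := (sub S).
Local Notation dom := (dom S).
Local Notation mm := (mm hs ca k0 ak).
Local Notation Im := (Im hs ca k0 ak).
Local Notation ImD := (ImD hs ca k0 ak).
Local Notation ImB := (ImB hs ca k0 ak).
Local Notation ImZ := (ImZ hs ca k0 ak).
Local Notation eq_Im := (eq_Im hs ca k0 ak).
Local Notation Im_ge0 := (Im_ge0 hs ca k0 ak).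
Local Notation Im_le := (Im_le hs ca k0 ak).
Local Notation normr_Im := (normr_Im hs ca k0 ak).
Local Notation kappa := (kappa hs ca k0 ak).
Local Notation Jint := (Jint hs ca k0 ak).
Local Notation subM := (subM hs).
Local Notation G_ge0 := (G_ge0 hs).
Local Notation G_rS := (G_rS hs).
Local Notation G_neg := (G_neg hs).
Local Notation G_sub := (G_sub hs).
Local Notation rS_gt0 := (rS_gt0 hs).
Local Notation rS_ge0 := (rS_ge0 S).
Local Notation tail := (tail hs ca k0 ak).
Local Notation mb := (mb a s).
Context {d : measure_display} {T : measurableType d}.
Variables (P : probability T R) (Q : R -> R.-pker R ~> R) (X : R -> T -> R) (x : R).
Hypotheses (x0 : 0 < x) (mX : forall t, 0 <= t -> measurable_fun setT (X t)).
Hypotheses (cX : continuous_paths X) (X0 : forall w, X 0 w = x) (Xp : forall t w, 0 <= t -> 0 <= X t w).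
Hypothesis law : forall t (g : R -> \bar R), 0 <= t -> nnmeas g ->
  (\int[P]_w g (X t w) = \int[Q t x]_v g v)%E.
Variable kp : nat -> R -> R -> R.
Hypothesis kpB : forall j t0, 0 < t0 -> exists2 C, 0 <= C & forall t y, t0 <= t -> 0 < y -> `|kp j t y| <= C * rS y.
Hypothesis kpM : forall j t, 0 < t -> measurable_fun D (kp j t).
Hypothesis kpC : forall t y, 0 < t -> 0 < y -> {for y, continuous (kp 0%N t)}.
Hypothesis kpW : forall t y, 0 < t -> 0 < y -> \int[Q t x]_v G v y = Im (fun z => G y z * kp 0%N t z).
Local Notation p := (dens a s kp).

Let ksub t : 0 < t -> sub (kp 0%N t).
Proof.
move=> t0; split; first exact: kpM.
by have [C _ CP] := kpB 0 t0; exists C => v v0; exact: CP.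
Qed.

Lemma kernel_law t (A : set R) : 0 <= t -> measurable A -> Q t x A = P (X t @^-1` A).
Proof.
move=> t0 mA; have := law t0 (nnmeas_indic mA); rewrite [X in _ = X]integral_indic// setIT => <-.
have mXA : measurable (X t @^-1` A) by rewrite -[X in measurable X]setTI; apply: mX.
by rewrite -(setIT (X t @^-1` A)) -integral_indic.
Qed.

Lemma Im0 : Im (fun=> 0) = 0.
Proof. by rewrite /Submission.Im Rintegral_cst ?mul0r//; exact: measurable_pos. Qed.

Let Gb (v y : R) : `|G v y| <= S (Num.max 0 y).
Proof.
rewrite ger0_norm ?G_ge0// (le_trans (G_le hs _ (_ : y <= Num.max 0 y)))// ?le_max ?lexx ?orbT//.
by apply: (G_le_S hs); rewrite le_max lexx.
Qed.

Let Qint t (f : R -> R) C : measurable_fun setT f -> (forall v, `|f v| <= C) ->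
  (Q t x).-integrable setT (EFin \o f).
Proof.
move=> mf fC; apply: (@bounded_integrable _ _ R (Q t x) setT measurableT _ C) => //.
by rewrite prob_kernel ltry.
Qed.

(** Both expressions of the expectation of [G] are differentiated from the right with respect to S
    y. With positive increments the quotients of [G] converge at every point, v = y included, to the
    indicator of the open ray. *)
Lemma Q_tail t (y : R) : 0 < t -> 0 <= y -> Q t x `]y, +oo[%classic = (tail (kp 0%N t) y)%:E.
Proof.
move=> t0 y0; pose h n : R := n.+1%:R^-1.
have h0 n : 0 < h n by rewrite invr_gt0.
have yh n : 0 <= y + h n by rewrite addr_ge0// ltW.
have hn n : h n != 0 by rewrite gt_eqF.
have L1 := @Im_quot_cvg R a b s sd S hs ca k k0 ak _ _ _ (ksub t0) y0 hn yh (@invS_cvg0 R).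
have Sp n : 0 < S (y + h n) - S y by rewrite subr_gt0; apply: (S_lt hs) => //; rewrite ltrDl.
have WE (y' : R) : 0 <= y' -> \int[Q t x]_v G v y' = Im (fun z => G y' z * kp 0%N t z).
  rewrite le_eqVlt => /orP[/eqP <-|y'0]; last exact: kpW.
  transitivity (0 : R); last first.
    by transitivity (Im (fun=> 0)); [rewrite Im0|apply: eq_Im => z _; rewrite G_neg// mul0r].
  transitivity (\int[Q t x]_(v in setT) (0 : R)).
    by apply: eq_Rintegral => v _; rewrite GC G_neg.
  by rewrite Rintegral_cst// mul0r.
have Gi (y' : R) : (Q t x).-integrable setT (EFin \o (fun v => G v y')).
  by apply: (@Qint t _ (S (Num.max 0 y'))) => //; exact: (G_measurable_l hs).
pose f n (v : R) := (S (y + h n) - S y)^-1 * (G v (y + h n) - G v y).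
have yy n : y <= y + h n by rewrite lerDl ltW.
have [] := @Rintegral_dct R _ R (Q t x) setT measurableT f (fun v => (y < v)%R%:R) (fun=> 1).
- by move=> n; apply: measurable_funM => //; apply: measurable_funB; exact: (G_measurable_l hs).
- move=> v _; apply: cvg_near_cst; have [yv|vy] := ltP y v; last first.
    apply: nearW => n; apply/eqP; rewrite /f /Submission.G !min_l ?subrr ?mulr0//.
    exact: le_trans (yy n).
  have N1 := @near_invS_lt R (v - y); rewrite subr_gt0 in N1.
  apply: filterS (N1 yv) => n hv; have v0 := le_lt_trans y0 yv.
  have yhv : y + h n <= v by rewrite -lerBrDl ltW.
  apply/eqP; rewrite /f !GE// ?(ltW v0)// !min_r ?(ltW yv)// mulVf//.
  by rewrite gt_eqF.
- by apply: (@Qint t _ 1) => // v; rewrite normr1.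
- move=> n v _; have /andP[g0 g1] := G_lip hs v y0 (yy n).
  by rewrite /f ger0_norm ?mulr_ge0 ?invr_ge0 ?(ltW (Sp n))// mulrC ler_pdivrMr// mul1r.
move=> ig L2.
have EI n : \int[Q t x]_v f n v = (Im (fun z => G (y + h n) z * kp 0%N t z) -
    Im (fun z => G y z * kp 0%N t z)) / (S (y + h n) - S y).
  rewrite -!WE// -(RintegralB measurableT (Gi _) (Gi _)) mulrC -RintegralZl//.
  by have := integrableB measurableT (Gi (y + h n)) (Gi y).
have -> : tail (kp 0%N t) y = \int[Q t x]_v (y < v)%R%:R.
  have L3 := @eq_cvgn R _ _ _ EI L2.
  by rewrite -(cvg_lim _ L1)// -(cvg_lim _ L3).
rewrite EFin_Rintegral// -[X in Q t x X]setIT -integral_indic//.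
by apply: eq_integral => v _; rewrite indicE mem_setE in_itv/= andbT.
Qed.

(** Probabilities of rays decrease, and the derivative of the tail is - mb kp 0. *)
Lemma kp_ge0 t (y : R) : 0 < t -> 0 < y -> 0 <= kp 0%N t y.
Proof.
move=> t0 y0; have H := tail_derive hs ca k0 ak (ksub t0) y0 (kpC t0 y0).
have hn n : (n.+1%:R^-1 : R) != 0 by rewrite gt_eqF// invr_gt0.
have L := is_derive_cvg_seq H (@invS_cvg0 R) hn.
have M := mb_gt0 hs k0 ak y0.
rewrite -(pmulr_rge0 _ M) -oppr_le0 -(cvg_lim _ L)//; apply: limr_le.
  by apply/cvg_ex; eexists; exact: L.
apply: nearW => n; rewrite pmulr_lle0 ?invr_gt0 ?invr_gt0// subr_le0 -lee_fin.
have yn : 0 <= y + n.+1%:R^-1 by rewrite addr_ge0// ltW.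
rewrite -!Q_tail// ?(ltW y0)//; apply: le_measure; [by apply/mem_set; exact: measurable_itv|by apply/mem_set; exact: measurable_itv|].
by apply: subset_itvr; rewrite bnd_simp lerDl.
Qed.

Lemma dens_ge0 t (y : R) : 0 < t -> 0 <= p t y.
Proof.
move=> t0; have [y0|y0] := ltP 0 y; first by rewrite mulr_ge0 ?kp_ge0// (mb_ge0 hs k0 ak).
by rewrite /dens /Submission.mb ltNge y0/= mul0r.
Qed.

Lemma dens_measurable t : 0 < t -> measurable_fun setT (p t).
Proof.
move=> t0; have -> : p t = (fun y => mb y * kp 0%N t y) \_ D.
  apply/funext => y; rewrite patchE; case: ifPn => // /negP yD.
  rewrite /dens /Submission.mb; case: ifP => [y0|_]; last by rewrite mul0r.
  by exfalso; apply: yD; apply/mem_set/posP.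
apply/(measurable_restrictT _ (@measurable_pos R)); apply: measurable_funM; last exact: kpM.
by apply: measurable_funTS; exact: (mb_measurable hs ca k0 ak).
Qed.

Lemma dens_integral t (f : R -> R) : 0 < t -> dom (fun v => f v * kp 0%N t v) ->
  (forall v, 0 < v -> 0 <= f v) ->
  (\int[mu]_(y in `[0%R, +oo[) ((p t y)%:E * (f y)%:E) = (Im (fun v => f v * kp 0%N t v))%:E)%E.
Proof.
move=> t0 df f0; rewrite (@Im_EFin R a b s sd S hs ca k k0 ak _ df); last first.
  by move=> v v0; rewrite mulr_ge0 ?f0// kp_ge0.
rewrite integral_mkcond; apply: eq_integral => v _; rewrite patchE mem_setE in_itv/= andbT.
rewrite -EFinM /dens; case: ifPn => [_|]; first by congr EFin; ring.
by rewrite -ltNge => v0; rewrite /Submission.mb ltNge (ltW v0)/= mul0r.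
Qed.

Lemma extinction t : 0 < t -> Q t x [set 0] = (1 - Im (kp 0%N t))%:E.
Proof.
move=> t0; rewrite kernel_law ?(ltW t0)//.
have m1 : measurable (X t @^-1` `]0, +oo[).
  by rewrite -[X in measurable X]setTI; apply: (mX (ltW t0) measurableT); exact: measurable_itv.
have -> : X t @^-1` [set 0] = ~` (X t @^-1` `]0, +oo[).
  apply/seteqP; split => w /=; rewrite in_itv/= andbT; first by move=> ->; rewrite ltxx.
  by move=> /negP; rewrite -leNgt => h; apply/eqP; rewrite eq_le h Xp// ltW.
rewrite probability_setC//.
have mi : measurable (`]0, +oo[%classic : set R) by exact: measurable_itv.
by have := kernel_law (ltW t0) mi; rewrite Q_tail// tail0 => <-.
Qed.

Local Notation E t := (fine (Q t x [set 0])).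

Lemma E_Im t : 0 < t -> E t = 1 - Im (kp 0%N t).
Proof. by move=> t0; rewrite extinction. Qed.

Lemma dens_total t : 0 < t -> (\int[mu]_(y in `[0%R, +oo[) (p t y)%:E = (Im (kp 0%N t))%:E)%E.
Proof.
move=> t0; have e : (fun v => 1 * kp 0%N t v) = kp 0%N t by apply/funext => v; rewrite mul1r.
have := @dens_integral t (fun=> 1) t0; rewrite e => H.
by rewrite -(H (sub_dom hs (ksub t0)))//; apply: eq_integral => v _; rewrite mule1.
Qed.

(** Rays suffice: from y >= 0 this is [Q_tail], and from y < 0 both sides are 1, the atom completing
    the mass of the density. *)
Lemma kernel_decomposition t (g : R -> \bar R) : 0 < t -> nnmeas g ->
  (\int[Q t x]_v g v = (E t)%:E * g 0%R + \int[mu]_(y in `[0%R, +oo[) ((p t y)%:E * g y))%E.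
Proof.
move=> t0; move: g.
have E0 : 0 <= E t by rewrite fine_ge0.
apply: il_eq_rays.
- have H := il_pushforward (Q t x) measurableT (@measurable_id _ R setT); exact H.
- apply: il_addf; first by apply: il_eval; rewrite lee_fin.
  apply: (@il_comp R _ R _ (measurableTypeR R) mu `[0, +oo[%classic (measurable_itv _) (fun y g => (p t y)%:E * g y)%E).
    by move=> y _; apply: il_eval; rewrite lee_fin dens_ge0.
  move=> g [_ mg]; apply: measurable_funTS; apply: emeasurable_funM => //.
  by apply/measurable_EFinP; exact: dens_measurable.
- move=> y; rewrite integral_indic// setIT.
  have dI : (\int[mu]_(v in `[0%R, +oo[) ((p t v)%:E * (\1_`]y, +oo[ v)%:E) = (tail (kp 0%N t) y)%:E)%E.
    rewrite -(dens_integral t0 (sub_dom hs (tail_sub y (ksub t0))))//.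
    by apply: eq_integral => v _; rewrite indicE mem_setE in_itv/= andbT.
  rewrite dI indicE mem_setE in_itv/= andbT; have [y0|y0] := ltP y 0; last by rewrite mule0 add0e Q_tail.
  rewrite mule1 E_Im// -EFinD.
  have -> : tail (kp 0%N t) y = Im (kp 0%N t).
    by apply: eq_Im => z z0; rewrite (lt_trans y0 z0) mul1r.
  rewrite subrK (kernel_law (ltW t0) (measurable_itv _)).
  rewrite (_ : X t @^-1` _ = setT) ?probability_setT//.
  apply/seteqP; split => // w _ /=; rewrite in_itv/= andbT (lt_le_trans y0)// Xp//; exact: ltW.
- move=> y; rewrite integral_indic// setIT.
  apply: (@le_lt_trans _ _ (Q t x setT)); last by rewrite prob_kernel ltry.
  by apply: le_measure; [apply/mem_set; exact: measurable_itv|apply/mem_set; exact: measurableT|exact: subsetT].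
Qed.

(** Continuity of [phi] is asked at [x] only, along nonnegative sequences; this admits the indicator
    of 0, needed for [E_cvg0]. *)
Lemma law_cvg (phi : R -> R) K : measurable_fun setT phi -> (forall y, `|phi y| <= K) ->
  (forall v : nat -> R, (forall n, 0 <= v n) -> v n @[n --> \oo] --> x -> phi (v n) @[n --> \oo] --> phi x) ->
  \int[P]_w phi (X t w) @[t --> 0^'+] --> phi x.
Proof.
move=> mphi pK pc; apply/cvg_at_rightP => u [u0 u1].
have u0' n : 0 <= u n by exact: ltW.
rewrite -(RintegralP_cst P (phi x)).
have := @Rintegral_dct R _ T P setT measurableT (fun n w => phi (X (u n) w)) (fun=> phi x) (fun=> K).
case=> //.
- by move=> n; exact: (measurableT_comp mphi (mX (u0' n))).
- move=> w _; apply: pc; first by move=> n; exact: Xp.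
  have I0 : (`[0, +oo[%classic : set R) 0 by rewrite /= in_itv/= lexx.
  have In n : (`[0, +oo[%classic : set R) (u n) by rewrite /= in_itv/= u0'.
  have cw : {within `[0, +oo[, continuous (X ^~ w)} := @cX w.
  by have := @within_cvg_seq R _ _ 0 u cw I0 In u1; rewrite X0.
- exact: (@bounded_integrableP _ _ _ _ _ `|K|).
Qed.

Lemma E_cvg0 : E t @[t --> 0^'+] --> 0.
Proof.
have x1 : (\1_[set 0] x : R) = 0.
  by rewrite indicE; case: (boolP (x \in _)) => // /set_mem/= h; move: x0; rewrite h ltxx.
have H := @law_cvg (\1_[set 0] : R -> R) 1.
have {}H : \int[P]_w \1_[set 0] (X t w) @[t --> 0^'+] --> (\1_[set 0] x : R).
  apply: H.
  - exact: measurable_indic.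
  - by move=> y; rewrite indicE ger0_norm// lern1 leq_b1.
  - move=> v v0 vx; rewrite x1; apply: cvg_near_cst.
    have N1 : \forall n \near \oo, 0 < v n by exact: (cvgr_gt x vx 0 x0).
    apply: filterS N1 => n vn.
    by apply/eqP; rewrite indicE; case: (boolP (v n \in _)) => // /set_mem/= h; move: vn; rewrite h ltxx.
rewrite x1 in H; apply: cvg_trans H; apply: near_eq_cvg; near=> t.
have t0 : 0 < t by near: t; exact: nbhs_right_gt.
rewrite /Rintegral kernel_law ?(ltW t0)//; congr fine.
have mXA : measurable (X t @^-1` [set 0]) by rewrite -[X in measurable X]setTI; apply: mX => //; exact: ltW.
by rewrite -(setIT (X t @^-1` [set 0])) -integral_indic.
Unshelve. all: by end_near. Qed.

Lemma E_zero : E 0 = 0.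
Proof.
rewrite kernel_law// (_ : _ @^-1` _ = set0) ?measure0//.
by apply/seteqP; split => // w /=; rewrite X0 => h; move: x0; rewrite h ltxx.
Qed.

(** Path continuity gives the limit for the whole law, from which the vanishing atom at 0 is
    subtracted. [f] is extended to negative arguments by its value at 0, and shifted by [K] because
    the decomposition is for nonnegative integrands. *)
Lemma dens_weak_cvg : weak_cvg_dirac p x.
Proof.
move=> f cf [K fK].
have K0 : 0 <= K by exact: le_trans (fK 0 (lexx 0)).
pose g (y : R) := f (Num.max 0 y).
have m0 (y : R) : 0 <= Num.max 0 y by rewrite le_max lexx.
have gK y : `|g y| <= K by exact: fK.
have mI : measurable (`[0, +oo[%classic : set R) by exact: measurable_itv.
have mf : measurable_fun (`[0, +oo[%classic : set R) f by exact: subspace_continuous_measurable_fun.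
have mg : measurable_fun setT g.
  apply: (measurable_comp mI _ mf); last exact: measurable_maxr.
  by move=> _ [y _ <-]/=; rewrite in_itv/= m0.
have gx : g x = f x by rewrite /g max_r// ltW.
have L1 : \int[P]_w g (X t w) @[t --> 0^'+] --> g x.
  apply: (law_cvg mg gK) => v v0 vx; rewrite gx.
  rewrite (_ : (fun n => g (v n)) = (fun n => f (v n))); last by apply/funext => n; rewrite /g max_r.
  apply: (within_cvg_seq cf _ _ vx) => /=; first by rewrite in_itv/= ltW.
  by move=> n; rewrite in_itv/= v0.
rewrite -gx -[g x]subr0 -[X in _ - X](mul0r (f 0)).
have L2 : \int[P]_w g (X t w) - E t * f 0 @[t --> 0^'+] --> g x - 0 * f 0.
  by apply: cvgB L1 _; apply: cvgM; [exact: E_cvg0|exact: cvg_cst].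
apply: cvg_trans L2; apply: near_eq_cvg; near=> t.
have t0 : 0 < t by near: t; exact: nbhs_right_gt.
have t0' := ltW t0.
pose I : set (measurableTypeR R) := `[0, +oo[%classic.
have mI' : measurable I by exact: measurable_itv.
have mp := dens_measurable t0.
have ip : mu.-integrable I (EFin \o p t).
  apply/integrableP; split; first by apply/measurable_EFinP; exact: measurable_funTS.
  under eq_integral do rewrite /= ger0_norm ?dens_ge0//.
  by rewrite dens_total// ltry.
have igp : mu.-integrable I (EFin \o (fun y => g y * p t y)).
  apply: (le_integrable mI' _ _ (integrableZl mI' K ip)).
    by apply/measurable_EFinP; apply: measurable_funM; exact: measurable_funTS.
  move=> y _ /=; rewrite lee_fin !normrM (ger0_norm K0) ler_wpM2r//.
have iK : mu.-integrable I (EFin \o (fun y => K * p t y)) by exact: (integrableZl mI' K ip).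
have nK : nnmeas (fun y => (g y + K)%:E).
  split; last by apply/measurable_EFinP; exact: measurable_funD.
  by move=> y; rewrite lee_fin -lerBlDr sub0r; have := gK y; rewrite ler_norml => /andP[].
have := law t0' nK; rewrite (kernel_decomposition t0 nK).
have igX : P.-integrable setT (EFin \o (fun w => g (X t w))).
  by apply: (@bounded_integrableP _ _ _ _ _ K) => //; exact: (measurableT_comp mg (mX t0')).
have iKX : P.-integrable setT (EFin \o (fun _ : T => K)) by exact: (@bounded_integrableP _ _ _ _ _ `|K|).
have iS : P.-integrable setT (EFin \o (fun w => g (X t w) + K)) by exact: (integrableD measurableT igX iKX).
rewrite -(EFin_Rintegral measurableT iS) (RintegralD measurableT igX iKX) RintegralP_cst.
have -> : (\int[mu]_(y in `[0%R, +oo[) ((p t y)%:E * (g y + K)%:E) =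
    (\int[mu]_(y in I) (g y * p t y) + K * Im (kp 0%N t))%:E)%E.
  have iD : mu.-integrable I (EFin \o (fun y => g y * p t y + K * p t y)) by exact: (integrableD mI' igp iK).
  transitivity (\int[mu]_(y in I) (g y * p t y + K * p t y)%:E)%E.
    by apply: eq_integral => y _; rewrite -EFinM; congr EFin; ring.
  rewrite -(EFin_Rintegral mI' iD) (RintegralD mI' igp iK) (RintegralZl K mI' ip).
  by rewrite {2}/Rintegral dens_total.
have -> : \int[mu]_(y in `[0, +oo[) (f y * p t y) = \int[mu]_(y in I) (g y * p t y).
  apply: eq_Rintegral => y /set_mem/=; rewrite in_itv/= andbT => y0; by rewrite /g max_r.
have -> : g 0 = f 0 by rewrite /g max_r.
rewrite -EFinM -EFinD => -[] H; apply/eqP; rewrite subr_eq; apply/eqP; move: H (E_Im t0).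
move: (fine _) (Im _) (Rintegral _ _ _) (Rintegral _ _ _) => e i r1 r2 H He.
by rewrite -(addrK K r2) H He; ring.
Unshelve. all: by end_near. Qed.
End Conclusion.

(** * Polynomial coefficients and the final assembly *)

Lemma quadratic_derive (R : realType) (c q y : R) : is_derive y 1 (fun y => c * y + q * (y * y)) (c + 2 * q * y).
Proof.
have H := is_deriveD (is_deriveM (is_derive_cst c y 1) (is_derive_id y 1))
  (is_deriveM (is_derive_cst q y 1) (is_deriveM (is_derive_id y 1) (is_derive_id y 1))).
by apply: is_derive_eq H _; rewrite /GRing.scale/=; ring.
Qed.

Lemma affine_derive (R : realType) (c q y : R) : is_derive y 1 (fun y => c + q * y) q.
Proof.
have H := is_deriveD (is_derive_cst c y 1) (is_deriveM (is_derive_cst q y 1) (is_derive_id y 1)).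
by apply: is_derive_eq H _; rewrite /GRing.scale/=; ring.
Qed.

Theorem mainTheorem2 (R : realType) (lambda mu alpha rho : R)
    (lambda_gt0 : 0 < lambda) (mu_gt0 : 0 < mu)
    (alpha_gt0 : 0 < alpha) (rho_gt0 : 0 < rho)
    (d : measure_display) (T : measurableType d) (P : probability T R)
    (F : R -> set (set T)) (B : R -> T -> R) (Q : R -> R.-pker R ~> R) :
  let b : R -> R := fun y => (lambda - mu - alpha * y) * y in
  let a : R -> R := fun y => rho ^+ 2 * (lambda + mu + alpha * y) * y in
  let sigma : R -> R := fun y => Num.sqrt (a y) in
  is_filtration F ->
  is_brownian_motion P F B ->
  well_posed_absorbed P F B b sigma ->
  is_transition_kernel P F B b sigma Q ->
  forall x : R, 0 < x ->
  let E : R -> R := fun t => fine (Q t x [set 0]) in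
  exists p : R -> R -> R,
    (forall t : R, 0 < t ->
      [/\ measurable_fun (`[0, +oo[ : set R) (p t),
          forall y : R, 0 <= y -> 0 <= p t y,
          forall A : set R, measurable A ->
            (Q t x A = (E t)%:E * \d_(0%R : R) A
               + (\int[lebesgue_measure]_(y in A `&` `[0%R, +oo[) (p t y)%:E))%E
        & ((E t)%:E
             = 1 - (\int[lebesgue_measure]_(y in `[0%R, +oo[) (p t y)%:E))%E]) /\
    [/\ C12 p,
        forall t y : R, 0 < t -> 0 < y ->
          derive1 (p ^~ y) t = - derive1 (fun z => b z * p t z) y
                           + 2^-1 * derive1n 2 (fun z => a z * p t z) y
      & weak_cvg_dirac p x] /\
    [/\ forall t : R, 0 < t -> exists D : R,
          is_right_derive (fun y => a y * p t y) 0 D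
          /\ is_derive t 1 E (2^-1 * D),
        E 0 = 0
      & E t @[t --> 0^'+] --> E 0].
Proof.
move=> b a sigma hF hB hW hQ x x0 E.
have [s [sd [S hs0]]] := scale_exists lambda_gt0 mu_gt0 alpha_gt0 rho_gt0.
have hs : scale_fun a b s sd S := hs0.
pose a1 (y : R) := rho ^+ 2 * (lambda + mu) + 2 * (rho ^+ 2 * alpha) * y.
pose b1 (y : R) := (lambda - mu) + 2 * (- alpha) * y.
have ad (y : R) : is_derive y 1 a (a1 y).
  have := quadratic_derive (rho ^+ 2 * (lambda + mu)) (rho ^+ 2 * alpha) y.
  by congr is_derive; apply/funext => v; rewrite /a; ring.
have bd (y : R) : is_derive y 1 b (b1 y).
  have := quadratic_derive (lambda - mu) (- alpha) y.
  by congr is_derive; apply/funext => v; rewrite /b; ring.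
have ad2 (y : R) : is_derive y 1 a1 ((fun=> 2 * (rho ^+ 2 * alpha)) y) by exact: affine_derive.
have cb1 : continuous b1 by exact: (continuous_deriv (affine_derive (lambda - mu) (2 * - alpha))).
have ca2 : continuous (fun _ : R => 2 * (rho ^+ 2 * alpha)) by move=> y; exact: cvg_cst.
have ca := continuous_deriv ad; have cb := continuous_deriv bd.
have csigma : continuous sigma.
  move=> y; apply: (@continuous_comp _ _ _ a Num.sqrt); first exact: ca.
  exact: sqrt_continuous.
have rho2 : 0 < rho ^+ 2 by rewrite exprn_gt0.
have lm : 0 < lambda + mu by rewrite addr_gt0.
have a0 (y : R) : 0 <= y -> 0 <= a y.
  move=> y0; apply: mulr_ge0 => //; apply: mulr_ge0; first exact: ltW.
  by apply: addr_ge0; [exact: ltW|apply: mulr_ge0 => //; exact: ltW].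
have sa (y : R) : 0 <= y -> sigma y ^+ 2 = a y by move=> y0; rewrite /sigma sqr_sqrtr// a0.
(* The smaller coefficient of the affine factor of [a], which is therefore at least a multiple of 1
   + y. *)
pose k := rho ^+ 2 * Num.min (lambda + mu) alpha.
have k0 : 0 < k by rewrite mulr_gt0// lt_min lm alpha_gt0.
have ak (y : R) : 0 <= y -> k * (y * (1 + y)) <= a y.
  move=> y0; rewrite (_ : k * _ = rho ^+ 2 * (Num.min (lambda + mu) alpha * (1 + y)) * y); last by rewrite /k; ring.
  apply: ler_wpM2r => //; apply: ler_wpM2l; first exact: ltW.
  rewrite mulrDr mulr1; apply: lerD; first by rewrite ge_min lexx.
  by apply: ler_wpM2r => //; rewrite ge_min lexx orbT.
have [X [sX X0 _ _]] := hW x (ltW x0).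
have [_ cX Xp _] := sX.
have mX t (t0 : 0 <= t) : measurable_fun setT (X t) := X_measurable hF sX t0.
have law t g (t0 : 0 <= t) (ng : nnmeas g) := law_int hF hQ sX X0 t0 ng.
have [kp [kpD kpB kpM kpI kpW]] := @kernel_density_family R a b s sd S hs ca k k0 ak d T P F B Q sigma
  hF hB cb csigma sa hW hQ x x0.
have kpC t y (t0 : 0 < t) (y0 : 0 < y) : {for y, continuous (kp 0%N t)} := kp_cont_y kpB kpM kpI (j := 0%N) t0 y0.
exists (dens a s kp); split.
  move=> t t0; split.
  - by apply: measurable_funTS; exact: (dens_measurable hs ca k0 ak kpM t0).
  - by move=> y _; exact: (dens_ge0 kpB kpM kpC kpW y t0).
  - move=> A mA.
    have := kernel_decomposition mX Xp law kpB kpM kpC kpW t0 (nnmeas_indic mA).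
    rewrite integral_indic// setIT => ->; rewrite diracE indicE; congr (_ + _)%E.
    rewrite setIC [RHS]integral_mkcondr; apply: eq_integral => y _.
    by rewrite patchE indicE; case: ifP; rewrite ?mule1 ?mule0.
  - rewrite (dens_total kpB kpM kpC kpW t0) /E (E_Im mX Xp law kpB kpM kpW t0).
    by rewrite EFinB.
have EE t : 0 < t -> E t = 1 - Im hs ca k0 ak (kp 0%N t) by move=> t0; exact: (E_Im mX Xp law kpB kpM kpW t0).
have E0 : E 0 = 0 by exact: (E_zero x0 mX X0 law).
split; split.
- exact: (dens_C12 kpD kpB kpM kpI ad ad2 bd ca2 cb1).
- by move=> t y t0 y0; exact: (dens_Fokker_Planck kpD kpB kpM kpI ad bd t0 y0).
- exact: (dens_weak_cvg x0 mX cX X0 Xp law kpB kpM kpC kpW).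
(* The integral of [kp 1] is half the boundary slope and also the derivative of [E], since [E] is 1
   minus the integral of [kp 0]. *)
- move=> t t0; exists (2 * Im hs ca k0 ak (kp 1%N t)); split.
    exact: (dens_boundary kpB kpM kpI t0).
  rewrite mulrA mulVf// mul1r.
  have H := is_deriveB (is_derive_cst (1 : R) t 1) (Im_kp_derive hs ca k0 ak kpD kpB kpM 0 t0).
  apply: (@near_eq_is_derive _ _ _ (fun u => 1 - Im hs ca k0 ak (kp 0%N u))).
    by near=> u; rewrite EE//; near: u; exact: lt_nbhsr.
  by apply: is_derive_eq H _; rewrite sub0r opprK.
- exact: E0.
- by rewrite E0; exact: (E_cvg0 x0 mX cX X0 Xp law).
Unshelve. all: by end_near. Qed.
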